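(* Let $N \ge 1$ and $p \in (1,\infty)$. Then there exists a constant $C = C(N,p) > 0$ such that for all $s \in (0,1)$ and all $f \in \mathscr{S}(\mathbb{R}^N)$: (1) if $1 < p \leq 2$, then $$C^{-1} \left(\frac{1}{s^{1/p}} + \frac{1}{(1-s)^{1/p}}\right) [f]_{\dot{F}^{s}_{p,2}(\mathbb{R}^N)} \leq [f]_{\dot W^{s,p}(\mathbb{R}^N)};$$ (2) if $2 \leq p < \infty$, then $$[f]_{\dot W^{s,p}(\mathbb{R}^N)} \leq C \left(\frac{1}{s^{1/p}} + \frac{1}{(1-s)^{1/p}}\right) [f]_{\dot{F}^{s}_{p,2}(\mathbb{R}^N)}.$$
   Context: $\mathscr{S}(\mathbb{R}^N)$ is the space of Schwartz functions on $\mathbb{R}^N$, and $\mathcal{F}f(\xi)=\int_{\mathbb{R}^N} f(x)e^{-ix\cdot\xi}\,dx$ is the Fourier transform. Littlewood-Paley projections: fix once and for all a real-valued $\eta \in \mathscr{S}(\mathbb{R}^N)$ with $\eta(-z)=\eta(z)$ and $\mathcal{F}\eta(\xi)=\mathcal{F}\eta_0(\xi)-\mathcal{F}\eta_0(2\xi)$, where $\eta_0$ is a Schwartz function with $\mathcal{F}\eta_0(\xi)=1$ for $|\xi|\le 1$ and $\mathcal{F}\eta_0(\xi)=0$ for $|\xi|\ge 2$. For $j \in \mathbb{Z}$ put $\Delta_j f := f * [2^{jN}\eta(2^j\,\cdot)]$. (Constants may depend on this fixed choice of $\eta$.) Homogeneous Triebel-Lizorkin seminorm: for $s\in\mathbb{R}$,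 $p,q\in(1,\infty)$, $$[f]_{\dot{F}^{s}_{p,q}(\mathbb{R}^N)} := \left(\int_{\mathbb{R}^N} \Big(\sum_{j \in \mathbb{Z}} 2^{jsq} |\Delta_j f(x)|^q\Big)^{p/q} dx\right)^{1/p}.$$ Gagliardo seminorm: for $s\in(0,1)$, $p\in(1,\infty)$, $$[f]_{\dot W^{s,p}(\mathbb{R}^N)} := \left(\int_{\mathbb{R}^N}\int_{\mathbb{R}^N} \frac{|f(x)-f(y)|^p}{|x-y|^{N+sp}}\, dx\, dy\right)^{1/p}.$$ *)

(* Defs.v *)
From HB Require Import structures.
From mathcomp Require Import all_boot all_order all_algebra.
From mathcomp Require Import complex.
From mathcomp Require Import all_classical all_reals all_analysis.

Set Implicit Arguments.
Unset Strict Implicit.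
Unset Printing Implicit Defensive.

Import Order.TTheory GRing.Theory Num.Theory.
Import numFieldNormedType.Exports.
Import ComplexField.Normc.

Local Open Scope classical_set_scope.
Local Open Scope ring_scope.
Local Open Scope complex_scope.

(* The product sigma-algebra (equivalently, the Borel sigma-algebra) on R^n:
   the one generated by the coordinate functions. *)
Section measurable_rV.
Context (R : realType) (n : nat).

Let coord (i : 'I_n) (x : 'rV[R]_n) : measurableTypeR R := x 0 i.

Let rV_set0 : g_sigma_preimage coord set0.
Proof. exact: sigma_algebra0. Qed.

Let rV_setC A : g_sigma_preimage coord A -> g_sigma_preimage coord (~` A).
Proof. exact: sigma_algebraC. Qed.

Let rV_bigcup (F : _^nat) : (forall i, g_sigma_preimage coord (F i)) ->
  g_sigma_preimage coord (\bigcup_i (F i)).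
Proof. exact: sigma_algebra_bigcup. Qed.

HB.instance Definition _ := @isMeasurable.Build default_measure_display
  'rV[R]_n (g_sigma_preimage coord) rV_set0 rV_setC rV_bigcup.

Lemma measurable_rV_coord (i : 'I_n) :
  measurable_fun [set: 'rV[R]_n] (fun x => x 0 i : measurableTypeR R).
Proof.
move=> _ Y mY; rewrite setTI; apply: sub_sigma_algebra => /=.
rewrite -bigcup_seq/=; exists i => /=; first by rewrite mem_index_enum.
by exists Y => //; rewrite setTI.
Qed.

Lemma measurable_fun_rVP d (T : measurableType d) (f : T -> 'rV[R]_n) :
  (forall i, measurable_fun [set: T] (fun t => f t 0 i : measurableTypeR R)) ->
  measurable_fun [set: T] f.
Proof.
move=> mf.
apply: (@measurability _ _ _ _ setT f
  (\big[setU/set0]_(i < n)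
     preimage_set_system setT (coord i) measurable)) => //.
move=> _ [B + <-]; rewrite -bigcup_seq/= => -[i _ [A mA <-]].
by rewrite !setTI; have := mf i measurableT A mA; rewrite setTI.
Qed.

End measurable_rV.

Section rV_cons.
Context (R : realType).

Definition rV_cons n (xy : measurableTypeR R * 'rV[R]_n) : 'rV[R]_n.+1 :=
  row_mx (xy.1)%:M xy.2.

Lemma rV_cons0 n xy : @rV_cons n xy 0 0 = xy.1.
Proof.
have -> : 0 = @lshift 1 n 0 :> 'I_n.+1 by apply/val_inj.
by rewrite /rV_cons (@row_mxEl _ 1 1 n) mxE eqxx mulr1n.
Qed.

Lemma rV_consS n xy i : @rV_cons n xy 0 (lift 0 i) = xy.2 0 i.
Proof.
have -> : lift 0 i = rshift 1 i by apply/val_inj.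
exact: (@row_mxEr _ 1 1 n).
Qed.

Lemma measurable_rV_cons n : measurable_fun [set: _] (@rV_cons n).
Proof.
apply: measurable_fun_rVP => i; have [j ->|->] := unliftP 0 i.
  rewrite (_ : (fun t => _) =
    (fun x : 'rV[R]_n => x 0 j : measurableTypeR R) \o snd).
    exact: (measurableT_comp (measurable_rV_coord j) measurable_snd).
  by apply/funext => t /=; rewrite rV_consS.
rewrite (_ : (fun t => _) = fst); first exact: measurable_fst.
by apply/funext => t /=; rewrite rV_cons0.
Qed.

Lemma rV_cons_inj n : injective (@rV_cons n).
Proof.
move=> xy xy' /rowP e; rewrite [xy]surjective_pairing [xy']surjective_pairing.
congr pair; first by have := e 0; rewrite !rV_cons0.
by apply/rowP => i; have := e (lift 0 i); rewrite !rV_consS.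
Qed.

Lemma rV_cons_surj n (z : 'rV[R]_n.+1) :
  z = rV_cons (z 0 0, \row_i z 0 (lift 0 i)).
Proof.
apply/rowP => i; have [j ->|->] := unliftP 0 i.
  by rewrite rV_consS mxE.
by rewrite rV_cons0.
Qed.

Lemma measurable_image_rV_cons n (A : set (measurableTypeR R * 'rV[R]_n)) :
  measurable A -> measurable (@rV_cons n @` A).
Proof.
move=> mA.
pose h (z : 'rV[R]_n.+1) : measurableTypeR R * 'rV[R]_n :=
  (z 0 0, \row_i z 0 (lift 0 i)).
have mh : measurable_fun [set: _] h.
  apply: measurable_fun_pair; first exact: measurable_rV_coord.
  apply: measurable_fun_rVP => i.
  rewrite (_ : (fun t => _) =
    (fun z : 'rV[R]_n.+1 => z 0 (lift 0 i) : measurableTypeR R)).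
    exact: measurable_rV_coord.
  by apply/funext => z; rewrite mxE.
rewrite (_ : _ @` A = h @^-1` A).
  by have := mh measurableT A mA; rewrite setTI.
apply/seteqP; split => [_ [xy Axy <-]|z Ahz].
  suff -> : (h @^-1` A) (rV_cons xy) = A xy by [].
  by congr A; apply: (@rV_cons_inj n); rewrite -rV_cons_surj.
by exists (h z) => //; rewrite -rV_cons_surj.
Qed.

End rV_cons.

Section lebesgue_rV_step.
Context (R : realType) (n : nat).
Variable m : {sigma_finite_measure set 'rV[R]_n -> \bar R}.

Definition lebesgue_rV_step : set 'rV[R]_n.+1 -> \bar R :=
  pushforward (lebesgue_measure \x m)%E (@rV_cons R n).

Let step0 : lebesgue_rV_step set0 = 0%E.
Proof. by rewrite /lebesgue_rV_step /pushforward preimage_set0 measure0. Qed.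

Let step_ge0 A : (0 <= lebesgue_rV_step A)%E.
Proof. exact: (measure_ge0 (lebesgue_measure \x m)%E). Qed.

Let measurable_preimage A : measurable A -> measurable (@rV_cons R n @^-1` A).
Proof.
by move=> mA; have := @measurable_rV_cons R n measurableT A mA; rewrite setTI.
Qed.

Let step_sigma_additive : semi_sigma_additive lebesgue_rV_step.
Proof.
move=> F mF tF mUF; rewrite /lebesgue_rV_step /pushforward preimage_bigcup.
apply: measure_semi_sigma_additive.
- by move=> k; exact: measurable_preimage.
- apply/trivIsetP => /= i j _ _ ij; rewrite -preimage_setI.
  by move/trivIsetP : tF => /(_ _ _ _ _ ij) ->//; rewrite preimage_set0.
- by rewrite -preimage_bigcup; exact: measurable_preimage.
Qed.

HB.instance Definition _ := isMeasure.Build _ _ _ lebesgue_rV_step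
  step0 step_ge0 step_sigma_additive.

Let step_sigma_finite : sigma_finite setT lebesgue_rV_step.
Proof.
have /sigma_finiteP[F [TF ndF Foo]] := sigma_finiteT (@lebesgue_measure R).
have /sigma_finiteP[G [TG ndG Goo]] := sigma_finiteT m.
exists (fun k => @rV_cons R n @` (F k `*` G k)) => [|k].
  apply/esym; rewrite -subTset => z _; rewrite [z]rV_cons_surj.
  have : [set: measurableTypeR R] (z 0 0) by [].
  have : [set: 'rV[R]_n] (\row_i z 0 (lift 0 i)) by [].
  rewrite TF TG => -[k _ Gk] [l _ Fl]; exists (maxn k l) => //.
  exists (z 0 0, \row_i z 0 (lift 0 i)) => //; split => /=.
    by move: Fl; exact/subsetPset/ndF/leq_maxr.
  by move: Gk; exact/subsetPset/ndG/leq_maxl.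
have [mF F_oo] := Foo k; have [mG G_oo] := Goo k.
split; first by apply: measurable_image_rV_cons; exact: measurableX.
rewrite /lebesgue_rV_step /pushforward (_ : _ @^-1` _ = F k `*` G k).
  by rewrite product_measure1E// lte_mul_pinfty// ge0_fin_numE.
apply/seteqP; split => [xy [xy' Fxy' /rV_cons_inj <-]//|].
exact: preimage_image.
Qed.

HB.instance Definition _ := Measure_isSigmaFinite.Build _ _ _ lebesgue_rV_step
  step_sigma_finite.

End lebesgue_rV_step.

(* Lebesgue measure on R^n, as the n-fold product of Lebesgue measure on R. *)
Fixpoint lebesgue_rV (R : realType) (n : nat) :
    {sigma_finite_measure set 'rV[R]_n -> \bar R} :=
  match n with
  | 0 => dirac (0 : 'rV[R]_0)
  | n.+1 => lebesgue_rV_step (lebesgue_rV R n)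
  end.

Section schwartz_fourier.
Context (R : realType) (n : nat).
Implicit Types (f g : 'rV[R]_n -> R[i]) (x y xi : 'rV[R]_n).

Definition dotp x y : R := \sum_i x 0 i * y 0 i.

(* Euclidean norm; the library's norm `|x| on 'rV[R]_n is the sup norm. *)
Definition enorm x : R := Num.sqrt (dotp x x).

(* Calculus on complex-valued functions is componentwise, since R[i] is not
   a normed module over R in the libraries. *)
Definition cdifferentiable f x : Prop :=
  differentiable (fun y => complex.Re (f y)) x /\
  differentiable (fun y => complex.Im (f y)) x.

Definition cpartial (i : 'I_n) f : 'rV[R]_n -> R[i] := fun x =>
  ('D_(delta_mx 0 i) (fun y => complex.Re (f y)) x) +i*
  ('D_(delta_mx 0 i) (fun y => complex.Im (f y)) x).

(* The derivative of order [size beta] along the listed coordinate directions: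
   beta = [:: i1; ..; ik] stands for d_i1 (.. (d_ik f)). *)
Definition cpartials (beta : seq 'I_n) f : 'rV[R]_n -> R[i] :=
  foldr cpartial f beta.

Definition monomial (alpha : 'I_n -> nat) x : R := \prod_i x 0 i ^+ alpha i.

Definition schwartz f : Prop :=
  (forall beta x, cdifferentiable (cpartials beta f) x) /\
  (forall alpha beta, exists M : R, forall x,
    `|monomial alpha x| * normc (cpartials beta f x) <= M).

Definition cintegral f : R[i] :=
  (\int[lebesgue_rV R n]_(x in setT) complex.Re (f x)) +i*
  (\int[lebesgue_rV R n]_(x in setT) complex.Im (f x)).

(* e^{i t} *)
Definition cis (t : R) : R[i] := cos t +i* sin t.

Definition fourier f : 'rV[R]_n -> R[i] := fun xi =>
  cintegral (fun x => f x * cis (- dotp x xi)).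

Definition convolution f g : 'rV[R]_n -> R[i] := fun x =>
  cintegral (fun y => f (x - y) * g y).

Definition littlewood_paley (eta : 'rV[R]_n -> R[i]) : Prop :=
  [/\ schwartz eta,
      forall z, complex.Im (eta z) = 0,
      forall z, eta (- z) = eta z &
      exists eta0 : 'rV[R]_n -> R[i],
        [/\ schwartz eta0,
            forall xi, enorm xi <= 1 -> fourier eta0 xi = 1,
            forall xi, 2 <= enorm xi -> fourier eta0 xi = 0 &
            forall xi,
              fourier eta xi = fourier eta0 xi - fourier eta0 (2 *: xi)]].

Definition LP_projection (eta : 'rV[R]_n -> R[i]) (j : int) f :
    'rV[R]_n -> R[i] :=
  convolution f (fun x => ((2 : R) ^ (j * n%:Z))%:C * eta ((2 : R) ^ j *: x)).

Definition triebel_lizorkin (eta : 'rV[R]_n -> R[i]) (s p q : R) f : \bar R :=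
  ((\int[lebesgue_rV R n]_x
      ((\esum_(j in [set: int])
         (2 `^ (j%:~R * s * q) * normc (LP_projection eta j f x) `^ q)%:E)
       `^ (p / q))) `^ p^-1)%E.

(* On the null set x = y the integrand is 0, as 0^-1 = 0. *)
Definition gagliardo (s p : R) f : \bar R :=
  ((\int[lebesgue_rV R n]_y \int[lebesgue_rV R n]_x
      (normc (f x - f y) `^ p / enorm (x - y) `^ (n%:R + s * p))%:E)
   `^ p^-1)%E.

End schwartz_fourier.

(* Main.v *)
Require Import Defs.
From mathcomp Require Import all_boot all_order all_algebra.
From mathcomp Require Import complex.
From mathcomp Require Import all_classical all_reals all_analysis.
From mathcomp Require Import measurable_realfun zify ring lra.

Set Implicit Arguments.
Unset Strict Implicit.
Unset Printing Implicit Defensive.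

Import Order.TTheory GRing.Theory Num.Theory.
Import numFieldNormedType.Exports.

Local Open Scope classical_set_scope.
Local Open Scope ring_scope.

(** Write [d_j] for the Littlewood-Paley pieces of [u] and [D_h u = u - u(. - h)].
    The transform of [eta] being supported in an annulus, [eta = zeta * eta] with
    [zeta] of mean zero, so that a smooth square function estimate
    [|sum_j zeta_j * g_j|_r <= C |(sum_j g_j^2)^(1/2)|_r], [r >= 2], is available.
    It is proved by telescoping the integral of [|f|^r] along successive averages
    of [f] by exponential kernels, with the help of the dual Doob inequality.

    For [p >= 2], apply it to [g_j = D_h d_j], which is bounded by
    [min(1, 2^j |h|)] times averages of [d_j]. Integration in [h] then gives the
    factor [1/s + 1/(1-s)], the size of the integral of
    [|h|^(-n-2s) min(1, |h|^2)].

    For [p <= 2], apply it at the conjugate exponent. At a scale [b], [d_j] is an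
    average over [|h| ~ 1/b] of [sum_(l < L_j) (D_h d_j)(. - l h)] with
    [L_j ~ max(1, b / 2^j)]; testing against
    [L_j^-1 d_j A^(p-2)], [A^2 = sum_j L_j^-2 d_j^2], and absorbing bounds the
    integral of [A^p] by that of [|D_h u|^p] over [|h| ~ 1/b]. Summation over
    dyadic [b] with weights [b^(sp)] recovers the Gagliardo integral on the right
    and, by concavity of [t^(p/2)], the factor [1/s + 1/(1-s)] on the left. *)


(** The analytic core treats finite sums of bounded integrable functions, with constants independent
    of the number of terms; infinite sums are reached only at the end, by Fatou's lemma. Exponential
    kernels are chosen because a translation by y changes them by at most a factor exp (a |y|), and
    the product of such a factor with a kernel of larger parameter is again an exponential kernel up
    to a constant. This Harnack property takes the place of conditioning in a martingale and makes
    the Doob-type inequalities elementary; the polynomial majorants of Schwartz kernels are in turn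
    dominated by dyadic superpositions of exponential kernels. Convolution identities between
    band-limited kernels are read off from their transforms, which needs uniqueness of the Fourier
    transform but no inversion formula. For p <= 2 the weight 1 / L_j is the size of the multiplier
    of D_h on the frequencies of d_j when |h| ~ 1/b, so nothing is lost in the weighted sums. The
    factor in s comes from geometric series of ratios 4^-s and 4^-(1-s), compared with 1/s and
    1/(1-s) by Bernoulli's inequality. *)

Section lebesgue_rV_theory.
Context {R : realType}.

(** * Lebesgue measure on R^n: Tonelli and affine changes of variables *)

Lemma ge0_integral_rV_cons n (f : 'rV[R]_n.+1 -> \bar R) :
  measurable_fun setT f -> (forall x, 0 <= f x)%E ->
  (\int[lebesgue_rV R n.+1]_x f x =
   \int[lebesgue_measure]_t \int[lebesgue_rV R n]_y f (rV_cons (t, y)))%E.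
Proof.
move=> mf f0.
have mfc : measurable_fun setT (f \o @rV_cons R n).
  by apply: measurableT_comp => //; exact: measurable_rV_cons.
transitivity (\int[(lebesgue_measure \x lebesgue_rV R n)%E]_z
    (f \o @rV_cons R n) z)%E.
  rewrite -[in RHS](preimage_setT (@rV_cons R n)).
  by rewrite -(ge0_integral_pushforward (@measurable_rV_cons R n)).
by rewrite fubini_tonelli1//=.
Qed.

Lemma measurable_affine1 (a b : R) :
  measurable_fun setT (fun t : measurableTypeR R => a * t + b : measurableTypeR R).
Proof. by apply: measurable_funD => //; apply: measurable_funM. Qed.

(** Uniqueness of Lebesgue measure: [|a|] times the pushforward under t -> a t + b gives every
    interval ]u, v] its length. For a < 0 the preimage is closed at the other end, which does not
    affect its measure. *)
Lemma ge0_integral_affine1 (a b : R) (f : measurableTypeR R -> \bar R) :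
  a != 0 -> measurable_fun setT f -> (forall x, 0 <= f x)%E ->
  (`|a|%:E * \int[lebesgue_measure]_t f (a * t + b)%R =
   \int[lebesgue_measure]_t f t)%E.
Proof.
move=> a0 mf f0.
pose phi (t : measurableTypeR R) : measurableTypeR R := a * t + b.
have mphi : measurable_fun setT phi by exact: measurable_affine1.
have a_ge0 : 0 <= `|a| by [].
pose k : {nonneg R} := NngNum a_ge0.
pose nu0 : {measure set (measurableTypeR R) -> \bar R} :=
  measure_function_pushforward__canonical__measure_function_Measure
    (@lebesgue_measure R) mphi.
pose nu := mscale k nu0.
rewrite (_ : (\int[_]_t f t)%E = (\int[nu]_t f t)%E); last first.
  apply: eq_measure_integral => A mA _.
  apply: lebesgue_measure_unique => // X [/= [u v] uv <-].
  rewrite /nu /= /mscale /= /pushforward.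
  have [an|ap] := ltP a 0.
  - rewrite (_ : phi @^-1` _ = `[(v - b) / a, (u - b) / a[%classic).
      rewrite !lebesgue_measure_itv/= !lte_fin.
      rewrite ltr_ndivlMr// divfK ?ltr0_neq0// ltrD2r.
      case: ifPn => uv'; last by rewrite mule0.
      rewrite !EFinN -!EFinD -EFinM ltr0_norm//; congr EFin.
      by field; rewrite ltr0_neq0.
    apply/seteqP; split => t /=; rewrite /phi !in_itv/=;
      rewrite ler_ndivrMr// ltr_ndivlMr// => /andP[h1 h2];
      apply/andP; split; lra.
  - have {}ap : 0 < a by rewrite lt0r a0.
    rewrite (_ : phi @^-1` _ = `](u - b) / a, (v - b) / a]%classic).
      rewrite !lebesgue_measure_itv/= !lte_fin.
      rewrite ltr_pdivrMr// divfK ?gt_eqF// ltrD2r.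
      case: ifPn => uv'; last by rewrite mule0.
      rewrite !EFinN -!EFinD -EFinM gtr0_norm//; congr EFin.
      by field; rewrite gt_eqF.
    apply/seteqP; split => t /=; rewrite /phi !in_itv/=;
      rewrite ltr_pdivrMr// ler_pdivlMr// => /andP[h1 h2];
      apply/andP; split; lra.
rewrite ge0_integral_mscale//= -[in LHS](preimage_setT phi); congr (_ * _)%E.
by rewrite ge0_integral_pushforward.
Qed.

Lemma measurable_rV_affine n (a : R) (b : 'rV[R]_n) :
  measurable_fun setT (fun x : 'rV[R]_n => a *: x + b).
Proof.
apply: measurable_fun_rVP => i.
rewrite (_ : (fun _ => _) = (fun x : 'rV[R]_n => a * x 0 i + b 0 i)).
  apply: measurable_funD => //; apply: measurable_funM => //.
  exact: measurable_rV_coord.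
by apply/funext => x; rewrite !mxE.
Qed.

Lemma ge0_integral_affine n (a : R) (b : 'rV[R]_n) (f : 'rV[R]_n -> \bar R) :
  a != 0 -> measurable_fun setT f -> (forall x, 0 <= f x)%E ->
  ((`|a| ^+ n)%:E * \int[lebesgue_rV R n]_x f (a *: x + b)%R =
   \int[lebesgue_rV R n]_x f x)%E.
Proof.
move=> a0; elim: n b f => [|n IH] b f mf f0.
  rewrite expr0 mul1e; apply: eq_integral => x _.
  by rewrite [X in f X]thinmx0 [in RHS](thinmx0 x).
have mg : measurable_fun setT (fun x : 'rV[R]_n.+1 => f (a *: x + b)).
  by apply: measurableT_comp => //; exact: measurable_rV_affine.
rewrite !ge0_integral_rV_cons//.
have mfc : measurable_fun setT (f \o @rV_cons R n).
  by apply: measurableT_comp => //; exact: measurable_rV_cons.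
pose b' : 'rV[R]_n := \row_i b 0 (lift 0 i).
have E t y : a *: rV_cons (t, y) + b = rV_cons (a * t + b 0 0, a *: y + b').
  apply/rowP => i; have [j ->|->] := unliftP 0 i.
    by rewrite mxE mxE !rV_consS/= !mxE.
  by rewrite mxE mxE !rV_cons0/=.
have E2 t : (\int[lebesgue_rV R n]_y f (rV_cons (t, y)) =
   (`|a| ^+ n)%:E *
    \int[lebesgue_rV R n]_y f (rV_cons (t, a *: y + b')%R))%E.
  rewrite (IH b' (fun y => f (rV_cons (t, y))))//.
  have := measurableT_comp mfc (@pair1_measurable _ _ (measurableTypeR R) 'rV[R]_n t).
  exact.
have mI : measurable_fun setT (fun t : measurableTypeR R =>
    \int[lebesgue_rV R n]_y f (rV_cons (t, a *: y + b')%R))%E.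
  apply: (measurable_fun_fubini_tonelli_F (m2 := lebesgue_rV R n)
     (fun z : measurableTypeR R * 'rV[R]_n =>
        f (rV_cons (z.1, a *: z.2 + b')))) => //.
  have mp : measurable_fun setT (fun z : measurableTypeR R * 'rV[R]_n =>
      ((z.1, a *: z.2 + b') : measurableTypeR R * 'rV[R]_n)).
    apply: measurable_fun_pair; first exact: measurable_fst.
    have := measurableT_comp (measurable_rV_affine a b')
      (@measurable_snd _ _ (measurableTypeR R) 'rV[R]_n).
    exact.
  exact: (measurableT_comp mfc mp).
have I0 t : (0 <= \int[lebesgue_rV R n]_y f (rV_cons (t, a *: y + b')%R))%E.
  exact: integral_ge0.
have -> : (\int[lebesgue_measure]_t
    \int[lebesgue_rV R n]_y f (rV_cons (t, y)) =
    (`|a| ^+ n)%:E * \int[lebesgue_measure]_t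
      \int[lebesgue_rV R n]_y f (rV_cons (t, a *: y + b')%R))%E.
  have p0 : (0 <= (`|a| ^+ n)%:E)%E by rewrite lee_fin exprn_ge0.
  rewrite -(@ge0_integralZl _ _ _ (@lebesgue_measure R) _ measurableT _ mI
    _ (fun t _ => I0 t) p0).
  by apply: eq_integral => t _; exact: E2.
rewrite -(@ge0_integral_affine1 a (b 0 0) _ a0 mI I0).
rewrite exprS mulrC EFinM -[LHS]muleA; congr (_ * (_ * _))%E.
apply: eq_integral => t _; apply: eq_integral => y _.
by rewrite E.
Qed.

(* A continuous function is the limit of its values at dyadic grid points, and
   functions of the grid point are measurable because the grid is countable. *)
Lemma continuous_measurable_rV n (f : 'rV[R]_n -> R) :
  continuous f -> measurable_fun setT f.
Proof.
move=> cf.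
pose fl m (x : 'rV[R]_n) : 'rV[int]_n := \row_i Num.floor (2 ^+ m * x 0 i).
pose pt m (v : 'rV[int]_n) : 'rV[R]_n := \row_i ((v 0 i)%:~R / 2 ^+ m).
have mfl m (A : set 'rV[int]_n) : measurable (fl m @^-1` A).
  rewrite (_ : fl m @^-1` A =
      \bigcup_v (if v \in A then fl m @^-1` [set v] else set0)); last first.
    apply/seteqP; split => [x Ax|x [v _]].
      by exists (fl m x) => //; rewrite mem_set.
    by case: ifPn => // + /= -> => /set_mem.
  apply: countable_bigcupT_measurable => // v; case: ifPn => // _.
  have -> : fl m @^-1` [set v] = \bigcap_(i in [set: 'I_n])
     [set x | Num.floor (2 ^+ m * x 0 i) = v 0 i].
    apply/seteqP; split => [x /= <- i _ /=|x /= h]; first by rewrite mxE.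
    by apply/rowP => i; rewrite mxE h.
  apply: fin_bigcap_measurable => // i _.
  rewrite [X in measurable X](_ : _ =
     (fun x : 'rV[R]_n => 2 ^+ m * x 0 i) @^-1` `[(v 0 i)%:~R, (v 0 i + 1)%:~R[);
    last first.
    apply/seteqP; split => x /=; rewrite in_itv/=.
      by move=> <-; rewrite Num.Theory.floor_le_tmp Num.Theory.floorD1_gt.
    by move/andP => [h1 h2]; apply: Num.Theory.floor_def; rewrite h1.
  have mm : measurable_fun setT (fun x : 'rV[R]_n => 2 ^+ m * x 0 i : measurableTypeR R).
    by apply: measurable_funM => //; exact: measurable_rV_coord.
  have := mm measurableT _ (measurable_itv `[(v 0 i)%:~R, (v 0 i + 1)%:~R[).
  by rewrite setTI.
apply: (@measurable_fun_cvg _ _ _ setT (fun m x => f (pt m (fl m x)))) => //.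
  move=> m _ Y _; rewrite setTI.
  exact: (mfl m [set v | Y (f (pt m v))]).
move=> x _; apply: (@cvg_comp _ _ _ (fun m => pt m (fl m x)) f); last exact: cf.
apply/cvgrPdist_le => e e0.
have : (2^-1 ^+ m : R) @[m --> \oo] --> 0.
  by apply: cvg_expr; rewrite ger0_norm; lra.
move=> /cvgrPdist_le/(_ e e0) [M _ HM].
exists M => // m /HM; rewrite sub0r normrN ger0_norm ?exprn_ge0// => le_e.
rewrite (le_trans _ le_e)//.
rewrite /Num.norm/= mx_normrE; apply: bigmax_le => //= -[i j] _.
rewrite !mxE/=; have -> : i = 0 by exact: ord1.
have p0 : 0 < (2 : R) ^+ m by rewrite exprn_gt0.
set t := 2 ^+ m * x 0 j.
have -> : x 0 j = t / 2 ^+ m by rewrite /t mulrAC divff ?mul1r// gt_eqF.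
rewrite -mulrBl normrM [X in _ * X]ger0_norm ?invr_ge0 ?ltW//.
rewrite exprVn -[ltRHS]mul1r ltr_pM2r ?invr_gt0//.
have := Num.Theory.floor_itv t => /andP[h1 h2].
rewrite ltr_norml; move: h2; rewrite intrD => h2; apply/andP; split; lra.
Qed.

End lebesgue_rV_theory.

(** * Closure rules for measurability *)

Section measurable_real_functions.
Context {R : realType} {d : measure_display} {S : measurableType d}.
Implicit Types f g : S -> R.

Lemma mf_cst (c : R) : measurable_fun setT (fun _ : S => c).
Proof. exact: measurable_cst. Qed.

Lemma mf_add f g : measurable_fun setT f -> measurable_fun setT g ->
  measurable_fun setT (fun x => f x + g x).
Proof. exact: measurable_funD. Qed.

Lemma mf_sub f g : measurable_fun setT f -> measurable_fun setT g ->
  measurable_fun setT (fun x => f x - g x).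
Proof. exact: measurable_funB. Qed.

Lemma mf_mul f g : measurable_fun setT f -> measurable_fun setT g ->
  measurable_fun setT (fun x => f x * g x).
Proof. exact: measurable_funM. Qed.

Lemma mf_opp f : measurable_fun setT f -> measurable_fun setT (fun x => - f x).
Proof. by move=> mf; rewrite -[X in measurable_fun _ X]/(\- f); exact: measurable_funN. Qed.

Lemma mf_norm f : measurable_fun setT f -> measurable_fun setT (fun x => `|f x|).
Proof. by move=> mf; apply: measurableT_comp. Qed.

Lemma mf_powR f q : measurable_fun setT f -> measurable_fun setT (fun x => f x `^ q).
Proof.
move=> mf; apply: (measurableT_comp (f := (@powR R)^~ q)) => //.
Qed.

Lemma mf_exp f k : measurable_fun setT f -> measurable_fun setT (fun x => f x ^+ k).
Proof. exact: measurable_funX. Qed.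

Lemma mf_expR f : measurable_fun setT f -> measurable_fun setT (fun x => expR (f x)).
Proof. by move=> mf; apply: (measurableT_comp (f := @expR R)). Qed.

Lemma mf_sum I (s : seq I) (P : pred I) (F : I -> S -> R) :
  (forall i, P i -> measurable_fun setT (F i)) ->
  measurable_fun setT (fun x => \sum_(i <- s | P i) F i x).
Proof.
move=> mF; rewrite (_ : (fun _ => _) =
  (fun x => \sum_(i <- s) (if P i then F i x else 0))).
  by apply: measurable_sum => i; case E : (P i) => //; exact: mF.
by apply/funext => x; rewrite big_mkcond.
Qed.

End measurable_real_functions.

Section measurable_rV_functions.
Context {R : realType} {n : nat}.
Local Notation T := 'rV[R]_n.
Implicit Types (f g : T -> R) (a : R) (b : T).

Lemma mf_aff f a b : measurable_fun setT f ->
  measurable_fun setT (fun x : T => f (a *: x + b)).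
Proof.
by move=> mf; apply: measurableT_comp => //; exact: measurable_rV_affine.
Qed.

Lemma mf_scale f a : measurable_fun setT f ->
  measurable_fun setT (fun x : T => f (a *: x)).
Proof. by move=> /(mf_aff a 0); under eq_fun do rewrite addr0. Qed.

Lemma mf_addr f b : measurable_fun setT f -> measurable_fun setT (fun x : T => f (x + b)).
Proof. by move=> /(mf_aff 1 b); under eq_fun do rewrite scale1r. Qed.

Lemma mf_subr f b : measurable_fun setT f -> measurable_fun setT (fun x : T => f (x - b)).
Proof. exact: mf_addr. Qed.

Lemma mf_rsub f b : measurable_fun setT f -> measurable_fun setT (fun x : T => f (b - x)).
Proof. by move=> /(mf_aff (-1) b); under eq_fun do rewrite scaleN1r addrC. Qed.

Lemma mf_neg f : measurable_fun setT f -> measurable_fun setT (fun x : T => f (- x)).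
Proof. by move=> /(mf_rsub 0); under eq_fun do rewrite sub0r. Qed.

Lemma measurable_rV_lin (a b : R) :
  measurable_fun setT (fun z : T * T => a *: z.1 + b *: z.2).
Proof.
apply: measurable_fun_rVP => i.
rewrite (_ : (fun _ => _) = (fun z : T * T => a * z.1 0 i + b * z.2 0 i)).
  apply: measurable_funD; apply: measurable_funM => //.
    exact: (measurableT_comp (measurable_rV_coord i) measurable_fst).
  exact: (measurableT_comp (measurable_rV_coord i) measurable_snd).
by apply/funext => x; rewrite !mxE.
Qed.

Lemma mf_lin2 f (a b : R) : measurable_fun setT f ->
  measurable_fun setT (fun z : T * T => f (a *: z.1 + b *: z.2)).
Proof.
by move=> mf; apply: (measurableT_comp mf); exact: measurable_rV_lin.
Qed.

Lemma mf_sub2 f : measurable_fun setT f ->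
  measurable_fun setT (fun z : T * T => f (z.1 - z.2)).
Proof.
by move=> /(mf_lin2 1 (-1)); under eq_fun do rewrite scale1r scaleN1r.
Qed.

Lemma mf_add2 f : measurable_fun setT f ->
  measurable_fun setT (fun z : T * T => f (z.1 + z.2)).
Proof.
by move=> /(mf_lin2 1 1); under eq_fun do rewrite !scale1r.
Qed.

Lemma mf_fst f : measurable_fun setT f ->
  measurable_fun setT (fun z : T * T => f z.1).
Proof.
by move=> /(mf_lin2 1 0); under eq_fun do rewrite scale1r scale0r addr0.
Qed.

Lemma mf_snd f : measurable_fun setT f ->
  measurable_fun setT (fun z : T * T => f z.2).
Proof.
by move=> /(mf_lin2 0 1); under eq_fun do rewrite scale1r scale0r add0r.
Qed.

Lemma mf_xsect (G : T * T -> R) x : measurable_fun setT G ->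
  measurable_fun setT (fun y => G (x, y)).
Proof.
by move=> mG; have := measurableT_comp mG (@pair1_measurable _ _ T T x).
Qed.

Lemma mf_ysect (G : T * T -> R) y : measurable_fun setT G ->
  measurable_fun setT (fun x => G (x, y)).
Proof.
by move=> mG; have := measurableT_comp mG (@pair2_measurable _ _ T T y).
Qed.

End measurable_rV_functions.

(** Substitutions are matched before the closure rules: the function behind a translated or dilated
    argument has to be named explicitly, since higher-order unification would not find it. *)
Ltac mf_step := match goal with
  | |- measurable_fun _ (fun x => ?f (x.1 - x.2)) => apply: (@mf_sub2 _ _ f)
  | |- measurable_fun _ (fun x => ?f (x.1 + x.2)) => apply: (@mf_add2 _ _ f)
  | |- measurable_fun _ (fun x => ?f x.1) => apply: (@mf_fst _ _ f)
  | |- measurable_fun _ (fun x => ?f x.2) => apply: (@mf_snd _ _ f)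
  | |- measurable_fun _ (fun x => ?f (x - ?b)) => apply: (@mf_subr _ _ f b)
  | |- measurable_fun _ (fun x => ?f (x + ?b)) => apply: (@mf_addr _ _ f b)
  | |- measurable_fun _ (fun x => ?f (?b - x)) => apply: (@mf_rsub _ _ f b)
  | |- measurable_fun _ (fun x => ?f (- x)) => apply: (@mf_neg _ _ f)
  | |- measurable_fun _ (fun x => ?f (?a *: x)) => apply: (@mf_scale _ _ f a)
  | |- measurable_fun _ (fun x => ?c) => apply: mf_cst
  end.

Ltac mf := repeat first
  [ assumption | mf_step | apply: mf_add | apply: mf_sub | apply: mf_mul
  | apply: mf_opp | apply: mf_norm | apply: mf_powR | apply: mf_exp
  | apply: mf_expR | apply: mf_sum => ? ? ].

(** * Bounded measurable and bounded integrable functions *)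

Section bounded_integrable.
Context {R : realType} {n : nat}.
Local Notation T := 'rV[R]_n.
Local Notation mu := (lebesgue_rV R n).
Implicit Types (f g h k : T -> R) (a q : R) (b : T).

Definition Int f : R := \int[mu]_x f x.

Definition bdm f := exists M, measurable_fun setT f /\ forall x, `|f x| <= M.

(** The working class. It is closed under sums, products, powers of exponent at least 1, affine
    substitutions and convolution, so the integrals below are finite real numbers; [bdm] is the
    class of admissible multipliers. *)
Definition bl f := exists M,
  [/\ measurable_fun setT f, forall x, `|f x| <= M &
      mu.-integrable setT (EFin \o f)].

Lemma bl_bdm f : bl f -> bdm f. Proof. by case=> M [mf fM _]; exists M. Qed.
Lemma bl_mf f : bl f -> measurable_fun setT f. Proof. by case=> M []. Qed.
Lemma bdm_mf f : bdm f -> measurable_fun setT f. Proof. by case=> M []. Qed.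
Lemma bl_int f : bl f -> mu.-integrable setT (EFin \o f).
Proof. by case=> M []. Qed.

Lemma bdm_bound f : bdm f -> exists M, forall x, `|f x| <= M.
Proof. by case=> M [_ ?]; exists M. Qed.

Lemma bl_bound f : bl f -> exists M, forall x, `|f x| <= M.
Proof. by move/bl_bdm; exact: bdm_bound. Qed.

Lemma bdmI M f : measurable_fun setT f -> (forall x, `|f x| <= M) -> bdm f.
Proof. by move=> mf fM; exists M. Qed.

Lemma blI f : bdm f -> mu.-integrable setT (EFin \o f) -> bl f.
Proof. by move=> [M [mf fM]] jf; exists M. Qed.

Lemma bdm_le f g : measurable_fun setT f -> bdm g ->
  (forall x, `|f x| <= g x) -> bdm f.
Proof.
move=> mf [M [_ gM]] fg; exists M; split=> // x.
by rewrite (le_trans (fg x))// (le_trans _ (gM x))// ler_norm.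
Qed.

Lemma bl_dom f g : measurable_fun setT f -> bl g ->
  (forall x, `|f x| <= g x) -> bl f.
Proof.
move=> mf bg fg; apply: blI; first exact: bdm_le (bl_bdm bg) fg.
apply: (le_integrable measurableT _ _ (bl_int bg)) => [|x _ /=].
  exact/measurable_EFinP.
by rewrite lee_fin (le_trans (fg x))// ler_norm.
Qed.

Lemma eq_bl f g : f =1 g -> bl f -> bl g.
Proof. by move=> /funext ->. Qed.

Lemma eq_Int f g : f =1 g -> Int f = Int g.
Proof. by move=> /funext ->. Qed.

Lemma IntE f : Int f = fine (\int[mu]_x (f x)%:E)%E.
Proof. by []. Qed.

Lemma bdm_cst c : bdm (fun _ => c).
Proof. by exists `|c|; split; [exact: mf_cst|]. Qed.

Lemma bdm_add f g : bdm f -> bdm g -> bdm (fun x => f x + g x).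
Proof.
move=> [M [mf fM]] [N [mg gN]]; exists (M + N); split=> [|x]; first exact: mf_add.
by rewrite (le_trans (ler_normD _ _))// lerD.
Qed.

Lemma bdm_opp f : bdm f -> bdm (fun x => - f x).
Proof.
move=> [M [mf fM]]; exists M; split=> [|x]; first exact: mf_opp.
by rewrite normrN.
Qed.

Lemma bdm_sub f g : bdm f -> bdm g -> bdm (fun x => f x - g x).
Proof. by move=> bf /bdm_opp; exact: bdm_add. Qed.

Lemma bdm_norm f : bdm f -> bdm (fun x => `|f x|).
Proof.
move=> [M [mf fM]]; exists M; split=> [|x]; first exact: mf_norm.
by rewrite normr_id.
Qed.

Lemma bdm_mul f g : bdm f -> bdm g -> bdm (fun x => f x * g x).
Proof.
move=> [M [mf fM]] [N [mg gN]]; exists (M * N); split=> [|x]; first exact: mf_mul.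
by rewrite normrM ler_pM.
Qed.

Lemma bdm_exp f i : bdm f -> bdm (fun x => f x ^+ i).
Proof.
move=> [M [mf fM]]; exists (M ^+ i); split=> [|x]; first exact: mf_exp.
by rewrite normrX lerXn2r// nnegrE (le_trans _ (fM x)).
Qed.

(* Negative bases are harmless: powR is 1 there. *)
Lemma bdm_powR f q : 0 <= q -> bdm f -> bdm (fun x => f x `^ q).
Proof.
move=> q0 [M [mf fM]]; exists (Num.max M 1 `^ q).
split=> [|x]; first exact: mf_powR.
rewrite ger0_norm ?powR_ge0//.
have M1 : 1 <= Num.max M 1 by rewrite le_max lexx orbT.
have M0 : 0 <= Num.max M 1 by rewrite (le_trans _ M1).
have [fx|fx] := ltP (f x) 0.
  have : 1 `^ q <= Num.max M 1 `^ q by rewrite ge0_ler_powR// nnegrE.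
  by move=> h; rewrite (lt0_powR1 _ fx); move: h; rewrite powR1.
apply: ge0_ler_powR; rewrite ?nnegrE// le_max; apply/orP; left.
by rewrite (le_trans (ler_norm _)).
Qed.

Lemma bdm_sum I (s : seq I) (P : pred I) (F : I -> T -> R) :
  (forall i, P i -> bdm (F i)) -> bdm (fun x => \sum_(i <- s | P i) F i x).
Proof.
move=> bF; elim: s => [|i s IH].
  by under eq_fun do rewrite big_nil; exact: bdm_cst.
under eq_fun do rewrite big_cons; case E : (P i) => //.
by apply: bdm_add => //; exact: bF.
Qed.

Lemma bdm_addr f b : bdm f -> bdm (fun x => f (x + b)).
Proof. by move=> [M [mf fM]]; exists M; split; [exact: mf_addr|]. Qed.

Lemma bdm_subr f b : bdm f -> bdm (fun x => f (x - b)).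
Proof. exact: bdm_addr. Qed.

Lemma bdm_rsub f b : bdm f -> bdm (fun x => f (b - x)).
Proof. by move=> [M [mf fM]]; exists M; split; [exact: mf_rsub|]. Qed.

Lemma bdm_scale f a : bdm f -> bdm (fun x => f (a *: x)).
Proof. by move=> [M [mf fM]]; exists M; split; [exact: mf_scale|]. Qed.

Lemma bdm_neg f : bdm f -> bdm (fun x => f (- x)).
Proof. by move=> [M [mf fM]]; exists M; split; [exact: mf_neg|]. Qed.

Lemma bl0 : bl (fun _ => 0).
Proof.
apply: blI; first exact: bdm_cst.
by rewrite (_ : _ \o _ = cst 0%E)//; exact: integrable0.
Qed.

Lemma bl_add f g : bl f -> bl g -> bl (fun x => f x + g x).
Proof.
move=> bf bg; apply: blI; first by apply: bdm_add; exact: bl_bdm.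
move: (bl_int bf) (bl_int bg) => jf jg.
by rewrite (_ : _ \o _ = (EFin \o f) \+ (EFin \o g))%E//; exact: integrableD.
Qed.

Lemma bl_mulr f g : bdm f -> bl g -> bl (fun x => f x * g x).
Proof.
move=> bf bg; have [M [mf fM]] := bf.
apply: (@bl_dom _ (fun x => M * `|g x|)).
- by apply: mf_mul => //; exact: bl_mf.
- apply: blI; first by apply: bdm_mul; [exact: bdm_cst|apply/bdm_norm/bl_bdm].
  have := integrableZl measurableT M (integrable_norm (bl_int bg)).
  by under eq_fun do rewrite /= -EFinM.
- by move=> x; rewrite normrM ler_wpM2r.
Qed.

Lemma bl_mull f g : bl f -> bdm g -> bl (fun x => f x * g x).
Proof.
by move=> bf bg; under eq_fun do rewrite mulrC; exact: bl_mulr.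
Qed.

Lemma bl_opp f : bl f -> bl (fun x => - f x).
Proof.
move=> bf; under eq_fun do rewrite -mulN1r; apply: bl_mulr => //.
exact: bdm_cst.
Qed.

Lemma bl_sub f g : bl f -> bl g -> bl (fun x => f x - g x).
Proof. by move=> bf /bl_opp; exact: bl_add. Qed.

Lemma bl_norm f : bl f -> bl (fun x => `|f x|).
Proof.
move=> bf; apply: blI; first exact/bdm_norm/bl_bdm.
exact: (integrable_norm (bl_int bf)).
Qed.

Lemma bl_exp f i : bl f -> bl (fun x => f x ^+ i.+1).
Proof.
move=> bf; under eq_fun do rewrite exprS; apply: bl_mull => //.
by apply/bdm_exp/bl_bdm.
Qed.

Lemma bl_powR f q : 1 <= q -> bl f -> bl (fun x => `|f x| `^ q).
Proof.
move=> q1 bf; have q0 : 0 < q by exact: lt_le_trans q1.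
under eq_fun do rewrite -mulr_powRB1//.
apply: bl_mull; first exact: bl_norm.
by apply: bdm_powR; [rewrite subr_ge0|apply/bdm_norm/bl_bdm].
Qed.

Lemma bl_powR0 f q : 1 <= q -> (forall x, 0 <= f x) -> bl f ->
  bl (fun x => f x `^ q).
Proof.
by move=> q1 f0 /(bl_powR q1); under eq_fun do rewrite ger0_norm//.
Qed.

Lemma bl_sum I (s : seq I) (P : pred I) (F : I -> T -> R) :
  (forall i, P i -> bl (F i)) -> bl (fun x => \sum_(i <- s | P i) F i x).
Proof.
move=> bF; elim: s => [|i s IH].
  by under eq_fun do rewrite big_nil; exact: bl0.
under eq_fun do rewrite big_cons; case E : (P i) => //.
by apply: bl_add => //; exact: bF.
Qed.


Lemma ge0_integral_bl f : bl f -> (\int[mu]_x (f x)%:E)%E = (Int f)%:E.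
Proof.
by move=> /bl_int jf; rewrite /Int /Rintegral fineK//; exact: integrable_fin_num.
Qed.

Lemma bl_aff a b f : a != 0 -> bl f -> bl (fun x => f (a *: x + b)).
Proof.
move=> a0 bf; have [M [mf fM jf]] := bf; apply: blI.
  by exists M; split; [exact: mf_aff|].
have mf' := mf_aff a b mf; apply/integrableP; split; first exact/measurable_EFinP.
have /integrableP[_] := jf.
rewrite -(@ge0_integral_affine _ _ a b (fun x => `|(f x)%:E|)%E)//; last first.
  by apply: measurableT_comp => //; exact/measurable_EFinP.
set I := (X in (_ * X)%E); have I0 : (0 <= I)%E by exact: integral_ge0.
have p0 : (0 < (`|a| ^+ n)%:E)%E by rewrite lte_fin exprn_gt0// normr_gt0.
have IE : (\int[mu]_x `|(EFin \o (fun x => f (a *: x + b)%R)) x|)%E = I by [].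
rewrite IE; clear IE; clearbody I.
case: I I0 => [r| |] I0 //; first by move=> _; rewrite ltry.
by rewrite gt0_muley// ltxx.
Qed.

Lemma Int_add f g : bl f -> bl g -> Int (fun x => f x + g x) = Int f + Int g.
Proof. by move=> /bl_int jf /bl_int jg; rewrite /Int RintegralD. Qed.

Lemma Int_sub f g : bl f -> bl g -> Int (fun x => f x - g x) = Int f - Int g.
Proof. by move=> /bl_int jf /bl_int jg; rewrite /Int RintegralB. Qed.

Lemma IntZ c f : bl f -> Int (fun x => c * f x) = c * Int f.
Proof. by move=> /bl_int jf; rewrite /Int RintegralZl. Qed.

Lemma IntZr c f : bl f -> Int (fun x => f x * c) = Int f * c.
Proof. by move=> bf; under eq_Int do rewrite mulrC; rewrite IntZ// mulrC. Qed.

Lemma Int_opp f : bl f -> Int (fun x => - f x) = - Int f.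
Proof.
by move=> bf; under eq_Int do rewrite -mulN1r; rewrite IntZ// mulN1r.
Qed.

Lemma Int0 : Int (fun _ => 0) = 0.
Proof. by rewrite /Int /Rintegral integral0. Qed.

Lemma Int_sum I (s : seq I) (P : pred I) (F : I -> T -> R) :
  (forall i, P i -> bl (F i)) ->
  Int (fun x => \sum_(i <- s | P i) F i x) = \sum_(i <- s | P i) Int (F i).
Proof.
move=> bF; elim: s => [|i s IH].
  by under eq_Int do rewrite big_nil; rewrite big_nil Int0.
under eq_Int do rewrite big_cons; rewrite big_cons; case E : (P i) => //.
by rewrite Int_add ?IH//; [exact: bF|exact: bl_sum].
Qed.

Lemma Int_ge0 f : (forall x, 0 <= f x) -> 0 <= Int f.
Proof. by move=> f0; exact: Rintegral_ge0. Qed.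

Lemma Int_le f g : bl f -> bl g -> (forall x, f x <= g x) -> Int f <= Int g.
Proof. by move=> /bl_int jf /bl_int jg fg; exact: le_Rintegral. Qed.

Lemma Int_norm f : bl f -> `|Int f| <= Int (fun x => `|f x|).
Proof. by move=> /bl_int jf; exact: le_normr_Rintegral. Qed.

Lemma Int_aff a b f : a != 0 -> bl f ->
  `|a| ^+ n * Int (fun x => f (a *: x + b)) = Int f.
Proof.
move=> a0.
have ge0 g : bl g -> (forall x, 0 <= g x) ->
    `|a| ^+ n * Int (fun x => g (a *: x + b)) = Int g.
  move=> bg g0; apply: EFin_inj; rewrite EFinM -!ge0_integral_bl//; last first.
    exact: bl_aff.
  rewrite (@ge0_integral_affine _ _ a b (EFin \o g))//.
  by apply/measurable_EFinP; exact: bl_mf.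
move=> bf; have bn := bl_norm bf; have bs := bl_add bn bf.
have s0 x : 0 <= `|f x| + f x by have := ler_norm (- f x); rewrite normrN; lra.
(* A difference of two nonnegative functions of the class, which reduces the claim to the Tonelli
   version. *)
have E : f =1 (fun x => (`|f x| + f x) - `|f x|) by move=> x; ring.
rewrite [RHS](eq_Int E) Int_sub// -(ge0 _ bs)// -(ge0 _ bn)// -mulrBr.
congr (_ * _).
rewrite -(Int_sub (bl_aff b a0 bs) (bl_aff b a0 bn)).
by apply: eq_Int => x; ring.
Qed.

Lemma bl_addr f b : bl f -> bl (fun x => f (x + b)).
Proof.
by move=> /(bl_aff b (oner_neq0 _)); under eq_fun do rewrite scale1r.
Qed.

Lemma Int_addr f b : bl f -> Int (fun x => f (x + b)) = Int f.
Proof.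
move=> bf; rewrite -[RHS](Int_aff b (oner_neq0 _) bf) normr1 expr1n mul1r.
by apply: eq_Int => x; rewrite scale1r.
Qed.

Lemma bl_subr f b : bl f -> bl (fun x => f (x - b)).
Proof. exact: bl_addr. Qed.

Lemma Int_subr f b : bl f -> Int (fun x => f (x - b)) = Int f.
Proof. exact: Int_addr. Qed.

Let m1 : (-1 : R) != 0. Proof. by rewrite oppr_eq0 oner_neq0. Qed.

Lemma bl_rsub f b : bl f -> bl (fun x => f (b - x)).
Proof.
by move=> /(bl_aff b m1); under eq_fun do rewrite scaleN1r addrC.
Qed.

Lemma Int_rsub f b : bl f -> Int (fun x => f (b - x)) = Int f.
Proof.
move=> bf; rewrite -[RHS](Int_aff b m1 bf) normrN1 expr1n mul1r.
by apply: eq_Int => x; rewrite scaleN1r addrC.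
Qed.

Lemma bl_neg f : bl f -> bl (fun x => f (- x)).
Proof. by move=> /(bl_rsub 0); under eq_fun do rewrite sub0r. Qed.

Lemma Int_neg f : bl f -> Int (fun x => f (- x)) = Int f.
Proof.
by move=> bf; rewrite -(Int_rsub 0 bf); apply: eq_Int => x; rewrite sub0r.
Qed.

Lemma bl_scale f a : a != 0 -> bl f -> bl (fun x => f (a *: x)).
Proof. by move=> a0 /(bl_aff 0 a0); under eq_fun do rewrite addr0. Qed.

Lemma Int_scale f a : a != 0 -> bl f ->
  `|a| ^+ n * Int (fun x => f (a *: x)) = Int f.
Proof.
move=> a0 bf; rewrite -[RHS](Int_aff 0 a0 bf); congr (_ * _).
by apply: eq_Int => x; rewrite addr0.
Qed.

End bounded_integrable.

Global Opaque Int.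

Ltac bdm_step := match goal with
  | |- bdm (fun x => ?f (x - ?b)) => apply: (@bdm_subr _ _ f b)
  | |- bdm (fun x => ?f (x + ?b)) => apply: (@bdm_addr _ _ f b)
  | |- bdm (fun x => ?f (?b - x)) => apply: (@bdm_rsub _ _ f b)
  | |- bdm (fun x => ?f (- x)) => apply: (@bdm_neg _ _ f)
  | |- bdm (fun x => ?f (?a *: x)) => apply: (@bdm_scale _ _ f a)
  | |- bdm (fun x => ?c) => apply: bdm_cst
  end.

Ltac bdms := repeat first
  [ assumption | (apply: bl_bdm; assumption)
  | match goal with H : forall _, bdm _ |- _ => exact: H
    | H : forall _, bl _ |- _ => exact: (bl_bdm (H _)) end
  | bdm_step | apply: bdm_add | apply: bdm_sub | apply: bdm_mul
  | apply: bdm_opp | apply: bdm_norm | apply: bdm_exp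
  | (apply: bdm_powR; [by []|]) | apply: bdm_sum => ? ? ].

Ltac bl_step := match goal with
  | |- bl (fun x => ?f (x - ?b)) => apply: (@bl_subr _ _ f b)
  | |- bl (fun x => ?f (x + ?b)) => apply: (@bl_addr _ _ f b)
  | |- bl (fun x => ?f (?b - x)) => apply: (@bl_rsub _ _ f b)
  | |- bl (fun x => ?f (- x)) => apply: (@bl_neg _ _ f)
  | |- bl (fun x => ?f (?a *: x)) => apply: (@bl_scale _ _ f a); [by []|]
  end.

Ltac bls := solve
  [ assumption | match goal with H : forall _, bl _ |- _ => exact: H end
  | exact: bl0 | bl_step; bls | apply: bl_add; bls | apply: bl_sub; bls
  | apply: bl_opp; bls | apply: bl_norm; bls | apply: bl_exp; bls
  | apply: bl_powR; [by []|bls] | apply: bl_powR0; [by []|by []|bls]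
  | apply: bl_sum => ? ?; bls
  | apply: bl_mulr; [solve [bdms]|bls] | apply: bl_mull; [bls|solve [bdms]] ].

(** * Power inequalities: Bernoulli, Jensen, Young *)

Section power_inequalities.
Context {R : realType}.
Implicit Types a b t u p q e : R.

(** Young's inequality for the product t * 1 with exponents q and q / (q - 1). *)
Lemma bernoulli t q : 0 <= t -> 1 <= q -> 1 + q * (t - 1) <= t `^ q.
Proof.
move=> t0; rewrite le_eqVlt => /predU1P[<-|q1]; first by rewrite powRr1//; lra.
have q0 : 0 < q by lra.
pose p := q / (q - 1).
have qq : q - 1 != 0 by rewrite subr_eq0 gt_eqF.
have p0 : 0 < p by rewrite divr_gt0// subr_gt0.
have pq : q^-1 + p^-1 = 1 by rewrite /p invf_div; field; rewrite gt_eqF.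
have := conjugate_powR t0 ler01 q0 p0 pq.
rewrite mulr1 powR1 => h.
have : q * t <= t `^ q + q * p^-1.
  have -> : t `^ q + q * p^-1 = q * (t `^ q / q + 1 / p) by field; rewrite !gt_eqF.
  by rewrite ler_pM2l.
rewrite /p invf_div mulrCA divff ?gt_eqF// mulr1 => h2.
lra.
Qed.

(** Bernoulli's inequality at u / a, multiplied by a^q. This tangent bound is the source of the
    Jensen and telescoping inequalities below. *)
Lemma powR_tangent a u q : 0 <= a -> 0 <= u -> 1 <= q ->
  a `^ q + q * a `^ (q - 1) * (u - a) <= u `^ q.
Proof.
move=> a0 u0 q1; have q0 : 0 < q by lra.
move: a0; rewrite le_eqVlt => /predU1P[<-|a0].
  rewrite powR0 ?gt_eqF// subr0 add0r.
  have [->|q1'] := eqVneq q 1; first by rewrite subrr powRr0 powRr1// !mul1r.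
  by rewrite powR0 ?subr_eq0// mulr0 mul0r powR_ge0.
have := @bernoulli (u / a) q (divr_ge0 u0 (ltW a0)) q1.
rewrite -(ler_pM2l (powR_gt0 q a0)) -powRM ?divr_ge0 ?(ltW a0)//.
rewrite mulrCA divff ?gt_eqF// mulr1; apply: le_trans.
rewrite [leRHS]mulrDr mulr1 lerD2l le_eqVlt; apply/orP; left; apply/eqP.
rewrite -(mulr_powRB1 (ltW a0) q0); set X := a `^ (q - 1).
by field; rewrite gt_eqF.
Qed.

Lemma powR_le_mono a b q : 0 <= q -> 0 <= a -> a <= b -> a `^ q <= b `^ q.
Proof. by move=> q0 a0 ab; apply: ge0_ler_powR; rewrite ?nnegrE// (le_trans a0). Qed.

(** The weights need not have total mass 1, whence the power of W. Summing the tangent inequality at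
    an arbitrary m bounds Y from below, and the mean m = X / W is the best choice. *)
Lemma jensen_sum (I : eqType) (s : seq I) (P : pred I) (w x : I -> R) q : 1 <= q ->
  (forall i, P i -> 0 <= w i) -> (forall i, P i -> 0 <= x i) ->
  (\sum_(i <- s | P i) w i * x i) `^ q <=
  (\sum_(i <- s | P i) w i) `^ (q - 1) * \sum_(i <- s | P i) w i * x i `^ q.
Proof.
move=> q1 w0 x0; have q0 : 0 < q by lra.
set W := \sum_(i <- s | P i) w i; set X := \sum_(i <- s | P i) _.
set Y := \sum_(i <- s | P i) w i * x i `^ q.
have W0 : 0 <= W by exact: sumr_ge0.
have X0 : 0 <= X by apply: sumr_ge0 => i Pi; rewrite mulr_ge0 ?w0 ?x0.
have Y0 : 0 <= Y by apply: sumr_ge0 => i Pi; rewrite mulr_ge0 ?w0 ?powR_ge0.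
have E m : 0 <= m -> W * m `^ q + q * m `^ (q - 1) * (X - W * m) <= Y.
  move=> m0; have -> : W * m `^ q + q * m `^ (q - 1) * (X - W * m) =
    \sum_(i <- s | P i) w i * (m `^ q + q * m `^ (q - 1) * (x i - m)).
    transitivity (m `^ q * W + q * m `^ (q - 1) * X - q * m `^ (q - 1) * m * W).
      by ring.
    rewrite /W /X !mulr_sumr -big_split/= -sumrB.
    by apply: eq_bigr => i _; ring.
  apply: ler_sum => i Pi; rewrite ler_wpM2l ?w0//.
  by apply: powR_tangent => //; exact: x0.
have [W00|Wn0] := eqVneq W 0; last first.
  have := E (X / W) (divr_ge0 X0 W0).
  rewrite [W * (X / W)]mulrC divfK// subrr mulr0 addr0.
  move=> /(ler_wpM2l (powR_ge0 W (q - 1))); apply: le_trans.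
  rewrite mulrA [_ * W]mulrC mulr_powRB1// ?lt0r ?Wn0// -powRM ?divr_ge0//.
  by rewrite mulrC divfK.
suff -> : X = 0 by rewrite powR0 ?gt_eqF// mulr_ge0 ?powR_ge0.
apply: big1_seq => i /andP[Pi si].
have /eqP := W00; rewrite psumr_eq0// => /allP/(_ i si); rewrite Pi/= => /eqP ->.
by rewrite mul0r.
Qed.

(** If a <= e b, the second term alone suffices; otherwise b < a / e, which gives C = e^-(p-1). *)
Lemma young_split p e : 0 < e -> 1 <= p -> exists2 C, 0 <= C &
  forall a b, 0 <= a -> 0 <= b -> a * b `^ (p - 1) <= C * a `^ p + e * b `^ p.
Proof.
move=> e0 p1; have p0 : 0 < p by lra.
exists (e^-1 `^ (p - 1)) => [|a b a0 b0]; first exact: powR_ge0.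
have [ab|ba] := leP a (e * b).
  rewrite (@le_trans _ _ (e * b `^ p))//; last first.
    by rewrite ler_wpDl// mulr_ge0 ?powR_ge0.
  by rewrite -(mulr_powRB1 b0 p0) mulrA ler_wpM2r ?powR_ge0.
rewrite (@le_trans _ _ (e^-1 `^ (p - 1) * a `^ p))//; last first.
  by rewrite lerDl mulr_ge0 ?powR_ge0// ltW.
rewrite -(mulr_powRB1 a0 p0) mulrCA ler_wpM2l// -powRM ?invr_ge0 ?(ltW e0)//.
apply: powR_le_mono => //; first by rewrite subr_ge0.
by rewrite mulrC ler_pdivlMr// mulrC ltW.
Qed.

End power_inequalities.

(** * Fubini's theorem, convolution and dilation *)

Section fubini_bl.
Context {R : realType} {n : nat}.
Local Notation T := 'rV[R]_n.
Local Notation mu := (lebesgue_rV R n).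
Implicit Types (f g h k a b c : T -> R) (G : T * T -> R).

Let subrDC (x y z : T) : x - (y + z) = x - z - y.
Proof. by rewrite opprD addrA addrAC. Qed.

Lemma integrable_mf f : mu.-integrable setT (EFin \o f) -> measurable_fun setT f.
Proof. by move=> /integrableP[/measurable_EFinP]. Qed.

(** A bound [c] on the inner L^1 norms makes G integrable on the product. The conclusion is
    asymmetric: [c] also bounds the marginal in y, while the marginal in x is only integrable at
    this stage. *)
Lemma Int_swap G c : measurable_fun setT G ->
  (forall x, bl (fun y => G (x, y))) -> (forall y, bl (fun x => G (x, y))) ->
  bl c -> (forall y, Int (fun x => `|G (x, y)|) <= c y) ->
  [/\ mu.-integrable setT (EFin \o (fun x => Int (fun y => G (x, y)))),
      bl (fun y => Int (fun x => G (x, y))) &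
      Int (fun x => Int (fun y => G (x, y))) =
      Int (fun y => Int (fun x => G (x, y)))].
Proof.
move=> mG bx by' bc Gc.
have iG : (mu \x mu)%E.-integrable setT (EFin \o G).
  apply/integrable21ltyP; first exact/measurable_EFinP.
  apply: (@le_lt_trans _ _ (\int[mu]_y (c y)%:E)%E); last first.
    by rewrite ge0_integral_bl// ltry.
  apply: ge0_le_integral => //.
  - by move=> y _; exact: integral_ge0.
  - have mG' : measurable_fun setT (fun z : T * T => `|(G z)%:E|)%E.
      by apply: measurableT_comp => //; exact/measurable_EFinP.
    exact: (@measurable_fun_fubini_tonelli_G _ _ T T R mu _ mG' (fun z => abse_ge0 _)).
  - by apply/measurable_EFinP; exact: bl_mf.
  - move=> y _; rewrite (_ : (\int[_]__ _)%E = (Int (fun x => `|G (x, y)|))%:E).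
      by rewrite lee_fin.
    by rewrite -ge0_integral_bl//; exact: bl_norm.
have EF : fubini_F mu (EFin \o G) = EFin \o (fun x => Int (fun y => G (x, y))).
  by apply/funext => x; rewrite /fubini_F/= -ge0_integral_bl.
have EG : fubini_G mu (EFin \o G) = EFin \o (fun y => Int (fun x => G (x, y))).
  by apply/funext => y; rewrite /fubini_G/= -ge0_integral_bl.
split.
- by rewrite -EF; exact: integrable_fubini_F.
- apply: (@bl_dom _ _ _ c) => // [|y].
    by apply/measurable_EFinP; have := measurable_fubini_G iG; rewrite EG.
  by rewrite (le_trans (Int_norm (by' y))).
- have := Fubini iG; rewrite -/(fubini_F mu (EFin \o G)) => h.
  rewrite !IntE; congr fine.
  transitivity (\int[mu]_x fubini_F mu (EFin \o G) x)%E.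
    by rewrite EF.
  transitivity (\int[mu]_y fubini_G mu (EFin \o G) y)%E; first exact: h.
  by rewrite EG.
Qed.

Lemma bounded_Int_sub a b : bl a -> bl b -> (forall x, 0 <= b x) ->
  exists M, forall x, Int (fun y => a (x - y) * b y) <= M.
Proof.
move=> ba bb b0; have [M aM] := bl_bound ba; exists (M * Int b) => x.
rewrite -IntZ//; apply: Int_le => [||y]; first by bls.
  by apply: bl_mulr => //; exact: bdm_cst.
by rewrite ler_wpM2r// (le_trans (ler_norm _)).
Qed.

Lemma Int_swap_sub G a b : measurable_fun setT G -> bl a -> bl b ->
  (forall y, 0 <= b y) ->
  (forall x y, `|G (x, y)| <= a (x - y) * b y) ->
  [/\ bl (fun x => Int (fun y => G (x, y))),
      bl (fun y => Int (fun x => G (x, y))) &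
      Int (fun x => Int (fun y => G (x, y))) =
      Int (fun y => Int (fun x => G (x, y)))].
Proof.
move=> mG ba bb b0 Gab.
have bx x : bl (fun y => G (x, y)).
  apply: (@bl_dom _ _ _ (fun y => a (x - y) * b y)) => //; first exact: mf_xsect.
  by bls.
have by' y : bl (fun x => G (x, y)).
  apply: (@bl_dom _ _ _ (fun x => a (x - y) * b y)) => //; first exact: mf_ysect.
  by bls.
have le y : Int (fun x => `|G (x, y)|) <= Int a * b y.
  rewrite -(Int_subr y ba) -IntZr; last by bls.
  by apply: Int_le => [||x]; [exact: bl_norm|by bls|].
have bc : bl (fun y => Int a * b y) by bls.
have [I1 I2 E] := Int_swap mG bx by' bc le; split=> //.
apply: blI => //.
  have [M HM] := bounded_Int_sub ba bb b0; apply: (bdmI (M := M)) => [|x]; first exact: integrable_mf I1.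
  rewrite (le_trans (Int_norm (bx x)))// (le_trans _ (HM x))//.
  by apply: Int_le => [||y]; [exact: bl_norm|by bls|].
Qed.

Lemma Int_swap_mul G a b : measurable_fun setT G -> bl a -> bl b ->
  (forall x y, `|G (x, y)| <= a x * b y) ->
  [/\ bl (fun x => Int (fun y => G (x, y))),
      bl (fun y => Int (fun x => G (x, y))) &
      Int (fun x => Int (fun y => G (x, y))) =
      Int (fun y => Int (fun x => G (x, y)))].
Proof.
move=> mG ba bb Gab.
have bx x : bl (fun y => G (x, y)).
  by apply: (@bl_dom _ _ _ (fun y => a x * b y)) => //; [exact: mf_xsect|bls].
have by' y : bl (fun x => G (x, y)).
  by apply: (@bl_dom _ _ _ (fun x => a x * b y)) => //; [exact: mf_ysect|bls].
have le y : Int (fun x => `|G (x, y)|) <= Int a * b y.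
  rewrite -IntZr//; apply: Int_le => [||x]; [exact: bl_norm|by bls|exact: Gab].
have bc : bl (fun y => Int a * b y) by bls.
have [I1 I2 E] := Int_swap mG bx by' bc le; split=> //.
apply: blI => //.
  have [M HM] : exists M, forall x, `|a x * Int b| <= M.
    by apply: bdm_bound; bdms.
  apply: (bdmI (M := M)) => [|x]; first exact: integrable_mf I1.
  rewrite (le_trans (Int_norm (bx x)))//.
  rewrite (le_trans _ (HM x))// (le_trans _ (ler_norm _))// -IntZ//.
  by apply: Int_le => [||y]; [exact: bl_norm|by bls|].
Qed.

Definition cv f g : T -> R := fun x => Int (fun y => f (x - y) * g y).

Lemma bl_cv_sect f g x : bl f -> bdm g -> bl (fun y => f (x - y) * g y).
Proof. by move=> bf bg; bls. Qed.

Lemma bl_cv_sect' f g x : bdm f -> bl g -> bl (fun y => f (x - y) * g y).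
Proof. by move=> bf bg; apply: bl_mulr => //; bdms. Qed.

Lemma cvC f g x : bl f -> bdm g -> cv f g x = cv g f x.
Proof.
move=> bf bg; rewrite /cv -[RHS](Int_rsub x); last exact: bl_cv_sect'.
by apply: eq_Int => y; rewrite subKr mulrC.
Qed.

Lemma cv_swap f g : bl f -> bl g ->
  [/\ bl (cv f g), bl (fun y => Int (fun x => f (x - y) * g y)) &
   Int (cv f g) = Int (fun y => Int (fun x => f (x - y) * g y))].
Proof.
move=> bf bg.
apply: (@Int_swap_sub (fun z => f (z.1 - z.2) * g z.2) (fun x => `|f x|)
  (fun x => `|g x|)).
- by move: (bl_mf bf) (bl_mf bg) => *; mf.
- exact: bl_norm.
- exact: bl_norm.
- by [].
- by move=> x y; rewrite normrM.
Qed.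

Lemma bl_cv f g : bl f -> bl g -> bl (cv f g).
Proof. by move=> bf bg; have [] := cv_swap bf bg. Qed.

Lemma Int_cv f g : bl f -> bl g -> Int (cv f g) = Int f * Int g.
Proof.
move=> bf bg; have [_ _ ->] := cv_swap bf bg.
rewrite -IntZ//; apply: eq_Int => y; rewrite IntZr ?Int_subr//; bls.
Qed.

Lemma cvA f g h x : bl f -> bl g -> bl h -> cv f (cv g h) x = cv (cv f g) h x.
Proof.
move=> bf bg bh; have [M fM] := bl_bound bf.
have [_ _ E] : [/\ bl (fun y => Int (fun z => f (x - y) * (g (y - z) * h z))),
   bl (fun z => Int (fun y => f (x - y) * (g (y - z) * h z))) &
   Int (fun y => Int (fun z => f (x - y) * (g (y - z) * h z))) =
   Int (fun z => Int (fun y => f (x - y) * (g (y - z) * h z)))].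
  apply: (@Int_swap_sub (fun u => f (x - u.1) * (g (u.1 - u.2) * h u.2))
    (fun y => M * `|g y|) (fun y => `|h y|)) => //; [|by bls|by bls|].
  - move: (bl_mf bf) (bl_mf bg) (bl_mf bh) => *; mf.
    by apply: (@mf_fst _ _ (fun z => f (x - z))); mf.
  - by move=> y z /=; rewrite !normrM mulrA ler_wpM2r// ler_wpM2r.
transitivity (Int (fun y => Int (fun z => f (x - y) * (g (y - z) * h z)))).
  by apply: eq_Int => y; rewrite /cv IntZ//; bls.
rewrite E; apply: eq_Int => z.
transitivity (Int (fun y => (fun y => f (x - y) * g (y - z)) y * h z)).
  by apply: eq_Int => y; rewrite mulrA.
rewrite IntZr; last by bls.
congr (_ * _); rewrite /cv -(Int_addr z); last by bls.
by apply: eq_Int => y; rewrite addrK subrDC.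
Qed.

Lemma cv_ge0 f g x : (forall y, 0 <= f y) -> (forall y, 0 <= g y) -> 0 <= cv f g x.
Proof. by move=> f0 g0; apply: Int_ge0 => y; rewrite mulr_ge0. Qed.

Lemma cv_le f g h x : bl f -> bdm g -> bdm h -> (forall y, 0 <= f y) ->
  (forall y, g y <= h y) -> cv f g x <= cv f h x.
Proof.
move=> bf bg bh f0 gh; apply: Int_le => [||y]; [exact: bl_cv_sect..|].
by rewrite ler_wpM2l.
Qed.

Lemma cv_lel f g h x : bl f -> bl g -> bdm h -> (forall y, 0 <= h y) ->
  (forall y, f y <= g y) -> cv f h x <= cv g h x.
Proof.
move=> bf bg bh h0 fg; apply: Int_le => [||y]; [exact: bl_cv_sect..|].
by rewrite ler_wpM2r.
Qed.

Lemma cv_norm f g x : bl f -> bdm g ->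
  `|cv f g x| <= cv (fun y => `|f y|) (fun y => `|g y|) x.
Proof.
move=> bf bg; rewrite (le_trans (Int_norm (bl_cv_sect _ bf bg)))//.
by rewrite le_eqVlt; apply/orP; left; apply/eqP/eq_Int => y; rewrite normrM.
Qed.

Lemma cv_shiftl f g (x h : T) : cv (fun y => f (y - h)) g x = cv f g (x - h).
Proof. by apply: eq_Int => y; rewrite addrAC. Qed.

Lemma cv_shiftr f g (x h : T) : bl f -> bdm g ->
  cv f (fun y => g (y - h)) x = cv f g (x - h).
Proof.
move=> bf bg; rewrite /cv -(Int_addr h); last by apply: bl_cv_sect => //; bdms.
by apply: eq_Int => y; rewrite addrK subrDC.
Qed.

Lemma cvZr f g (c : R) x : bl f -> bdm g ->
  cv f (fun y => c * g y) x = c * cv f g x.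
Proof.
move=> bf bg; rewrite /cv -IntZ; last exact: bl_cv_sect.
by apply: eq_Int => y; rewrite mulrCA.
Qed.

Lemma cvZl f g (c : R) x : bl f -> bdm g ->
  cv (fun y => c * f y) g x = c * cv f g x.
Proof.
move=> bf bg; rewrite /cv -IntZ; last exact: bl_cv_sect.
by apply: eq_Int => y; rewrite mulrA.
Qed.

Lemma cvDr f g h x : bl f -> bdm g -> bdm h ->
  cv f (fun y => g y + h y) x = cv f g x + cv f h x.
Proof.
move=> bf bg bh; rewrite /cv -Int_add; [|exact: bl_cv_sect..].
by apply: eq_Int => y; rewrite mulrDr.
Qed.

Lemma cvDl f g h x : bl f -> bl g -> bdm h ->
  cv (fun y => f y + g y) h x = cv f h x + cv g h x.
Proof.
move=> bf bg bh; rewrite /cv -Int_add; [|exact: bl_cv_sect..].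
by apply: eq_Int => y; rewrite mulrDl.
Qed.

Lemma cvBl f g h x : bl f -> bl g -> bdm h ->
  cv (fun y => f y - g y) h x = cv f h x - cv g h x.
Proof.
move=> bf bg bh; rewrite /cv -Int_sub; [|exact: bl_cv_sect..].
by apply: eq_Int => y; rewrite mulrBl.
Qed.

Lemma cvBr f g h x : bl f -> bdm g -> bdm h ->
  cv f (fun y => g y - h y) x = cv f g x - cv f h x.
Proof.
move=> bf bg bh; rewrite /cv -Int_sub; [|exact: bl_cv_sect..].
by apply: eq_Int => y; rewrite mulrBr.
Qed.

Lemma cv_sumr I (s : seq I) (P : pred I) f (F : I -> T -> R) x : bl f ->
  (forall i, P i -> bdm (F i)) ->
  cv f (fun y => \sum_(i <- s | P i) F i y) x = \sum_(i <- s | P i) cv f (F i) x.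
Proof.
move=> bf bF; rewrite /cv -Int_sum => [|i Pi]; last by apply: bl_cv_sect; auto.
by apply: eq_Int => y; rewrite mulr_sumr.
Qed.

Lemma cv_suml I (s : seq I) (P : pred I) f (F : I -> T -> R) x : bdm f ->
  (forall i, P i -> bl (F i)) ->
  cv (fun y => \sum_(i <- s | P i) F i y) f x = \sum_(i <- s | P i) cv (F i) f x.
Proof.
move=> bf bF; rewrite /cv -Int_sum => [|i Pi]; last by apply: bl_cv_sect; auto.
by apply: eq_Int => y; rewrite mulr_suml.
Qed.

Lemma eq_cvr f g h x : g =1 h -> cv f g x = cv f h x.
Proof. by move=> /funext ->. Qed.

Lemma eq_cvl f g h x : f =1 g -> cv f h x = cv g h x.
Proof. by move=> /funext ->. Qed.

(* The adjoint of convolution by k, tested against a merely bounded G. *)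
Lemma Int_cvM k f g : bl k -> bl f -> bdm g ->
  bl (fun y => k y * Int (fun x => f x * g (x + y))) /\
  Int (fun x => cv k f x * g x) = Int (fun y => k y * Int (fun x => f x * g (x + y))).
Proof.
move=> bk bf bg; have [M gM] := bdm_bound bg.
have [_ B E] : [/\ bl (fun x => Int (fun y => f (x - y) * k y * g x)),
   bl (fun y => Int (fun x => f (x - y) * k y * g x)) &
   Int (fun x => Int (fun y => f (x - y) * k y * g x)) =
   Int (fun y => Int (fun x => f (x - y) * k y * g x))].
  apply: (@Int_swap_sub (fun u => f (u.1 - u.2) * k u.2 * g u.1)
    (fun y => M * `|f y|) (fun y => `|k y|)) => //; [|by bls|by bls|].
  - by move: (bl_mf bf) (bl_mf bk) (bdm_mf bg) => *; mf.
  - by move=> y z /=; rewrite !normrM mulrC mulrA ler_wpM2r// ler_wpM2r.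
have E2 y : Int (fun x => f (x - y) * k y * g x) =
    k y * Int (fun x => f x * g (x + y)).
  rewrite -IntZ; last by bls.
  rewrite -[RHS](Int_subr y); last by bls.
  by apply: eq_Int => x; rewrite subrK mulrCA mulrA.
split; first by apply: eq_bl B => y; exact: E2.
rewrite -(eq_Int E2) -E; apply: eq_Int => x.
rewrite (cvC _ bk (bl_bdm bf)) IntZr; last exact: bl_cv_sect bf (bl_bdm bk).
by [].
Qed.

(** Normalized to preserve the integral; a large parameter means concentration at length 1 / a. *)
Definition dil (a : R) f : T -> R := fun x => a ^+ n * f (a *: x).

Lemma bl_dil (a : R) f : 0 < a -> bl f -> bl (dil a f).
Proof.
move=> a0 bf; rewrite /dil; apply: bl_mulr; first exact: bdm_cst.
by apply: bl_scale => //; rewrite gt_eqF.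
Qed.

Lemma Int_dil (a : R) f : 0 < a -> bl f -> Int (dil a f) = Int f.
Proof.
move=> a0 bf; have an0 : a != 0 by rewrite gt_eqF.
rewrite /dil IntZ; last exact: bl_scale.
by rewrite -[RHS](Int_scale an0 bf) gtr0_norm.
Qed.

Lemma dil_ge0 (a : R) f x : 0 < a -> (forall y, 0 <= f y) -> 0 <= dil a f x.
Proof. by move=> a0 f0; rewrite mulr_ge0// exprn_ge0// ltW. Qed.

Lemma cv_dil (a : R) f g x : 0 < a -> bl f -> bl g ->
  cv (dil a f) (dil a g) x = dil a (cv f g) x.
Proof.
move=> a0 bf bg; have an0 : a != 0 by rewrite gt_eqF.
have B : bl (fun y => f (a *: x - y) * g y).
  by apply: bl_cv_sect => //; exact: bl_bdm.
rewrite /cv /dil -[in RHS](Int_scale an0 B) gtr0_norm//.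
rewrite mulrA -IntZ; last exact: bl_scale an0 B.
by apply: eq_Int => y; rewrite scalerBr; ring.
Qed.

Lemma dil_dil (a b : R) f : dil a (dil b f) = dil (a * b) f.
Proof. by apply/funext => x; rewrite /dil scalerA mulrA exprMn (mulrC b). Qed.

(** As for sums, with the tangent inequality integrated against [k]. If [k] has mass zero, the left
    side vanishes because [f] is bounded. *)
Lemma jensen_Int k f (q : R) : 1 <= q -> bl k -> bdm f ->
  (forall x, 0 <= k x) -> (forall x, 0 <= f x) ->
  (Int (fun x => k x * f x)) `^ q <=
  (Int k) `^ (q - 1) * Int (fun x => k x * f x `^ q).
Proof.
move=> q1 bk bf k0 f0; have q0 : 0 < q by lra.
set W := Int k; set X := Int (fun x => k x * f x).
have q01 : 0 <= q - 1 by lra.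
have q00 : 0 <= q by lra.
have W0 : 0 <= W by exact: Int_ge0.
have X0 : 0 <= X by apply: Int_ge0 => x; rewrite mulr_ge0.
set Y := Int (fun x => k x * f x `^ q).
have Y0 : 0 <= Y by apply: Int_ge0 => x; rewrite mulr_ge0 ?powR_ge0.
have bkf : bl (fun x => k x * f x) by bls.
have bkq : bl (fun x => k x * f x `^ q) by apply: bl_mull => //; apply: bdm_powR.
have E m : 0 <= m -> W * m `^ q + q * m `^ (q - 1) * (X - W * m) <= Y.
  move=> m0; rewrite /X /W mulrBr -IntZ// [Int k * m]mulrC -(IntZ m)//.
  rewrite [Int k * _]mulrC -(IntZ (m `^ q))// -(IntZ (q * m `^ (q - 1))); last by bls.
  rewrite -Int_sub; [|by bls..]; rewrite -Int_add; [|by bls..].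
  apply: Int_le => [||x]; [by bls|by []|].
  have := powR_tangent m0 (f0 x) q1.
  by move/(ler_wpM2l (k0 x)); apply: le_trans; rewrite le_eqVlt; apply/orP; left;
    apply/eqP; ring.
have [W00|Wn0] := eqVneq W 0; last first.
  have Wp : 0 < W by rewrite lt0r Wn0.
  have := E (X / W) (divr_ge0 X0 W0); rewrite [W * (X / W)]mulrC divfK// subrr mulr0 addr0.
  move=> /(ler_wpM2l (powR_ge0 W (q - 1))); apply: le_trans.
  rewrite mulrA [_ * W]mulrC mulr_powRB1// -powRM ?divr_ge0//.
  by rewrite mulrC divfK.
have [->|Xn0] := eqVneq X 0.
  by rewrite powR0 ?gt_eqF// mulr_ge0 ?powR_ge0.
have [M fM] := bdm_bound bf.
have : X <= M * W.
  rewrite /W -IntZ//; apply: Int_le => [||x]; [by []|by bls|].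
  by rewrite mulrC ler_wpM2r// (le_trans (ler_norm _)).
by rewrite W00 mulr0 le_eqVlt (negPf Xn0)/= ltNge X0.
Qed.

Lemma cv_powR k f (q : R) x : 1 <= q -> bl k -> bdm f ->
  (forall x, 0 <= k x) -> (forall x, 0 <= f x) ->
  (cv k f x) `^ q <= (Int k) `^ (q - 1) * cv k (fun y => f y `^ q) x.
Proof.
move=> q1 bk bf k0 f0; rewrite -(Int_rsub x bk).
by apply: (@jensen_Int (fun y => k (x - y))) => //; bls.
Qed.

End fubini_bl.

(** * The l^1 norm and exponential kernels *)

Section l1_norm.
Context {R : realType}.

(** The l^1 norm is preferred because exp (-|x|) then factors over the coordinates; the Euclidean
    norm returns only in the comparison of the Gagliardo weights. *)
Definition l1 n (x : 'rV[R]_n) : R := \sum_i `|x 0 i|.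

Lemma l1_ge0 n (x : 'rV[R]_n) : 0 <= l1 x.
Proof. exact: sumr_ge0. Qed.

Lemma l1D n (x y : 'rV[R]_n) : l1 (x + y) <= l1 x + l1 y.
Proof. by rewrite /l1 -big_split; apply: ler_sum => i _; rewrite mxE ler_normD. Qed.

Lemma l1N n (x : 'rV[R]_n) : l1 (- x) = l1 x.
Proof. by apply: eq_bigr => i _; rewrite mxE normrN. Qed.

Lemma l1B n (x y : 'rV[R]_n) : l1 (x - y) <= l1 x + l1 y.
Proof. by rewrite -(l1N y) l1D. Qed.

Lemma l1_dist n (x y : 'rV[R]_n) : l1 x <= l1 (x - y) + l1 y.
Proof. by rewrite -{1}(subrK y x) l1D. Qed.

Lemma l1Z n a (x : 'rV[R]_n) : 0 <= a -> l1 (a *: x) = a * l1 x.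
Proof.
by move=> a0; rewrite mulr_sumr; apply: eq_bigr => i _; rewrite mxE normrM ger0_norm.
Qed.

Lemma mf_l1 n : measurable_fun setT (@l1 n).
Proof.
apply: mf_sum => i _; apply: mf_norm; exact: measurable_rV_coord.
Qed.

Lemma l1_cons n t (y : 'rV[R]_n) : l1 (rV_cons (t, y)) = `|t| + l1 y.
Proof.
rewrite /l1 big_ord_recl rV_cons0; congr (_ + _).
by apply: eq_bigr => i _; rewrite rV_consS.
Qed.

Let e1 (t : measurableTypeR R) : \bar R := (expR (- `|t|))%:E.

Let mfN : measurable_fun setT (fun t : measurableTypeR R => expR (- `|t|) : R).
Proof. by apply: mf_expR; apply: mf_opp; apply: mf_norm. Qed.

Let me1 : measurable_fun setT e1.
Proof. exact/measurable_EFinP. Qed.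

Let pdf (t : R) : R := exponential_pdf 1 t.

Let mpdf : measurable_fun setT (fun t : measurableTypeR R => (pdf t)%:E).
Proof. by apply/measurable_EFinP; exact: measurable_exponential_pdf. Qed.

Let pdf0 t : 0 <= pdf t. Proof. exact: exponential_pdf_ge0. Qed.

Let pdfE t : pdf t = if 0 <= t then expR (- t) else 0.
Proof.
rewrite /pdf /exponential_pdf patchE; case: ifPn => t0.
  have -> : 0 <= t by move: t0; rewrite inE/= in_itv/= andbT.
  by rewrite mul1r mulN1r.
case: ifPn => // t0'; move: t0; rewrite notin_setE/= in_itv/= andbT t0'.
by [].
Qed.

(** The integral lies between 1 and 2, by comparison with the exponential density and with its sum
    with its reflection. *)
Lemma integral_exp_abs : exists2 c : R, 1 <= c &
  (\int[lebesgue_measure]_t (expR (- `|t|))%:E = c%:E)%E.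
Proof.
have I0 : (0 <= \int[lebesgue_measure]_t e1 t)%E.
  by apply: integral_ge0 => t _; rewrite lee_fin expR_ge0.
have I1 : (1 <= \int[lebesgue_measure]_t e1 t)%E.
  rewrite -(integral_exponential_pdf (@ltr01 R)); apply: ge0_le_integral => //.
    by move=> t _; rewrite lee_fin; exact: pdf0.
  move=> t _; rewrite lee_fin -/(pdf t) pdfE; case: ifPn => t0.
    by rewrite ger0_norm.
  by rewrite expR_ge0.
have N1 : (-1 : R) != 0 by rewrite oppr_eq0 oner_neq0.
have mpdfN : measurable_fun setT (fun t : measurableTypeR R => (pdf (-1 * t + 0))%:E).
  exact: (measurableT_comp mpdf (@measurable_affine1 R (-1) 0)).
have I2 : (\int[lebesgue_measure]_t e1 t <= 1 + 1)%E.
  have E := @ge0_integral_affine1 R (-1) 0 (fun t => (pdf t)%:E) N1 mpdf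
    (fun t => pdf0 t : (0 <= (pdf t)%:E)%E).
  rewrite normrN1 mul1e in E.
  rewrite -{1}(integral_exponential_pdf (@ltr01 R)) -(integral_exponential_pdf (@ltr01 R)).
  rewrite -{2}E -ge0_integralD//; last 2 first.
    by move=> t _; rewrite lee_fin; exact: pdf0.
    by move=> t _; rewrite lee_fin; exact: pdf0.
  apply: ge0_le_integral => //.
  - by move=> t _; rewrite lee_fin expR_ge0.
  - by apply: emeasurable_funD.
  move=> t _; rewrite -EFinD lee_fin -/(pdf t) !pdfE mulN1r addr0.
  have [t0|t0] := leP 0 t.
    by rewrite ger0_norm// lerDl; case: ifPn => //; rewrite expR_ge0.
  by rewrite oppr_ge0 (ltW t0) (ltr0_norm t0) add0r.
move: I0 I1 I2; rewrite -[X in (0 <= X -> 1 <= X -> X <= _ -> _)%E]/(\int[lebesgue_measure]_t e1 t)%E.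
have -> : (\int[lebesgue_measure]_t (expR (- `|t|))%:E = \int[lebesgue_measure]_t e1 t)%E by [].
case: (\int[lebesgue_measure]_t e1 t)%E => [r| |] //= _ r1 r2.
exists r => //.
Qed.

Lemma integral_exp_l1 : exists2 c : R, 1 <= c & forall n,
  (\int[lebesgue_rV R n]_x (expR (- l1 x))%:E = (c ^+ n)%:E)%E.
Proof.
have [c c1 cE] := integral_exp_abs; exists c => // n.
have me m : measurable_fun setT (fun x : 'rV[R]_m => (expR (- l1 x))%:E).
  by apply/measurable_EFinP; apply: mf_expR; apply: mf_opp; exact: mf_l1.
elim: n => [|n IH].
  transitivity (\int[\d_(0%R : 'rV[R]_0)]_x (expR (- l1 x))%:E)%E; first by [].
  rewrite integral_dirac; [|exact: measurableT|exact: me].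
  by rewrite /dirac indicT mul1e /l1 big_ord0 oppr0 expR0 expr0.
rewrite ge0_integral_rV_cons; [|exact: me|by move=> x; rewrite lee_fin expR_ge0].
have E t : (\int[lebesgue_rV R n]_y (expR (- l1 (rV_cons (t, y))))%:E =
    (c ^+ n)%:E * e1 t)%E.
  rewrite -IH muleC -ge0_integralZl; [|exact: measurableT|exact: me|
    by move=> y _; rewrite lee_fin expR_ge0|by rewrite lee_fin expR_ge0].
  by apply: eq_integral => y _; rewrite l1_cons opprD expRD EFinM.
transitivity (\int[lebesgue_measure]_t ((c ^+ n)%:E * e1 t))%E.
  by apply: eq_integral => t _; exact: E.
rewrite ge0_integralZl; [|exact: measurableT|exact: me1|
    by move=> t _; rewrite lee_fin expR_ge0|
    by rewrite lee_fin exprn_ge0// (le_trans ler01)].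
by rewrite cE -EFinM exprSr.
Qed.

End l1_norm.

Section exponential_kernel.
Context {R : realType} {n : nat}.
Local Notation T := 'rV[R]_n.
Implicit Types (f g F G : T -> R) (a b c q : R) (x y : T).

Lemma bl_exp_l1 : bl (fun x : T => expR (- l1 x)).
Proof.
have m : measurable_fun setT (fun x : T => expR (- l1 x)).
  by apply: mf_expR; apply: mf_opp; exact: mf_l1.
apply: blI.
  apply: (bdmI (M := 1)) m _ => x.
  by rewrite ger0_norm ?expR_ge0// expR_le1 oppr_le0 l1_ge0.
apply/integrableP; split; first exact/measurable_EFinP.
have [c _ cE] := @integral_exp_l1 R.
rewrite (_ : (\int[_]_x _)%E = (c ^+ n)%:E) ?ltry//.
rewrite -cE; apply: eq_integral => x _.
by rewrite /= ger0_norm ?expR_ge0.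
Qed.

Let Z : R := Int (fun x : T => expR (- l1 x)).

Let Z0 : 0 < Z.
Proof.
rewrite /Z IntE; have [c c1 ->] := @integral_exp_l1 R.
by rewrite /= exprn_gt0// (lt_le_trans ltr01).
Qed.

Definition ek : T -> R := fun x => Z^-1 * expR (- l1 x).

Lemma ek_gt0 x : 0 < ek x.
Proof. by rewrite mulr_gt0 ?invr_gt0// expR_gt0. Qed.

Lemma ek_ge0 x : 0 <= ek x. Proof. exact/ltW/ek_gt0. Qed.

Lemma bl_ek : bl ek.
Proof. by apply: bl_mulr; [exact: bdm_cst|exact: bl_exp_l1]. Qed.

Lemma Int_ek : Int ek = 1.
Proof. by rewrite /ek IntZ ?mulVf ?gt_eqF//; exact: bl_exp_l1. Qed.

Definition ekd a : T -> R := dil a ek.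

Lemma ekd_gt0 a x : 0 < a -> 0 < ekd a x.
Proof. by move=> a0; rewrite mulr_gt0 ?exprn_gt0// ek_gt0. Qed.

Lemma ekd_ge0 a x : 0 < a -> 0 <= ekd a x.
Proof. by move=> a0; exact/ltW/ekd_gt0. Qed.

Lemma bl_ekd a : 0 < a -> bl (ekd a).
Proof. by move=> a0; apply: bl_dil => //; exact: bl_ek. Qed.

Lemma Int_ekd a : 0 < a -> Int (ekd a) = 1.
Proof. by move=> a0; rewrite Int_dil// ?Int_ek//; exact: bl_ek. Qed.

Lemma ekdE a x : 0 < a -> ekd a x = a ^+ n * (Z^-1 * expR (- (a * l1 x))).
Proof. by move=> a0; rewrite /ekd /dil /ek l1Z// ltW. Qed.

Lemma ekdN a x : ekd a (- x) = ekd a x.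
Proof. by rewrite /ekd /dil /ek scalerN l1N. Qed.

(** The triangle inequality in the exponent. *)
Lemma ekd_harnack a x y : 0 < a -> ekd a (x - y) <= expR (a * l1 y) * ekd a x.
Proof.
move=> a0; rewrite !ekdE// [leRHS]mulrCA ler_wpM2l ?exprn_ge0 ?(ltW a0)//.
rewrite [leRHS]mulrCA ler_wpM2l ?invr_ge0 ?(ltW Z0)// -expRD ler_expR.
have := l1_dist x y; rewrite -(ler_pM2l a0) mulrDr; lra.
Qed.

(** The exponents add, and the constant restores the normalization of the wider kernel. Combined
    with [ekd_harnack], this absorbs translations under an average. *)
Lemma exp_ekd a b x : 0 < b -> b < a ->
  expR (b * l1 x) * ekd a x = (a / (a - b)) ^+ n * ekd (a - b) x.
Proof.
move=> b0 ba; have ab0 : 0 < a - b by rewrite subr_gt0.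
rewrite (ekdE _ (lt_trans b0 ba)) (ekdE _ ab0) expr_div_n.
have -> : expR (- ((a - b) * l1 x)) = expR (b * l1 x) * expR (- (a * l1 x)).
  by rewrite -expRD; congr expR; ring.
by field; rewrite expf_neq0 gt_eqF//= Z0.
Qed.

Lemma ekd_scale_le a k x : 0 < a -> 1 <= k -> ekd a x <= k ^+ n * ekd (a / k) x.
Proof.
move=> a0 k1; have k0 : 0 < k by lra.
rewrite !ekdE ?divr_gt0// expr_div_n [leRHS]mulrA [k ^+ n * _]mulrCA.
rewrite divff ?expf_neq0 ?gt_eqF// mulr1 ler_wpM2l ?exprn_ge0 ?(ltW a0)// ler_wpM2l ?invr_ge0 ?(ltW Z0)//.
rewrite ler_expR lerN2 ler_wpM2r ?l1_ge0// ler_pdivrMr// ler_peMr// ltW//.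
Qed.

Definition av c F : T -> R := cv (ekd c) F.

Lemma bl_av c F : 0 < c -> bl F -> bl (av c F).
Proof. by move=> c0 bF; apply: bl_cv => //; exact: bl_ekd. Qed.

Lemma av_ge0 c F x : 0 < c -> (forall y, 0 <= F y) -> 0 <= av c F x.
Proof. by move=> c0 F0; apply: cv_ge0 => // y; exact: ekd_ge0. Qed.

Lemma Int_av c F : 0 < c -> bl F -> Int (av c F) = Int F.
Proof. by move=> c0 bF; rewrite Int_cv ?Int_ekd ?mul1r//; exact: bl_ekd. Qed.

Lemma av_le c F G x : 0 < c -> bdm F -> bdm G -> (forall y, F y <= G y) ->
  av c F x <= av c G x.
Proof.
move=> c0 bF bG FG; apply: cv_le => //; first exact: bl_ekd.
by move=> y; exact: ekd_ge0.
Qed.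

Lemma av_norm c F x : 0 < c -> bdm F -> `|av c F x| <= av c (fun y => `|F y|) x.
Proof.
move=> c0 bF; apply: (le_trans (cv_norm _ (bl_ekd c0) bF)).
rewrite (eq_cvl (g := ekd c)) => // y; rewrite ger0_norm//; exact: ekd_ge0.
Qed.

Lemma av_powR c F q x : 0 < c -> 1 <= q -> bdm F -> (forall y, 0 <= F y) ->
  (av c F x) `^ q <= av c (fun y => F y `^ q) x.
Proof.
move=> c0 q1 bF F0; apply: le_trans (cv_powR x q1 (bl_ekd c0) bF _ F0) _.
  by move=> y; exact: ekd_ge0.
by rewrite Int_ekd// powR1 mul1r.
Qed.

Lemma av_harnack c F x y : 0 < c -> bl F -> (forall z, 0 <= F z) ->
  av c F (x - y) <= expR (c * l1 y) * av c F x.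
Proof.
move=> c0 bF F0; have be := bl_ekd c0; have bFb := bl_bdm bF.
rewrite /av /cv -IntZ; last exact: bl_cv_sect.
apply: Int_le => [||z].
- exact: bl_cv_sect.
- apply: bl_mulr; [exact: bdm_cst|exact: bl_cv_sect].
- by rewrite mulrA ler_wpM2r// addrAC ekd_harnack.
Qed.

Lemma av_harnackD c F x y : 0 < c -> bl F -> (forall z, 0 <= F z) ->
  av c F (x + y) <= expR (c * l1 y) * av c F x.
Proof. by move=> c0 bF F0; rewrite -(l1N y) -{1}(opprK y) av_harnack. Qed.

Lemma av_scale_le c k F x : 0 < c -> 1 <= k -> bl F -> (forall z, 0 <= F z) ->
  av c F x <= k ^+ n * av (c / k) F x.
Proof.
move=> c0 k1 bF F0; have ck : 0 < c / k by rewrite divr_gt0// (lt_le_trans ltr01).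
rewrite /av -cvZl; [|exact: bl_ekd|exact: bl_bdm].
apply: cv_lel => //; [exact: bl_ekd| |exact: bl_bdm|].
  by apply: bl_mulr; [exact: bdm_cst|exact: bl_ekd].
by move=> y; exact: ekd_scale_le.
Qed.

Lemma Int_avM c F G : 0 < c -> bl F -> bdm G ->
  bl (fun y => ekd c y * Int (fun x => F x * G (x + y))) /\
  Int (fun x => av c F x * G x) =
  Int (fun y => ekd c y * Int (fun x => F x * G (x + y))).
Proof. by move=> c0 bF bG; apply: Int_cvM => //; exact: bl_ekd. Qed.

Lemma Int_av_sym c F G : 0 < c -> bl F -> bl G ->
  Int (fun x => av c F x * G x) = Int (fun x => F x * av c G x).
Proof.
move=> c0 bF bG; have be := bl_ekd c0.
have [_ ->] := Int_avM c0 bF (bl_bdm bG).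
transitivity (Int (fun x => av c G x * F x)); last by apply: eq_Int => x; rewrite mulrC.
have [B ->] := Int_avM c0 bG (bl_bdm bF).
rewrite -[LHS]Int_neg; last by have [] := Int_avM c0 bF (bl_bdm bG).
apply: eq_Int => y; rewrite ekdN; congr (_ * _).
rewrite -[LHS](Int_addr y); last first.
  by apply: bl_mull => //; bdms.
by apply: eq_Int => x; rewrite addrK mulrC.
Qed.

End exponential_kernel.

(** * The dual Doob inequality and the maximal inequality *)

Section dual_maximal.
Context {R : realType} {n : nat}.
Local Notation T := 'rV[R]_n.
Implicit Types (f g : T -> R) (F : nat -> T -> R) (a : nat -> R).

(** Later indices are finer averages, since [ekd a] lives at length 1 / a. *)
Definition scales a := (forall i, 0 < a i) /\ (forall i, a i <= a i.+1).

Lemma scales_le a i j : scales a -> (i <= j)%N -> a i <= a j.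
Proof.
move=> [_ aS] /subnK <-; elim: (j - i)%N => // k IH.
by rewrite (le_trans IH)// addSn.
Qed.

Lemma scales_div a k : scales a -> 0 < k -> scales (fun i => a i / k).
Proof.
move=> [a0 aS] k0; split=> i; first by rewrite divr_gt0.
by rewrite ler_pM2r ?invr_gt0.
Qed.

(** Lets t tend to infinity by the Archimedean property. It closes iterations whose error is halved
    in every round. *)
Lemma le_of_halving (x c k y : R) : 0 <= k * y ->
  (forall t, x <= (c + k / 2 ^+ t) * y) -> x <= c * y.
Proof.
move=> ky0 H; rewrite leNgt; apply/negP => lt.
have d0 : 0 < x - c * y by rewrite subr_gt0.
have := H (Num.bound (k * y / (x - c * y))).
set t := Num.bound _ => Ht.
have : k * y < t%:R * (x - c * y).
  by rewrite -ltr_pdivrMr//; rewrite /t archi_boundP// divr_ge0// ltW.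
have t2 : (t%:R : R) <= 2 ^+ t by rewrite -natrX ler_nat ltnW// ltn_expl.
have p0 : 0 < (2 : R) ^+ t by rewrite exprn_gt0.
have : (x - c * y) * 2 ^+ t <= k * y.
  rewrite -ler_pdivlMr//; move: Ht; rewrite mulrDl mulrAC; lra.
have : t%:R * (x - c * y) <= (x - c * y) * 2 ^+ t by rewrite mulrC ler_pM2l.
lra.
Qed.

Lemma sum_widen (A : nat -> R) j m : (forall i, 0 <= A i) -> (j <= m)%N ->
  \sum_(i < j) A i <= \sum_(i < m) A i.
Proof.
move=> A0 /subnK <-; elim: (m - j)%N => // k IH.
by rewrite addSn big_ord_recr/= (le_trans IH)// lerDl.
Qed.

(** Each increment of the q-th power of the partial sums is bounded by the tangent at the larger
    partial sum. *)
Lemma powR_telescope (A : nat -> R) (q : R) m : 1 <= q -> (forall i, 0 <= A i) ->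
  (\sum_(i < m) A i) `^ q <=
  q * \sum_(j < m) A j * (\sum_(i < j.+1) A i) `^ (q - 1).
Proof.
move=> q1 A0; elim: m => [|m IH].
  by rewrite !big_ord0 mulr0 powR0// gt_eqF// (lt_le_trans _ q1).
rewrite [in leRHS]big_ord_recr/= mulrDr -lerBlDr (le_trans _ IH)//.
have S0 k : 0 <= \sum_(i < k) A i by exact: sumr_ge0.
have := powR_tangent (S0 m.+1) (S0 m) q1; apply: le_trans.
have -> : \sum_(i < m) A i - \sum_(i < m.+1) A i = - A m.
  by rewrite big_ord_recr/=; ring.
by rewrite le_eqVlt; apply/orP; left; apply/eqP; ring.
Qed.

(** Telescoping tests each av (b_j) F_j against the (q-1)-st power of a partial sum over scales no
    finer than the j-th. Such a sum varies slowly at length 1 / b_j, so the average can be moved off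
    F_j onto it at bounded cost. Young's inequality then returns half of the original quantity, but
    at the scales b / K: it cannot be absorbed, and the argument is iterated instead, starting from
    a crude bound with factor m^q. *)
Lemma dual_doob (q : R) : 1 <= q -> exists2 C : R, 0 <= C &
  forall m a F, scales a -> (forall i, bl (F i)) -> (forall i x, 0 <= F i x) ->
  Int (fun x => (\sum_(i < m) av (a i) (F i) x) `^ q) <=
  C * Int (fun x => (\sum_(i < m) F i x) `^ q).
Proof.
move=> q1; have q0 : 0 < q by lra.
have q10 : 0 <= q - 1 by lra.
(* At the scales b / K the Harnack factor, raised to the power q - 1, stays below exp (b_j |y| / 2),
   which the kernel of parameter b_j absorbs. *)
pose K := 2 * q.
have K1 : 1 <= K by rewrite /K; lra.
have K0 : 0 < K by lra.
pose B := q * ((K ^+ n) `^ (q - 1) * 2 ^+ n).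
have B0 : 0 < B by rewrite !mulr_gt0 ?powR_gt0 ?exprn_gt0.
have e0 : 0 < (2 * B)^-1 by rewrite invr_gt0 mulr_gt0.
have [Ce Ce0 He] := young_split e0 q1.
exists (2 * B * Ce) => [|m a F sa bF F0]; first by rewrite mulr_ge0// mulr_ge0// (ltW B0).
have PhiQ0 : 0 <= Int (fun x => (\sum_(i < m) F i x) `^ q).
  by apply: Int_ge0 => x; exact: powR_ge0.
have bPhi : bl (fun x => (\sum_(i < m) F i x) `^ q).
  by apply: bl_powR0 => // [x|]; [exact: sumr_ge0|apply: bl_sum].
have bA (b : nat -> R) i : (forall i, 0 < b i) -> bl (av (b i) (F i)).
  by move=> b0; exact: bl_av.
have A0 (b : nat -> R) i x : (forall i, 0 < b i) -> 0 <= av (b i) (F i) x.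
  by move=> b0; exact: av_ge0.
have bS (b : nat -> R) k : (forall i, 0 < b i) ->
    bl (fun x => \sum_(i < k) av (b i) (F i) x).
  by move=> b0; apply: bl_sum => i _; exact: bA.
have S0 (b : nat -> R) k x : (forall i, 0 < b i) ->
    0 <= \sum_(i < k) av (b i) (F i) x.
  by move=> b0; apply: sumr_ge0 => i _; exact: A0.
have bSq (b : nat -> R) k : (forall i, 0 < b i) ->
    bl (fun x => (\sum_(i < k) av (b i) (F i) x) `^ q).
  by move=> b0; apply: bl_powR0 => // [x|]; [exact: S0|exact: bS].
suff main t : forall b, scales b ->
    Int (fun x => (\sum_(i < m) av (b i) (F i) x) `^ q) <=
    (2 * B * Ce + m%:R `^ q / 2 ^+ t) * Int (fun x => (\sum_(i < m) F i x) `^ q).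
  apply: (@le_of_halving _ _ (m%:R `^ q)) => [|t]; last exact: main.
  by rewrite mulr_ge0 ?powR_ge0.
elim: t => [|t IH] b sb.
  have [b0 _] := sb.
  rewrite expr0 divr1.
  (* Crude bound: Jensen over the m terms costs m^(q-1), and bounding each F_i by the whole sum
     costs another m. *)
  have H1 : Int (fun x => (\sum_(i < m) av (b i) (F i) x) `^ q) <=
      m%:R `^ (q - 1) * \sum_(i < m) Int (fun x => F i x `^ q).
    have bFq i : bl (fun x => F i x `^ q) by apply: bl_powR0.
    rewrite -Int_sum//.
    rewrite -IntZ; last by bls.
    have -> : Int (fun x => m%:R `^ (q - 1) * \sum_(i < m) F i x `^ q) =
       Int (fun x => m%:R `^ (q - 1) * \sum_(i < m) av (b i) (fun y => F i y `^ q) x).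
      rewrite !IntZ; [|by apply: bl_sum => i _; exact: bl_av|by bls].
      congr (_ * _); rewrite !Int_sum => [|i _|i _]; [|exact: bl_av|by []].
      by apply: eq_bigr => i _; rewrite Int_av.
    apply: Int_le => [||x]; first exact: bSq.
      apply: bl_mulr; first exact: bdm_cst.
      by apply: bl_sum => i _; exact: bl_av.
    have := @jensen_sum R 'I_m (index_enum 'I_m) predT (fun=> 1)
      (fun i => av (b i) (F i) x) q q1 (fun _ _ => ler01)
      (fun i _ => A0 b i x b0).
    rewrite sumr_const cardT size_enum_ord -mulr_natl mulr1.
    under eq_bigr do rewrite mul1r.
    under [X in _ <= _ * X -> _]eq_bigr do rewrite mul1r.
    move/le_trans; apply; rewrite ler_wpM2l ?powR_ge0//.
    apply: ler_sum => i _; apply: av_powR => //; exact: bl_bdm.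
  have H2 : \sum_(i < m) Int (fun x => F i x `^ q) <=
      m%:R * Int (fun x => (\sum_(i < m) F i x) `^ q).
    have -> : m%:R * Int (fun x => (\sum_(i < m) F i x) `^ q) =
       \sum_(i < m) Int (fun x => (\sum_(i < m) F i x) `^ q).
      by rewrite sumr_const cardT size_enum_ord mulr_natl.
    apply: ler_sum => i _; apply: Int_le => [||x] //; first exact: bl_powR0.
    apply: powR_le_mono => //; first exact: ltW.
    by rewrite (bigD1 i)//= lerDl sumr_ge0.
  rewrite (le_trans H1)// mulrDl ler_wpDl//.
    by rewrite mulr_ge0// mulr_ge0// mulr_ge0// (ltW B0).
  have [->|m0] := eqVneq m 0%N.
    rewrite big_ord0 mulr0; apply: mulr_ge0; first exact: powR_ge0.
    by apply: Int_ge0 => x; exact: powR_ge0.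
  rewrite (le_trans (ler_wpM2l (powR_ge0 _ _) H2))// mulrA.
  by rewrite [_ * m%:R]mulrC mulr_powRB1.
have [b0 bS'] := sb.
pose b' i := b i / K.
have sb' : scales b' by exact: scales_div.
have [b'0 _] := sb'.
pose S x := \sum_(i < m) av (b i) (F i) x.
pose S' k x := \sum_(i < k) av (b' i) (F i) x.
pose Phi x := \sum_(i < m) F i x.
have S'0 k x : 0 <= S' k x by exact: S0.
have bdS' k : bdm (fun x => S' k x `^ (q - 1)).
  by apply: bdm_powR => //; apply: bl_bdm; exact: bS.
have bAS j : bl (fun x => av (b j) (F j) x * S' j.+1 x `^ (q - 1)).
  by apply: bl_mull => //; exact: bA.
have bFS j k : bl (fun x => F j x * S' k x `^ (q - 1)).
  by apply: bl_mull.
have step1 : Int (fun x => S x `^ q) <= q * (K ^+ n) `^ (q - 1) *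
    \sum_(j < m) Int (fun x => av (b j) (F j) x * S' j.+1 x `^ (q - 1)).
  rewrite -Int_sum// -IntZ; last by apply: bl_sum.
  apply: Int_le => [||x]; first exact: bSq.
    by apply: bl_mulr; [exact: bdm_cst|apply: bl_sum].
  apply: le_trans (powR_telescope m q1 (fun i => A0 b i x b0)) _.
  rewrite -mulrA ler_wpM2l ?(ltW q0)// mulr_sumr ler_sum// => j _.
  rewrite mulrCA ler_wpM2l ?A0// -powRM ?exprn_ge0 ?(ltW K0)//.
  apply: powR_le_mono => //; first exact: S0.
  rewrite mulr_sumr ler_sum// => i _; exact: av_scale_le.
have step2 j : (j < m)%N ->
    Int (fun x => av (b j) (F j) x * S' j.+1 x `^ (q - 1)) <=
    2 ^+ n * Int (fun x => F j x * S' m x `^ (q - 1)).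
  move=> jm; have [B1 ->] := Int_avM (b0 j) (bF j) (bdS' j.+1).
  set I := Int (fun x => F j x * S' m x `^ (q - 1)).
  have I0 : 0 <= I by apply: Int_ge0 => x; rewrite mulr_ge0 ?powR_ge0.
  have h0 : 0 < b j / 2 by rewrite divr_gt0.
  have -> : 2 ^+ n * I = Int (fun y : T => 2 ^+ n * I * ekd (b j / 2) y).
    by rewrite IntZ ?Int_ekd ?mulr1//; exact: bl_ekd.
  apply: Int_le => // [|y].
    by apply: bl_mulr; [exact: bdm_cst|exact: bl_ekd].
  have -> : 2 ^+ n * I * ekd (b j / 2) y = I * (expR (b j / 2 * l1 y) * ekd (b j) y).
    have E : b j - b j / 2 = b j / 2 by field.
    rewrite exp_ekd; [|exact: h0|by move: (b0 j); clear; lra].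
    have -> : b j / (b j - b j / 2) = 2 by rewrite E; field; rewrite gt_eqF.
    by rewrite E; ring.
  rewrite mulrC [leRHS]mulrA; apply: ler_wpM2r; first exact: ekd_ge0.
  rewrite /I -IntZr; last exact: bFS.
  apply: Int_le => [||x].
  - apply: bl_mull; [exact: bF|exact: (bdm_addr y (bdS' j.+1))].
  - by apply: bl_mull; [exact: bFS|exact: bdm_cst].
  rewrite -mulrA ler_wpM2l//.
  (* All scales in this partial sum are at most b'_j, so a single Harnack factor serves every
     term. *)
  have H : S' j.+1 (x + y) <= expR (b' j * l1 y) * S' m x.
    apply: (@le_trans _ _ (expR (b' j * l1 y) * S' j.+1 x)).
      rewrite mulr_sumr; apply: ler_sum => i _.
      apply: (le_trans (av_harnackD x y (b'0 i) (bF i) (F0 i))).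
      rewrite ler_wpM2r ?A0// ler_expR ler_wpM2r ?l1_ge0//.
      by apply: scales_le => //; rewrite -ltnS.
    rewrite ler_wpM2l ?expR_ge0//.
    by apply: (@sum_widen (fun i => av (b' i) (F i) x)) => // i; exact: A0.
  apply: (@le_trans _ _ ((expR (b' j * l1 y) * S' m x) `^ (q - 1))).
    exact: powR_le_mono.
  rewrite powRM ?expR_ge0// mulrC ler_wpM2l ?powR_ge0//.
  rewrite -expRM ler_expR /b' /K.
  have -> : b j / (2 * q) * l1 y * (q - 1) = b j / 2 * l1 y * ((q - 1) / q).
    by field; rewrite gt_eqF.
  apply: ler_piMr; first by apply: mulr_ge0; [exact: ltW|exact: l1_ge0].
  by rewrite ler_pdivrMr// mul1r gerBl.
have bPS : bl (fun x => Phi x * S' m x `^ (q - 1)).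
  by apply: bl_mull => //; rewrite /Phi; bls.
have step3 : Int (fun x => S x `^ q) <= B * Int (fun x => Phi x * S' m x `^ (q - 1)).
  rewrite (le_trans step1)// /B -!mulrA ler_wpM2l ?(ltW q0)//.
  rewrite ler_wpM2l ?powR_ge0//.
  have -> : Int (fun x => Phi x * S' m x `^ (q - 1)) =
      \sum_(j < m) Int (fun x => F j x * S' m x `^ (q - 1)).
    rewrite -Int_sum//; apply: eq_Int => x; exact: mulr_suml.
  rewrite mulr_sumr; apply: ler_sum => j _; exact: step2.
have step4 : Int (fun x => Phi x * S' m x `^ (q - 1)) <=
    Ce * Int (fun x => Phi x `^ q) + (2 * B)^-1 * Int (fun x => S' m x `^ q).
  rewrite -!IntZ//; [|exact: bSq..].
  rewrite -Int_add; [|apply: bl_mulr; [exact: bdm_cst|by []] |].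
    apply: Int_le => // [|x].
      apply: bl_add; apply: bl_mulr; try exact: bdm_cst; [exact: bPhi|exact: bSq].
    apply: He => //; exact: sumr_ge0.
  by apply: bl_mulr; [exact: bdm_cst|exact: bSq].
rewrite (le_trans step3)//.
apply: (le_trans (ler_wpM2l (ltW B0) step4)).
have := IH b' sb'.
set Y := Int (fun x => (\sum_(i < m) av (b' i) (F i) x) `^ q).
set X := Int (fun x => (\sum_(i < m) F i x) `^ q) => HY.
have -> : B * (Ce * X + (2 * B)^-1 * Y) = B * Ce * X + Y / 2.
  by field; rewrite gt_eqF.
rewrite exprSr; have p0 : (2 : R) ^+ t != 0 by rewrite expf_neq0.
have -> : (2 * B * Ce + m%:R `^ q / (2 ^+ t * 2)) * X =
   B * Ce * X + ((2 * B * Ce + m%:R `^ q / 2 ^+ t) * X) / 2.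
  by field.
by rewrite lerD2l ler_pM2r// invr_gt0.
Qed.


(** Built one scale at a time, so that the increments of its powers telescope; the initial value 0
    makes the telescoping start from 0. *)
Fixpoint fmax a f m : T -> R := match m with
  | 0 => fun=> 0
  | k.+1 => fun x => Num.max (fmax a f k x) (av (a k) (fun y => `|f y|) x)
  end.

Lemma fmax_ge0 a f m x : 0 <= fmax a f m x.
Proof. by elim: m => //= m IH; rewrite le_max IH. Qed.

Lemma fmax_ge a f m k x : (k < m)%N -> av (a k) (fun y => `|f y|) x <= fmax a f m x.
Proof.
elim: m => //= m IH; rewrite ltnS leq_eqVlt => /predU1P[->|km].
  by rewrite le_max lexx orbT.
by rewrite le_max IH.
Qed.

Lemma bl_fmax a f m : scales a -> bl f -> bl (fmax a f m).
Proof.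
move=> [a0 _] bf; elim: m => [|m IH] /=; first exact: bl0.
have bav : bl (av (a m) (fun y => `|f y|)) by apply: bl_av => //; bls.
apply: (@bl_dom _ _ _ (fun x => fmax a f m x + av (a m) (fun y => `|f y|) x)).
- by apply: measurable_maxr; exact: bl_mf.
- by bls.
- move=> x; have h1 := fmax_ge0 a f m x.
  have h2 : 0 <= av (a m) (fun y => `|f y|) x by exact: av_ge0.
  rewrite ger0_norm ?le_max ?h1// ge_max; apply/andP; split; lra.
Qed.

(* Linearize through the increments of fmax^(p-1), which telescope, and apply
   the dual inequality at the conjugate exponent. *)
Lemma maximal_inequality (p : R) : 2 <= p -> exists2 C : R, 0 <= C &
  forall m a f, scales a -> bl f ->
  Int (fun x => fmax a f m x `^ p) <= C * Int (fun x => `|f x| `^ p).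
Proof.
move=> p2; have p0 : 0 < p by lra.
have p1 : 1 <= p by lra.
have p10 : 0 < p - 1 by lra.
pose q := p / (p - 1).
have q0 : 0 < q by rewrite divr_gt0.
have q1 : 1 <= q by rewrite ler_pdivlMr//; lra.
(* The exponents fit: fmax^(p-1) has q-th power fmax^p and (q-1)-st power fmax. *)
have qE : (p - 1) * q = p by rewrite /q mulrC divfK// gt_eqF.
have qE' : (p - 1) * (q - 1) = 1 by rewrite mulrBr qE; ring.
have [CD CD0 HD] := dual_doob q1.
have CD1 : 0 < CD + 1 by lra.
(* Chosen so that the term returned by the dual inequality is at most half of the left-hand side. *)
have e0 : 0 < (2 * q * (CD + 1))^-1 by rewrite invr_gt0 mulr_gt0// mulr_gt0.
have [Ce Ce0 He] := young_split e0 p1.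
exists (2 * q * Ce) => [|m a f sa bf].
  by rewrite mulr_ge0// mulr_ge0// ltW.
have [a0 _] := sa.
pose U k x := fmax a f k x `^ (p - 1).
pose G k x := U k.+1 x - U k x.
pose fa x := `|f x|.
have bfa : bl fa by apply: bl_norm.
have U0 k x : 0 <= U k x by exact: powR_ge0.
have fS k x : fmax a f k x <= fmax a f k.+1 x by rewrite /= le_max lexx.
have G0 k x : 0 <= G k x.
  rewrite subr_ge0; apply: powR_le_mono => //; [exact: ltW|exact: fmax_ge0].
have bU k : bl (U k).
  apply: bl_powR0; [lra|exact: fmax_ge0|exact: bl_fmax].
have bG k : bl (G k) by apply: bl_sub.
have bav k : bl (av (a k) fa) by apply: bl_av.
have bavG k : bl (av (a k) (G k)) by apply: bl_av.
have UE k x : U k x `^ q = fmax a f k x `^ p by rewrite -powRrM qE.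
have bM k : bl (fun x => fmax a f k x `^ p).
  by apply: bl_powR0 => //; [exact: fmax_ge0|exact: bl_fmax].
have sumG k x : \sum_(i < k) G i x = U k x.
  elim: k => [|k IH]; last by rewrite big_ord_recr/= IH /G addrC subrK.
  by rewrite big_ord0 /U /= powR0// gt_eqF.
have step k x : fmax a f k x `^ p <= q * \sum_(i < k) av (a i) fa x * G i x.
  elim: k => [|k IH].
    by rewrite big_ord0 mulr0 powR0// gt_eqF.
  rewrite big_ord_recr/= -/(U k.+1 x) -/(G k x) mulrDr -lerBlDr (le_trans _ IH)//.
  have := powR_tangent (U0 k.+1 x) (U0 k x) q1; rewrite !UE.
  apply: le_trans; rewrite lerD2l.
  have -> : q * U k.+1 x `^ (q - 1) * (U k x - U k.+1 x) =
     - (q * (U k.+1 x `^ (q - 1) * G k x)) by rewrite /G; ring.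
  rewrite lerN2 ler_wpM2l ?(ltW q0)//.
  rewrite -powRrM qE' powRr1 ?fmax_ge0//=.
  (* The increment G_k is nonzero only where the maximum is attained by the new average. *)
  have [le|lt] := leP (fmax a f k x) (av (a k) fa x).
    by [].
  have -> : G k x = 0 by rewrite /G /U /= max_l ?subrr// ltW.
  by rewrite !mulr0.
pose X x := \sum_(i < m) av (a i) (G i) x.
have X0 x : 0 <= X x by apply: sumr_ge0 => i _; exact: av_ge0.
have bX : bl X by apply: bl_sum => i _; exact: bavG.
have bfX : bl (fun x => fa x * X x) by apply: bl_mull => //; exact: bl_bdm.
have bavGG i : bl (fun x => av (a i) fa x * G i x).
  by apply: bl_mull => //; exact: bl_bdm.
have H1 : Int (fun x => fmax a f m x `^ p) <= q * Int (fun x => fa x * X x).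
  have -> : q * Int (fun x => fa x * X x) =
      Int (fun x => q * \sum_(i < m) av (a i) fa x * G i x).
    rewrite IntZ; last by apply: bl_sum.
    rewrite Int_sum//; congr (_ * _).
    transitivity (Int (fun x => \sum_(i < m) fa x * av (a i) (G i) x)).
      by apply: eq_Int => x; rewrite mulr_sumr.
    rewrite Int_sum => [|i _]; last by apply: bl_mull => //; exact: bl_bdm.
    by apply: eq_bigr => i _; rewrite Int_av_sym.
  apply: Int_le => //; apply: bl_mulr; first exact: bdm_cst.
  by apply: bl_sum.
have bXq : bl (fun x => X x `^ q) by apply: bl_powR0.
have bfp : bl (fun x => fa x `^ p) by exact: (bl_powR p1 bf).
have H2 : Int (fun x => fa x * X x) <=
    Ce * Int (fun x => fa x `^ p) + (2 * q * (CD + 1))^-1 * Int (fun x => X x `^ q).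
  rewrite -!IntZ// -Int_add; [|by bls..].
  apply: Int_le => [||x]; [by []|by bls|].
  have := He (fa x) (X x `^ (p - 1)^-1) (normr_ge0 _) (powR_ge0 _ _).
  rewrite -!powRrM mulVf ?gt_eqF// powRr1//.
  by rewrite (_ : (p - 1)^-1 * p = q)// mulrC.
have H3 : Int (fun x => X x `^ q) <= CD * Int (fun x => fmax a f m x `^ p).
  apply: (le_trans (HD m a G sa bG G0)); rewrite ler_wpM2l//.
  apply: Int_le => [||x]; [|by []|].
    by apply: bl_powR0 => // [x|]; [exact: sumr_ge0|apply: bl_sum].
  by rewrite sumG UE.
set Y := Int (fun x => fmax a f m x `^ p) in H1 H3 *.
have Y0 : 0 <= Y by apply: Int_ge0 => x; exact: powR_ge0.
set Z := Int (fun x => fa x `^ p) in H2 *.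
have qC0 : 0 < q * (CD + 1) by rewrite mulr_gt0.
have H4 : q * ((2 * q * (CD + 1))^-1 * Int (fun x => X x `^ q)) <= Y / 2.
  have -> : q * ((2 * q * (CD + 1))^-1 * Int (fun x => X x `^ q)) =
      (CD + 1)^-1 * Int (fun x => X x `^ q) / 2.
    by field; rewrite !gt_eqF.
  rewrite ler_pM2r ?invr_gt0// ler_pdivrMl// (le_trans H3)//.
  by rewrite ler_wpM2r// lerDl.
have := ler_wpM2l (ltW q0) H2; rewrite mulrDr => H5.
rewrite -mulrA -mulrA; lra.
Qed.

End dual_maximal.

(** * Limits of powers, sums and integrals *)

Section limits_of_integrals.
Context {R : realType} {n : nat}.
Local Notation T := 'rV[R]_n.
Local Notation mu := (lebesgue_rV R n).

Lemma powR_lip (a b M q : R) : 1 <= q -> 0 <= a -> 0 <= b -> a <= M -> b <= M ->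
  `|a `^ q - b `^ q| <= q * M `^ (q - 1) * `|a - b|.
Proof.
move=> q1; have q0 : 0 <= q by lra.
wlog ab : a b / a <= b.
  move=> H a0 b0 aM bM; have [ab|/ltW ba] := leP a b; first exact: H.
  by rewrite distrC [`|a - b|]distrC; exact: H.
move=> a0 b0 aM bM.
have h : a `^ q <= b `^ q by exact: powR_le_mono.
rewrite [X in X <= _]distrC [`|a - b|]distrC !ger0_norm ?subr_ge0//.
have := powR_tangent b0 a0 q1 => t.
have : q * b `^ (q - 1) * (b - a) <= q * M `^ (q - 1) * (b - a).
  rewrite ler_wpM2r ?subr_ge0// ler_wpM2l//.
  by apply: powR_le_mono => //; rewrite subr_ge0.
lra.
Qed.

Lemma cvg_powR (u : nat -> R) (l q : R) : 1 <= q -> (forall k, 0 <= u k) -> 0 <= l ->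
  u k @[k --> \oo] --> l -> (u k) `^ q @[k --> \oo] --> l `^ q.
Proof.
move=> q1 u0 l0 ul; have q0 : 0 < q by lra.
have K0 : 0 < q * (l + 1) `^ (q - 1) by rewrite mulr_gt0// powR_gt0// ltr_wpDl.
apply/cvgrPdist_le => e e0.
have d0 : 0 < e / (q * (l + 1) `^ (q - 1)) by rewrite divr_gt0.
move/cvgrPdist_le : (ul) => /(_ _ d0) [N1 _ H1].
move/cvgrPdist_le : ul => /(_ _ ltr01) [N2 _ H2].
exists (maxn N1 N2) => // k; rewrite /= geq_max => /andP[k1 k2].
have := H1 k k1; rewrite ler_pdivlMr// => h1; have := H2 k k2 => h2.
rewrite (le_trans _ h1)// mulrC powR_lip//; first lra.
by move: h2; rewrite distrC ler_norml => /andP[_]; lra.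
Qed.

Lemma cvg_bigsum (I : Type) (s : seq I) (u : nat -> I -> R) (l : I -> R) :
  (forall i, u k i @[k --> \oo] --> l i) ->
  \sum_(i <- s) u k i @[k --> \oo] --> \sum_(i <- s) l i.
Proof.
move=> ul; elim: s => [|i s IH].
  by under eq_fun do rewrite big_nil; rewrite big_nil; exact: cvg_cst.
under eq_fun do rewrite big_cons; rewrite big_cons.
by apply: cvgD; [exact: ul|exact: IH].
Qed.

Lemma mf_cvg (f_ : nat -> T -> R) (f : T -> R) :
  (forall k, measurable_fun setT (f_ k)) ->
  (forall x, f_ k x @[k --> \oo] --> f x) -> measurable_fun setT f.
Proof. by move=> mf cf; apply: (measurable_fun_cvg (h := f_)). Qed.

Lemma fatou_le (f_ : nat -> T -> R) (f : T -> R) (M : \bar R) :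
  (forall k, measurable_fun setT (f_ k)) -> (forall k x, 0 <= f_ k x) ->
  (forall x, f_ k x @[k --> \oo] --> f x) ->
  (forall k, \int[mu]_x (f_ k x)%:E <= M)%E -> (\int[mu]_x (f x)%:E <= M)%E.
Proof.
move=> mf f0 cf HM.
have mE k : measurable_fun setT (fun x => (f_ k x)%:E) by exact/measurable_EFinP.
have E0 k x : setT x -> (0 <= (f_ k x)%:E)%E by move=> _; rewrite lee_fin.
have := fatou mu measurableT mE E0.
have -> : (\int[mu]_x limn_einf (fun k => (f_ k x)%:E) = \int[mu]_x (f x)%:E)%E.
  apply: eq_integral => x _.
  have c : (f_ k x)%:E @[k --> \oo] --> (f x)%:E by apply/cvg_EFin; [exact: nearW|exact: cf].
  by rewrite (cvg_limn_einf_sup c).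
move/le_trans; apply; rewrite limn_einf_lim; apply: lime_le.
  exact: is_cvg_einfs.
apply: nearW => k; apply: le_trans (HM k).
by apply: ereal_inf_lbound; exists k => /=.
Qed.

Lemma fatou_bl (f_ : nat -> T -> R) (f : T -> R) (M : R) :
  (forall k, bl (f_ k)) -> bl f -> (forall k x, 0 <= f_ k x) ->
  (forall x, f_ k x @[k --> \oo] --> f x) ->
  (forall k, Int (f_ k) <= M) -> Int f <= M.
Proof.
move=> bf_ bf f0 cf HM; rewrite -lee_fin -ge0_integral_bl//.
apply: (fatou_le (f_ := f_)) => // k; first exact: bl_mf.
by rewrite ge0_integral_bl// lee_fin.
Qed.

Lemma Int_cvg (g_ : nat -> T -> R) (g h : T -> R) :
  (forall k, measurable_fun setT (g_ k)) -> bl h -> (forall k x, `|g_ k x| <= h x) ->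
  (forall x, g_ k x @[k --> \oo] --> g x) ->
  Int (g_ k) @[k --> \oo] --> Int g.
Proof.
move=> mg bh gh cg.
have mg' : measurable_fun setT g by exact: mf_cvg cg.
have ig k : mu.-integrable setT (EFin \o g_ k) by apply: bl_int; exact: bl_dom (gh k).
have cE x : (g_ k x)%:E @[k --> \oo] --> (g x)%:E.
  by apply/cvg_EFin; [exact: nearW|exact: cg].
have [ie _ H] := @dominated_convergence _ _ R mu setT measurableT
  (fun k => EFin \o g_ k) (EFin \o g) (EFin \o h)
  (fun k => (measurable_EFinP _ _).2 (mg k)) ((measurable_EFinP _ _).2 mg')
  (aeW _ (fun x _ => cE x)) (bl_int bh)
  (aeW _ (fun x k _ => gh k x)).
rewrite IntE; under eq_fun do rewrite IntE.
apply: fine_cvg; rewrite fineK; first exact: H.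
exact: (integrable_fin_num measurableT ie).
Qed.

End limits_of_integrals.

(** * Polynomially decaying kernels as superpositions of exponential ones *)

Section polynomial_kernel.
Context {R : realType} {n : nat}.
Local Notation T := 'rV[R]_n.
Local Notation mu := (lebesgue_rV R n).
Implicit Types (f g : T -> R) (x y z : T) (a : R).

Lemma mf_l1f : measurable_fun setT (@l1 R n). Proof. exact: mf_l1. Qed.

(** The standard majorant of Schwartz kernels: the first integer order of decay beyond the
    dimension, hence integrable. *)
Definition om : T -> R := fun x => ((1 + l1 x) ^+ n.+1)^-1.

Lemma l1p_gt0 x : 0 < 1 + l1 x. Proof. by rewrite ltr_pwDl// l1_ge0. Qed.

Lemma l1p_ge1 x : 1 <= 1 + l1 x. Proof. by rewrite lerDl l1_ge0. Qed.

Lemma om_gt0 x : 0 < om x.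
Proof. by rewrite invr_gt0 exprn_gt0// l1p_gt0. Qed.

Lemma om_ge0 x : 0 <= om x. Proof. exact/ltW/om_gt0. Qed.

Lemma om_le1 x : om x <= 1.
Proof. by rewrite invf_le1 ?exprn_gt0 ?l1p_gt0// exprn_ege1// l1p_ge1. Qed.

Lemma mf_inv_l1p k : measurable_fun setT (fun x => ((1 + l1 x) ^+ k)^-1).
Proof.
rewrite (_ : (fun _ => _) = (fun x => expR (- (ln (1 + l1 x) *+ k)))).
  apply: mf_expR; apply: mf_opp.
  rewrite (_ : (fun _ => _) = (fun x => k%:R * ln (1 + l1 x))).
    apply: mf_mul; first exact: mf_cst.
    apply: (measurableT_comp (f := @ln R)); first exact: measurable_ln.
    by apply: mf_add; [exact: mf_cst|exact: mf_l1].
  by apply/funext => x; rewrite mulr_natl.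
apply/funext => x; rewrite expRN -mulr_natl expRM_natl lnK//.
by rewrite posrE l1p_gt0.
Qed.

Lemma mf_om : measurable_fun setT om. Proof. exact: mf_inv_l1p. Qed.

Lemma l1p_sub x y : 1 + l1 x <= (1 + l1 (x - y)) * (1 + l1 y).
Proof.
have := l1_dist x y; have := l1_ge0 (x - y); have := l1_ge0 y; nra.
Qed.

Lemma om_harnack x y : om (x - y) <= (1 + l1 y) ^+ n.+1 * om x.
Proof.
rewrite /om -ler_pdivrMl ?exprn_gt0 ?l1p_gt0// -invfM.
rewrite lef_pV2 ?posrE ?mulr_gt0 ?exprn_gt0 ?l1p_gt0//.
rewrite -exprMn lerXn2r ?nnegrE ?mulr_ge0 ?(ltW (l1p_gt0 _))//.
by rewrite mulrC l1p_sub.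
Qed.

Lemma dyadic_level (t : R) : 1 <= t -> exists k, 2 ^+ k <= t < 2 ^+ k.+1.
Proof.
move=> t1; have t0 : 0 <= t by lra.
pose N := Num.bound t.
have tN : t < 2 ^+ N.
  rewrite (lt_le_trans (archi_boundP t0))// -natrX ler_nat ltnW//.
  exact: ltn_expl.
have ex : exists k, t < 2 ^+ k by exists N.
case: (ex_minnP ex) => -[|k] tk min; first by move: tk; rewrite expr0 ltNge t1.
exists k; rewrite tk andbT leNgt; apply/negP => /min.
by rewrite ltnn.
Qed.

Definition omsum L : T -> R := fun x => \sum_(l < L) 2 ^- l * ekd (2 ^- l) x.

Let p2 l : 0 < (2 : R) ^- l. Proof. by rewrite invr_gt0 exprn_gt0. Qed.

Let bl_term l : bl (fun x : T => 2 ^- l * ekd (2 ^- l) x).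
Proof. by apply: bl_mulr; [exact: bdm_cst|exact: bl_ekd]. Qed.

Lemma bl_omsum L : bl (omsum L).
Proof. by apply: bl_sum => l _; exact: bl_term. Qed.

Lemma omsum_ge0 L x : 0 <= omsum L x.
Proof. by apply: sumr_ge0 => l _; rewrite mulr_ge0 ?ekd_ge0// ltW. Qed.

Lemma ek0E x : ek x = ek (0 : T) * expR (- l1 x).
Proof.
rewrite /ek -mulrA; congr (_ * _).
rewrite [l1 (0 : T)]/l1 big1 ?oppr0 ?expR0 ?mul1r// => i _.
by rewrite mxE normr0.
Qed.

(** On 2^k <= 1 + |x| < 2^(k+1) the left side is at most 2^(-k(n+1)), and the k-th exponential term
    is comparable to that number. *)
Lemma om_dyadic : exists2 C : R, 0 < C &
  forall x, exists k, om x <= C * (2 ^- k * ekd (2 ^- k) x).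
Proof.
have e0 := @ek_gt0 R n 0.
pose C := expR 2 / ek (0 : T).
have C0 : 0 < C by rewrite divr_gt0// expR_gt0.
exists C => // x.
have [k /andP[k1 k2]] := dyadic_level (l1p_ge1 x); exists k.
have p0 : 0 < (2 : R) ^+ k by rewrite exprn_gt0.
have E : ekd (2 ^- k) x = (2 ^- k) ^+ n * (ek (0 : T) * expR (- (2 ^- k * l1 x))).
  by rewrite /ekd /dil ek0E l1Z// ltW.
rewrite E /C.
have -> : expR 2 / ek (0 : T) *
   (2 ^- k * ((2 ^- k) ^+ n * (ek (0 : T) * expR (- (2 ^- k * l1 x))))) =
   (2 ^- k) ^+ n.+1 * (expR 2 * expR (- (2 ^- k * l1 x))).
  by set u := (2 : R) ^- k; rewrite exprS; field; rewrite gt_eqF.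
rewrite /om -[leLHS]mulr1; apply: ler_pM => //.
- by rewrite invr_ge0 exprn_ge0// (ltW (l1p_gt0 _)).
- rewrite exprVn lef_pV2 ?posrE ?exprn_gt0 ?l1p_gt0//.
  by rewrite lerXn2r ?nnegrE// ?(ltW p0)// (ltW (l1p_gt0 _)).
- rewrite -expRD -[leLHS]expR0 ler_expR subr_ge0.
  by rewrite ler_pdivrMl//; have := ltW k2; rewrite exprSr; lra.
Qed.

(** Integrability of [om] is not yet available, so it is truncated by the partial sums [omsum L]. By
    [om_dyadic] the truncation is eventually exact at each point. *)
Lemma om_approx : exists2 C : R, 0 < C & exists omL : nat -> T -> R,
  [/\ forall L, bl (omL L), forall L x, 0 <= omL L x <= om x,
      forall L x, omL L x <= C * omsum L x &
      forall x, omL L x @[L --> \oo] --> om x].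
Proof.
have [C C0 HC] := om_dyadic; exists C => //.
pose omL L x := Num.min (om x) (C * omsum L x).
have h0 L x : 0 <= omL L x.
  by rewrite le_min om_ge0 mulr_ge0 ?omsum_ge0// ltW.
exists omL; split=> [L|L x|L x|x].
- apply: (@bl_dom _ _ _ (fun x => C * omsum L x)).
  + apply: measurable_minr; first exact: mf_om.
    by apply: mf_mul; [exact: mf_cst|exact: bl_mf (bl_omsum L)].
  + by apply: bl_mulr; [exact: bdm_cst|exact: bl_omsum].
  + by move=> x; rewrite ger0_norm// ge_min lexx orbT.
- by rewrite h0 ge_min lexx.
- by rewrite ge_min lexx orbT.
- have [k Hk] := HC x.
  apply: cvg_near_cst; exists k.+1 => // L /= kL.
  apply/min_idPl; rewrite (le_trans Hk)// ler_wpM2l ?(ltW C0)//.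
  rewrite /omsum (bigD1 (Ordinal kL))//= lerDl sumr_ge0// => l _.
  by rewrite mulr_ge0 ?ekd_ge0// ltW.
Qed.

Lemma sum_half L : \sum_(l < L) (2 : R) ^- l <= 2.
Proof.
have -> : \sum_(l < L) (2 : R) ^- l = 2 - 2 * 2 ^- L.
  elim: L => [|L IH]; first by rewrite big_ord0 expr0 invr1; lra.
  rewrite big_ord_recr/= IH exprS invfM; lra.
by rewrite gerBl mulr_ge0// ltW.
Qed.

Lemma bl_om : bl om.
Proof.
have [C C0 [omL [bL L0 LC cL]]] := om_approx.
apply: blI.
  by apply: (bdmI (M := 1)) mf_om _ => x; rewrite ger0_norm ?om_ge0// om_le1.
apply/integrableP; split; first by apply/measurable_EFinP; exact: mf_om.
apply: (@le_lt_trans _ _ (C * 2)%:E); last by rewrite ltry.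
rewrite (_ : (\int[_]_x _)%E = (\int[mu]_x (om x)%:E)%E); last first.
  by apply: eq_integral => x _; rewrite /= ger0_norm ?om_ge0.
apply: (fatou_le (f_ := omL)) => // [L|L x|L]; [exact: bl_mf|by case/andP: (L0 L x)|].
rewrite ge0_integral_bl// lee_fin.
apply: (@le_trans _ _ (Int (fun x => C * omsum L x))).
  apply: Int_le => //.
  by apply: bl_mulr; [exact: bdm_cst|exact: bl_omsum].
rewrite IntZ; last exact: bl_omsum.
rewrite ler_wpM2l ?(ltW C0)// Int_sum => [|l _]; last exact: bl_term.
rewrite (le_trans _ (sum_half L))// ler_sum// => l _.
by rewrite IntZ ?Int_ekd ?mulr1//; exact: bl_ekd.
Qed.

Definition omd a : T -> R := dil a om.

Lemma bl_omd a : 0 < a -> bl (omd a).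
Proof. by move=> a0; apply: bl_dil => //; exact: bl_om. Qed.

Lemma omd_ge0 a x : 0 < a -> 0 <= omd a x.
Proof. by move=> a0; apply: dil_ge0 => //; exact: om_ge0. Qed.

Lemma omd_harnack a x y : 0 < a -> omd a (x - y) <= (1 + a * l1 y) ^+ n.+1 * omd a x.
Proof.
move=> a0; rewrite /omd /dil scalerBr [leRHS]mulrCA.
rewrite ler_wpM2l ?exprn_ge0 ?(ltW a0)//.
by apply: le_trans (om_harnack _ _) _; rewrite l1Z// ltW.
Qed.

Definition avo a f : T -> R := cv (omd a) f.

Lemma bl_avo a f : 0 < a -> bl f -> bl (avo a f).
Proof. by move=> a0 bf; apply: bl_cv => //; exact: bl_omd. Qed.

Lemma avo_ge0 a f x : 0 < a -> (forall y, 0 <= f y) -> 0 <= avo a f x.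
Proof. by move=> a0 f0; apply: cv_ge0 => // y; exact: omd_ge0. Qed.

Lemma avo_le a f g x : 0 < a -> bdm f -> bdm g -> (forall y, f y <= g y) ->
  avo a f x <= avo a g x.
Proof.
move=> c0 bF bG FG; apply: cv_le => //; first exact: bl_omd.
by move=> y; exact: omd_ge0.
Qed.

Lemma avo_harnack a f x y : 0 < a -> bl f -> (forall z, 0 <= f z) ->
  avo a f (x - y) <= (1 + a * l1 y) ^+ n.+1 * avo a f x.
Proof.
move=> c0 bF F0; have be := bl_omd c0; have bFb := bl_bdm bF.
rewrite /avo /cv -IntZ; last exact: bl_cv_sect.
apply: Int_le => [||z].
- exact: bl_cv_sect.
- apply: bl_mulr; [exact: bdm_cst|exact: bl_cv_sect].
- by rewrite mulrA ler_wpM2r// addrAC omd_harnack.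
Qed.

Definition omI : R := Int om.

Lemma omI_ge0 : 0 <= omI. Proof. exact/Int_ge0/om_ge0. Qed.

Lemma Int_omd a : 0 < a -> Int (omd a) = omI.
Proof. by move=> a0; rewrite Int_dil//; exact: bl_om. Qed.

Lemma avo_powR a f (q : R) x : 0 < a -> 1 <= q -> bdm f -> (forall y, 0 <= f y) ->
  (avo a f x) `^ q <= omI `^ (q - 1) * avo a (fun y => f y `^ q) x.
Proof.
move=> a0 q1 bf f0; rewrite -(Int_omd a0).
by apply: cv_powR => //; [exact: bl_omd|move=> y; exact: omd_ge0].
Qed.

(** Dividing all scales by 2^l leaves them increasing, so [dual_doob] holds for every exponential
    layer of [om] with the same constant; Jensen with the summable weights 2^-l puts the layers
    together. Truncated kernels come first and Fatou removes the truncation. *)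
Lemma dual_doob_om (q : R) : 1 <= q -> exists2 C : R, 0 <= C &
  forall m (a : nat -> R) (F : nat -> T -> R), scales a -> (forall i, bl (F i)) ->
  (forall i x, 0 <= F i x) ->
  Int (fun x => (\sum_(i < m) avo (a i) (F i) x) `^ q) <=
  C * Int (fun x => (\sum_(i < m) F i x) `^ q).
Proof.
move=> q1; have q0 : 0 < q by lra.
have q10 : 0 <= q - 1 by lra.
have [C1 C10 HD] := @dual_doob R n q q1.
have [C C0 [omL [bL L0 LC cL]]] := om_approx.
exists (C `^ q * (2 `^ (q - 1) * (2 * C1))).
  by rewrite mulr_ge0 ?powR_ge0// mulr_ge0 ?powR_ge0// mulr_ge0.
move=> m a F [a0 aS] bF F0.
have omL0 L x : 0 <= omL L x by case/andP: (L0 L x).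
have bdL L i : bl (dil (a i) (omL L)) by apply: bl_dil.
have bcv L i : bl (cv (dil (a i) (omL L)) (F i)) by apply: bl_cv.
have cv0 L i x : 0 <= cv (dil (a i) (omL L)) (F i) x.
  by apply: cv_ge0 => // y; apply: dil_ge0.
pose f_ L x := (\sum_(i < m) cv (dil (a i) (omL L)) (F i) x) `^ q.
have bf_ L : bl (f_ L).
  apply: bl_powR0 => // [x|]; first by apply: sumr_ge0 => i _; exact: cv0.
  by apply: bl_sum => i _; exact: bcv.
have bavo i : bl (avo (a i) (F i)) by apply: bl_avo.
have avo0 i x : 0 <= avo (a i) (F i) x by apply: avo_ge0.
apply: (fatou_bl (f_ := f_)) => //.
- apply: bl_powR0 => // [x|]; first by apply: sumr_ge0 => i _.
  exact: bl_sum.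
- by move=> k x; exact: powR_ge0.
- move=> x; apply: cvg_powR => // [k||]; [exact: sumr_ge0|exact: sumr_ge0|].
  apply: cvg_bigsum => i.
  apply: (Int_cvg (h := fun y => omd (a i) (x - y) * F i y)).
  + by move=> k; apply: bl_mf; apply: bl_cv_sect => //; exact: bl_bdm.
  + apply: bl_cv_sect; [exact: bl_omd|exact: bl_bdm].
  + move=> k y; rewrite ger0_norm; last by apply: mulr_ge0 => //; apply: dil_ge0.
    apply: ler_wpM2r; first exact: F0.
    apply: ler_wpM2l; first exact/exprn_ge0/ltW.
    by case/andP: (L0 k (a i *: (x - y))).
  + move=> y; apply: cvgM; last exact: cvg_cst.
    by apply: cvgM; [exact: cvg_cst|exact: cL].
move=> L.
pose X l x := \sum_(i < m) av (a i * 2 ^- l) (F i) x.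
have sa l : scales (fun i => a i * 2 ^- l).
  by apply: (@scales_div R a (2 ^+ l)); [split|rewrite exprn_gt0].
have bav l i : bl (av (a i * 2 ^- l) (F i)).
  by apply: bl_av => //; rewrite mulr_gt0.
have av0 l i x : 0 <= av (a i * 2 ^- l) (F i) x.
  by apply: av_ge0 => //; rewrite mulr_gt0.
have bX l : bl (X l) by apply: bl_sum.
have X0 l x : 0 <= X l x by apply: sumr_ge0.
have bXq l : bl (fun x => X l x `^ q) by apply: bl_powR0.
have H1 x : \sum_(i < m) cv (dil (a i) (omL L)) (F i) x <=
    C * \sum_(l < L) 2 ^- l * X l x.
  have -> : \sum_(l < L) 2 ^- l * X l x =
      \sum_(i < m) \sum_(l < L) 2 ^- l * av (a i * 2 ^- l) (F i) x.
    rewrite exchange_big/=; apply: eq_bigr => l _; exact: mulr_sumr.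
  rewrite mulr_sumr; apply: ler_sum => i _.
  have bt l : bl (fun y : T => 2 ^- l * ekd (a i * 2 ^- l) y).
    by apply: bl_mulr; [exact: bdm_cst|apply: bl_ekd; rewrite mulr_gt0].
  have -> : C * \sum_(l < L) 2 ^- l * av (a i * 2 ^- l) (F i) x =
      cv (fun y => C * \sum_(l < L) 2 ^- l * ekd (a i * 2 ^- l) y) (F i) x.
    rewrite cvZl; [|exact: bl_sum|exact: bl_bdm].
    rewrite cv_suml; [|exact: bl_bdm|by []]; congr (_ * _).
    apply: eq_bigr => l _; rewrite cvZl//; last exact: bl_bdm.
    by apply: bl_ekd; rewrite mulr_gt0.
  apply: cv_lel => //; [|exact: bl_bdm|].
    by apply: bl_mulr; [exact: bdm_cst|exact: bl_sum].
  move=> y; rewrite /dil; apply: (le_trans (ler_wpM2l _ (LC L (a i *: y)))).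
    by rewrite exprn_ge0// ltW.
  rewrite mulrCA ler_wpM2l ?(ltW C0)// /omsum mulr_sumr ler_sum// => l _.
  by rewrite mulrCA -/(dil (a i) (ekd (2 ^- l)) y) /ekd dil_dil.
have b2X : bl (fun x => \sum_(l < L) 2 ^- l * X l x `^ q).
  by apply: bl_sum => l _; apply: bl_mulr; [exact: bdm_cst|exact: bXq].
have H2 x : f_ L x <= C `^ q * (2 `^ (q - 1) * \sum_(l < L) 2 ^- l * X l x `^ q).
  apply: (@le_trans _ _ ((C * \sum_(l < L) 2 ^- l * X l x) `^ q)).
    apply: powR_le_mono => //; [exact: ltW|exact: sumr_ge0].
  have S0 : 0 <= \sum_(l < L) 2 ^- l * X l x.
    by apply: sumr_ge0 => l _; rewrite mulr_ge0// ltW.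
  rewrite powRM ?(ltW C0)// ler_wpM2l ?powR_ge0//.
  have W0 (l : 'I_L) : true -> 0 <= (2 : R) ^- l by move=> _; exact: ltW.
  apply: (le_trans (jensen_sum _ q1 W0 (fun l _ => X0 l x))).
  apply: ler_wpM2r.
    by apply: sumr_ge0 => l _; rewrite mulr_ge0 ?powR_ge0// ltW.
  apply: powR_le_mono => //; [exact: sumr_ge0|exact: sum_half].
apply: (@le_trans _ _ (C `^ q * (2 `^ (q - 1) * \sum_(l < L) 2 ^- l * Int (fun x => X l x `^ q)))).
  have -> : \sum_(l < L) 2 ^- l * Int (fun x => X l x `^ q) =
      Int (fun x => \sum_(l < L) 2 ^- l * X l x `^ q).
    rewrite Int_sum => [|l _]; last by apply: bl_mulr; [exact: bdm_cst|exact: bXq].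
    by apply: eq_bigr => l _; rewrite IntZ.
  rewrite -IntZ// -IntZ; last by apply: bl_mulr; [exact: bdm_cst|].
  apply: Int_le => //.
  apply: bl_mulr; first exact: bdm_cst.
  by apply: bl_mulr; first exact: bdm_cst.
rewrite -!mulrA ler_wpM2l ?powR_ge0// ler_wpM2l ?powR_ge0//.
set Y := Int (fun x => (\sum_(i < m) F i x) `^ q).
have Y0 : 0 <= Y by apply: Int_ge0 => x; exact: powR_ge0.
apply: (@le_trans _ _ (\sum_(l < L) 2 ^- l * (C1 * Y))).
  apply: ler_sum => l _; apply: ler_wpM2l; first exact: ltW.
  exact: (HD m (fun i => a i * 2 ^- l) F (sa l) bF F0).
by rewrite -mulr_suml ler_wpM2r ?mulr_ge0// sum_half.
Qed.

End polynomial_kernel.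

(** * Convexity of |a|^r and the decrease of the L^r energy under averaging *)

Section signed_power.
Context {R : realType}.
Implicit Types a b r : R.

(** The derivative of |a|^r is r times this function. *)
Definition spow r a : R := `|a| `^ (r - 2) * a.

Lemma powR_norm2 r a : 2 <= r -> `|a| `^ (r - 2) * a ^+ 2 = `|a| `^ r.
Proof.
move=> r2; have [->|a0] := eqVneq a 0.
  by rewrite normr0 expr0n mulr0 powR0// gt_eqF//; lra.
rewrite -real_normK ?num_real// -powR_mulrn// -powRD; last by rewrite normr_eq0 a0 implybT.
by congr (_ `^ _); ring.
Qed.

Lemma spow_convex r a b : 2 <= r -> `|a| `^ r - `|b| `^ r <= r * (spow r a * (a - b)).
Proof.
move=> r2; have r1 : 1 <= r by lra.
have := powR_tangent (normr_ge0 a) (normr_ge0 b) r1.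
set s := `|a| `^ (r - 2).
have s0 : 0 <= s by exact: powR_ge0.
have -> : `|a| `^ (r - 1) = s * `|a|.
  have e : r - 2 = r - 1 - 1 by ring.
  by rewrite /s e mulrC mulr_powRB1//; lra.
have h : a * b <= `|a| * `|b| by rewrite -normrM ler_norm.
have h2 : `|a| * `|a| = a * a by rewrite -normrM ger0_norm// -expr2 sqr_ge0.
rewrite /spow -/s => H.
have : r * s * (a * b) <= r * s * (`|a| * `|b|) by rewrite ler_wpM2l// mulr_ge0//; lra.
have -> : r * (s * a * (a - b)) = r * s * (a * a) - r * s * (a * b) by ring.
move: H; rewrite -h2.
have -> : r * (s * `|a|) * (`|b| - `|a|) = r * s * (`|a| * `|b|) - r * s * (`|a| * `|a|) by ring.
lra.
Qed.

(** For |b| <= |a|, with A = |a|^(r-2) and B = |b|^(r-2), the difference of the signed powers is A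
    (a - b) + b (A - B); the second term is controlled by the tangent inequality for t^(r-1). *)
Lemma spow_lip r a b : 2 <= r -> (spow r a - spow r b) * (a - b) <=
  (r - 1) * ((`|a| `^ (r - 2) + `|b| `^ (r - 2)) * (a - b) ^+ 2).
Proof.
move=> r2; wlog ba : a b / `|b| <= `|a|.
  move=> H; have [|/ltW] := leP `|b| `|a|; first exact: H.
  move/H => h; rewrite (_ : (spow r a - spow r b) * (a - b) =
    (spow r b - spow r a) * (b - a)); last by ring.
  rewrite (_ : (`|a| `^ (r - 2) + `|b| `^ (r - 2)) * (a - b) ^+ 2 =
    (`|b| `^ (r - 2) + `|a| `^ (r - 2)) * (b - a) ^+ 2); last by ring.
  exact: h.
have r10 : 0 <= r - 1 by lra.
set s := r - 2; set A := `|a| `^ s; set B := `|b| `^ s.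
have s0 : 0 <= s by rewrite /s; lra.
have s1 : 1 <= s + 1 by lra.
have s1' : 0 < s + 1 by lra.
have A0 : 0 <= A by exact: powR_ge0.
have B0 : 0 <= B by exact: powR_ge0.
have BA : B <= A by exact: powR_le_mono.
have key : `|b| * (A - B) <= s * A * `|a - b|.
  have := powR_tangent (normr_ge0 a) (normr_ge0 b) s1.
  rewrite -(mulr_powRB1 (normr_ge0 b) s1') -(mulr_powRB1 (normr_ge0 a) s1').
  rewrite addrK -/A -/B => H.
  have : s * A * (`|a| - `|b|) <= s * A * `|a - b|.
    by rewrite ler_wpM2l ?mulr_ge0// lerB_dist.
  nra.
have E : (spow r a - spow r b) * (a - b) = A * (a - b) ^+ 2 + b * (A - B) * (a - b).
  by rewrite /spow -/s -/A -/B; ring.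
have h1 : b * (A - B) * (a - b) <= s * A * (a - b) ^+ 2.
  rewrite (le_trans (ler_norm _))// 2!normrM [`|A - B|]ger0_norm ?subr_ge0//.
  rewrite -[(a - b) ^+ 2]real_normK ?num_real// expr2 mulrA.
  by rewrite ler_wpM2r.
rewrite E; have d0 := sqr_ge0 (a - b).
have : 0 <= (r - 1) * (B * (a - b) ^+ 2) by exact: mulr_ge0 r10 (mulr_ge0 B0 d0).
move: h1; rewrite /s; nra.
Qed.

End signed_power.

Section energy.
Context {R : realType} {n : nat}.
Local Notation T := 'rV[R]_n.
Implicit Types (e f v : T -> R) (H : T * T -> R).

Lemma Int_swap_bd e H (B M : R) : bl e -> (forall y, 0 <= e y) ->
  measurable_fun setT H -> (forall z, `|H z| <= B) ->
  (forall y, bl (fun x => H (x, y))) -> (forall y, Int (fun x => `|H (x, y)|) <= M) ->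
  [/\ bl (fun x => Int (fun y => e y * H (x, y))),
      bl (fun y => e y * Int (fun x => H (x, y))) &
      Int (fun x => Int (fun y => e y * H (x, y))) =
      Int (fun y => e y * Int (fun x => H (x, y)))].
Proof.
move=> be e0 mH HB bH HM.
have bdx x : bdm (fun y => H (x, y)).
  by apply: (bdmI (M := B)) => //; exact: mf_xsect.
have bx x : bl (fun y => e y * H (x, y)) by apply: bl_mull.
have by' y : bl (fun x => e y * H (x, y)) by apply: bl_mulr; first exact: bdm_cst.
have mG : measurable_fun setT (fun z : T * T => e z.2 * H z).
  by have me := bl_mf be; mf.
have le y : Int (fun x => `|e y * H (x, y)|) <= M * e y.
  under eq_Int do rewrite normrM (ger0_norm (e0 y)).
  by rewrite IntZ; [rewrite mulrC ler_wpM2r|exact: bl_norm].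
have bc : bl (fun y => M * e y) by apply: bl_mulr => //; exact: bdm_cst.
have [I1 I2 E] := @Int_swap R n (fun z => e z.2 * H z) _ mG bx by' bc le.
have E2 y : Int (fun x => e y * H (x, y)) = e y * Int (fun x => H (x, y)).
  by rewrite IntZ.
split.
- apply: blI => //; apply: (bdmI (M := B * Int e)); first exact: integrable_mf I1.
  move=> x; rewrite (le_trans (Int_norm (bx x)))// -IntZ//.
  apply: Int_le => [||y]; first exact: bl_norm.
    by apply: bl_mulr => //; exact: bdm_cst.
  by rewrite normrM (ger0_norm (e0 y)) mulrC ler_wpM2r.
- by apply: eq_bl I2.
- by rewrite -(eq_Int E2).
Qed.

Definition osc2 (c : R) v x : R := Int (fun y => ekd c y * (v (x - y) - v x) ^+ 2).

Lemma osc2_ge0 c v x : 0 < c -> 0 <= osc2 c v x.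
Proof. by move=> c0; apply: Int_ge0 => y; rewrite mulr_ge0 ?ekd_ge0 ?sqr_ge0. Qed.

Let swap_w (c : R) v w (s : nat) : 0 < c -> bl v -> bdm w ->
  [/\ bl (fun x => Int (fun y => ekd c y * (w x * (v (x - y) - v x) ^+ s.+1))),
      bl (fun y => ekd c y * Int (fun x => w x * (v (x - y) - v x) ^+ s.+1)) &
      Int (fun x => Int (fun y => ekd c y * (w x * (v (x - y) - v x) ^+ s.+1))) =
      Int (fun y => ekd c y * Int (fun x => w x * (v (x - y) - v x) ^+ s.+1))].
Proof.
move=> c0 bv bw; have [M vM] := bl_bound bv; have [K wK] := bdm_bound bw.
have M0 : 0 <= M by apply: le_trans (vM 0).
have K0 : 0 <= K by apply: le_trans (wK 0).
have mv := bl_mf bv; have mw := bdm_mf bw.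
have vd x y : `|v (x - y) - v x| <= M + M.
  by rewrite (le_trans (ler_normB _ _))// lerD.
have bd y : bl (fun x => v (x - y) - v x) by bls.
have bS y : bl (fun x => w x * (v (x - y) - v x) ^+ s.+1).
  by apply: bl_mulr => //; apply: (@bl_exp _ _ (fun x => v (x - y) - v x)).
apply: (@Int_swap_bd (ekd c) (fun z => w z.1 * (v (z.1 - z.2) - v z.1) ^+ s.+1)
  (K * (M + M) ^+ s.+1) (K * (M + M) ^+ s * (Int (fun x => `|v x|) + Int (fun x => `|v x|)))) => //.
- exact: bl_ekd.
- by move=> y; exact: ekd_ge0.
- by mf.
- move=> [x y] /=; rewrite normrM normrX ler_pM ?exprn_ge0//.
  by rewrite lerXn2r// nnegrE ?addr_ge0.
move=> y /=.
have bn : bl (fun x => `|v x|) by bls.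
rewrite -{1}(Int_subr y bn) -Int_add; [|exact: (bl_subr y bn)|exact: bn].
rewrite -IntZ; last by apply: bl_add; [exact: (bl_subr y bn)|exact: bn].
apply: Int_le => [||x]; first exact: bl_norm.
  apply: bl_mulr; first exact: bdm_cst.
  by apply: bl_add; [exact: (bl_subr y bn)|exact: bn].
rewrite normrM normrX exprSr mulrA ler_pM ?mulr_ge0 ?exprn_ge0//; last exact: ler_normB.
by rewrite ler_pM ?exprn_ge0// lerXn2r// nnegrE ?addr_ge0.
Qed.

Lemma bl_osc2 c v : 0 < c -> bl v -> bl (osc2 c v).
Proof.
move=> c0 bv; have [B _ _] := swap_w 1 c0 bv (bdm_cst 1).
apply: eq_bl B => x; apply: eq_Int => y; by rewrite mul1r.
Qed.

(** Convexity bounds the decrement by the pairing of [spow r v] with v - av c v, which is of first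
    order. Since the kernel is even, averaging over y and -y turns it into a product of two
    differences, to which [spow_lip] applies. *)
Lemma energy_decrement (r c : R) v : 2 <= r -> 0 < c -> bl v ->
  Int (fun x => `|v x| `^ r) - Int (fun x => `|av c v x| `^ r) <=
  r * (r - 1) * Int (fun x => `|v x| `^ (r - 2) * osc2 c v x).
Proof.
move=> r2 c0 bv; have r1 : 1 <= r by lra.
have r0 : 0 <= r by lra.
have r20 : 0 <= r - 2 by lra.
have be : bl (ekd c : T -> R) by exact: bl_ekd.
have e0 (y : T) : 0 <= ekd c y by exact: ekd_ge0.
have bw : bdm (fun x => `|v x| `^ (r - 2)).
  by apply: bdm_powR => //; apply: bdm_norm; exact: bl_bdm.
have bphi : bl (fun x => spow r (v x)) by rewrite /spow; apply: bl_mulr.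
have bav := bl_av c0 bv.
have [B1 B2 E12] := swap_w 0 c0 bv (bl_bdm bphi).
have [B3 B4 E34] := swap_w 1 c0 bv bw.
have bvr : bl (fun x => `|v x| `^ r) by apply: bl_powR.
have bavr : bl (fun x => `|av c v x| `^ r) by apply: bl_powR.
have bP : bl (fun x => spow r (v x) * (v x - av c v x)).
  by apply: bl_mull => //; apply: bl_bdm; apply: bl_sub.
pose D y := Int (fun x => spow r (v x) * (v (x - y) - v x) ^+ 1).
pose G y := Int (fun x => `|v x| `^ (r - 2) * (v (x - y) - v x) ^+ 2).
have step1 : Int (fun x => `|v x| `^ r) - Int (fun x => `|av c v x| `^ r) <=
    r * Int (fun x => spow r (v x) * (v x - av c v x)).
  rewrite -Int_sub// -IntZ//; apply: Int_le => [||x]; [by apply: bl_sub| |].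
    by apply: bl_mulr => //; exact: bdm_cst.
  exact: spow_convex.
have step2 : Int (fun x => spow r (v x) * (v x - av c v x)) =
    - Int (fun y => ekd c y * D y).
  rewrite -E12 -Int_opp//; apply: eq_Int => x.
  rewrite /av (cvC x be (bl_bdm bv)) /cv.
  have b1 : bl (fun y => v (x - y) * ekd c y).
    by apply: bl_cv_sect' => //; exact: bl_bdm.
  have b2 : bl (fun y : T => v x * ekd c y) by apply: bl_mulr; first exact: bdm_cst.
  have -> : v x - Int (fun y => v (x - y) * ekd c y) =
      Int (fun y => ekd c y * (v x - v (x - y))).
    have -> : Int (fun y => ekd c y * (v x - v (x - y))) =
        Int (fun y => v x * ekd c y - v (x - y) * ekd c y).
      by apply: eq_Int => y; ring.
    by rewrite Int_sub// IntZ// Int_ekd// mulr1.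
  have bd k : bdm (fun y => (v (x - y) - v x) ^+ k).
    by apply: bdm_exp; apply: bdm_sub; [apply: bdm_rsub; exact: bl_bdm|exact: bdm_cst].
  rewrite -IntZ; last first.
    apply: bl_mull => //; apply: bdm_sub; first exact: bdm_cst.
    by apply: bdm_rsub; exact: bl_bdm.
  rewrite -Int_opp; last first.
    by apply: bl_mull => //; apply: bdm_mul; first exact: bdm_cst.
  by apply: eq_Int => y; rewrite expr1; ring.
(* Translating by y makes D (-y) involve the same two values v x and v (x - y) as D y. *)
have DN y : D (- y) = Int (fun x => spow r (v (x - y)) * (v x - v (x - y))).
  rewrite /D -(Int_subr y); last first.
    apply: bl_mull => //; apply: bdm_exp; apply: bl_bdm; apply: bl_sub => //.
    exact: bl_subr.
  by apply: eq_Int => x; rewrite opprK subrK expr1.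
have bG y : bl (fun x => `|v x| `^ (r - 2) * (v (x - y) - v x) ^+ 2).
  apply: bl_mulr => //; apply: (@bl_exp _ _ (fun x => v (x - y) - v x)).
  by apply: bl_sub => //; exact: bl_subr.
have GN y : G (- y) = Int (fun x => `|v (x - y)| `^ (r - 2) * (v x - v (x - y)) ^+ 2).
  rewrite /G -(Int_subr y); last exact: bG.
  by apply: eq_Int => x; rewrite opprK subrK.
have bvy y : bl (fun x => v (x - y)) by exact: bl_subr.
have bphiy y : bl (fun x => spow r (v (x - y))) by exact: (bl_subr y bphi).
have bwy y : bdm (fun x => `|v (x - y)| `^ (r - 2)) by exact: (bdm_subr y bw).
have key y : - (D y + D (- y)) <= (r - 1) * (G y + G (- y)).
  rewrite DN GN /D /G -Int_add; last 2 first.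
  - apply: bl_mull => //; apply: bdm_exp; apply: bl_bdm; apply: bl_sub => //.
  - by apply: bl_mull => //; apply: bl_bdm; apply: bl_sub.
  have b2 : bl (fun x => `|v (x - y)| `^ (r - 2) * (v x - v (x - y)) ^+ 2).
    apply: bl_mulr => //; apply: (@bl_exp _ _ (fun x => v x - v (x - y))).
    by apply: bl_sub.
  rewrite -Int_add// -IntZ; last by apply: bl_add.
  rewrite -Int_opp; last first.
    apply: bl_add; apply: bl_mull => //; try apply: bdm_exp; apply: bl_bdm; exact: bl_sub.
  apply: Int_le => [||x].
  - apply: bl_opp; apply: bl_add; apply: bl_mull => //; try apply: bdm_exp; apply: bl_bdm; exact: bl_sub.
  - by apply: bl_mulr; [exact: bdm_cst|apply: bl_add].
  have := spow_lip (v x) (v (x - y)) r2.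
  set a := v x; set b := v (x - y); set A := `|a| `^ (r - 2); set B := `|b| `^ (r - 2).
  rewrite expr1 => H.
  have -> : - (spow r a * (b - a) + spow r b * (a - b)) = (spow r a - spow r b) * (a - b) by ring.
  by have -> : (r - 1) * (A * (b - a) ^+ 2 + B * (a - b) ^+ 2) = (r - 1) * ((A + B) * (a - b) ^+ 2) by ring.
have sym (F : T -> R) : bl (fun y => ekd c y * F y) ->
    Int (fun y => ekd c y * F y) = Int (fun y => ekd c y * F (- y)).
  by move=> bF; rewrite -(Int_neg bF); apply: eq_Int => y; rewrite ekdN.
have B2' : bl (fun y => ekd c y * D (- y)).
  by have := bl_neg B2; apply: eq_bl => y; rewrite ekdN.
have B4' : bl (fun y => ekd c y * G (- y)).
  by have := bl_neg B4; apply: eq_bl => y; rewrite ekdN.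
have aux (a a' g g' k : R) : a = a' -> g = g' ->
    - (a + a') <= k * (g + g') -> - a <= k * g by move=> -> ->; clear; lra.
have step3 : - Int (fun y => ekd c y * D y) <= (r - 1) * Int (fun y => ekd c y * G y).
  have : - (Int (fun y => ekd c y * D y) + Int (fun y => ekd c y * D (- y))) <=
     (r - 1) * (Int (fun y => ekd c y * G y) + Int (fun y => ekd c y * G (- y))).
    rewrite -(Int_add B2 B2') -(Int_add B4 B4') -IntZ; last exact: bl_add.
    rewrite -Int_opp; last exact: bl_add.
    apply: Int_le => [||y].
    - by apply: bl_opp; exact: bl_add.
    - by apply: bl_mulr; [exact: bdm_cst|exact: bl_add].
    have := ler_wpM2l (e0 y) (key y).
    by rewrite mulrN mulrDr mulrCA mulrDr.
  exact: (aux _ _ _ _ (r - 1) (sym D B2) (sym G B4)).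
have step4 : Int (fun y => ekd c y * G y) = Int (fun x => `|v x| `^ (r - 2) * osc2 c v x).
  rewrite -E34; apply: eq_Int => x; rewrite /osc2 -IntZ; last first.
    apply: bl_mull => //; apply: bdm_exp; apply: bdm_sub; last exact: bdm_cst.
    by apply: bdm_rsub; exact: bl_bdm.
  by apply: eq_Int => y; rewrite mulrCA.
apply: (le_trans step1); rewrite step2 -mulrA -step4.
exact: ler_wpM2l r0 _ _ step3.
Qed.

End energy.

(** * Chains of averages at halving scales *)

Section averaging_chains.
Context {R : realType} {n : nat}.
Local Notation T := 'rV[R]_n.
Implicit Types (f g F G : T -> R) (x y : T) (a b c : R).

Lemma powR_sqr (t : R) : 0 <= t -> t `^ 2 = t ^+ 2.
Proof. by move=> t0; rewrite -powR_mulrn. Qed.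

Lemma av_sqr c F x : 0 < c -> bdm F -> (forall y, 0 <= F y) ->
  (av c F x) ^+ 2 <= av c (fun y => F y ^+ 2) x.
Proof.
move=> c0 bF F0; rewrite -powR_sqr ?av_ge0//.
have q1 : 1 <= (2 : R) by lra.
apply: (le_trans (av_powR x c0 q1 bF F0)).
by rewrite (_ : (fun y => F y `^ 2) = (fun y => F y ^+ 2))//; apply/funext => y; rewrite powR_sqr.
Qed.

Lemma avo_sqr c F x : 0 < c -> bdm F -> (forall y, 0 <= F y) ->
  (avo c F x) ^+ 2 <= omI (R := R) (n := n) * avo c (fun y => F y ^+ 2) x.
Proof.
move=> c0 bF F0; rewrite -powR_sqr ?avo_ge0//.
have q1 : 1 <= (2 : R) by lra.
apply: (le_trans (avo_powR x c0 q1 bF F0)).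
rewrite (_ : 2 - 1 = 1 :> R) ?powRr1 ?omI_ge0//; last by ring.
by rewrite (_ : (fun y => F y `^ 2) = (fun y => F y ^+ 2))//; apply/funext => y; rewrite powR_sqr.
Qed.

Lemma sum_sqr (I : eqType) (s : seq I) (P : pred I) (w t : I -> R) :
  (forall i, P i -> 0 <= w i) -> (forall i, P i -> 0 <= t i) ->
  (\sum_(i <- s | P i) w i * t i) ^+ 2 <=
  (\sum_(i <- s | P i) w i) * \sum_(i <- s | P i) w i * t i ^+ 2.
Proof.
move=> w0 t0; have q1 : 1 <= (2 : R) by lra.
have := jensen_sum s q1 w0 t0.
rewrite (_ : 2 - 1 = 1 :> R); last by ring.
rewrite powRr1 ?sumr_ge0// powR_sqr; last first.
  by apply: sumr_ge0 => i Pi; rewrite mulr_ge0 ?w0 ?t0.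
rewrite (_ : \sum_(i <- s | P i) w i * t i `^ 2 = \sum_(i <- s | P i) w i * t i ^+ 2)//.
by apply: eq_bigr => i Pi; rewrite powR_sqr ?t0.
Qed.

Lemma av_comm a b F x : 0 < a -> 0 < b -> bl F -> av a (av b F) x = av b (av a F) x.
Proof.
move=> a0 b0 bF; have ba := @bl_ekd R n a a0; have bb := @bl_ekd R n b b0.
rewrite /av (cvA x ba bb bF) (cvA x bb ba bF).
by apply: eq_cvl => y; exact: cvC ba (bl_bdm bb).
Qed.

(** A Harnack factor exp (c |w|), integrated against the finer kernel, gives (b / (b - c))^n.
    Bounding this by an exponential in c / b lets the constants of successive averages multiply. *)
Lemma av_av_le c b F x : 0 < c -> c <= b / 2 -> bl F -> (forall y, 0 <= F y) ->
  av c (av b F) x <= expR (2 * n%:R * (c / b)) * av c F x.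
Proof.
move=> c0 cb bF F0; have b0 : 0 < b by lra.
have cb' : c < b by lra.
have bc0 : 0 < b - c by lra.
have bec := @bl_ekd R n c c0; have beb := @bl_ekd R n b b0.
rewrite /av (cvA x bec beb bF) -(cvZl _ _ bec (bl_bdm bF)).
apply: cv_lel => //; [exact: bl_cv|by apply: bl_mulr; [exact: bdm_cst|]|exact: bl_bdm|].
move=> u; apply: (@le_trans _ _ ((b / (b - c)) ^+ n * ekd c u)).
  have bbc := @bl_ekd R n _ bc0.
  have bE : bl (fun w : T => (b / (b - c)) ^+ n * ekd (b - c) w).
    by apply: bl_mulr => //; exact: bdm_cst.
  have <- : Int (fun w : T => ekd c u * (expR (c * l1 w) * ekd b w)) =
      (b / (b - c)) ^+ n * ekd c u.
    transitivity (Int (fun w : T => ekd c u * ((b / (b - c)) ^+ n * ekd (b - c) w))).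
      by apply: eq_Int => w; rewrite exp_ekd.
    by rewrite (IntZ _ bE) (IntZ _ bbc) Int_ekd// mulr1 mulrC.
  apply: Int_le => [||w]; first by apply: bl_cv_sect => //; exact: bl_bdm.
    apply: (@eq_bl _ _ (fun w : T => ekd c u * ((b / (b - c)) ^+ n * ekd (b - c) w))).
      by move=> w; rewrite exp_ekd.
    by apply: bl_mulr => //; exact: bdm_cst.
  by rewrite mulrA ler_wpM2r ?ekd_ge0// mulrC ekd_harnack.
rewrite ler_wpM2r ?ekd_ge0//.
have -> : 2 * n%:R * (c / b) = n%:R * (2 * (c / b)) by ring.
rewrite expRM_natl lerXn2r ?nnegrE ?expR_ge0// ?divr_ge0 ?(ltW b0) ?(ltW bc0)//.
apply: (le_trans _ (expR_ge1Dx _)).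
have t0 : 0 < c / b by rewrite divr_gt0.
have t2 : c / b <= 1 / 2 by rewrite ler_pdivrMr//; lra.
have -> : b / (b - c) = (1 - c / b)^-1 by field; rewrite ?gt_eqF//.
set t := c / b in t0 t2 *.
rewrite -[leLHS]mul1r ler_pdivrMr; last lra.
nra.
Qed.

Fixpoint chain (d : nat -> R) j f : T -> R :=
  if j is k.+1 then av (d k) (chain d k f) else f.

Variable d : nat -> R.
Hypothesis d0 : forall k, 0 < d k.

Lemma bl_chain j f : bl f -> bl (chain d j f).
Proof. by move=> bf; elim: j => //= j IH; exact: bl_av. Qed.

Lemma chain_ge0 j f x : (forall y, 0 <= f y) -> 0 <= chain d j f x.
Proof. by move=> f0; elim: j x => //= j IH x; exact: av_ge0. Qed.

Lemma chain_le j f g x : bl f -> bl g -> (forall y, f y <= g y) ->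
  chain d j f x <= chain d j g x.
Proof.
move=> bf bg fg; elim: j x => //= j IH x.
by apply: av_le => //; apply: bl_bdm; exact: bl_chain.
Qed.

Lemma chain_norm j f x : bl f -> `|chain d j f x| <= chain d j (fun y => `|f y|) x.
Proof.
move=> bf; elim: j x => //= j IH x; have bc := bl_chain j bf.
apply: (le_trans (av_norm _ (d0 j) (bl_bdm bc))).
apply: av_le => //; apply: bl_bdm; first exact: bl_norm.
by apply: bl_chain; exact: bl_norm.
Qed.

Lemma chainZ j f c x : bl f -> chain d j (fun y => c * f y) x = c * chain d j f x.
Proof.
move=> bf; elim: j x => //= j IH x.
rewrite -cvZr; [|exact: bl_ekd|by apply: bl_bdm; exact: bl_chain].
by apply: eq_cvr => y; exact: IH.
Qed.

Lemma chain_sub j f g x : bl f -> bl g ->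
  chain d j (fun y => f y - g y) x = chain d j f x - chain d j g x.
Proof.
move=> bf bg; elim: j x => //= j IH x.
rewrite -cvBr; [|exact: bl_ekd|by apply: bl_bdm; exact: bl_chain..].
by apply: eq_cvr => y; exact: IH.
Qed.

Lemma chain_sum j m (F : nat -> T -> R) x : (forall i, bl (F i)) ->
  chain d j (fun y => \sum_(i < m) F i y) x = \sum_(i < m) chain d j (F i) x.
Proof.
move=> bF; elim: j x => //= j IH x.
rewrite -cv_sumr; [|exact: bl_ekd|by move=> i _; apply: bl_bdm; exact: bl_chain].
by apply: eq_cvr => y; exact: IH.
Qed.

Lemma chain_shift j f x y : bl f -> chain d j (fun z => f (z - y)) x = chain d j f (x - y).
Proof.
move=> bf; elim: j x => //= j IH x.
rewrite /av -cv_shiftr; [|exact: bl_ekd|by apply: bl_bdm; exact: bl_chain].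
by apply: eq_cvr => z; exact: IH.
Qed.

Lemma chain_av j f c x : 0 < c -> bl f -> chain d j (av c f) x = av c (chain d j f) x.
Proof.
move=> c0 bf; elim: j x => //= j IH x.
rewrite av_comm//; last exact: bl_chain.
by apply: eq_cvr => z; exact: IH.
Qed.

Lemma chain_sqr j f x : bl f -> (forall y, 0 <= f y) ->
  chain d j f x ^+ 2 <= chain d j (fun y => f y ^+ 2) x.
Proof.
move=> bf f0; elim: j x => //= j IH x; have bc := bl_chain j bf.
apply: (le_trans (av_sqr x (d0 j) (bl_bdm bc) _)).
  by move=> y; exact: chain_ge0.
apply: av_le => //; apply: bl_bdm; first exact: bl_exp.
by apply: bl_chain; exact: bl_exp.
Qed.

Lemma Int_chain j f : bl f -> Int (chain d j f) = Int f.
Proof.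
move=> bf; elim: j => //= j IH.
by rewrite Int_av//; exact: bl_chain.
Qed.

Hypothesis dS : forall k, d k.+1 = d k / 2.

Lemma chain_scale j : d j = d 0%N / 2 ^+ j.
Proof.
elim: j => [|j IH]; first by rewrite expr0 divr1.
by rewrite dS IH exprS invfM mulrCA mulrC mulrA.
Qed.

(** Every finer average is absorbed into the coarsest one. The exponents c / d_k form a geometric
    series of sum at most 1, so the constant does not depend on the length of the chain. *)
Lemma chain_le_av j f x : bl f -> (forall y, 0 <= f y) ->
  chain d j.+1 f x <= expR (2 * n%:R) * av (d j) f x.
Proof.
move=> bf f0.
(* Stated for any sufficiently coarse c, for the sake of the induction; (2^k - 1) / d_0 is the sum
   of 1 / d_i over i < k. *)
have H k c y : 0 < c -> (0 < k)%N -> c <= d k.-1 / 2 ->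
    av c (chain d k f) y <= expR (2 * n%:R * (c * ((2 ^+ k - 1) / d 0%N))) * av c f y.
  move=> c0 _; elim: k y => [|k IH] y ck.
    by rewrite expr0 subrr mul0r !mulr0 expR0 mul1r.
  apply: (le_trans (av_av_le y c0 ck (bl_chain k bf) _)).
    by move=> z; exact: chain_ge0.
  rewrite /= in ck.
  apply: (@le_trans _ _ (expR (2 * n%:R * (c / d k)) *
      (expR (2 * n%:R * (c * ((2 ^+ k - 1) / d 0%N))) * av c f y))).
    rewrite ler_wpM2l ?expR_ge0// IH//; case: k {IH} ck => [|k] /=; first by [].
    by rewrite dS => h; have := d0 k; lra.
  rewrite mulrA -expRD ler_wpM2r ?av_ge0// ler_expR -mulrDr.
  rewrite ler_wpM2l ?mulr_ge0// -mulrDr ler_wpM2l ?(ltW c0)//.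
  rewrite chain_scale exprS.
  rewrite le_eqVlt; apply/orP; left; apply/eqP; field.
  by rewrite !gt_eqF// exprn_gt0.
case: j => [|j].
  by rewrite /= -[leLHS]mul1r ler_wpM2r ?av_ge0// -expR0 ler_expR mulr_ge0.
have h : d j.+1 <= d j.+1.-1 / 2 by rewrite dS.
apply: (le_trans (H j.+1 (d j.+1) x (d0 _) isT h)).
rewrite ler_wpM2r ?av_ge0// ler_expR -[leRHS]mulr1 ler_wpM2l ?mulr_ge0//.
rewrite chain_scale.
have p0 : 0 < (2 : R) ^+ j.+1 by rewrite exprn_gt0.
have -> : d 0%N / 2 ^+ j.+1 * ((2 ^+ j.+1 - 1) / d 0%N) = 1 - (2 ^+ j.+1)^-1.
  by field; rewrite !gt_eqF.
by rewrite gerBl invr_ge0 ltW.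
Qed.

End averaging_chains.

(** * Kernels of mean zero: smoothness and cancellation *)

Section good_kernels.
Context {R : realType} {n : nat}.
Local Notation T := 'rV[R]_n.
Implicit Types (f g z : T -> R) (x y : T) (a c A : R).

(** Two quantitative properties are retained of a Schwartz kernel of mean zero: one moment beyond
    [om], which exploits the cancellation, and a Lipschitz bound with the decay of [om], which
    expresses smoothness. *)
Definition good_kernel A z := [/\ bl z, Int z = 0,
  forall x, `|z x| * (1 + l1 x) <= A * om x &
  forall x y, `|z (x - y) - z x| <= A * (l1 y * (1 + l1 y) ^+ n.+1) * om x].

Lemma good_kernel_ge0 A z : good_kernel A z -> 0 <= A.
Proof.
move=> [_ _ h _]; rewrite -(pmulr_lge0 _ (om_gt0 (0 : T))).
by apply: (le_trans _ (h 0)); rewrite mulr_ge0// (ltW (l1p_gt0 _)).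
Qed.

Lemma ekd_lip c x y : 0 < c ->
  `|ekd c (x - y) - ekd c x| <= c * l1 y * (ekd c (x - y) + ekd c x).
Proof.
move=> c0.
have expl (s t : R) : `|expR (- s) - expR (- t)| <= `|s - t| * (expR (- s) + expR (- t)).
  wlog st : s t / s <= t.
    move=> H; have [/H//|/ltW/H h] := leP s t.
    by rewrite distrC [`|s - t|]distrC [X in _ <= _ * X]addrC.
  rewrite ger0_norm ?subr_ge0 ?ler_expR ?lerN2// distrC ger0_norm ?subr_ge0//.
  have -> : expR (- t) = expR (- s) * expR (- (t - s)).
    by rewrite -expRD; congr expR; ring.
  have := expR_ge1Dx (- (t - s)); have := expR_ge0 (- s); have := expR_ge0 (- (t - s)).
  have : 0 <= t - s by rewrite subr_ge0.
  set u := expR (- (t - s)); set w := expR (- s) => ts u0 w0 h.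
  have h1 : 0 <= w * (u - (1 + - (t - s))) by rewrite mulr_ge0// subr_ge0.
  have h2 : 0 <= (t - s) * (w * u) by rewrite mulr_ge0// mulr_ge0.
  rewrite -subr_ge0 (_ : _ - _ = w * (u - (1 + - (t - s))) + (t - s) * (w * u)).
    by rewrite addr_ge0.
  by ring.
rewrite /ekd /dil !(ek0E (c *: _)) !l1Z ?(ltW c0)//.
set K := c ^+ n; set e := ek (0 : T).
have K0 : 0 <= K by rewrite exprn_ge0// ltW.
have e0 : 0 <= e by exact: ek_ge0.
set s := c * l1 (x - y); set t := c * l1 x.
have st : `|s - t| <= c * l1 y.
  rewrite -mulrBr normrM (gtr0_norm c0) ler_pM2l// ler_norml.
  by have := l1_dist x y; have := l1B x y; lra.
rewrite -!mulrBr -!mulrDr 2!normrM (ger0_norm K0) (ger0_norm e0).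
rewrite [leRHS]mulrCA ler_wpM2l// [leRHS]mulrCA ler_wpM2l//.
apply: (le_trans (expl s t)); rewrite ler_wpM2r// addr_ge0 ?expR_ge0//.
Qed.

Variables (A : R) (z : T -> R).
Hypothesis gz : good_kernel A z.

Let bz : bl z. Proof. by case: gz. Qed.
Let z_om x : `|z x| * (1 + l1 x) <= A * om x. Proof. by case: gz. Qed.
Let A0 : 0 <= A. Proof. exact: good_kernel_ge0 gz. Qed.

Lemma kernel_le a x : 0 < a -> `|dil a z x| <= A * omd a x.
Proof.
move=> a0; rewrite /omd /dil normrM ger0_norm ?exprn_ge0 ?(ltW a0)//.
rewrite [leRHS]mulrCA ler_wpM2l ?exprn_ge0 ?(ltW a0)//.
apply: le_trans (z_om _); by rewrite ler_peMr// l1p_ge1.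
Qed.

Lemma kernel_moment a x : 0 < a -> l1 x * `|dil a z x| <= A / a * omd a x.
Proof.
move=> a0; rewrite mulrAC ler_pdivlMr// /omd /dil normrM ger0_norm ?exprn_ge0 ?(ltW a0)//.
have -> : l1 x * (a ^+ n * `|z (a *: x)|) * a = a ^+ n * (`|z (a *: x)| * l1 (a *: x)).
  by rewrite l1Z ?(ltW a0)//; ring.
rewrite [leRHS]mulrCA ler_wpM2l ?exprn_ge0 ?(ltW a0)//.
apply: le_trans (z_om _); rewrite ler_wpM2l//; lra.
Qed.

Lemma kernel_cv_le a g x : 0 < a -> bl g ->
  `|cv (dil a z) g x| <= A * avo a (fun y => `|g y|) x.
Proof.
move=> a0 bg; have bza := bl_dil a0 bz.
apply: (le_trans (cv_norm x bza (bl_bdm bg))).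
have bo := @bl_omd R n a a0; have bng := bl_norm bg.
rewrite /avo -cvZl//; last exact: bl_bdm.
apply: cv_lel => //; [exact: bl_norm|by apply: bl_mulr; [exact: bdm_cst|]|exact: bl_bdm|].
by move=> y; exact: kernel_le.
Qed.

Lemma kernel_diff a g x y : 0 < a -> bl g ->
  `|cv (dil a z) g (x - y) - cv (dil a z) g x| <=
  A * (a * l1 y * (1 + a * l1 y) ^+ n.+1) * avo a (fun y => `|g y|) x.
Proof.
move=> a0 bg; have bza := bl_dil a0 bz; have bdg := bl_bdm bg.
have bzy := bl_subr y bza.
rewrite -cv_shiftl -cvBl//.
have bd : bl (fun u => dil a z (u - y) - dil a z u) by exact: bl_sub.
apply: (le_trans (cv_norm x bd bdg)).
have bo := @bl_omd R n a a0; have bng := bl_norm bg.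
rewrite /avo -cvZl//; last exact: bl_bdm.
apply: cv_lel => //; [exact: bl_norm|by apply: bl_mulr; [exact: bdm_cst|]|exact: bl_bdm|].
move=> u; rewrite /omd /dil -mulrBr normrM ger0_norm ?exprn_ge0 ?(ltW a0)//.
rewrite [leRHS]mulrCA ler_wpM2l ?exprn_ge0 ?(ltW a0)// scalerBr -(l1Z y (ltW a0)).
by case: gz => _ _ _; apply.
Qed.

(** Because the kernel has mean zero, [ekd c u] may be subtracted from [ekd c (u - w)]. The
    difference costs c |w|, and the first moment of the kernel turns this into c / a, a gain when
    the average is coarser than the kernel. *)
Lemma kernel_smooth a c g x : 0 < a -> 0 < c -> bl g ->
  `|av c (cv (dil a z) g) x| <= A * (c / a) *
  (omI (R := R) (n := n) * av c (fun y => `|g y|) x + av c (avo a (fun y => `|g y|)) x).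
Proof.
move=> a0 c0 bg; have bza := bl_dil a0 bz; have bdg := bl_bdm bg.
have be := @bl_ekd R n c c0; have bo := @bl_omd R n a a0; have bng := bl_norm bg.
have bk : bl (cv (ekd c) (dil a z)) by exact: bl_cv.
have beo : bl (cv (ekd c) (omd a) : T -> R) by exact: bl_cv.
have bs : bl (fun u : T => omI (R := R) (n := n) * ekd c u + cv (ekd c) (omd a) u).
  by apply: bl_add => //; apply: bl_mulr => //; exact: bdm_cst.
rewrite /av (cvA x be bza bg); apply: (le_trans (cv_norm x bk bdg)).
apply: (@le_trans _ _ (cv (fun u : T => A * (c / a) *
   (omI (R := R) (n := n) * ekd c u + cv (ekd c) (omd a) u)) (fun y => `|g y|) x)); last first.
  have bdng := bl_bdm bng.
  have bs1 : bl (fun u : T => omI (R := R) (n := n) * ekd c u).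
    by apply: bl_mulr => //; exact: bdm_cst.
  rewrite (cvZl _ _ bs bdng) (cvDl _ bs1 beo bdng) (cvZl _ _ be bdng).
  by rewrite -(cvA x be bo bng).
apply: cv_lel => //; [exact: bl_norm|by apply: bl_mulr => //; exact: bdm_cst|exact: bl_bdm|].
move=> u.
have bsec : bl (fun w => ekd c (u - w) * dil a z w) by apply: bl_cv_sect => //; exact: bl_bdm.
have b2 : bl (fun w => ekd c u * dil a z w) by apply: bl_mulr => //; exact: bdm_cst.
have -> : cv (ekd c) (dil a z) u = Int (fun w => (ekd c (u - w) - ekd c u) * dil a z w).
  have -> : Int (fun w => (ekd c (u - w) - ekd c u) * dil a z w) =
     Int (fun w => ekd c (u - w) * dil a z w - ekd c u * dil a z w).
    by apply: eq_Int => w; rewrite mulrBl.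
  rewrite Int_sub// IntZ// Int_dil//; case: gz => _ -> _ _.
  by rewrite mulr0 subr0.
have bdif : bl (fun w => (ekd c (u - w) - ekd c u) * dil a z w).
  by apply: bl_mulr => //; apply: bdm_sub; [apply: bdm_rsub; exact: bl_bdm|exact: bdm_cst].
apply: (le_trans (Int_norm bdif)).
have b3 : bl (fun w => ekd c (u - w) * omd a w) by apply: bl_cv_sect => //; exact: bl_bdm.
have b4 : bl (fun w : T => ekd c u * omd a w) by apply: bl_mulr => //; exact: bdm_cst.
have -> : A * (c / a) * (omI (R := R) (n := n) * ekd c u + cv (ekd c) (omd a) u) =
    Int (fun w => A * (c / a) * (ekd c (u - w) * omd a w + ekd c u * omd a w)).
  rewrite IntZ; last exact: bl_add.
  rewrite (Int_add b3 b4) (IntZ _ bo) Int_omd//; congr (_ * _).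
  rewrite addrC; congr (_ + _); exact: mulrC.
apply: Int_le => [||w]; first exact: bl_norm.
  by apply: bl_mulr; [exact: bdm_cst|exact: bl_add].
rewrite normrM; have := ekd_lip u w c0; have := kernel_moment w a0.
have := ekd_ge0 (u - w) c0; have := ekd_ge0 u c0.
set e1 := ekd c u; set e2 := ekd c (u - w); set k := `|dil a z w|.
set o := omd a w => e10 e20 H1 H2.
have k0 : 0 <= k by exact: normr_ge0.
apply: (@le_trans _ _ (c * l1 w * (e2 + e1) * k)); first by rewrite ler_wpM2r.
have -> : c * l1 w * (e2 + e1) * k = c * (e2 + e1) * (l1 w * k) by ring.
have -> : A * (c / a) * (e2 * o + e1 * o) = c * (e2 + e1) * (A / a * o) by ring.
by rewrite ler_wpM2l// mulr_ge0 ?addr_ge0// ltW.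
Qed.

End good_kernels.

(** * The smooth square function estimate *)

Section square_function_preliminaries.
Context {R : realType} {n : nat}.
Local Notation T := 'rV[R]_n.

(** This is 2^-|i + j - I|, the two truncated differences adding up to an absolute value. With a_i =
    a0 2^i and d_j = a0 2^(I-j) it is whichever of a_i / d_j and d_j / a_i is at most 1. *)
Definition wt (I i j : nat) : R := 2 ^- ((i + j - I) + (I - (i + j))).

Lemma wt_gt0 I i j : 0 < wt I i j.
Proof. by rewrite invr_gt0 exprn_gt0. Qed.

Lemma wtC I i j : wt I i j = wt I j i. Proof. by rewrite /wt (addnC i j). Qed.

Lemma sum_wt I j m : \sum_(i < m) wt I i j <= 3.
Proof.
(* The closed form of the sum of 2^-|k - I| over all integers k < M. *)
pose V M : R := if (M <= I)%N then 2 ^- (I - M) else 3 - 2 * 2 ^- (M - I).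
have p2 k : 0 < (2 : R) ^- k by rewrite invr_gt0 exprn_gt0.
have p21 k : (2 : R) ^- k <= 1.
  by rewrite invf_le1 ?exprn_gt0// exprn_ege1//; lra.
suff H : \sum_(i < m) wt I i j <= V (m + j)%N.
  rewrite (le_trans H)// /V; case: ifPn => _; first by rewrite (le_trans (p21 _))//; lra.
  by have := p2 (m + j - I)%N; lra.
elim: m => [|m IH].
  rewrite big_ord0 /V; case: ifPn => _; first exact: ltW.
  by have := p21 (0 + j - I)%N; lra.
rewrite big_ord_recr/=; apply: (le_trans (lerD IH (lexx _))).
rewrite /V /wt addSn; set M := (m + j)%N.
have [MI|IM] := ltnP M I.
  rewrite (ltnW MI) (_ : M - I = 0)%N; last by apply/eqP; rewrite subn_eq0 ltnW.
  rewrite add0n -[in leLHS](subnSK MI) exprS invfM; set t := 2 ^- _; lra.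
rewrite (_ : I - M = 0)%N; last by apply/eqP; rewrite subn_eq0.
rewrite addn0 subSn// exprS invfM; have := p2 (M - I)%N.
have [MI'|_] := leqP M I; last by set t := 2 ^- _; lra.
have -> : M = I by apply/eqP; rewrite eqn_leq MI' IM.
by rewrite subnn expr0 invr1; lra.
Qed.

Lemma poly_le_exp k : exists2 C : R, 0 < C &
  forall t, 0 <= t -> (1 + t) ^+ k <= C * expR (t / 2).
Proof.
pose M : R := 2 * k.+1%:R.
have M0 : 0 < M by rewrite mulr_gt0 ?ltr0n.
exists (M ^+ k * expR (1 / 2)); first by rewrite mulr_gt0 ?exprn_gt0 ?expR_gt0.
move=> t t0; have t1 : 0 <= (1 + t) / M by rewrite divr_ge0 ?(ltW M0)//; lra.
have h : 1 + t <= M * expR ((1 + t) / M).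
  rewrite -ler_pdivrMl// mulrC (le_trans _ (expR_ge1Dx _))//; lra.
apply: (@le_trans _ _ ((M * expR ((1 + t) / M)) ^+ k)).
  by rewrite lerXn2r ?nnegrE ?mulr_ge0 ?expR_ge0 ?(ltW M0)//; lra.
rewrite exprMn -mulrA ler_wpM2l ?exprn_ge0 ?(ltW M0)// -expRM_natl -expRD ler_expR.
have -> : 1 / 2 + t / 2 = k.+1%:R * ((1 + t) / M).
  by rewrite /M; field; rewrite nat1r pnatr_eq0.
by rewrite ler_wpM2r// ler_nat.
Qed.

(** A polynomial in d |y| is dominated by exp (d |y| / 2), which leaves half of the parameter. *)
Lemma ekd_poly k : exists2 C : R, 0 < C & forall d (y : T), 0 < d ->
  ekd d y * (1 + d * l1 y) ^+ k <= C * ekd (d / 2) y.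
Proof.
have [C C0 H] := poly_le_exp k; exists (C * 2 ^+ n); first by rewrite mulr_gt0// exprn_gt0.
move=> d y d0; have l0 := l1_ge0 y.
apply: (@le_trans _ _ (ekd d y * (C * expR (d * l1 y / 2)))).
  by rewrite ler_wpM2l ?ekd_ge0// H// mulr_ge0// ltW.
have -> : d * l1 y / 2 = d / 2 * l1 y by ring.
rewrite [leLHS]mulrCA -[leRHS]mulrA ler_wpM2l ?(ltW C0)// mulrC.
have d2 : d / 2 < d by lra.
have d20 : 0 < d / 2 by lra.
have E : d - d / 2 = d / 2 by field.
rewrite exp_ekd// E (_ : d / (d / 2) = 2)//.
by field; rewrite gt_eqF.
Qed.

Lemma powR_add (a b q : R) : 1 <= q -> 0 <= a -> 0 <= b ->
  (a + b) `^ q <= 2 `^ (q - 1) * (a `^ q + b `^ q).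
Proof.
move=> q1 a0 b0.
have w0 (i : bool) : true -> 0 <= (1 : R) by [].
have x0 (i : bool) : true -> 0 <= (if i then a else b) by case: i.
have := jensen_sum [:: true; false] q1 w0 x0.
by rewrite !big_cons !big_nil/= !mul1r !addr0.
Qed.

(** Proved by comparing S with e F^2 rather than from conjugate exponents, which would degenerate at
    r = 2. *)
Lemma young_square (r e : R) : 2 <= r -> 0 < e -> exists2 C, 0 <= C &
  forall F S : R, 0 <= F -> 0 <= S ->
  F `^ (r - 2) * S <= e * F `^ r + C * S `^ (r / 2).
Proof.
move=> r2 e0; have r0 : 0 <= r - 2 by lra.
exists (e^-1 `^ (r / 2 - 1)) => [|F S F0 S0]; first exact: powR_ge0.
have [SF|FS] := leP S (e * F ^+ 2).
  apply: (@le_trans _ _ (e * F `^ r)); last by rewrite lerDl mulr_ge0 ?powR_ge0.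
  rewrite -[in leRHS](ger0_norm F0) -(powR_norm2 F r2) (ger0_norm F0).
  by rewrite mulrCA ler_wpM2l ?powR_ge0.
apply: (@le_trans _ _ (e^-1 `^ (r / 2 - 1) * S `^ (r / 2))); last first.
  by rewrite lerDr mulr_ge0 ?powR_ge0// ltW.
have r20 : 0 < r / 2 by lra.
rewrite -(mulr_powRB1 S0 r20) mulrCA mulrC ler_wpM2l//.
rewrite -powRM ?invr_ge0 ?(ltW e0)//.
have -> : F `^ (r - 2) = (F ^+ 2) `^ (r / 2 - 1).
  by rewrite -powR_sqr// -powRrM; congr (_ `^ _); field.
apply: powR_le_mono; [lra|exact: sqr_ge0|].
by rewrite mulrC ler_pdivlMr// mulrC ltW.
Qed.

(** The scales of a chain decrease with j, so the indices are reversed to meet [scales]. The summand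
    F_j stands beside its average because oscillations and chains are both bounded in that form. *)
Lemma dual_doob_desc (q : R) : 1 <= q -> exists2 C : R, 0 <= C &
  forall m (d : nat -> R) (F : nat -> T -> R), (forall k, 0 < d k) ->
  (forall k, d k.+1 <= d k) -> (forall i, bl (F i)) -> (forall i x, 0 <= F i x) ->
  Int (fun x => (\sum_(j < m) (F j x + av (d j) (F j) x)) `^ q) <=
  C * Int (fun x => (\sum_(j < m) F j x) `^ q).
Proof.
move=> q1; have [C C0 H] := @dual_doob R n q q1.
exists (2 `^ (q - 1) * (1 + C)); first by rewrite mulr_ge0 ?powR_ge0// addr_ge0.
move=> m d F d0 dS bF F0.
have dle i j : (i <= j)%N -> d j <= d i.
  move=> /subnK <-; elim: (j - i)%N => // k IH.
  by rewrite addSn (le_trans _ IH).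
pose a i := d (m.-1 - i)%N; pose F' i := F (m.-1 - i)%N.
have sa : scales a.
  split=> i; first exact: d0.
  by apply: dle; rewrite leq_sub2l.
have bav j : bl (av (d j) (F j)) by exact: bl_av.
have av0 j x : 0 <= av (d j) (F j) x by exact: av_ge0.
have rev (G : nat -> R) : \sum_(j < m) G j = \sum_(i < m) G (m.-1 - i)%N.
  rewrite (reindex_inj rev_ord_inj)/=; apply: eq_bigr => i _.
  by congr G; rewrite -subn1 -subnDA add1n.
have H1 := H m a F' sa (fun i => bF _) (fun i x => F0 _ x).
have e1 x : (\sum_(i < m) av (a i) (F' i) x) `^ q = (\sum_(j < m) av (d j) (F j) x) `^ q.
  by rewrite (rev (fun j => av (d j) (F j) x)).
have e2 x : (\sum_(i < m) F' i x) `^ q = (\sum_(j < m) F j x) `^ q.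
  by rewrite (rev (fun j => F j x)).
rewrite (eq_Int e1) (eq_Int e2) in H1.
have b1 : bl (fun x => (\sum_(j < m) F j x) `^ q).
  by apply: bl_powR0 => // [x|]; [exact: sumr_ge0|exact: bl_sum].
have b2 : bl (fun x => (\sum_(j < m) av (d j) (F j) x) `^ q).
  by apply: bl_powR0 => // [x|]; [exact: sumr_ge0|exact: bl_sum].
apply: (@le_trans _ _ (Int (fun x => 2 `^ (q - 1) *
    ((\sum_(j < m) F j x) `^ q + (\sum_(j < m) av (d j) (F j) x) `^ q)))).
  apply: Int_le => [||x].
  - apply: bl_powR0 => // [x|]; first by apply: sumr_ge0 => j _; exact: addr_ge0.
    by apply: bl_sum => j _; apply: bl_add.
  - by apply: bl_mulr; [exact: bdm_cst|exact: bl_add].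
  - by rewrite big_split/=; apply: powR_add => //; exact: sumr_ge0.
rewrite IntZ; last exact: bl_add.
rewrite (Int_add b1 b2) -mulrA mulrDl mul1r; apply: ler_wpM2l; first exact: powR_ge0.
by apply: lerD.
Qed.

End square_function_preliminaries.

Section square_function.
Context {R : realType} {n : nat}.
Local Notation T := 'rV[R]_n.
Variables (A : R) (z : T -> R).
Hypothesis gz : good_kernel A z.

Let A0 : 0 <= A. Proof. exact: good_kernel_ge0 gz. Qed.
Let bz : bl z. Proof. by case: gz. Qed.
Local Notation oI := (omI (R := R) (n := n)).

Section pieces.
Variables (I : nat) (a0 : R) (g : nat -> T -> R).
Hypotheses (a0_gt0 : 0 < a0) (bg : forall i, bl (g i)).

Let a i := a0 * 2 ^+ i.
Let d j := a0 * 2 ^+ I / 2 ^+ j.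
Let u i := cv (dil (a i) z) (g i).
Let L i x := `|g i x| + avo (a i) (fun y => `|g i y|) x.
Let Y j x := \sum_(i < I) wt I i j * L i x ^+ 2.
Let f x := \sum_(i < I) u i x.

Let p2 k : 0 < (2 : R) ^+ k. Proof. by rewrite exprn_gt0. Qed.
Let a_gt0 i : 0 < a i. Proof. by rewrite mulr_gt0. Qed.
Let d_gt0 i : 0 < d i. Proof. by rewrite divr_gt0// mulr_gt0. Qed.
Let dS k : d k.+1 = d k / 2.
Proof. by rewrite /d exprS invfM [2^-1 * _]mulrC mulrA. Qed.

Let a_le i j : (i + j <= I)%N -> a i = wt I i j * d j.
Proof.
move=> ij; rewrite /wt (_ : i + j - I = 0)%N; last by apply/eqP; rewrite subn_eq0.
rewrite add0n /a /d -{2}(subnK ij) !exprD.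
by field; rewrite !gt_eqF.
Qed.

Let d_le i j : (I <= i + j)%N -> d j = wt I i j * a i.
Proof.
move=> ij; rewrite /wt (_ : I - (i + j) = 0)%N; last by apply/eqP; rewrite subn_eq0.
rewrite addn0 /a /d.
have E : (2 : R) ^+ i * 2 ^+ j = 2 ^+ (i + j - I) * 2 ^+ I by rewrite -!exprD subnK.
apply: (@mulIf _ (2 ^+ j)); first by rewrite gt_eqF.
rewrite divfK ?gt_eqF// -!mulrA E.
by field; rewrite gt_eqF.
Qed.

Let bu i : bl (u i). Proof. by apply: bl_cv => //; exact: bl_dil. Qed.
Let bn i : bl (fun y => `|g i y|). Proof. exact: bl_norm. Qed.
Let bav i : bl (avo (a i) (fun y => `|g i y|)). Proof. exact: bl_avo. Qed.
Let avo_0 i x : 0 <= avo (a i) (fun y => `|g i y|) x. Proof. exact: avo_ge0. Qed.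
Let bL i : bl (L i). Proof. exact: bl_add. Qed.
Let L0 i x : 0 <= L i x. Proof. by rewrite addr_ge0. Qed.
Let bL2 i : bl (fun x => L i x ^+ 2). Proof. exact: bl_exp. Qed.
Let bY j : bl (Y j).
Proof. by apply: bl_sum => i _; apply: bl_mulr => //; exact: bdm_cst. Qed.
Let Y0 j x : 0 <= Y j x.
Proof. by apply: sumr_ge0 => i _; rewrite mulr_ge0 ?sqr_ge0// (ltW (wt_gt0 _ _ _)). Qed.
Let bf : bl f. Proof. exact: bl_sum. Qed.

Let C0 := 2 * A * (1 + oI).

Let C00 : 0 <= C0.
Proof. by rewrite mulr_ge0 ?addr_ge0 ?omI_ge0// mulr_ge0. Qed.

(** Two regimes. If a_i <= d_j, the piece is smooth at length 1 / d_j and [kernel_diff] yields the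
    factor a_i / d_j. If a_i > d_j, the last average of the chain meets an oscillating piece and
    [kernel_smooth] yields d_j / a_i for each of the two values separately. *)
Lemma chain_piece_diff i j x y : (i < I)%N ->
  `|chain d j (u i) (x - y) - chain d j (u i) x| <=
  C0 * (wt I i j * (1 + d j * l1 y) ^+ n.+2) *
  (chain d j (L i) (x - y) + chain d j (L i) x).
Proof.
move=> iI; have oI0 : 0 <= oI by exact: omI_ge0.
have w0 := wt_gt0 (R := R) I i j; have l0 := l1_ge0 y.
have wd0 : 0 <= wt I i j * d j by apply: mulr_ge0; exact: ltW.
have cL0 w : 0 <= chain d j (L i) w by exact: chain_ge0.
have P1 : 1 <= (1 + d j * l1 y) ^+ n.+2.
  by rewrite exprn_ege1// lerDl mulr_ge0// ltW.
have [ij|ij] := leqP (i + j) I.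
  have bs : bl (fun w => u i (w - y)) by exact: bl_subr.
  rewrite -chain_shift// -chain_sub//.
  have bd := bl_sub bs (bu i).
  apply: (le_trans (chain_norm d_gt0 j x bd)).
  set t := a i * l1 y * (1 + a i * l1 y) ^+ n.+1.
  have bt : bl (fun w => A * t * avo (a i) (fun y => `|g i y|) w).
    by apply: bl_mulr => //; exact: bdm_cst.
  apply: (@le_trans _ _ (chain d j (fun w => A * t * avo (a i) (fun y => `|g i y|) w) x)).
    apply: chain_le => //; first exact: bl_norm.
    by move=> w; exact: kernel_diff.
  have t0 : 0 <= t.
    have al0 : 0 <= a i * l1 y by apply: mulr_ge0 => //; exact: ltW.
    by apply: mulr_ge0 => //; apply: exprn_ge0; exact: addr_ge0.
  rewrite chainZ//.
  have H1 : chain d j (avo (a i) (fun y => `|g i y|)) x <= chain d j (L i) x.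
    by apply: chain_le => // w; rewrite /L lerDr.
  have H2 : t <= wt I i j * (1 + d j * l1 y) ^+ n.+2.
    rewrite /t (a_le ij) [in leRHS]exprS mulrA; apply: ler_pM.
    - exact: mulr_ge0 wd0 l0.
    - apply: exprn_ge0; apply: addr_ge0 => //.
      exact: mulr_ge0 wd0 l0.
    - by rewrite -mulrA ler_wpM2l ?(ltW w0)// lerDr.
    - have w1 : wt I i j * d j <= d j.
        rewrite ler_piMl ?(ltW (d_gt0 j))// /wt invf_le1 ?exprn_gt0// exprn_ege1//; lra.
      apply: lerXn2r; rewrite ?nnegrE.
      + by apply: addr_ge0 => //; exact: mulr_ge0 wd0 l0.
      + by apply: addr_ge0 => //; apply: mulr_ge0 => //; exact: ltW.
      + by rewrite lerD2l ler_wpM2r.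
  apply: (@le_trans _ _ (A * (wt I i j * (1 + d j * l1 y) ^+ n.+2) * chain d j (L i) x)).
    apply: ler_pM => //; first by rewrite mulr_ge0.
      by apply: chain_ge0.
    by rewrite ler_wpM2l.
  apply: ler_pM => //; [by rewrite mulr_ge0// mulr_ge0// ?(ltW w0)// (le_trans ler01)| |].
    apply: ler_wpM2r; first by apply: mulr_ge0; [exact: ltW|exact: le_trans P1].
    by rewrite /C0; have := mulr_ge0 A0 oI0; have := A0; lra.
  by rewrite lerDr.
(* Here i + j > I > i, so the chain is not empty and ends with the average at d_(j-1) = 2 d_j. *)
have j0 : (0 < j)%N by case: j {w0 wd0 cL0 P1} ij => //; rewrite addn0 ltnNge (ltnW iI).
have key w : `|chain d j (u i) w| <= C0 * wt I i j * chain d j (L i) w.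
  rewrite -(prednK j0) /= prednK//; set k := j.-1.
  have bLk : bl (av (d k) (L i)) by exact: bl_av.
  (* Averages commute, so the last one can be made to act on the piece first. *)
  rewrite -!chain_av//.
  apply: (le_trans (chain_norm d_gt0 k w (bl_av (d_gt0 k) (bu i)))).
  rewrite -chainZ//; apply: chain_le => //.
  - by apply: bl_norm; exact: bl_av.
  - by apply: bl_mulr => //; exact: bdm_cst.
  move=> v; apply: (le_trans (kernel_smooth gz v (a_gt0 i) (d_gt0 k) (bg i))).
  have -> : d k = 2 * d j by rewrite -(prednK j0) dS -/k; field.
  rewrite (d_le (ltnW ij)).
  have -> : A * (2 * (wt I i j * a i) / a i) = 2 * A * wt I i j.
    by field; rewrite gt_eqF.
  have dj2 : 0 < 2 * (wt I i j * a i) by rewrite mulr_gt0// mulr_gt0.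
  set c := 2 * (wt I i j * a i).
  have -> : av c (L i) v = av c (fun y => `|g i y|) v + av c (avo (a i) (fun y => `|g i y|)) v.
    by apply: cvDr; [exact: bl_ekd|exact: bl_bdm|exact: bl_bdm].
  have h1 : 0 <= av c (fun y => `|g i y|) v by apply: av_ge0.
  have h2 : 0 <= av c (avo (a i) (fun y => `|g i y|)) v by apply: av_ge0.
  set a1 := av c (fun y => `|g i y|) v in h1 *.
  set b1 := av c (avo (a i) (fun y => `|g i y|)) v in h2 *.
  have -> : C0 * wt I i j * (a1 + b1) = 2 * A * wt I i j * ((1 + oI) * (a1 + b1)).
    by rewrite /C0; ring.
  apply: ler_wpM2l; first by apply: mulr_ge0; [exact: mulr_ge0|exact: ltW].
  have := mulr_ge0 oI0 h2; move: h1 h2; lra.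
apply: (le_trans (ler_normB _ _)); apply: (le_trans (lerD (key _) (key _))).
rewrite -mulrDr ler_wpM2r ?addr_ge0// ler_wpM2l// ler_peMr// ltW//.
Qed.

Lemma sum_chain_sqr j x :
  \sum_(i < I) wt I i j * chain d j (L i) x ^+ 2 <= chain d j (Y j) x.
Proof.
have bw i : bl (fun y => wt I i j * L i y ^+ 2).
  by apply: bl_mulr => //; exact: bdm_cst.
rewrite (chain_sum d_gt0 j I x bw); apply: ler_sum => i _.
rewrite chainZ// ler_wpM2l ?(ltW (wt_gt0 _ _ _))//.
exact: chain_sqr.
Qed.

(** Cauchy-Schwarz with the weights [wt], of total mass at most 3, followed by (s + t)^2 <= 2 (s^2 +
    t^2); hence the 6. *)
Lemma chain_diff_sqr j x y :
  (chain d j f (x - y) - chain d j f x) ^+ 2 <=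
  6 * C0 ^+ 2 * (1 + d j * l1 y) ^+ (n.+2 * 2) *
  (chain d j (Y j) (x - y) + chain d j (Y j) x).
Proof.
set P := (1 + d j * l1 y) ^+ n.+2.
have P0 : 0 <= P by rewrite exprn_ge0// addr_ge0// mulr_ge0 ?l1_ge0// ltW.
have W0 i : 0 <= wt (R := R) I i j by exact/ltW/wt_gt0.
have cL0 i w : 0 <= chain d j (L i) w by exact: chain_ge0.
pose t i := chain d j (L i) (x - y) + chain d j (L i) x.
have t0 i : 0 <= t i by exact: addr_ge0.
have H1 : `|chain d j f (x - y) - chain d j f x| <= C0 * P * \sum_(i < I) wt I i j * t i.
  rewrite !(chain_sum d_gt0 j I _ bu) -sumrB (le_trans (ler_norm_sum _ _ _))//.
  rewrite mulr_sumr; apply: ler_sum => i _.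
  apply: (le_trans (chain_piece_diff j x y (ltn_ord i))).
  by rewrite -/P -/(t i) le_eqVlt; apply/orP; left; apply/eqP; ring.
rewrite -real_normK ?num_real// exprM -/P.
apply: (@le_trans _ _ ((C0 * P * \sum_(i < I) wt I i j * t i) ^+ 2)).
  have S0 : 0 <= C0 * P * \sum_(i < I) wt I i j * t i.
    apply: mulr_ge0; first exact: mulr_ge0.
    by apply: sumr_ge0 => i _; exact: mulr_ge0.
  by rewrite lerXn2r ?nnegrE.
have H2 : (\sum_(i < I) wt I i j * t i) ^+ 2 <= 3 * \sum_(i < I) wt I i j * t i ^+ 2.
  apply: (le_trans (sum_sqr (index_enum 'I_I) (fun i _ => W0 i) (fun i _ => t0 i))).
  rewrite ler_wpM2r ?sum_wt//; apply: sumr_ge0 => i _.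
  by rewrite mulr_ge0 ?sqr_ge0.
have H3 : \sum_(i < I) wt I i j * t i ^+ 2 <=
    2 * (chain d j (Y j) (x - y) + chain d j (Y j) x).
  apply: (@le_trans _ _ (2 * (\sum_(i < I) wt I i j * chain d j (L i) (x - y) ^+ 2 +
     \sum_(i < I) wt I i j * chain d j (L i) x ^+ 2))).
    rewrite -big_split/= mulr_sumr; apply: ler_sum => i _.
    rewrite -mulrDr [leRHS]mulrCA ler_wpM2l// /t.
    by have := sqr_ge0 (chain d j (L i) (x - y) - chain d j (L i) x); nra.
  by rewrite ler_wpM2l// lerD// sum_chain_sqr.
rewrite [(C0 * P * _) ^+ 2]exprMn [(C0 * P) ^+ 2]exprMn.
have h : 0 <= C0 ^+ 2 * P ^+ 2 by rewrite mulr_ge0 ?sqr_ge0.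
have H4 : (\sum_(i < I) wt I i j * t i) ^+ 2 <=
   6 * (chain d j (Y j) (x - y) + chain d j (Y j) x) by lra.
apply: (le_trans (ler_wpM2l h H4)).
by rewrite le_eqVlt; apply/orP; left; apply/eqP; ring.
Qed.

Lemma osc2_chain_le (C1 : R) j x : 0 < C1 ->
  (forall c (y : T), 0 < c -> ekd c y * (1 + c * l1 y) ^+ (n.+2 * 2) <= C1 * ekd (c / 2) y) ->
  osc2 (d j) (chain d j f) x <=
  6 * C0 ^+ 2 * C1 * (chain d j (Y j) x + av (d j / 2) (chain d j (Y j)) x).
Proof.
move=> C10 HC1; set Z := chain d j (Y j).
have dj := d_gt0 j; have d2 : 0 < d j / 2 by rewrite divr_gt0.
have bZ : bl Z by exact: bl_chain.
have Z0 w : 0 <= Z w by exact: chain_ge0.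
have bv : bl (chain d j f) by exact: bl_chain.
have be := @bl_ekd R n _ dj; have be2 := @bl_ekd R n _ d2.
have K0 : 0 <= 6 * C0 ^+ 2 by rewrite mulr_ge0// sqr_ge0.
have b1 : bl (fun y => ekd (d j / 2) y * Z (x - y)).
  by apply: bl_mull => //; apply: bdm_rsub; exact: bl_bdm.
have b2 : bl (fun y : T => Z x * ekd (d j / 2) y).
  by apply: bl_mulr => //; exact: bdm_cst.
have -> : 6 * C0 ^+ 2 * C1 * (Z x + av (d j / 2) Z x) =
    Int (fun y => 6 * C0 ^+ 2 * C1 * (Z x * ekd (d j / 2) y + ekd (d j / 2) y * Z (x - y))).
  rewrite IntZ; last exact: bl_add.
  rewrite (Int_add b2 b1) (IntZ _ be2) Int_ekd// mulr1; congr (_ * (_ + _)).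
  rewrite /av (cvC x be2 (bl_bdm bZ)); apply: eq_Int => y; exact: mulrC.
apply: Int_le => [||y].
- apply: bl_mull => //; apply: bdm_exp; apply: bdm_sub; last exact: bdm_cst.
  by apply: bdm_rsub; exact: bl_bdm.
- by apply: bl_mulr; [exact: bdm_cst|exact: bl_add].
have e0 := ekd_ge0 y dj.
apply: (le_trans (ler_wpM2l e0 (chain_diff_sqr j x y))); rewrite -/Z.
set P := (1 + d j * l1 y) ^+ (n.+2 * 2).
have -> : ekd (d j) y * (6 * C0 ^+ 2 * P * (Z (x - y) + Z x)) =
    6 * C0 ^+ 2 * (ekd (d j) y * P) * (Z (x - y) + Z x) by ring.
have -> : 6 * C0 ^+ 2 * C1 * (Z x * ekd (d j / 2) y + ekd (d j / 2) y * Z (x - y)) =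
    6 * C0 ^+ 2 * (C1 * ekd (d j / 2) y) * (Z (x - y) + Z x) by ring.
apply: ler_wpM2r; first exact: addr_ge0.
by apply: ler_wpM2l => //; exact: HC1.
Qed.

Lemma chain_le_fmax m j x : (j < m)%N ->
  `|chain d j f x| <= expR (2 * n%:R) * (`|f x| + fmax (fun i => d m.-1 * 2 ^+ i) f m x).
Proof.
move=> jm; have E1 : 1 <= expR (2 * n%:R : R) by rewrite -expR0 ler_expR mulr_ge0.
have F0 := fmax_ge0 (fun i => d m.-1 * 2 ^+ i) f m x.
case: j jm => [|j] jm /=.
  by rewrite -[leLHS]mul1r ler_pM// lerDl.
have bnf := bl_norm bf.
apply: (le_trans (chain_norm d_gt0 j.+1 x bf)).
apply: (le_trans (chain_le_av d_gt0 dS j x bnf (fun y => normr_ge0 _))).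
rewrite ler_wpM2l ?expR_ge0// ler_wpDl//.
(* The scales d_(m-1) 2^i run through the d_j backwards, since the maximal inequality wants them
   increasing. *)
have E : d j = d m.-1 * 2 ^+ (m.-1 - j).
  have jm1 : (j <= m.-1)%N by rewrite -ltnS prednK ?(ltn_trans _ jm)// ltnW.
  by rewrite /d -{1}(subnK jm1) exprD; field; rewrite !gt_eqF.
rewrite E; apply: (@fmax_ge _ _ (fun i => d m.-1 * 2 ^+ i)).
by case: m jm {F0 E} => // m jm; rewrite ltnS leq_subr.
Qed.

Lemma sum_Y_le m x : \sum_(j < m) Y j x <= 3 * \sum_(i < I) L i x ^+ 2.
Proof.
rewrite exchange_big/= mulr_sumr; apply: ler_sum => i _.
rewrite -mulr_suml ler_wpM2r ?sqr_ge0//.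
rewrite (_ : \sum_(j < m) wt I i j = \sum_(j < m) wt (R := R) I j i).
  exact: sum_wt.
by apply: eq_bigr => j _; rewrite wtC.
Qed.

Lemma sum_L2_le x : \sum_(i < I) L i x ^+ 2 <=
  2 * (\sum_(i < I) g i x ^+ 2 + oI * \sum_(i < I) avo (a i) (fun y => g i y ^+ 2) x).
Proof.
rewrite mulr_sumr -big_split/= mulr_sumr; apply: ler_sum => i _.
have -> : avo (a i) (fun y => g i y ^+ 2) x = avo (a i) (fun y => `|g i y| ^+ 2) x.
  by apply: eq_cvr => y; rewrite real_normK ?num_real.
have h := avo_sqr x (a_gt0 i) (bl_bdm (bn i)) (fun y => normr_ge0 _).
rewrite -(real_normK (num_real (g i x))) /L.
have := sqr_ge0 (`|g i x| - avo (a i) (fun y => `|g i y|) x); nra.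
Qed.

End pieces.
End square_function.

Section square_function_theorem.
Context {R : realType} {n : nat}.
Local Notation T := 'rV[R]_n.
Local Notation oI := (omI (R := R) (n := n)).

Lemma sum_telescope (V : nat -> R) m : V 0%N - V m = \sum_(j < m) (V j - V j.+1).
Proof.
elim: m => [|m IH]; first by rewrite big_ord0 subrr.
by rewrite big_ord_recr/= -IH addrA subrK.
Qed.

Lemma le_mul_step (c k x y w : R) : 0 <= c -> x <= c * y -> y <= k * w ->
  x <= c * k * w.
Proof. by move=> c0 xy yw; rewrite (le_trans xy)// -mulrA ler_wpM2l. Qed.

(** Absorption: the coefficient of F is such that, after multiplication by B and with F <= M1 X, at
    most X / 2 comes back. *)
Lemma stage_arith (B M1 CY K3 X V F H S W : R) : 0 <= B -> 0 < M1 -> 0 <= CY ->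
  0 <= X -> X - V <= B * H -> H <= (2 * (B + 1) * M1)^-1 * F + CY * S ->
  F <= M1 * X -> S <= K3 * W -> X <= 2 * V + 2 * (B * (CY * K3)) * W.
Proof.
move=> B0 M10 CY0 X0 h1 h2 h3 h4.
have B1 : 0 < B + 1 by lra.
have k0 : 0 < 2 * (B + 1) * M1 by rewrite mulr_gt0// mulr_gt0.
have h5 : (2 * (B + 1) * M1)^-1 * F <= X / (2 * (B + 1)).
  rewrite ler_pdivrMl// (le_trans h3)// le_eqVlt; apply/orP; left; apply/eqP.
  by field; rewrite gt_eqF.
have h6 : B * (X / (2 * (B + 1))) <= X / 2.
  have -> : B * (X / (2 * (B + 1))) = X / 2 * (B / (B + 1)).
    by field; rewrite gt_eqF.
  rewrite ler_piMr ?divr_ge0// ler_pdivrMr//; lra.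
have h7 : B * H <= B * (X / (2 * (B + 1)) + CY * (K3 * W)).
  rewrite ler_wpM2l// (le_trans h2)// lerD// ler_wpM2l//.
have -> : 2 * (B * (CY * K3)) * W = 2 * (B * (CY * (K3 * W))) by ring.
move: h7; rewrite mulrDr; lra.
Qed.

(* Telescope int |f|^r along the averages v_0 = f, v_(j+1) = e_(d_j) * v_j; each
   decrement is controlled by an oscillation, in which the scale-a_i piece of f
   appears with the summable weight 2^-|log (a_i / d_j)|. *)
Theorem square_function (r A : R) (z : T -> R) : 2 <= r -> (0 < n)%N ->
  good_kernel A z -> exists2 C : R, 0 <= C &
  forall (I : nat) (a0 : R) (g : nat -> T -> R), 0 < a0 -> (forall i, bl (g i)) ->
  Int (fun x => `|\sum_(i < I) cv (dil (a0 * 2 ^+ i) z) (g i) x| `^ r) <=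
  C * Int (fun x => (\sum_(i < I) g i x ^+ 2) `^ (r / 2)).
Proof.
move=> r2 n0 gz; have r1 : 1 <= r by lra.
have r0 : 0 <= r by lra.
have r20 : 0 <= r - 2 by lra.
pose q := r / 2.
have q1 : 1 <= q by rewrite /q; lra.
have q0 : 0 <= q by lra.
have rr0 : 0 <= r * (r - 1) by apply: mulr_ge0; lra.
have A0 := good_kernel_ge0 gz.
have [bz _ _ _] := gz.
have oI0 : 0 <= oI by exact: omI_ge0.
have [C1 C10 HC1] := @ekd_poly R n (n.+2 * 2).
have [CM CM0 HM] := @maximal_inequality R n r r2.
have [CD CD0 HD] := @dual_doob_desc R n q q1.
have [CO CO0 HO] := @dual_doob_om R n q q1.
pose C0 := 2 * A * (1 + oI).
pose K := 6 * C0 ^+ 2 * C1.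
have K0 : 0 <= K by rewrite mulr_ge0 ?(ltW C10)// mulr_ge0// sqr_ge0.
pose E := expR (2 * n%:R : R).
have E1 : 1 <= E by rewrite /E -expR0 ler_expR mulr_ge0.
have E0 : 0 <= E by lra.
pose B := r * (r - 1) * (E `^ (r - 2) * K).
have B0 : 0 <= B.
  by rewrite mulr_ge0// ?mulr_ge0 ?powR_ge0//; lra.
pose M1 := 2 `^ (r - 1) * (1 + CM).
have M10 : 0 < M1 by rewrite mulr_gt0 ?powR_gt0//; lra.
have e0 : 0 < (2 * (B + 1) * M1)^-1 by rewrite invr_gt0 mulr_gt0//; lra.
have [CY CY0 HY] := young_square r2 e0.
pose K2 := 2 `^ q * (2 `^ (q - 1) * (1 + oI `^ q * CO)).
have K20 : 0 <= K2.
  by rewrite mulr_ge0 ?powR_ge0// mulr_ge0 ?powR_ge0// addr_ge0// mulr_ge0 ?powR_ge0.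
pose K3 := CD * (E `^ q * (CD * (3 `^ q * K2))).
have K30 : 0 <= K3.
  by rewrite mulr_ge0// mulr_ge0 ?powR_ge0// mulr_ge0// mulr_ge0 ?powR_ge0.
exists (2 * (B * (CY * K3))); first by rewrite mulr_ge0// mulr_ge0// mulr_ge0.
move=> I a0 g a00 bg.
pose a i := a0 * 2 ^+ i.
pose d j := a0 * 2 ^+ I / 2 ^+ j.
have p2 k : 0 < (2 : R) ^+ k by rewrite exprn_gt0.
have a_gt0 i : 0 < a i by rewrite mulr_gt0.
have d_gt0 i : 0 < d i by rewrite divr_gt0// mulr_gt0.
have dS k : d k.+1 = d k / 2 by rewrite /d exprS invfM [2^-1 * _]mulrC mulrA.
have dS' k : d k.+1 <= d k by rewrite dS; have := d_gt0 k; lra.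
have sa : scales a.
  split=> i //; rewrite /a exprS ler_wpM2l ?(ltW a00)//.
  by rewrite ler_peMl ?ler1n// ltW.
pose f x := \sum_(i < I) cv (dil (a i) z) (g i) x.
pose L i x := `|g i x| + avo (a i) (fun y => `|g i y|) x.
pose Y j x := \sum_(i < I) wt I i j * L i x ^+ 2.
pose v j := chain d j f.
pose Z j := chain d j (Y j).
pose G x := \sum_(i < I) g i x ^+ 2.
have bf : bl f by apply: bl_sum => i _; apply: bl_cv => //; exact: bl_dil.
have bL i : bl (L i).
  apply: bl_add; first exact: bl_norm.
  by apply: bl_avo => //; exact: bl_norm.
have bL2 i : bl (fun x => L i x ^+ 2) by exact: bl_exp.
have bY j : bl (Y j) by apply: bl_sum => i _; apply: bl_mulr => //; exact: bdm_cst.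
have Y0 j x : 0 <= Y j x.
  by apply: sumr_ge0 => i _; rewrite mulr_ge0 ?sqr_ge0// (ltW (wt_gt0 _ _ _)).
have bv j : bl (v j) by exact: bl_chain.
have bZ j : bl (Z j) by exact: bl_chain.
have Z0 j x : 0 <= Z j x by exact: chain_ge0.
have d2 j : 0 < d j / 2 by rewrite divr_gt0.
have bavZ j : bl (av (d j / 2) (Z j)) by exact: bl_av.
have avZ0 j x : 0 <= av (d j / 2) (Z j) x by exact: av_ge0.
have bg2 i : bl (fun x => g i x ^+ 2) by exact: bl_exp.
have bG : bl G by exact: bl_sum.
have G0 x : 0 <= G x by apply: sumr_ge0 => i _; exact: sqr_ge0.
have bGq : bl (fun x => G x `^ q) by exact: bl_powR0.
have bvr j : bl (fun x => `|v j x| `^ r) by exact: bl_powR.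
set X := Int (fun x => `|\sum_(i < I) cv (dil (a0 * 2 ^+ i) z) (g i) x| `^ r).
have XE : X = Int (fun x => `|v 0%N x| `^ r) by [].
have X0 : 0 <= X by apply: Int_ge0 => x; exact: powR_ge0.
set W := Int (fun x => _ `^ (r / 2)).
have WE : W = Int (fun x => G x `^ q) by [].
have W0 : 0 <= W by apply: Int_ge0 => x; exact: powR_ge0.
(* After m averages the only uncontrolled term is the energy of v_m, shown further down to tend to
   0. *)
have stage m : X <= 2 * Int (fun x => `|v m x| `^ r) + 2 * (B * (CY * K3)) * W.
  pose S x := \sum_(j < m) (Z j x + av (d j / 2) (Z j) x).
  have S0 x : 0 <= S x by apply: sumr_ge0 => j _; exact: addr_ge0.
  have bS : bl S by apply: bl_sum => j _; exact: bl_add.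
  have bSq : bl (fun x => S x `^ q) by exact: bl_powR0.
  pose sc i := d m.-1 * 2 ^+ i.
  have ssc : scales sc.
    split=> i; first by rewrite mulr_gt0.
    rewrite /sc ler_wpM2l ?(ltW (d_gt0 _))// exprS.
    by rewrite ler_peMl ?ler1n// ltW.
  pose F x := `|f x| + fmax sc f m x.
  have F0 x : 0 <= F x by rewrite addr_ge0// fmax_ge0.
  have bfm : bl (fmax sc f m) by exact: bl_fmax.
  have bnf : bl (fun x => `|f x|) by exact: bl_norm.
  have bF : bl F by exact: bl_add.
  have bFr : bl (fun x => F x `^ r) by exact: bl_powR0.
  have bF2 : bdm (fun x => F x `^ (r - 2)) by apply: bdm_powR => //; exact: bl_bdm.
  have bFS : bl (fun x => F x `^ (r - 2) * S x) by exact: bl_mulr.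
  have vF j x : (j < m)%N -> `|v j x| <= E * F x.
    by move=> jm; exact: (@chain_le_fmax R n A z gz I a0 g a00 bg m j x jm).
  have step1 : X - Int (fun x => `|v m x| `^ r) <= B * Int (fun x => F x `^ (r - 2) * S x).
    have -> : X - Int (fun x => `|v m x| `^ r) =
        \sum_(j < m) (Int (fun x => `|v j x| `^ r) - Int (fun x => `|v j.+1 x| `^ r)).
      by rewrite XE (sum_telescope (fun j => Int (fun x => `|v j x| `^ r))).
    have -> : B * Int (fun x => F x `^ (r - 2) * S x) =
       \sum_(j < m) r * (r - 1) * Int (fun x => E `^ (r - 2) * F x `^ (r - 2) *
          (K * (Z j x + av (d j / 2) (Z j) x))).
      have bj j : bl (fun x => F x `^ (r - 2) * (Z j x + av (d j / 2) (Z j) x)).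
        by apply: bl_mulr => //; exact: bl_add.
      have -> : Int (fun x => F x `^ (r - 2) * S x) =
          \sum_(j < m) Int (fun x => F x `^ (r - 2) * (Z j x + av (d j / 2) (Z j) x)).
        by rewrite -Int_sum//; apply: eq_Int => x; rewrite mulr_sumr.
      rewrite mulr_sumr; apply: eq_bigr => j _.
      rewrite (_ : B * _ = r * (r - 1) * (E `^ (r - 2) * K *
        Int (fun x => F x `^ (r - 2) * (Z j x + av (d j / 2) (Z j) x)))); last first.
        exact/esym/mulrA.
      congr (_ * _); rewrite -(IntZ _ (bj j)).
      apply: eq_Int => x; exact: mulrACA.
    apply: ler_sum => j _.
    apply: (le_trans (energy_decrement r2 (d_gt0 j) (bv j))).
    apply: ler_wpM2l; first exact: rr0.
    have bo : bl (osc2 (d j) (v j)) by exact: bl_osc2.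
    have bw : bdm (fun x => `|v j x| `^ (r - 2)).
      by apply: bdm_powR => //; apply: bdm_norm; exact: bl_bdm.
    apply: Int_le => [||x].
    - exact: bl_mulr.
    - apply: bl_mulr; first by apply: bdm_mul => //; exact: bdm_cst.
      by apply: bl_mulr; [exact: bdm_cst|exact: bl_add].
    apply: ler_pM; [exact: powR_ge0|exact: osc2_ge0| |].
    - rewrite -powRM//; apply: powR_le_mono => //; exact: vF.
    - exact: (@osc2_chain_le R n A z gz I a0 g a00 bg C1 j x C10 HC1).
  have step2 : Int (fun x => F x `^ (r - 2) * S x) <=
      (2 * (B + 1) * M1)^-1 * Int (fun x => F x `^ r) + CY * Int (fun x => S x `^ q).
    have b1 : bl (fun x => (2 * (B + 1) * M1)^-1 * F x `^ r).
      by apply: bl_mulr => //; exact: bdm_cst.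
    have b2 : bl (fun x => CY * S x `^ q) by apply: bl_mulr => //; exact: bdm_cst.
    rewrite -(IntZ _ bFr) -(IntZ _ bSq) -(Int_add b1 b2).
    by apply: Int_le => // [|x]; [exact: bl_add|exact: HY].
  have step3 : Int (fun x => F x `^ r) <= M1 * X.
    have b3 : bl (fun x => `|f x| `^ r) by exact: bl_powR.
    have b4 : bl (fun x => fmax sc f m x `^ r).
      by apply: bl_powR0 => // x; exact: fmax_ge0.
    apply: (@le_trans _ _ (Int (fun x => 2 `^ (r - 1) * (`|f x| `^ r + fmax sc f m x `^ r)))).
      apply: Int_le => // [|x].
        by apply: bl_mulr; [exact: bdm_cst|exact: bl_add].
      by apply: powR_add => //; exact: fmax_ge0.
    rewrite (IntZ _ (bl_add b3 b4)) (Int_add b3 b4) /M1 -mulrA mulrDl mul1r.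
    apply: ler_wpM2l; first exact: powR_ge0.
    apply: lerD; [exact: lexx|exact: HM].
  have step4 : Int (fun x => S x `^ q) <= K3 * W.
    have dhS k : d k.+1 / 2 <= d k / 2 by rewrite ler_pM2r ?invr_gt0.
    have h1 := HD m (fun j => d j / 2) Z d2 dhS bZ Z0.
    apply: (le_mul_step CD0 h1).
    (* A chain of length j > 0 is dominated by the average at d_(j-1). For j = 0 the chain is Y_0
       itself, and e_0 = d_0 merely keeps the sequence monotone. *)
    pose e j := d j.-1.
    have e_gt0 j : 0 < e j by exact: d_gt0.
    have eS j : e j.+1 <= e j by rewrite /e; case: j => //=.
    have bavY j : bl (av (e j) (Y j)) by exact: bl_av.
    have avY0 j x : 0 <= av (e j) (Y j) x by exact: av_ge0.
    have ZY j x : Z j x <= E * (Y j x + av (e j) (Y j) x).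
      rewrite /Z; case: j => [|j].
        rewrite /= -[leLHS]mul1r; apply: ler_pM => //; rewrite lerDl; exact: avY0.
      apply: (le_trans (chain_le_av d_gt0 dS j x (bY j.+1) (Y0 j.+1))).
      by rewrite ler_wpM2l// lerDr.
    pose U x := \sum_(j < m) (Y j x + av (e j) (Y j) x).
    have U0 x : 0 <= U x by apply: sumr_ge0 => j _; exact: addr_ge0.
    have bU : bl U by apply: bl_sum => j _; exact: bl_add.
    have bUq : bl (fun x => U x `^ q) by exact: bl_powR0.
    have bZs : bl (fun x => (\sum_(j < m) Z j x) `^ q).
      by apply: bl_powR0 => // [x|]; [exact: sumr_ge0|exact: bl_sum].
    apply: (le_mul_step (y := Int (fun x => U x `^ q)) (powR_ge0 _ _)).
      rewrite -(IntZ _ bUq); apply: Int_le => // [|x]; first by apply: bl_mulr => //; exact: bdm_cst.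
      rewrite -powRM//; apply: powR_le_mono => //; first exact: sumr_ge0.
      by rewrite mulr_sumr; apply: ler_sum => j _; exact: ZY.
    apply: (le_mul_step CD0 (HD m e Y e_gt0 eS bY Y0)).
    have bYs : bl (fun x => (\sum_(j < m) Y j x) `^ q).
      by apply: bl_powR0 => // [x|]; [exact: sumr_ge0|exact: bl_sum].
    pose V x := \sum_(i < I) avo (a i) (fun y => g i y ^+ 2) x.
    have bV : bl V by apply: bl_sum => i _; exact: bl_avo.
    have V0 x : 0 <= V x.
      by apply: sumr_ge0 => i _; apply: avo_ge0 => // y; exact: sqr_ge0.
    have bVq : bl (fun x => V x `^ q) by exact: bl_powR0.
    have bGV : bl (fun x => G x `^ q + oI `^ q * V x `^ q).
      by apply: bl_add => //; apply: bl_mulr => //; exact: bdm_cst.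
    have bc1 : bl (fun x => 2 `^ (q - 1) * (G x `^ q + oI `^ q * V x `^ q)).
      by apply: bl_mulr => //; exact: bdm_cst.
    have bc2 : bl (fun x => 2 `^ q * (2 `^ (q - 1) * (G x `^ q + oI `^ q * V x `^ q))).
      by apply: bl_mulr => //; exact: bdm_cst.
    apply: (le_mul_step (powR_ge0 _ _) (y := Int (fun x => 2 `^ q * (2 `^ (q - 1) *
        (G x `^ q + oI `^ q * V x `^ q))))).
      rewrite -(IntZ _ bc2); apply: Int_le => // [|x].
        by apply: bl_mulr; first exact: bdm_cst.
      have h2 := @sum_Y_le R n I a0 g m x.
      have h3 := @sum_L2_le R n I a0 g a00 bg x.
      apply: (@le_trans _ _ ((3 * (2 * (G x + oI * V x))) `^ q)).
        apply: powR_le_mono => //; first exact: sumr_ge0.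
        by apply: (le_trans h2); rewrite ler_wpM2l.
      have GV0 : 0 <= G x + oI * V x by rewrite addr_ge0// mulr_ge0.
      rewrite !powRM// ?mulr_ge0//.
      apply: ler_wpM2l; first exact: powR_ge0.
      apply: ler_wpM2l; first exact: powR_ge0.
      rewrite -powRM//; apply: powR_add => //; exact: mulr_ge0.
    rewrite (IntZ _ bc1) (IntZ _ bGV).
    apply: (le_mul_step (powR_ge0 _ _) (lexx _)).
    apply: (le_mul_step (powR_ge0 _ _) (lexx _)).
    have bVq' : bl (fun x => oI `^ q * V x `^ q) by apply: bl_mulr => //; exact: bdm_cst.
    rewrite (Int_add bGq bVq') (IntZ _ bVq) mulrDl mul1r WE; apply: lerD; first exact: lexx.
    apply: (le_mul_step (powR_ge0 _ _) (lexx _)).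
    exact: (HO I a (fun i y => g i y ^+ 2) sa bg2 (fun i y => sqr_ge0 _)).
  exact: (stage_arith B0 M10 CY0 X0 step1 step2 step3 step4).
have [Mf fM] := bl_bound bf.
have bnf : bl (fun x => `|f x|) by exact: bl_norm.
have If0 : 0 <= Int (fun x => `|f x|) by apply: Int_ge0.
(* An average at d_m is at most d_m^n ek(0) times the L^1 norm; since n >= 1 this decays at least
   like 2^-m. *)
pose Q := E * ((a0 * 2 ^+ I) ^+ n * (ek (0 : T) * Int (fun x => `|f x|))).
have Q0 : 0 <= Q.
  apply: mulr_ge0 => //; apply: mulr_ge0.
    by apply: exprn_ge0; apply: mulr_ge0; exact: ltW.
  by apply: mulr_ge0 => //; exact: ek_ge0.
have vQ m x : `|v m.+1 x| <= Q / 2 ^+ m.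
  apply: (le_trans (chain_norm d_gt0 m.+1 x bf)).
  apply: (le_trans (chain_le_av d_gt0 dS m x bnf (fun y => normr_ge0 _))).
  rewrite /Q -mulrA; apply: ler_wpM2l => //.
  have be := @bl_ekd R n _ (d_gt0 m).
  apply: (@le_trans _ _ ((d m) ^+ n * (ek (0 : T) * Int (fun x => `|f x|)))).
    rewrite -IntZ// -IntZ; last by apply: bl_mulr => //; exact: bdm_cst.
    apply: Int_le => [||y]; first by apply: bl_cv_sect => //; exact: bl_bdm.
      apply: bl_mulr; first exact: bdm_cst.
      by apply: bl_mulr => //; exact: bdm_cst.
    rewrite /ekd /dil -mulrA; apply: ler_wpM2l; first exact/exprn_ge0/ltW.
    rewrite ler_wpM2r// ek0E ler_piMr ?ek_ge0//.
    by rewrite -expR0 ler_expR oppr_le0 l1_ge0.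
  have Y1 : 0 <= ek (0 : T) * Int (fun x => `|f x|) by rewrite mulr_ge0// ek_ge0.
  rewrite [leRHS]mulrAC ler_wpM2r// /d expr_div_n ler_wpM2l//.
    by rewrite exprn_ge0// mulr_ge0// ltW.
  rewrite lef_pV2 ?posrE ?exprn_gt0// -exprM.
  by rewrite ler_weXn2l//; [rewrite ler1n|rewrite leq_pmulr].
have vI m : Int (fun x => `|v m.+1 x| `^ r) <= Q `^ (r - 1) * Int (fun x => `|f x|) / 2 ^+ m.
  have r10 : 0 <= r - 1 by move: r2; clear; lra.
  have rp : 0 < r by move: r2; clear; lra.
  have h1 : Int (fun x => `|v m.+1 x|) <= Int (fun x => `|f x|).
    rewrite -[leRHS](Int_chain d_gt0 m.+1 bnf); apply: Int_le => [||x].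
    - exact: bl_norm.
    - exact: bl_chain.
    - exact: chain_norm.
  apply: (@le_trans _ _ ((Q `^ (r - 1) / 2 ^+ m) * Int (fun x => `|v m.+1 x|))).
    rewrite -IntZ; last exact: bl_norm.
    apply: Int_le => // [|x].
      by apply: bl_mulr; [exact: bdm_cst|exact: bl_norm].
    rewrite -(mulr_powRB1 (normr_ge0 _) rp) mulrC ler_wpM2r//.
    apply: (@le_trans _ _ ((Q / 2 ^+ m) `^ (r - 1))); first exact: powR_le_mono.
    rewrite powRM ?invr_ge0 ?(ltW (p2 m))// ler_wpM2l ?powR_ge0//.
    have t0 : 0 < (2 ^+ m)^-1 :> R by rewrite invr_gt0.
    have t1 : (2 ^+ m)^-1 <= 1 :> R by rewrite invf_le1// exprn_ege1// ler1n.
    have t01 : (0 < (2 ^+ m)^-1 :> R) && ((2 ^+ m)^-1 <= 1 :> R) by rewrite t0.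
    by apply: ge1r_powR => //; move: r2; clear; lra.
  rewrite mulrAC ler_wpM2r ?invr_ge0 ?(ltW (p2 m))//.
  by rewrite ler_wpM2l ?powR_ge0.
rewrite -[leRHS]mulr1.
apply: (@le_of_halving _ _ _ (2 * (Q `^ (r - 1) * Int (fun x => `|f x|)))).
  by rewrite mulr1 mulr_ge0// mulr_ge0// powR_ge0.
move=> t; rewrite mulr1 addrC; apply: (le_trans (stage t.+1)); apply: lerD => //.
by rewrite -mulrA ler_wpM2l.
Qed.

End square_function_theorem.

(** * Uniqueness of the Fourier transform *)

Section limits_of_cosines.
Context {R : realType}.

Lemma cvg_sinc (s : R) : k.+1%:R * sin (s / k.+1%:R) @[k --> \oo] --> s.
Proof.
have [->|s0] := eqVneq s 0.
  by under eq_fun do rewrite mul0r sin0 mulr0; exact: cvg_cst.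
have c0 : s / k.+1%:R @[k --> \oo] --> (0 : R).
  by rewrite -[0](mulr0 s); apply: cvgM; [exact: cvg_cst|exact: cvg_harmonic].
have [d e] := @is_derive_sin R 0.
have H : (fun h : R => h^-1 *: (sin (h *: (1:R) + 0) - sin 0)) @ 0^' --> (1 : R).
  by rewrite -[X in _ --> X]cos0 -e; move: d; rewrite /derivable /derive /=; exact: id.
have /cvgr_dnbhsP/(_ (fun k => s / k.+1%:R)) := H.
move=> /(_ (conj _ c0)) H1.
have {}H1 : (s / k.+1%:R)^-1 *: (sin ((s / k.+1%:R) *: (1:R) + 0) - sin 0)
    @[k --> \oo] --> (1 : R).
  by apply: H1 => k; rewrite mulf_neq0.
have -> : (fun k => k.+1%:R * sin (s / k.+1%:R)) = fun k =>
    s * ((s / k.+1%:R)^-1 *: (sin ((s / k.+1%:R) *: (1:R) + 0) - sin 0)).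
  apply/funext => k; rewrite sin0 subr0 addr0 -[_ *: 1]/(_ * 1) mulr1.
  by rewrite -[_ *: _]/(_ * _) invf_div mulrA mulrCA divff// mulr1.
by rewrite -[X in _ --> X]mulr1; apply: cvgM => //; exact: cvg_cst.
Qed.

Lemma expR_le_1B (a : R) : a < 1 -> expR (- (a / (1 - a))) <= 1 - a.
Proof.
move=> a1; have a0 : 0 < 1 - a by lra.
rewrite expRN -[leRHS]invrK lef_pV2 ?posrE ?expR_gt0 ?invr_gt0//.
apply: le_trans (expR_ge1Dx (a / (1 - a))).
by rewrite (_ : 1 + a / (1 - a) = (1 - a)^-1)//; field; lra.
Qed.

(** Writing the squared cosine as 1 - a, the power is squeezed by exp (-a / (1 - a)) <= 1 - a <= exp
    (-a), and a times the exponent tends to s^2. *)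
Lemma cvg_cos_gauss (s : R) :
  (cos (s / k.+1%:R) ^+ 2) ^+ (k.+1 ^ 2) @[k --> \oo] --> expR (- s ^+ 2).
Proof.
pose a k := sin (s / k.+1%:R) ^+ 2; pose b k := (k.+1%:R * sin (s / k.+1%:R)) ^+ 2.
have bE k : b k = (k.+1 ^ 2)%:R * a k by rewrite /b exprMn natrX.
have cb : b k @[k --> \oo] --> s ^+ 2.
  by rewrite expr2; under eq_fun do rewrite /b expr2; apply: cvgM; exact: cvg_sinc.
have ca : a k @[k --> \oo] --> (0 : R).
  have -> : a = fun k => b k * (k.+1%:R^-1 * k.+1%:R^-1).
    by apply/funext => k; rewrite bE natrX; field.
  rewrite -[X in _ --> X](mulr0 (s ^+ 2)); apply: cvgM => //.
  by rewrite -[X in _ --> X](mulr0 0); apply: cvgM; exact: cvg_harmonic.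
have a1 : \forall k \near \oo, a k < 1 by exact: cvgr_lt ca _ ltr01.
have a0 k : 0 <= a k by rewrite sqr_ge0.
apply: (@squeeze_cvgr _ _ _ _ (fun k => expR (- (b k / (1 - a k)))) (fun k => expR (- b k))).
- near=> k; have ak : a k < 1 by near: k.
  rewrite cos2sin2 -/(a k) bE; apply/andP; split.
    rewrite -mulrA -(mulrN _ (a k / (1 - a k))) expRM_natl; apply: lerXn2r; rewrite ?nnegrE ?expR_ge0//.
      by rewrite subr_ge0 ltW.
    exact: expR_le_1B.
  rewrite -(mulrN _ (a k)) expRM_natl; apply: lerXn2r; rewrite ?nnegrE ?expR_ge0//.
    by rewrite subr_ge0 ltW.
  exact: expR_ge1Dx.
- apply: continuous_cvg; first exact: continuous_expR.
  apply: cvgN; rewrite -[X in _ --> X]divr1; apply: cvgM => //.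
  apply: cvgV; first by rewrite oner_neq0.
  by rewrite -[X in _ --> X](subr0 1); apply: cvgB => //; exact: cvg_cst.
- apply: continuous_cvg; first exact: continuous_expR.
  exact: cvgN.
Unshelve. all: by end_near.
Qed.

End limits_of_cosines.

Section fourier_uniqueness.
Context {R : realType} {n : nat}.
Local Notation T := 'rV[R]_n.
Implicit Types (f g : T -> R) (x y xi : T).

(** For real f the Fourier transform is [fcos f - i fsin f]; the two parts are kept apart because
    [Int] is a real integral. *)
Definition fcos f xi : R := Int (fun x => f x * cos (dotp x xi)).
Definition fsin f xi : R := Int (fun x => f x * sin (dotp x xi)).
Definition fourier_null f := forall xi, fcos f xi = 0 /\ fsin f xi = 0.
(** Continuity along these particular sequences is all that dominated convergence needs here, and
    convolution preserves it easily. *)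
Definition radially_continuous f :=
  forall x y, f (x + k.+1%:R^-1 *: y) @[k --> \oo] --> f x.

Lemma mf_coord i : measurable_fun setT (fun x : T => x 0 i : R).
Proof. exact: measurable_rV_coord. Qed.

Lemma mf_cos f : measurable_fun setT f -> measurable_fun setT (fun x => cos (f x)).
Proof.
apply: measurableT_comp; apply: continuous_measurable_fun; exact: continuous_cos.
Qed.

Lemma mf_sin f : measurable_fun setT f -> measurable_fun setT (fun x => sin (f x)).
Proof.
apply: measurableT_comp; apply: continuous_measurable_fun; exact: continuous_sin.
Qed.

Lemma mf_dotp xi : measurable_fun setT (fun x : T => dotp x xi).
Proof.
by apply: mf_sum => i _; apply: mf_mul; [exact: mf_coord|exact: mf_cst].
Qed.

Lemma bdm_cos f : measurable_fun setT f -> bdm (fun x => cos (f x)).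
Proof. by move=> mf; apply: (bdmI (M := 1)) => [|x]; [exact: mf_cos|exact: cos_max]. Qed.

Lemma sin_max (t : R) : `|sin t| <= 1.
Proof. by rewrite ler_norml sin_geN1 sin_le1. Qed.

Lemma bdm_sin f : measurable_fun setT f -> bdm (fun x => sin (f x)).
Proof. by move=> mf; apply: (bdmI (M := 1)) => [|x]; [exact: mf_sin|exact: sin_max]. Qed.

Lemma bl_fcos f xi : bl f -> bl (fun x => f x * cos (dotp x xi)).
Proof. by move=> bf; apply: bl_mull => //; apply: bdm_cos; exact: mf_dotp. Qed.

Lemma bl_fsin f xi : bl f -> bl (fun x => f x * sin (dotp x xi)).
Proof. by move=> bf; apply: bl_mull => //; apply: bdm_sin; exact: mf_dotp. Qed.

Lemma bdm_cos_coord i (c : R) : bdm (fun x : T => cos (c * x 0 i)).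
Proof.
by apply: bdm_cos; apply: mf_mul; [exact: mf_cst|exact: mf_coord].
Qed.

Lemma dotp_addl x y xi : dotp (x + y) xi = dotp x xi + dotp y xi.
Proof.
by rewrite /dotp -big_split /=; apply: eq_bigr => i _; rewrite mxE mulrDl.
Qed.

Lemma dotpC x y : dotp x y = dotp y x.
Proof. by rewrite /dotp; apply: eq_bigr => i _; rewrite mulrC. Qed.

Lemma dotpZl (a : R) x y : dotp (a *: x) y = a * dotp x y.
Proof. by rewrite /dotp mulr_sumr; apply: eq_bigr => i _; rewrite mxE mulrA. Qed.

Lemma dotpNl x y : dotp (- x) y = - dotp x y.
Proof. by rewrite -scaleN1r dotpZl mulN1r. Qed.

Lemma dotp_delta x (c : R) i : dotp x (c *: delta_mx 0 i) = c * x 0 i.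
Proof.
rewrite dotpC dotpZl /dotp (bigD1 i)//= mxE !eqxx mul1r big1 ?addr0// => j ji.
by rewrite mxE (negbTE ji) andbF mul0r.
Qed.

(** Multiplication by a cosine averages the transform over two shifted frequencies. *)
Lemma null_mul_cos f i c : bl f -> fourier_null f ->
  fourier_null (fun x => f x * cos (c * x 0 i)).
Proof.
move=> bf nf xi; pose u : T := c *: delta_mx 0 i.
have [c1 s1] := nf (xi + u); have [c2 s2] := nf (xi - u).
have e x : dotp x (xi + u) = dotp x xi + c * x 0 i.
  by rewrite dotpC dotp_addl -!(dotpC x) dotp_delta.
have e' x : dotp x (xi - u) = dotp x xi - c * x 0 i.
  by rewrite dotpC dotp_addl dotpNl -!(dotpC x) dotp_delta.
split.
  have -> : fcos (fun x => f x * cos (c * x 0 i)) xi =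
      2^-1 * (fcos f (xi + u) + fcos f (xi - u)).
    rewrite -Int_add; [|exact: bl_fcos|exact: bl_fcos].
    rewrite -IntZ; last by apply: bl_add; exact: bl_fcos.
    by apply: eq_Int => x; rewrite e e' cosD cosB; field.
  by rewrite c1 c2 addr0 mulr0.
have -> : fsin (fun x => f x * cos (c * x 0 i)) xi =
    2^-1 * (fsin f (xi + u) + fsin f (xi - u)).
  rewrite -Int_add; [|exact: bl_fsin|exact: bl_fsin].
  rewrite -IntZ; last by apply: bl_add; exact: bl_fsin.
  by apply: eq_Int => x; rewrite e e' sinD sinB; field.
by rewrite s1 s2 addr0 mulr0.
Qed.

Lemma null_mul_cosX f i c m : bl f -> fourier_null f ->
  bl (fun x => f x * cos (c * x 0 i) ^+ m) /\
  fourier_null (fun x => f x * cos (c * x 0 i) ^+ m).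
Proof.
move=> bf nf; elim: m => [|m [b IH]].
  have -> : (fun x => f x * cos (c * x 0 i) ^+ 0) = f.
    by apply/funext => x; rewrite expr0 mulr1.
  by [].
have -> : (fun x => f x * cos (c * x 0 i) ^+ m.+1) =
    fun x => (fun x => f x * cos (c * x 0 i) ^+ m) x * cos (c * x 0 i).
  by apply/funext => x; rewrite exprSr mulrA.
split; last exact: null_mul_cos.
by apply: bl_mull => //; exact: bdm_cos_coord.
Qed.

Lemma null_mul_prod_cos f (s : seq 'I_n) c m : bl f -> fourier_null f ->
  bl (fun x => f x * \prod_(i <- s) cos (c * x 0 i) ^+ m) /\
  fourier_null (fun x => f x * \prod_(i <- s) cos (c * x 0 i) ^+ m).
Proof.
move=> bf nf; elim: s => [|i s [b IH]].
  have -> : (fun x => f x * \prod_(i <- [::]) cos (c * x 0 i) ^+ m) = f.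
    by apply/funext => x; rewrite big_nil mulr1.
  by [].
have -> : (fun x => f x * \prod_(j <- i :: s) cos (c * x 0 j) ^+ m) =
    fun x => (fun x => f x * \prod_(j <- s) cos (c * x 0 j) ^+ m) x * cos (c * x 0 i) ^+ m.
  by apply/funext => x; rewrite big_cons mulrCA mulrC.
exact: null_mul_cosX.
Qed.

Lemma null_Int f : fourier_null f -> Int f = 0.
Proof.
move=> nf; have [<- _] := nf 0; apply: eq_Int => x.
by rewrite dotpC -(scale0r (0 : T)) dotpZl mul0r cos0 mulr1.
Qed.

Definition gauss x : R := \prod_i expR (- (x 0 i) ^+ 2).

Lemma gauss_gt0 x : 0 < gauss x.
Proof. by apply: prodr_gt0 => i _; exact: expR_gt0. Qed.

Lemma mf_gauss : measurable_fun setT gauss.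
Proof.
apply: measurable_prod => i _; apply: mf_expR; apply: mf_opp; apply: mf_exp.
exact: mf_coord.
Qed.

Lemma bl_gauss : bl gauss.
Proof.
apply: (@bl_dom _ _ _ (fun x => expR 1 ^+ n * expR (- l1 x))) => [||x].
- exact: mf_gauss.
- by apply: bl_mulr; [exact: bdm_cst|exact: bl_exp_l1].
rewrite ger0_norm ?(ltW (gauss_gt0 _))// /gauss /l1 -sumrN.
rewrite expR_sum -[X in expR 1 ^+ X]card_ord -prodr_const -big_split /=.
apply: ler_prod => i _; rewrite expR_ge0 -expRD ler_expR /=.
rewrite -real_normK ?num_real//; nra.
Qed.

(** If the integral vanished, so would the integrals of ek min (1, k f), yet these tend to the mass
    1 of [ek]. *)
Lemma Int_gt0 f : bl f -> (forall x, 0 < f x) -> 0 < Int f.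
Proof.
move=> bf f0; rewrite lt_neqAle eq_sym Int_ge0 ?andbT; last by move=> x; exact: ltW.
apply/eqP => If; have e0 x : 0 <= @ek R n x by exact/ltW/ek_gt0.
have c : Int (fun x : T => ek x * Num.min 1 (k%:R * f x)) @[k --> \oo] --> Int (@ek R n).
  apply: (Int_cvg (h := ek)) => [k||k x|x].
  - apply: mf_mul; first exact: (bl_mf bl_ek).
    apply: measurable_minr; first exact: mf_cst.
    by apply: mf_mul; [exact: mf_cst|exact: bl_mf].
  - exact: bl_ek.
  - have m0 : 0 <= Num.min 1 (k%:R * f x) by rewrite le_min ler01 mulr_ge0// ltW.
    by rewrite (ger0_norm (mulr_ge0 (e0 x) m0)) (ler_piMr (e0 x))// ge_min lexx.
  - apply: cvg_near_cst; near=> k.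
    suff /min_idPl -> : 1 <= k%:R * f x by rewrite mulr1.
    rewrite -ler_pdivrMr//; near: k; exact: nbhs_infty_ger.
have [M eM] := bl_bound (@bl_ek R n).
have z k : Int (fun x : T => ek x * Num.min 1 (k%:R * f x)) = 0.
  apply/eqP; rewrite eq_le; apply/andP; split; last first.
    apply: Int_ge0 => x; rewrite (mulr_ge0 (e0 x))//.
    by rewrite le_min ler01 mulr_ge0// ltW.
  rewrite -(mulr0 (M * k%:R)) -If -(IntZ _ bf); apply: Int_le => [||x].
  - apply: (@bl_dom _ _ _ ek) => [||x]; last 2 first.
    + exact: bl_ek.
    + have m0 : 0 <= Num.min 1 (k%:R * f x) by rewrite le_min ler01 mulr_ge0// ltW.
      by rewrite (ger0_norm (mulr_ge0 (e0 x) m0)) (ler_piMr (e0 x))// ge_min lexx.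
    apply: mf_mul; first exact: (bl_mf bl_ek).
    apply: measurable_minr; first exact: mf_cst.
    by apply: mf_mul; [exact: mf_cst|exact: bl_mf].
  - by bls.
  - rewrite -[leRHS]mulrA; apply: (@le_trans _ _ (ek x * (k%:R * f x))).
      by rewrite (ler_wpM2l (e0 x))// ge_min lexx orbT.
    apply: ler_wpM2r; first by rewrite mulr_ge0// ltW.
    exact: le_trans (ler_norm _) (eM x).
move: c; under eq_fun do rewrite z; rewrite Int_ek => c.
have e : 1 = 0 :> R by have := cvg_unique _ c (cvg_cst (0 : R)) => ->.
by move/eqP : e; rewrite oner_eq0.
Unshelve. all: by end_near.
Qed.


Lemma cvg_bigprod (I : Type) (s : seq I) (u : nat -> I -> R) (l : I -> R) :
  (forall i, u k i @[k --> \oo] --> l i) ->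
  \prod_(i <- s) u k i @[k --> \oo] --> \prod_(i <- s) l i.
Proof.
move=> ul; elim: s => [|i s IH].
  by under eq_fun do rewrite big_nil; rewrite big_nil; exact: cvg_cst.
under eq_fun do rewrite big_cons; rewrite big_cons.
by apply: cvgM; [exact: ul|exact: IH].
Qed.

(* Powers of the cosines approximate a Gaussian, boundedly. *)
Lemma null_Int_gauss f t : bl f -> fourier_null f ->
  Int (fun x => f x * gauss (t *: x)) = 0.
Proof.
move=> bf nf.
pose w k x := \prod_i cos (t / k.+1%:R * x 0 i) ^+ (2 * k.+1 ^ 2).
have w1 k x : `|w k x| <= 1.
  rewrite normr_prod; apply: prodr_ile1 => i _ /=; rewrite normr_ge0/= normrX.
  by rewrite exprn_ile1// cos_max.
have c : Int (fun x => f x * w k x) @[k --> \oo] --> Int (fun x => f x * gauss (t *: x)).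
  apply: (Int_cvg (h := fun x => `|f x|)) => [k||k x|x].
  - by apply: bl_mf; have [] := null_mul_prod_cos (index_enum 'I_n) (t / k.+1%:R) (2 * k.+1 ^ 2) bf nf.
  - exact: bl_norm.
  - by rewrite normrM ler_piMr.
  - apply: cvgM; first exact: cvg_cst.
    apply: cvg_bigprod => i; rewrite mxE.
    have -> : (fun k => cos (t / k.+1%:R * x 0 i) ^+ (2 * k.+1 ^ 2)) =
        fun k => (cos (t * x 0 i / k.+1%:R) ^+ 2) ^+ (k.+1 ^ 2).
      by apply/funext => k; rewrite exprM mulrAC.
    exact: cvg_cos_gauss.
have z k : Int (fun x => f x * w k x) = 0.
  by apply: null_Int; have [] := null_mul_prod_cos (index_enum 'I_n) (t / k.+1%:R) (2 * k.+1 ^ 2) bf nf.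
move: c; under eq_fun do rewrite z.
by move=> c; have := cvg_unique _ c (cvg_cst (0 : R)) => ->.
Qed.

(** After rescaling, the vanishing integrals against ever narrower Gaussians are those of f (x /
    (k+1)) gauss x, which tend to f 0 times the positive mass of the Gaussian. *)
Lemma null_eq0 f : bl f -> radially_continuous f -> fourier_null f -> f 0 = 0.
Proof.
move=> bf cf nf; have [M fM] := bl_bound bf.
have c : Int (fun x => f (k.+1%:R^-1 *: x) * gauss x) @[k --> \oo] -->
    Int (fun x => f 0 * gauss x).
  apply: (Int_cvg (h := fun x => M * gauss x)) => [k||k x|x].
  - by apply: mf_mul; [apply: mf_scale; exact: bl_mf|exact: mf_gauss].
  - by apply: bl_mulr; [exact: bdm_cst|exact: bl_gauss].
  - by rewrite normrM (ger0_norm (ltW (gauss_gt0 x))) ler_wpM2r// ltW// gauss_gt0.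
  - apply: cvgM; last exact: cvg_cst.
    by have := cf 0 x; under eq_fun do rewrite add0r.
have z k : Int (fun x => f (k.+1%:R^-1 *: x) * gauss x) = 0.
  have k0 : k.+1%:R != 0 :> R by [].
  have bF : bl (fun x => f (k.+1%:R^-1 *: x) * gauss x).
    by apply: bl_mulr; [apply: bdm_scale; exact: bl_bdm|exact: bl_gauss].
  rewrite -(Int_scale k0 bF).
  under eq_Int do rewrite scalerA mulVf// scale1r.
  by rewrite null_Int_gauss// mulr0.
move: c; under eq_fun do rewrite z.
rewrite (IntZ _ bl_gauss) => c; have e : f 0 * Int gauss = 0 by have := cvg_unique _ c (cvg_cst (0 : R)) => ->.
move/eqP : e; rewrite mulf_eq0 (gt_eqF (Int_gt0 bl_gauss gauss_gt0)) orbF.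
by move/eqP.
Qed.

End fourier_uniqueness.

(** * Transforms of convolutions and dilations; the reproducing kernel *)

Section fourier_calculus.
Context {R : realType} {n : nat}.
Local Notation T := 'rV[R]_n.
Implicit Types (f g psi eta : T -> R) (x y xi : T) (a : R).

Lemma rc_sub f g : radially_continuous f -> radially_continuous g ->
  radially_continuous (fun x => f x - g x).
Proof. by move=> cf cg x y; apply: cvgB; [exact: cf|exact: cg]. Qed.

Lemma rc_dil f a : radially_continuous f -> radially_continuous (dil a f).
Proof.
move=> cf x y; apply: cvgM; first exact: cvg_cst.
have -> : (fun k => f (a *: (x + k.+1%:R^-1 *: y))) =
    fun k => f (a *: x + k.+1%:R^-1 *: (a *: y)).
  by apply/funext => k; rewrite scalerDr !scalerA mulrC.
exact: cf.
Qed.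

Lemma rc_cv f g : bl f -> bl g -> radially_continuous f -> radially_continuous (cv f g).
Proof.
move=> bf bg cf x y; have [M fM] := bl_bound bf.
apply: (Int_cvg (h := fun z => M * `|g z|)) => [k||k z|z].
- by apply: bl_mf; exact: bl_cv_sect (bl_bdm bg).
- by bls.
- by rewrite normrM ler_wpM2r.
- apply: cvgM; last exact: cvg_cst.
  have -> : (fun k => f (x + k.+1%:R^-1 *: y - z)) =
      fun k => f (x - z + k.+1%:R^-1 *: y).
    by apply/funext => k; rewrite addrAC.
  exact: cf.
Qed.

Lemma fcos_sub f g xi : bl f -> bl g ->
  fcos (fun x => f x - g x) xi = fcos f xi - fcos g xi.
Proof.
move=> bf bg; rewrite -Int_sub; [|exact: bl_fcos|exact: bl_fcos].
by apply: eq_Int => x; rewrite mulrBl.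
Qed.

Lemma fsin_sub f g xi : bl f -> bl g ->
  fsin (fun x => f x - g x) xi = fsin f xi - fsin g xi.
Proof.
move=> bf bg; rewrite -Int_sub; [|exact: bl_fsin|exact: bl_fsin].
by apply: eq_Int => x; rewrite mulrBl.
Qed.

Lemma dotp_scale x xi a : 0 < a -> dotp (a *: x) (a^-1 *: xi) = dotp x xi.
Proof. by move=> a0; rewrite dotpZl dotpC dotpZl dotpC mulrA divff ?gt_eqF// mul1r. Qed.

Lemma fcos_dil f a xi : 0 < a -> bl f -> fcos (dil a f) xi = fcos f (a^-1 *: xi).
Proof.
move=> a0 bf; rewrite /fcos -(Int_dil a0 (bl_fcos _ bf)).
by apply: eq_Int => x; rewrite /dil dotp_scale// mulrA.
Qed.

Lemma fsin_dil f a xi : 0 < a -> bl f -> fsin (dil a f) xi = fsin f (a^-1 *: xi).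
Proof.
move=> a0 bf; rewrite /fsin -(Int_dil a0 (bl_fsin _ bf)).
by apply: eq_Int => x; rewrite /dil dotp_scale// mulrA.
Qed.

Lemma fcos_addr f y xi : bl f ->
  Int (fun x => f x * cos (dotp (x + y) xi)) =
  fcos f xi * cos (dotp y xi) - fsin f xi * sin (dotp y xi).
Proof.
move=> bf; rewrite -(IntZr _ (bl_fcos _ bf)) -(IntZr _ (bl_fsin _ bf)) -Int_sub.
- by apply: eq_Int => x; rewrite dotp_addl cosD; ring.
- by apply: bl_mull; [exact: bl_fcos|exact: bdm_cst].
- by apply: bl_mull; [exact: bl_fsin|exact: bdm_cst].
Qed.

Lemma fsin_addr f y xi : bl f ->
  Int (fun x => f x * sin (dotp (x + y) xi)) =
  fsin f xi * cos (dotp y xi) + fcos f xi * sin (dotp y xi).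
Proof.
move=> bf; rewrite -(IntZr _ (bl_fcos _ bf)) -(IntZr _ (bl_fsin _ bf)) -Int_add.
- by apply: eq_Int => x; rewrite dotp_addl sinD; ring.
- by apply: bl_mull; [exact: bl_fsin|exact: bdm_cst].
- by apply: bl_mull; [exact: bl_fcos|exact: bdm_cst].
Qed.

Lemma Int_cv_mul f g w : bl f -> bl g -> bdm w ->
  Int (fun x => cv f g x * w x) = Int (fun y => g y * Int (fun x => f x * w (x + y))).
Proof.
move=> bf bg bw; have [_ <-] := Int_cvM bg bf bw.
by apply: eq_Int => x; rewrite cvC//; exact: bl_bdm.
Qed.

Lemma fcos_cv f g xi : bl f -> bl g ->
  fcos (cv f g) xi = fcos f xi * fcos g xi - fsin f xi * fsin g xi.
Proof.
move=> bf bg; rewrite [LHS]Int_cv_mul//; last by apply: bdm_cos; exact: mf_dotp.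
under eq_Int do rewrite fcos_addr//.
rewrite -(IntZ _ (bl_fcos _ bg)) -(IntZ _ (bl_fsin _ bg)) -Int_sub.
- by apply: eq_Int => x; ring.
- by apply: bl_mulr; [exact: bdm_cst|exact: bl_fcos].
- by apply: bl_mulr; [exact: bdm_cst|exact: bl_fsin].
Qed.

Lemma fsin_cv f g xi : bl f -> bl g ->
  fsin (cv f g) xi = fsin f xi * fcos g xi + fcos f xi * fsin g xi.
Proof.
move=> bf bg; rewrite [LHS]Int_cv_mul//; last by apply: bdm_sin; exact: mf_dotp.
under eq_Int do rewrite fsin_addr//.
rewrite -(IntZ _ (bl_fcos _ bg)) -(IntZ _ (bl_fsin _ bg)) -Int_add.
- by apply: eq_Int => x; ring.
- by apply: bl_mulr; [exact: bdm_cst|exact: bl_fcos].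
- by apply: bl_mulr; [exact: bdm_cst|exact: bl_fsin].
Qed.

(** Translating the difference by x moves the point of comparison to the origin, where [null_eq0]
    applies. *)
Lemma fourier_inj f g : bl f -> bl g -> radially_continuous f -> radially_continuous g ->
  fcos f =1 fcos g -> fsin f =1 fsin g -> f =1 g.
Proof.
move=> bf bg cf cg ec es x; apply/eqP; rewrite -subr_eq0; apply/eqP.
pose h y := f (y + x) - g (y + x).
have -> : f x - g x = h 0 by rewrite /h add0r.
have bh y : bl (fun z => f (z + y) - g (z + y)) by bls.
have bd : bl (fun z => f z - g z) by bls.
apply: null_eq0 => [||xi].
- exact: bh.
- move=> y z; have -> : (fun k => h (y + k.+1%:R^-1 *: z)) =
      fun k => f (y + x + k.+1%:R^-1 *: z) - g (y + x + k.+1%:R^-1 *: z).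
    by apply/funext => k; rewrite /h addrAC.
  exact: (@rc_sub f g).
- have e (w : R -> R) : measurable_fun setT (fun z => w (dotp z xi)) -> bdm (fun z => w (dotp z xi)) ->
     Int (fun z => h z * w (dotp z xi)) =
     Int (fun z => (f z - g z) * w (dotp (z - x) xi)).
    move=> mw bw; rewrite -[RHS](Int_addr x).
      by apply: eq_Int => z; rewrite addrK.
    apply: bl_mull => //; exact: (@bdm_subr _ _ (fun z => w (dotp z xi)) x).
  have mC := mf_cos (mf_dotp xi); have mS := mf_sin (mf_dotp xi).
  split.
    rewrite [LHS](e cos mC (bdm_cos (mf_dotp xi))) fcos_addr//.
    by rewrite fcos_sub// fsin_sub// ec es !subrr !mul0r subrr.
  rewrite [LHS](e sin mS (bdm_sin (mf_dotp xi))) fsin_addr//.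
  by rewrite fcos_sub// fsin_sub// ec es !subrr !mul0r addr0.
Qed.

Lemma enormZ a x : 0 <= a -> enorm (a *: x) = a * enorm x.
Proof.
move=> a0; rewrite /enorm dotpZl dotpC dotpZl mulrA -expr2 sqrtrM ?sqr_ge0//.
by rewrite sqrtr_sqr ger0_norm.
Qed.

(** The defining conditions on the transforms, restated for real functions; they are later met by
    the real parts of eta0 and eta. *)
Definition lp_symbols psi eta := [/\ bl psi /\ bl eta,
  radially_continuous psi /\ radially_continuous eta,
  forall xi, enorm xi <= 1 -> fcos psi xi = 1 /\ fsin psi xi = 0,
  forall xi, 2 <= enorm xi -> fcos psi xi = 0 /\ fsin psi xi = 0 &
  forall xi, fcos eta xi = fcos psi xi - fcos psi (2 *: xi) /\
             fsin eta xi = fsin psi xi - fsin psi (2 *: xi)].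

Variables psi eta : T -> R.
Hypothesis pe : lp_symbols psi eta.

Let bp : bl psi. Proof. by have [[]] := pe. Qed.
Let be : bl eta. Proof. by have [[]] := pe. Qed.
Let cp : radially_continuous psi. Proof. by have [_ []] := pe. Qed.
Let ce : radially_continuous eta. Proof. by have [_ []] := pe. Qed.
Let p1 xi : enorm xi <= 1 -> fcos psi xi = 1 /\ fsin psi xi = 0.
Proof. by have [_ _ H _ _] := pe; exact: H. Qed.
Let p0 xi : 2 <= enorm xi -> fcos psi xi = 0 /\ fsin psi xi = 0.
Proof. by have [_ _ _ H _] := pe; exact: H. Qed.
Let ep xi : fcos eta xi = fcos psi xi - fcos psi (2 *: xi) /\
             fsin eta xi = fsin psi xi - fsin psi (2 *: xi).
Proof. by have [_ _ _ _ H] := pe; exact: H. Qed.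

Lemma Int_lp_psi : Int psi = 1.
Proof.
have [<- _] : fcos psi 0 = 1 /\ fsin psi 0 = 0.
  by apply: p1; rewrite -(scale0r (0 : T)) enormZ// mul0r.
by apply: eq_Int => x; rewrite dotpC -(scale0r (0 : T)) dotpZl mul0r cos0 mulr1.
Qed.

Lemma lp_etaE x : eta x = psi x - dil 2^-1 psi x.
Proof.
have h0 : 0 < 2^-1 :> R by rewrite invr_gt0.
have bd := bl_dil h0 bp; have [bs cs] : bl (fun x => psi x - dil 2^-1 psi x) /\
   radially_continuous (fun x => psi x - dil 2^-1 psi x).
  by split; [bls|apply: rc_sub => //; exact: rc_dil].
apply: (fourier_inj be bs ce cs) => xi; have [e1 e2] := ep xi.
  by rewrite e1 fcos_sub// fcos_dil// invrK.
by rewrite e2 fsin_sub// fsin_dil// invrK.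
Qed.

Let eta_low xi : enorm xi <= 2^-1 -> fcos eta xi = 0 /\ fsin eta xi = 0.
Proof.
move=> x1; have [-> ->] := ep xi.
have [|-> ->] := p1 (_ : enorm xi <= 1); first lra.
by have [|-> ->] := p1 (_ : enorm (2 *: xi) <= 1); rewrite ?subrr// enormZ//; lra.
Qed.

Let eta_high xi : 2 <= enorm xi -> fcos eta xi = 0 /\ fsin eta xi = 0.
Proof.
move=> x1; have [-> ->] := ep xi.
have [-> ->] := p0 x1.
by have [|-> ->] := p0 (_ : 2 <= enorm (2 *: xi)); rewrite ?subrr// enormZ//; lra.
Qed.

(** Disjoint spectra: the transform of eta vanishes for |xi| <= 1/2, that of [dil c psi] for |xi| >=
    2 c. *)
Lemma lp_cv_low c x : 0 < c -> c <= 4^-1 -> cv eta (dil c psi) x = 0.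
Proof.
move=> c0 c4; have bd := bl_dil c0 bp.
have rz : radially_continuous (fun _ : T => 0 : R) by move=> u v; exact: cvg_cst.
have z : fcos (fun _ : T => 0 : R) =1 (fun=> 0) /\ fsin (fun _ : T => 0 : R) =1 (fun=> 0).
  by split=> xi; rewrite -[RHS](@Int0 R n); apply: eq_Int => u; rewrite mul0r.
have H xi : fcos (cv eta (dil c psi)) xi = 0 /\ fsin (cv eta (dil c psi)) xi = 0.
  rewrite fcos_cv// fsin_cv// fcos_dil// fsin_dil//.
  have [h|h] := leP (enorm xi) 2^-1.
    by have [-> ->] := eta_low h; rewrite !mul0r subrr addr0.
  have [|-> ->] := p0 (_ : 2 <= enorm (c^-1 *: xi)); last first.
    by rewrite !mulr0 subrr addr0.
  rewrite enormZ ?invr_ge0 ?(ltW c0)// mulrC ler_pdivlMr//; lra.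
apply: (@fourier_inj _ (fun=> 0)) => //; last 2 first.
- by move=> xi; rewrite (H xi).1 z.1.
- by move=> xi; rewrite (H xi).2 z.2.
- exact: bl_cv.
- exact: bl0.
- exact: rc_cv.
Qed.

(** The transform of [dil 2 psi] is 1 on |xi| <= 2, outside of which that of eta vanishes. *)
Lemma lp_cv_high x : cv eta (dil 2 psi) x = eta x.
Proof.
have t0 : 0 < 2 :> R by []; have bd := bl_dil t0 bp.
have H xi : fcos (cv eta (dil 2 psi)) xi = fcos eta xi /\
    fsin (cv eta (dil 2 psi)) xi = fsin eta xi.
  rewrite fcos_cv// fsin_cv// fcos_dil// fsin_dil//.
  have [h|h] := leP 2 (enorm xi).
    by have [-> ->] := eta_high h; rewrite !mul0r subrr addr0.
  have [|-> ->] := p1 (_ : enorm (2^-1 *: xi) <= 1); last first.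
    by rewrite !mulr1 !mulr0 subr0 addr0.
  by rewrite enormZ//; lra.
apply: fourier_inj => //; last 2 first.
- by move=> xi; rewrite (H xi).1.
- by move=> xi; rewrite (H xi).2.
- exact: bl_cv.
- exact: rc_cv.
Qed.

Lemma Int_lp_eta : Int eta = 0.
Proof.
have h0 : 0 < 2^-1 :> R by rewrite invr_gt0.
rewrite (eq_Int lp_etaE) Int_sub//; last exact: bl_dil.
by rewrite Int_dil// subrr.
Qed.

(** Two mollifiers of equal mass, one acting on eta as the identity and the other as zero; their
    difference has mean zero and still reproduces eta. *)
Definition zeta : T -> R := fun x => dil 2 psi x - dil 4^-1 psi x.

Lemma bl_zeta : bl zeta.
Proof.
by apply: bl_sub; apply: bl_dil => //; rewrite invr_gt0.
Qed.

Lemma Int_zeta : Int zeta = 0.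
Proof.
rewrite Int_sub; [|by apply: bl_dil|by apply: bl_dil; rewrite // invr_gt0].
by rewrite !Int_dil// ?invr_gt0// subrr.
Qed.

Lemma cv_zeta_eta x : cv zeta eta x = eta x.
Proof.
rewrite cvC ?bl_zeta//; [|exact: bl_zeta|exact: bl_bdm].
rewrite cvBr//; [|by apply: bl_bdm; apply: bl_dil|
  by apply: bl_bdm; apply: bl_dil; rewrite // invr_gt0].
by rewrite lp_cv_high lp_cv_low ?subr0// invr_gt0.
Qed.

End fourier_calculus.

(** * From Schwartz functions to quantitative decay and Lipschitz bounds *)

Section tame_functions.
Context {R : realType} {n : nat}.
Local Notation T := 'rV[R]_n.
Implicit Types (f g : T -> R) (x y v : T) (a : R).

(** Here v is the maximum of 1 and the |u_i|. It converts bounds on powers of single coordinates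
    into a bound on a power of 1 + |x|. *)
Lemma max_powers (I : Type) (s : seq I) (u : I -> R) k : exists2 v, 1 <= v &
  1 + \sum_(i <- s) `|u i| <= (size s).+1%:R * v /\
  v ^+ k <= 1 + \sum_(i <- s) `|u i| ^+ k.
Proof.
elim: s => [|i s [v v1 [h1 h2]]].
  by exists 1; rewrite // !big_nil !addr0 expr1n !mul1r.
have s0 : 0 <= \sum_(i <- s) `|u i| ^+ k by apply: sumr_ge0 => j _; rewrite exprn_ge0.
exists (Num.max v `|u i|); first by rewrite le_max v1.
rewrite !big_cons /=; split.
  have h3 : (size s).+1%:R * v <= (size s).+1%:R * Num.max v `|u i|.
    by rewrite ler_wpM2l// le_max lexx.
  have h4 : `|u i| <= Num.max v `|u i| by rewrite le_max lexx orbT.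
  rewrite -natr1 mulrDl mul1r; lra.
have u0 : 0 <= `|u i| ^+ k by rewrite exprn_ge0.
by case: (leP v `|u i|) => _; lra.
Qed.

Lemma l1_power_le x k :
  (1 + l1 x) ^+ k <= n.+1%:R ^+ k * (1 + \sum_i `|x 0 i| ^+ k).
Proof.
have [v v1 [h1 h2]] := max_powers (enum 'I_n) (fun i => x 0 i) k.
rewrite size_enum_ord big_enum in h1; rewrite big_enum in h2.
have l0 := l1_ge0 x.
apply: (@le_trans _ _ ((n.+1%:R * v) ^+ k)).
  by apply: lerXn2r; rewrite ?nnegrE//; [lra|rewrite mulr_ge0//; lra].
by rewrite exprMn ler_wpM2l// exprn_ge0.
Qed.

Lemma cvg_subseq_harmonic x y f : {for x, continuous f} ->
  f (x + k.+1%:R^-1 *: y) @[k --> \oo] --> f x.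
Proof.
move=> cf; apply: continuous_cvg => //.
rewrite -[X in _ --> X]addr0 -(scale0r y); apply: cvgD; first exact: cvg_cst.
by apply: cvgZr_tmp; exact: cvg_harmonic.
Qed.

Lemma derive_along f x v t : differentiable f (t *: v + x) ->
  is_derive t (1:R) (fun h => f (h *: v + x)) ('D_v f (t *: v + x)).
Proof.
move=> df; have d : derivable f (t *: v + x) v by exact: diff_derivable.
have E : (fun h : R => h^-1 *: (((fun h => f (h *: v + x)) \o shift t) (h *: (1:R)) - f (t *: v + x)))
   = (fun h => h^-1 *: ((f \o shift (t *: v + x)) (h *: v) - f (t *: v + x))).
  apply/funext => h; rewrite /= -[h *: (1:R)]/(h * 1) mulr1 scalerDl.
  by rewrite addrA.
by split; rewrite /derivable /derive E.
Qed.

Lemma derive_sum f x v : differentiable f x ->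
  'D_v f x = \sum_i v 0 i * 'D_(delta_mx 0 i) f x.
Proof.
move=> df; rewrite deriveE// {1}(row_sum_delta v) linear_sum.
by apply: eq_bigr => i _; rewrite linearZ /= deriveE.
Qed.

Lemma mean_value f x v : (forall z, differentiable f z) ->
  exists2 t, 0 <= t <= 1 &
  f (x + v) - f x = \sum_i v 0 i * 'D_(delta_mx 0 i) f (x + t *: v).
Proof.
move=> df; have D t : is_derive t (1:R) (fun h => f (h *: v + x)) ('D_v f (t *: v + x)).
  exact: derive_along.
have [|t] := @MVT_segment R _ _ 0 1 ler01 (fun t _ => D t).
  apply: continuous_subspaceT => t; apply: differentiable_continuous.
  by apply/derivable1_diffP; have [] := D t.
rewrite in_itv /= => t01; rewrite scale1r scale0r add0r subr0 mulr1 (addrC v) => ->.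
by exists t => //; rewrite derive_sum// (addrC x).
Qed.

(** What is kept of Schwartz regularity: stable under differences and dilations, and together with
    mean zero enough for [good_kernel]. *)
Definition tame f := continuous f /\ exists2 A, 0 <= A &
  forall x, `|f x| * (1 + l1 x) ^+ n.+2 <= A /\
  forall y, `|f (x - y) - f x| * (1 + l1 x) ^+ n.+1 <= A * (l1 y * (1 + l1 y) ^+ n.+1).

Lemma tame_sub f g : tame f -> tame g -> tame (fun x => f x - g x).
Proof.
move=> [cf [A A0 HA]] [cg [B B0 HB]]; split.
  by move=> x; apply: continuousB; [exact: cf|exact: cg].
exists (A + B); first exact: addr_ge0.
move=> x; have [a1 a2] := HA x; have [b1 b2] := HB x.
have p0 k : 0 <= (1 + l1 x) ^+ k by rewrite exprn_ge0// ltW// l1p_gt0.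
split=> [|y].
  apply: le_trans (lerD a1 b1); rewrite -mulrDl ler_wpM2r//.
  exact: ler_normB.
rewrite mulrDl; apply: le_trans (lerD (a2 y) (b2 y)); rewrite -mulrDl ler_wpM2r//.
by apply: le_trans (ler_normB _ _); rewrite le_eqVlt; apply/orP; left; apply/eqP; congr `|_|; ring.
Qed.

Lemma tame_dil f a : 0 < a -> tame f -> tame (dil a f).
Proof.
move=> a0 [cf [A A0 HA]]; split.
  move=> x; apply: (@continuousM _ _ (fun=> a ^+ n) (fun x => f (a *: x))); first exact: cst_continuous.
  apply: (@continuous_comp _ _ _ (fun x : T => a *: x) f); last exact: cf.
  exact: scaler_continuous.
pose K := 1 + a^-1; have K1 : 1 <= K by rewrite lerDl invr_ge0 ltW.
pose L := 1 + a; have L1 : 1 <= L by rewrite lerDl ltW.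
have K0 : 0 <= K by lra.
have L0 : 0 <= L by lra.
have an0 : 0 <= a ^+ n by rewrite exprn_ge0// ltW.
have h1 x k : (1 + l1 x) ^+ k <= K ^+ k * (1 + l1 (a *: x)) ^+ k.
  rewrite -exprMn; apply: lerXn2r; rewrite ?nnegrE ?mulr_ge0// ?(ltW (l1p_gt0 _))//.
  rewrite l1Z ?(ltW a0)// /K mulrDl mul1r mulrDr mulr1 mulKf ?gt_eqF//.
  have := l1_ge0 x; have : 0 <= a * l1 x by rewrite mulr_ge0 ?l1_ge0// ltW.
  have : 0 <= a^-1 by rewrite invr_ge0 ltW.
  lra.
have h2 y : l1 (a *: y) * (1 + l1 (a *: y)) ^+ n.+1 <=
    a * L ^+ n.+1 * (l1 y * (1 + l1 y) ^+ n.+1).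
  rewrite l1Z ?(ltW a0)// -!mulrA; apply: ler_wpM2l; first exact: ltW.
  rewrite [leRHS]mulrCA; apply: ler_wpM2l; first exact: l1_ge0.
  rewrite -exprMn; have y0 := l1_ge0 y.
  have ay : 0 <= a * l1 y by rewrite mulr_ge0// ltW.
  apply: lerXn2r; rewrite ?nnegrE; [lra|rewrite mulr_ge0//; lra|].
  by rewrite /L mulrDl mul1r mulrDr; nra.
exists (a ^+ n * K ^+ n.+2 * A + a ^+ n * K ^+ n.+1 * A * (a * L ^+ n.+1)).
  have K2 k : 0 <= K ^+ k by rewrite exprn_ge0.
  have L2 k : 0 <= L ^+ k by rewrite exprn_ge0.
  by apply: addr_ge0; repeat apply: mulr_ge0 => //; exact: ltW.
move=> x; have [H1 H2] := HA (a *: x); split=> [|y].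
  rewrite -[leLHS]addr0; apply: lerD; last by rewrite !mulr_ge0// ?exprn_ge0// ltW.
  rewrite /dil normrM ger0_norm// -[leLHS]mulrA -[leRHS]mulrA; apply: ler_wpM2l => //.
  apply: le_trans (ler_wpM2l _ (h1 x n.+2)) _; first exact: normr_ge0.
  by rewrite mulrCA; apply: ler_wpM2l => //; rewrite exprn_ge0.
rewrite -[leLHS]add0r [leRHS]mulrDl; apply: lerD.
  have y1 : 0 <= 1 + l1 y by rewrite ltW// l1p_gt0.
  have K2 : 0 <= K ^+ n.+2 by rewrite exprn_ge0.
  have y2 : 0 <= (1 + l1 y) ^+ n.+1 by rewrite exprn_ge0.
  exact: (mulr_ge0 (mulr_ge0 (mulr_ge0 an0 K2) A0) (mulr_ge0 (l1_ge0 y) y2)).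
have E (b c u v t : R) : b * c * u * v * t = b * (c * (u * (v * t))) by ring.
rewrite E /dil scalerBr -mulrBr normrM ger0_norm// -[leLHS]mulrA; apply: ler_wpM2l => //.
apply: le_trans (ler_wpM2l _ (h1 x n.+1)) _; first exact: normr_ge0.
rewrite mulrCA; apply: ler_wpM2l; first by rewrite exprn_ge0.
apply: le_trans (H2 (a *: y)) _; apply: ler_wpM2l => //.
Qed.

Lemma tame_mf f : tame f -> measurable_fun setT f.
Proof. by move=> [cf _]; exact: continuous_measurable_rV. Qed.

Lemma tame_rc f : tame f -> radially_continuous f.
Proof. by move=> [cf _] x y; apply: cvg_subseq_harmonic; exact: cf. Qed.

Lemma tame_bl f : tame f -> bl f.
Proof.
move=> tf; have [_ [A A0 HA]] := tf.
apply: (@bl_dom _ _ _ (fun x => A * om x)) => [||x].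
- exact: tame_mf.
- by apply: bl_mulr; [exact: bdm_cst|exact: bl_om].
have [+ _] := HA x; rewrite /om => h; rewrite ler_pdivlMr ?exprn_gt0 ?l1p_gt0//.
apply: le_trans h; apply: ler_wpM2l => //.
by rewrite [leRHS]exprSr ler_peMr ?l1p_ge1// exprn_ge0// ltW// l1p_gt0.
Qed.

Lemma tame_good_kernel f : tame f -> Int f = 0 -> exists A, good_kernel A f.
Proof.
move=> tf f0; have [_ [A A0 HA]] := tf; exists A; split=> //.
- exact: tame_bl.
- move=> x; have [+ _] := HA x.
  by rewrite /om ler_pdivlMr ?exprn_gt0 ?l1p_gt0// -mulrA -exprS.
- move=> x y; have [_ /(_ y)] := HA x.
  by rewrite /om ler_pdivlMr ?exprn_gt0 ?l1p_gt0.
Qed.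

End tame_functions.

Section schwartz_tame.
Context {R : realType} {n : nat}.
Local Notation T := 'rV[R]_n.
Local Notation normc := ComplexField.Normc.normc.
Implicit Types (f : T -> R[i]) (x y : T).

Lemma Re_le_normc (z : R[i]) : `|complex.Re z| <= normc z.
Proof. by case: z => a b /=; rewrite -sqrtr_sqr ler_wsqrtr// lerDl sqr_ge0. Qed.

Lemma Im_le_normc (z : R[i]) : `|complex.Im z| <= normc z.
Proof. by case: z => a b /=; rewrite -sqrtr_sqr ler_wsqrtr// lerDr sqr_ge0. Qed.

Lemma normc_ge0 (z : R[i]) : 0 <= normc z.
Proof. exact: le_trans (normr_ge0 _) (Re_le_normc z). Qed.

(** The monomials 1 and x_i^k suffice, by [l1_power_le]. *)
Lemma schwartz_decay f beta k : schwartz f -> exists2 A, 0 <= A &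
  forall x, normc (cpartials beta f x) * (1 + l1 x) ^+ k <= A.
Proof.
move=> [_ H]; have [M0 h0] := H (fun=> 0%N) beta.
have h i : exists M, forall x, `|x 0 i| ^+ k * normc (cpartials beta f x) <= M.
  have [M hM] := H (fun j => if j == i then k else 0%N) beta; exists M => x.
  have := hM x; rewrite /monomial (bigD1 i)//= eqxx big1 ?mulr1 ?normrX// => j ji.
  by rewrite (negbTE ji).
have {h} [M hM] : exists M : 'I_n -> R,
    forall i x, `|x 0 i| ^+ k * normc (cpartials beta f x) <= M i.
  by have [M hM] := choice h; exists M.
have E x : normc (cpartials beta f x) * (1 + l1 x) ^+ k <=
    n.+1%:R ^+ k * (M0 + \sum_i M i).
  apply: le_trans (ler_wpM2l (normc_ge0 _) (l1_power_le x k)) _.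
  rewrite mulrCA; apply: ler_wpM2l; first by rewrite exprn_ge0.
  rewrite mulrDr mulr1; apply: lerD.
    have := h0 x; rewrite /monomial big1 ?normr1 ?mul1r// => i _; exact: expr0.
  by rewrite mulr_sumr; apply: ler_sum => i _; rewrite mulrC.
exists (n.+1%:R ^+ k * (M0 + \sum_i M i)) => //.
by apply: le_trans (E 0); rewrite mulr_ge0 ?normc_ge0// exprn_ge0// ltW// l1p_gt0.
Qed.

(** Mean value theorem. The intermediate point z satisfies 1 + |x| <= (1 + |z|) (1 + |y|), which
    transfers the decay of the gradient from z to x. *)
Lemma tame_of_decay (g : T -> R) (A : R) (B : 'I_n -> R) :
  (forall x, differentiable g x) ->
  (forall x, `|g x| * (1 + l1 x) ^+ n.+2 <= A) ->
  (forall i x, `|'D_(delta_mx 0 i) g x| * (1 + l1 x) ^+ n.+1 <= B i) -> tame g.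
Proof.
move=> dg hA hB; split=> [x|]; first exact: differentiable_continuous.
have A0 : 0 <= A.
  by apply: le_trans (hA 0); rewrite mulr_ge0// exprn_ge0// ltW// l1p_gt0.
have B0 i : 0 <= B i.
  by apply: le_trans (hB i 0); rewrite mulr_ge0// exprn_ge0// ltW// l1p_gt0.
have BS i : B i <= \sum_i B i by rewrite (bigD1 i)//= lerDl sumr_ge0.
have S0 : 0 <= \sum_i B i by rewrite sumr_ge0.
exists (A + \sum_i B i) => [|x]; first by rewrite addr_ge0.
split=> [|y]; first by apply: le_trans (hA x) _; rewrite lerDl.
have [t /andP[t0 t1] ->] := mean_value x (- y) dg.
set z := x + t *: - y.
apply: (@le_trans _ _ ((\sum_i `|y 0 i| * `|'D_(delta_mx 0 i) g z|) * (1 + l1 x) ^+ n.+1)).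
  apply: ler_wpM2r; first by rewrite exprn_ge0// ltW// l1p_gt0.
  apply: le_trans (ler_norm_sum _ _ _) _; apply: ler_sum => i _.
  by rewrite mxE normrM normrN.
have hx : (1 + l1 x) ^+ n.+1 <= (1 + l1 z) ^+ n.+1 * (1 + l1 y) ^+ n.+1.
  have y0 := l1_ge0 y; have z0 := l1_ge0 z; have x0 := l1_ge0 x.
  rewrite -exprMn; apply: lerXn2r; rewrite ?nnegrE; [lra|by rewrite mulr_ge0//; lra|].
  have e : x = z + t *: y by rewrite /z scalerN subrK.
  have h := l1D z (t *: y); rewrite -e l1Z// in h.
  have h2 : t * l1 y <= l1 y by rewrite ler_piMl.
  have h3 : 0 <= l1 z * l1 y by rewrite mulr_ge0.
  rewrite mulrDl mul1r mulrDr mulr1; lra.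
apply: le_trans (ler_wpM2l _ hx) _.
  by apply: sumr_ge0 => i _; rewrite mulr_ge0.
rewrite !mulrA; apply: ler_wpM2r; first by rewrite exprn_ge0// ltW// l1p_gt0.
rewrite mulr_suml [leRHS]mulrC /l1 mulr_suml; apply: ler_sum => i _.
rewrite -mulrA; apply: ler_wpM2l => //; apply: le_trans (hB i z) _.
by apply: le_trans (BS i) _; rewrite lerDr.
Qed.

Lemma schwartz_tame_Re f : schwartz f -> tame (fun x => complex.Re (f x)).
Proof.
move=> sf; have [df _] := sf.
have [A _ hA] := schwartz_decay [::] n.+2 sf.
have h i : exists B, forall x, normc (cpartials [:: i] f x) * (1 + l1 x) ^+ n.+1 <= B.
  by have [B _ hB] := schwartz_decay [:: i] n.+1 sf; exists B.
have [B hB] := choice h.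
have l0 k x : 0 <= (1 + l1 x) ^+ k by rewrite exprn_ge0// ltW// l1p_gt0.
apply: (tame_of_decay (A := A) (B := B)) => [x|x|i x].
- by have [] := df [::] x.
- by apply: le_trans (hA x); apply: ler_wpM2r => //; exact: Re_le_normc.
- apply: le_trans (hB i x); apply: ler_wpM2r => //.
  exact: (Re_le_normc (cpartial i f x)).
Qed.

Lemma schwartz_tame_Im f : schwartz f -> tame (fun x => complex.Im (f x)).
Proof.
move=> sf; have [df _] := sf.
have [A _ hA] := schwartz_decay [::] n.+2 sf.
have h i : exists B, forall x, normc (cpartials [:: i] f x) * (1 + l1 x) ^+ n.+1 <= B.
  by have [B _ hB] := schwartz_decay [:: i] n.+1 sf; exists B.
have [B hB] := choice h.
have l0 k x : 0 <= (1 + l1 x) ^+ k by rewrite exprn_ge0// ltW// l1p_gt0.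
apply: (tame_of_decay (A := A) (B := B)) => [x|x|i x].
- by have [] := df [::] x.
- by apply: le_trans (hA x); apply: ler_wpM2r => //; exact: Im_le_normc.
- apply: le_trans (hB i x); apply: ler_wpM2r => //.
  exact: (Im_le_normc (cpartial i f x)).
Qed.

Lemma fourierE f xi : tame (fun x => complex.Re (f x)) -> tame (fun x => complex.Im (f x)) ->
  complex.Re (fourier f xi) =
    fcos (fun x => complex.Re (f x)) xi + fsin (fun x => complex.Im (f x)) xi /\
  complex.Im (fourier f xi) =
    fcos (fun x => complex.Im (f x)) xi - fsin (fun x => complex.Re (f x)) xi.
Proof.
move=> /tame_bl br /tame_bl bi; rewrite /fourier /cintegral /=.
rewrite -[X in X = _ /\ _]/(Int _) -[X in _ /\ X = _]/(Int _).
rewrite -(Int_add (bl_fcos _ br) (bl_fsin _ bi)) -(Int_sub (bl_fcos _ bi) (bl_fsin _ br)).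
split; apply: eq_Int => x; case: (f x) => a b /=; rewrite cosN sinN; ring.
Qed.

Lemma dotpNr x y : dotp x (- y) = - dotp x y.
Proof. by rewrite dotpC dotpNl dotpC. Qed.

Lemma fcosN (g : T -> R) xi : fcos g (- xi) = fcos g xi.
Proof. by apply: eq_Int => x; rewrite dotpNr cosN. Qed.

Lemma fsinN (g : T -> R) xi : bl g -> fsin g (- xi) = - fsin g xi.
Proof.
move=> bg; rewrite /fsin -(Int_opp (bl_fsin xi bg)).
by apply: eq_Int => x; rewrite dotpNr sinN mulrN.
Qed.

Lemma enormN x : enorm (- x) = enorm x.
Proof. by rewrite /enorm dotpNl dotpNr opprK. Qed.

(* Only the real part of eta0 matters: averaging its transform over xi and
   -xi isolates the transform of Re eta0. *)
Lemma fourier_parts f xi : schwartz f ->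
  fcos (fun x => complex.Re (f x)) xi =
    2^-1 * (complex.Re (fourier f xi) + complex.Re (fourier f (- xi))) /\
  fsin (fun x => complex.Re (f x)) xi =
    2^-1 * (complex.Im (fourier f (- xi)) - complex.Im (fourier f xi)).
Proof.
move=> sf; have tr := schwartz_tame_Re sf; have ti := schwartz_tame_Im sf.
have [r1 i1] := fourierE xi tr ti; have [r2 i2] := fourierE (- xi) tr ti.
rewrite r1 i1 r2 i2 !fcosN (fsinN _ (tame_bl tr)) (fsinN _ (tame_bl ti)).
by split; field.
Qed.

(** The witness is Re eta0. Decay of psi of every order is recorded separately: [tame] retains only
    order n + 2, while the estimate at a single scale takes order 2 n + 4. *)
Lemma littlewood_paley_symbols (eta : T -> R[i]) : littlewood_paley eta ->
  exists psi : T -> R, [/\ tame psi, tame (fun x => complex.Re (eta x)),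
    lp_symbols psi (fun x => complex.Re (eta x)) &
    forall k, exists A, forall x, `|psi x| * (1 + l1 x) ^+ k <= A].
Proof.
move=> [se eR _ [e0 [s0 h1 h0 he]]]; exists (fun x => complex.Re (e0 x)).
have te := schwartz_tame_Re se; have t0 := schwartz_tame_Re s0.
split=> //; last first.
  move=> k; have [A _ hA] := schwartz_decay [::] k s0; exists A => x.
  apply: le_trans (hA x); apply: ler_wpM2r; last exact: Re_le_normc.
  by rewrite exprn_ge0// ltW// l1p_gt0.
split; [by split; exact: tame_bl|by split; exact: tame_rc| | |].
- move=> xi h; have [-> ->] := fourier_parts xi s0.
  by rewrite !h1 ?enormN//= subrr mulr0; split=> //; field.
- move=> xi h; have [-> ->] := fourier_parts xi s0.
  by rewrite !h0 ?enormN//= subrr addr0 mulr0.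
- move=> xi; have [-> ->] := fourier_parts xi se.
  have [-> ->] := fourier_parts xi s0; have [-> ->] := fourier_parts (2 *: xi) s0.
  rewrite !he scalerN.
  case: (fourier e0 xi) (fourier e0 (- xi)) (fourier e0 (2 *: xi)) (fourier e0 (- (2 *: xi))) => a b [a1 b1] [a2 b2] [a3 b3] /=.
  by split; field.
Qed.

End schwartz_tame.

(** * Littlewood-Paley pieces and their sums *)

Section littlewood_paley_pieces.
Context {R : realType} {n : nat}.
Local Notation T := 'rV[R]_n.
Implicit Types (u : T -> R) (x y : T) (a : R).

Variables psi eta : T -> R.
Hypotheses (tpsi : tame psi) (teta : tame eta) (pe : lp_symbols psi eta).

Let bp : bl psi. Proof. exact: tame_bl. Qed.
Let be : bl eta. Proof. exact: tame_bl. Qed.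

(** At a = 2^j this is Delta_j; a real parameter lets a finite family of pieces start at any a0. *)
Definition lpd a u : T -> R := cv (dil a eta) u.

Lemma bl_lpd a u : 0 < a -> bl u -> bl (lpd a u).
Proof. by move=> a0 bu; apply: bl_cv => //; exact: bl_dil. Qed.

Lemma zeta_good_kernel : exists A, good_kernel A (zeta psi).
Proof.
apply: tame_good_kernel (Int_zeta pe).
by apply: tame_sub; apply: tame_dil => //; rewrite invr_gt0.
Qed.

Lemma eta_good_kernel : exists A, good_kernel A eta.
Proof. exact: tame_good_kernel teta (Int_lp_eta pe). Qed.

(** Presents a piece as a mean-zero convolution of itself, the form to which [square_function] and
    [kernel_diff] apply. *)
Lemma lpd_repr a u x : 0 < a -> bl u -> cv (dil a (zeta psi)) (lpd a u) x = lpd a u x.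
Proof.
move=> a0 bu; have bz := bl_zeta pe; have bd := bl_dil a0 be.
have bdz := bl_dil a0 bz.
rewrite (cvA x bdz bd bu); apply: eq_cvl => y.
by rewrite (cv_dil y a0 bz be) /dil (cv_zeta_eta pe).
Qed.

Lemma lpdE a u x : 0 < a -> bl u ->
  lpd a u x = cv (dil a psi) u x - cv (dil (a / 2) psi) u x.
Proof.
move=> a0 bu; have a20 : 0 < a / 2 by rewrite divr_gt0.
rewrite -(cvBl x (bl_dil a0 bp) (bl_dil a20 bp) (bl_bdm bu)).
by apply: eq_cvl => y; rewrite /dil (lp_etaE pe) mulrBr /dil exprMn mulrA scalerA (mulrC a 2^-1).
Qed.

Lemma lpd_sum I a u x : 0 < a -> bl u ->
  \sum_(i < I) lpd (a * 2 ^+ i) u x =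
  cv (dil (a * 2 ^+ I / 2) psi) u x - cv (dil (a / 2) psi) u x.
Proof.
move=> a0 bu; elim: I => [|I IH].
  by rewrite big_ord0 expr0 mulr1 subrr.
have aI : 0 < a * 2 ^+ I by rewrite mulr_gt0// exprn_gt0.
rewrite big_ord_recr /= IH (lpdE x aI bu) exprS.
have -> : a * (2 * 2 ^+ I) / 2 = a * 2 ^+ I by field.
by ring.
Qed.

Lemma cv_dil_cvg u x : bl u -> radially_continuous u ->
  cv (dil (2 ^+ k) psi) u x @[k --> \oo] --> u x.
Proof.
move=> bu cu; have [M uM] := bl_bound bu.
have -> : (fun k => cv (dil (2 ^+ k) psi) u x) =
    fun k => Int (fun y => u (x - (2 ^+ k)^-1 *: y) * psi y).
  apply/funext => k; have k0 : 0 < 2 ^+ k :> R by rewrite exprn_gt0.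
  have kn0 : 2 ^+ k != 0 :> R by rewrite gt_eqF.
  have bF : bl (fun y => u (x - (2 ^+ k)^-1 *: y) * psi y).
    apply: bl_mulr => //; apply: (@bdm_scale _ _ (fun y => u (x - y))).
    by bdms.
  rewrite -(Int_scale kn0 bF) gtr0_norm// (cvC x (bl_dil k0 bp) (bl_bdm bu)).
  rewrite -IntZ; last by apply: (bl_scale kn0 bF).
  apply: eq_Int => y; rewrite scalerA mulVf// scale1r /dil mulrCA; ring.
have -> : u x = Int (fun y => u x * psi y) by rewrite (IntZ _ bp) (Int_lp_psi pe) mulr1.
apply: (Int_cvg (h := fun y => M * `|psi y|)) => [k||k y|y].
- apply: mf_mul; last exact: bl_mf.
  by apply: (@mf_scale _ _ (fun y => u (x - y))); apply: mf_rsub; exact: bl_mf.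
- by bls.
- by rewrite normrM; apply: ler_wpM2r.
- apply: cvgM; last exact: cvg_cst.
  have H := cu x (- y).
  (* The numbers 2^-k form a subsequence of 1 / (k+1), along which radial continuity is
     available. *)
  have e : (fun k => (2 ^ k).-1) @ \oo --> \oo.
    apply/cvgnyPge => N; near=> k.
    rewrite -ltnS prednK ?expn_gt0//; apply: leq_ltn_trans (ltn_expl k _) => //.
    by near: k; exact: nbhs_infty_ge.
  have := cvg_comp _ _ e H.
  rewrite (_ : _ \o _ = fun k => u (x - (2 ^+ k)^-1 *: y))//.
  by apply/funext => k /=; rewrite prednK ?expn_gt0// natrX scalerN.
Unshelve. all: by end_near.
Qed.

Lemma cv_dil_cvg0 u x : (0 < n)%N -> bl u -> cv (dil (2 ^- k) psi) u x @[k --> \oo] --> (0 : R).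
Proof.
move=> n0 bu; have [M pM] := bl_bound bp; have bnu := bl_norm bu.
apply/norm_cvg0P.
have B k : 0 <= `|cv (dil (2 ^- k) psi) u x| <= geometric (M * Int (fun y => `|u y|)) 2^-1 k.
  rewrite normr_ge0 /=; have k0 : 0 < 2 ^- k :> R by rewrite invr_gt0 exprn_gt0.
  have k1 : (2 ^- k) ^+ n <= 2^-1 ^+ k :> R.
    rewrite [leRHS]exprVn -[leRHS]expr1 ler_wiXn2l ?(ltW k0)//.
    by rewrite invf_le1 ?exprn_gt0// exprn_ege1// ler1n.
  have M0 : 0 <= M by apply: le_trans (pM 0).
  rewrite mulrAC -(IntZ _ bnu).
  apply: le_trans (Int_norm (bl_cv_sect x (bl_dil k0 bp) (bl_bdm bu))) _.
  apply: Int_le => [||y].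
  - by apply: bl_norm; exact: (bl_cv_sect x (bl_dil k0 bp) (bl_bdm bu)).
  - by bls.
  rewrite normrM; apply: ler_wpM2r => //; rewrite /dil normrM.
  rewrite ger0_norm ?exprn_ge0 ?(ltW k0)// mulrC.
  by apply: ler_pM => //; rewrite exprn_ge0 ?(ltW k0).
apply: (@squeeze_cvgr _ _ _ _ (fun=> 0) (geometric (M * Int (fun y => `|u y|)) 2^-1)).
- exact: nearW.
- exact: cvg_cst.
- by apply: cvg_geometric; rewrite ger0_norm ?invr_ge0// invf_lt1// ltr1n.
Qed.

(** The 2 J + 1 pieces from 2^-J to 2^J telescope to two mollifications: the fine one tends to u,
    the coarse one to 0 because its kernel has sup norm of order 2^(-J n). *)
Lemma lpd_sum_cvg u x : (0 < n)%N -> bl u -> radially_continuous u ->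
  \sum_(i < J.*2.+1) lpd (2 ^- J * 2 ^+ i) u x @[J --> \oo] --> u x.
Proof.
move=> n0 bu cu; have -> : (fun J => \sum_(i < J.*2.+1) lpd (2 ^- J * 2 ^+ i) u x) =
    fun J => cv (dil (2 ^+ J) psi) u x - cv (dil (2 ^- J.+1) psi) u x.
  apply/funext => J; have a0 : 0 < 2 ^- J :> R by rewrite invr_gt0 exprn_gt0.
  rewrite (lpd_sum _ _ a0 bu).
  have -> : 2 ^- J * 2 ^+ J.*2.+1 / 2 = 2 ^+ J :> R.
    rewrite exprS -addnn exprD; field.
    by rewrite gt_eqF// exprn_gt0.
  by rewrite -invfM -exprSr.
rewrite -[X in _ --> X]subr0; apply: cvgB; first exact: cv_dil_cvg.
have := cv_dil_cvg0 x n0 bu.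
by rewrite -(@cvg_shiftS _ (fun k => cv (dil (2 ^- k) psi) u x)).
Qed.

End littlewood_paley_pieces.

(** * The integral of the weight |h|^(-n-2s) min (1, |h|^2) *)

Section gagliardo_weight.
Context {R : realType}.
Implicit Types (s t : R).

(** The chord of the convex function 4^-s over [0, 1], obtained from Bernoulli's inequality with
    exponent 1/s. *)
Lemma quarter_powR_le s : 0 < s -> s <= 1 -> 4^-1 `^ s <= 1 - 3 / 4 * s.
Proof.
move=> s0 s1; have s'1 : 1 <= s^-1 by rewrite invf_ge1.
have t0 : 0 <= 1 - 3 / 4 * s by lra.
have := bernoulli t0 s'1.
rewrite (_ : 1 + _ = 4^-1); last by field; lra.
move=> h; have e : 1 - 3 / 4 * s = ((1 - 3 / 4 * s) `^ s^-1) `^ s.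
  by rewrite -powRrM mulVf ?powRr1// gt_eqF.
by rewrite e; apply: powR_le_mono; [exact: ltW|rewrite invr_ge0|exact: h].
Qed.

Lemma geometric_sum_le (r : R) K : 0 <= r -> r < 1 -> \sum_(k < K) r ^+ k <= (1 - r)^-1.
Proof.
move=> r0 r1; have r10 : 0 < 1 - r by lra.
rewrite -[leRHS]mul1r ler_pdivlMr// mulrC -opprB mulNr -subrX1.
have : 0 <= r ^+ K by rewrite exprn_ge0.
lra.
Qed.

Lemma two_powR_X (k : nat) s : (2 ^+ k) `^ (- (2 * s)) = (4^-1 `^ s) ^+ k :> R.
Proof.
rewrite -powR_mulrn// -powRrM -(powR_mulrn k (powR_ge0 _ _)) -powRrM.
have -> : 4^-1 = 2 `^ (- 2) :> R by rewrite powRN powR_mulrn//; congr (_^-1); ring.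
by rewrite -powRrM; congr (_ `^ _); ring.
Qed.

Variable n : nat.

(** At t = 0 the weight is 0, since 0 to a nonzero power is 0 by convention. *)
Definition kapf s t : R := t `^ (- (n%:R + 2 * s)) * Num.min 1 (t ^+ 2).

Lemma kapf_ge0 s t : 0 <= kapf s t.
Proof. by rewrite mulr_ge0 ?powR_ge0// le_min ler01 sqr_ge0. Qed.

Lemma powRN_le (a b q : R) : 0 <= q -> 0 < a -> a <= b -> b `^ (- q) <= a `^ (- q).
Proof.
move=> q0 a0 ab; rewrite !powRN lef_pV2 ?posrE ?powR_gt0//; last exact: lt_le_trans ab.
by apply: powR_le_mono => //; exact: ltW.
Qed.

Lemma kapf_high s t k : 0 < s -> 2 ^+ k <= t ->
  kapf s t <= (4^-1 `^ s) ^+ k * (2 ^- k) ^+ n.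
Proof.
move=> s0 kt; have k1 : 1 <= 2 ^+ k :> R by rewrite exprn_ege1// ler1n.
have k0 : 0 < 2 ^+ k :> R by lra.
have e0 : 0 <= n%:R + 2 * s by rewrite addr_ge0// mulr_ge0// ltW.
have -> : kapf s t = t `^ (- (n%:R + 2 * s)).
  rewrite /kapf (_ : Num.min _ _ = 1) ?mulr1//; apply/min_idPl.
  by rewrite exprn_ege1//; lra.
apply: le_trans (powRN_le e0 k0 kt) _.
rewrite opprD powRD; last by rewrite (gt_eqF k0) implybT.
by rewrite two_powR_X powRN powR_mulrn ?(ltW k0)// mulrC exprVn.
Qed.

Lemma kapf_low s t k : s < 1 -> 0 < s -> 2 ^- k.+1 <= t -> t <= 2 ^- k ->
  kapf s t <= 2 ^+ n * ((4^-1 `^ (1 - s)) ^+ k * (2 ^+ k) ^+ n).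
Proof.
move=> s1 s0 kt tk; have k0 : 0 < 2 ^- k.+1 :> R by rewrite invr_gt0 exprn_gt0.
have t0 : 0 < t by exact: lt_le_trans kt.
have e0 : 0 <= n%:R + 2 * s by rewrite addr_ge0// mulr_ge0// ltW.
have -> : kapf s t <= 2 ^+ n * ((4^-1 `^ (1 - s)) ^+ k * (2 ^+ k) ^+ n) =
  (kapf s t <= (4^-1 `^ (1 - s)) ^+ k * (2 ^+ k.+1) ^+ n).
  by congr (_ <= _); rewrite exprS exprMn mulrCA.
apply: (@le_trans _ _ (t `^ (2 * (1 - s)) * t `^ (- n%:R))).
  rewrite /kapf; apply: (@le_trans _ _ (t `^ (- (n%:R + 2 * s)) * t ^+ 2)).
    by rewrite ler_wpM2l ?powR_ge0// ge_min lexx orbT.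
  rewrite -(powR_mulrn 2 (ltW t0)) -!powRD ?(gt_eqF t0) ?implybT//.
  by rewrite le_eqVlt; apply/orP; left; apply/eqP; congr (_ `^ _); ring.
apply: ler_pM; rewrite ?powR_ge0//.
  have e : 0 <= 2 * (1 - s) by lra.
  apply: le_trans (powR_le_mono e (ltW t0) tk) _.
  by rewrite -[2 ^- k]powR_inv1 ?exprn_ge0// -powRrM mulN1r two_powR_X.
apply: le_trans (powRN_le (ler0n _ n) k0 kt) _.
by rewrite powRN powR_mulrn ?invrK ?(ltW k0)// exprVn invrK.
Qed.


Local Notation T := 'rV[R]_n.
Local Notation mu := (lebesgue_rV R n).

Lemma kapf0 s : 0 < s -> kapf s 0 = 0.
Proof.
by move=> s0; rewrite /kapf powR0 ?mul0r// oppr_eq0 gt_eqF// ltr_wpDl// mulr_gt0.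
Qed.

Lemma mf_kapf s : measurable_fun setT (fun h : T => kapf s (l1 h)).
Proof.
have ml := @mf_l1 R n; apply: mf_mul; first by apply: mf_powR.
by apply: measurable_minr; [exact: mf_cst|exact: mf_exp].
Qed.

Lemma ekd_shell a (x : T) : 0 < a -> a * l1 x <= 2 ->
  a ^+ n <= Int (fun x : T => expR (- l1 x)) * expR 2 * ekd a x.
Proof.
move=> a0 h; rewrite ekdE//; set Z := Int _.
have Z0 : 0 < Z by apply: Int_gt0 => [|z]; [exact: bl_exp_l1|exact: expR_gt0].
have -> : Z * expR 2 * (a ^+ n * (Z^-1 * expR (- (a * l1 x)))) =
    a ^+ n * expR (2 - a * l1 x).
  by rewrite (expRD 2) (mulrCA (Z * expR 2)) (mulrACA Z) divff ?gt_eqF// mul1r.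
rewrite -[leLHS]mulr1; apply: ler_wpM2l; first by rewrite exprn_ge0// ltW.
by rewrite -[leLHS]expR0 ler_expR; lra.
Qed.

(** In place of polar coordinates, each dyadic shell is covered by an exponential kernel of mass 1.
    The coefficients are the sizes of t^(-2s) min (1, t^2) at t = 2^k and t = 2^-k. *)
Definition kapsum s K : T -> R := fun x =>
  \sum_(k < K) ((4^-1 `^ s) ^+ k * ekd (2 ^- k) x + (4^-1 `^ (1 - s)) ^+ k * ekd (2 ^+ k) x).

Let c0 : R := 2 ^+ n * (Int (fun x : T => expR (- l1 x)) * expR 2).

Let c00 : 0 <= c0.
Proof.
rewrite mulr_ge0 ?exprn_ge0// mulr_ge0 ?expR_ge0//.
by apply: Int_ge0 => x; exact: expR_ge0.
Qed.

Lemma kapsum_mono s K K' x : (K <= K')%N -> kapsum s K x <= kapsum s K' x.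
Proof.
move=> /subnKC <-; rewrite /kapsum big_split_ord /= lerDl.
apply: sumr_ge0 => k _; rewrite addr_ge0// mulr_ge0 ?exprn_ge0 ?powR_ge0//.
  by rewrite ekd_ge0// invr_gt0 exprn_gt0.
by rewrite ekd_ge0// exprn_gt0.
Qed.

Lemma kapf_le_kapsum s (x : T) : 0 < s -> s < 1 -> exists K, kapf s (l1 x) <= c0 * kapsum s K x.
Proof.
move=> s0 s1.
have g0 k t : 0 <= (4^-1 `^ t) ^+ k :> R by rewrite exprn_ge0// powR_ge0.
have d0 k : 0 < 2 ^+ k :> R by rewrite exprn_gt0.
have d0' k : 0 < 2 ^- k :> R by rewrite invr_gt0.
have term K : forall k : 'I_K, 0 <= (4^-1 `^ s) ^+ k * ekd (2 ^- k) x + (4^-1 `^ (1 - s)) ^+ k * ekd (2 ^+ k) x.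
  by move=> k; rewrite addr_ge0// mulr_ge0// ekd_ge0.
have last K : (4^-1 `^ s) ^+ K * ekd (2 ^- K) x + (4^-1 `^ (1 - s)) ^+ K * ekd (2 ^+ K) x
    <= kapsum s K.+1 x.
  rewrite /kapsum big_ord_recr /= lerDr; apply: sumr_ge0 => k _; exact: term.
have twon : 1 <= 2 ^+ n :> R by rewrite exprn_ege1// ler1n.
have [z|x0] := eqVneq (l1 x) 0.
  by exists 0%N; rewrite z kapf0// /kapsum big_ord0 mulr0.
have {}x0 : 0 < l1 x by rewrite lt_neqAle eq_sym x0 l1_ge0.
have [x1|x1] := leP 1 (l1 x).
  have [k /andP[k1 k2]] := dyadic_level x1; exists k.+1.
  apply: le_trans (kapf_high s0 k1) _.
  apply: le_trans (ler_wpM2l c00 (last k)).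
  have h : 2 ^- k * l1 x <= 2 by rewrite mulrC ler_pdivrMr// -exprS ltW.
  have := ekd_shell (d0' k) h; set Z := Int _ * _ => H.
  apply: (@le_trans _ _ ((4^-1 `^ s) ^+ k * (Z * ekd (2 ^- k) x))); first exact: ler_wpM2l.
  have Z0 : 0 <= Z * ekd (2 ^- k) x by apply: le_trans H; rewrite exprn_ge0// ltW.
  have W0 : 0 <= Z by rewrite -(pmulr_lge0 _ (ekd_gt0 x (d0' k))).
  rewrite mulrDr -[leLHS]addr0; apply: lerD; last first.
    by apply: mulr_ge0 => //; rewrite mulr_ge0// ekd_ge0.
  have -> : c0 * ((4^-1 `^ s) ^+ k * ekd (2 ^- k) x) =
      2 ^+ n * ((4^-1 `^ s) ^+ k * (Z * ekd (2 ^- k) x)).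
    by rewrite /c0 -/Z -[LHS]mulrA (mulrCA Z).
  by apply: ler_peMl => //; rewrite mulr_ge0.
have y1 : 1 <= (l1 x)^-1 by rewrite invf_ge1// ltW.
have [k /andP[k1 k2]] := dyadic_level y1; exists k.+1.
have xk : l1 x <= 2 ^- k by rewrite -[l1 x]invrK lef_pV2 ?posrE ?invr_gt0.
have kx : 2 ^- k.+1 <= l1 x by rewrite -[l1 x]invrK lef_pV2 ?posrE ?invr_gt0// ltW.
apply: le_trans (kapf_low s1 s0 kx xk) _.
apply: le_trans (ler_wpM2l c00 (last k)).
have h : 2 ^+ k * l1 x <= 2.
  have : 2 ^+ k * l1 x <= 1 by rewrite mulrC -ler_pdivlMr// div1r.
  lra.
have := ekd_shell (d0 k) h; set Z := Int _ * _ => H.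
have W0 : 0 <= Z.
  by rewrite -(pmulr_lge0 _ (ekd_gt0 x (d0 k))); apply: le_trans H; rewrite exprn_ge0// ltW.
rewrite mulrDr -[leLHS]add0r; apply: lerD.
  by apply: mulr_ge0 => //; rewrite mulr_ge0// ekd_ge0.
rewrite /c0 -/Z -mulrA; apply: ler_wpM2l; first by rewrite exprn_ge0.
by rewrite mulrCA; apply: ler_wpM2l.
Qed.

Lemma bl_kapsum s K : bl (kapsum s K).
Proof.
apply: bl_sum => k _; apply: bl_add; apply: bl_mulr; do ?exact: bdm_cst.
  by apply: bl_ekd; rewrite invr_gt0 exprn_gt0.
by apply: bl_ekd; rewrite exprn_gt0.
Qed.

Lemma Int_kapsum s K : 0 < s -> s < 1 -> Int (kapsum s K) <= 2 * (s^-1 + (1 - s)^-1).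
Proof.
move=> s0 s1.
have b1 (k : nat) : bl (@ekd R n (2 ^- k)) by apply: bl_ekd; rewrite invr_gt0 exprn_gt0.
have b2 (k : nat) : bl (@ekd R n (2 ^+ k)) by apply: bl_ekd; rewrite exprn_gt0.
have -> : Int (kapsum s K) = \sum_(k < K) (4^-1 `^ s) ^+ k + \sum_(k < K) (4^-1 `^ (1 - s)) ^+ k.
  rewrite Int_sum => [|k _]; last by bls.
  rewrite -big_split; apply: eq_bigr => k _ /=.
  rewrite Int_add; [|by bls|by bls].
  rewrite (IntZ _ (b1 k)) (IntZ _ (b2 k)) !Int_ekd ?mulr1 ?invr_gt0 ?exprn_gt0//.
(* The ratio is at most 1 - 3t/4, so the series is at most 4 / (3t) <= 2 / t. *)
have q (t : R) : 0 < t -> t < 1 -> \sum_(k < K) (4^-1 `^ t) ^+ k <= 2 * t^-1.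
  move=> t0 t1; have h := quarter_powR_le t0 (ltW t1).
  apply: le_trans (geometric_sum_le _ (powR_ge0 _ _) _) _; first by lra.
  rewrite -[2]invrK -invfM lef_pV2 ?posrE; [lra|lra|by rewrite mulr_gt0].
by rewrite mulrDr; apply: lerD; apply: q; lra.
Qed.

Lemma kapf_integral : exists2 C, 0 <= C & forall s, 0 < s -> s < 1 ->
  (\int[mu]_h (kapf s (l1 h))%:E <= (C * (s^-1 + (1 - s)^-1))%:E)%E.
Proof.
exists (c0 * 2) => [|s s0 s1]; first by rewrite mulr_ge0.
have b K : bl (fun x => Num.min (kapf s (l1 x)) (c0 * kapsum s K x)).
  have bs := bl_kapsum s K.
  apply: (@bl_dom _ _ _ (fun x => c0 * kapsum s K x)) => [||x]; last first.
  - rewrite ger0_norm ?ge_min ?lexx ?orbT// le_min kapf_ge0 mulr_ge0//.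
    by apply: le_trans (kapsum_mono _ _ (leq0n K)); rewrite /kapsum big_ord0.
  - by bls.
  - apply: measurable_minr; first exact: mf_kapf.
    by apply: mf_mul; [exact: mf_cst|exact: bl_mf].
apply: (fatou_le (f_ := fun K x => Num.min (kapf s (l1 x)) (c0 * kapsum s K x))).
- by move=> K; exact: bl_mf.
- move=> K x; rewrite le_min kapf_ge0 mulr_ge0//.
  by apply: le_trans (kapsum_mono _ _ (leq0n K)); rewrite /kapsum big_ord0.
- move=> x; have [K0 H] := kapf_le_kapsum x s0 s1.
  apply: cvg_near_cst; near=> K; apply/min_idPl; apply: le_trans H _.
  apply: ler_wpM2l => //; apply: kapsum_mono.
  by near: K; exact: nbhs_infty_ge.
- move=> K; rewrite ge0_integral_bl// lee_fin -mulrA.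
  apply: le_trans (ler_wpM2l c00 (Int_kapsum K s0 s1)).
  rewrite -(IntZ _ (bl_kapsum s K)); apply: Int_le => // [|x].
    by have := bl_kapsum s K => ?; bls.
  by rewrite ge_min lexx orbT.
Unshelve. all: by end_near.
Qed.

(** The substitution h -> a h trades the frequency a for a^(2s), the weight of the Triebel-Lizorkin
    sum. *)
Lemma kapf_integral_scale s a : 0 < a ->
  (\int[mu]_h (l1 h `^ (- (n%:R + 2 * s)) * Num.min 1 ((a * l1 h) ^+ 2))%:E =
   (a `^ (2 * s))%:E * \int[mu]_h (kapf s (l1 h))%:E)%E.
Proof.
move=> a0; have an0 : a != 0 by rewrite gt_eqF.
have mk : measurable_fun setT (fun h : T => (kapf s (l1 h))%:E).
  by apply/measurable_EFinP; exact: mf_kapf.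
rewrite -(ge0_integral_affine 0 an0 mk); last by move=> h; rewrite lee_fin kapf_ge0.
rewrite muleA -EFinM -ge0_integralZl//; last 3 first.
- apply/measurable_EFinP; apply: (@mf_aff _ _ (fun h => kapf s (l1 h))); exact: mf_kapf.
- by move=> h _; rewrite lee_fin kapf_ge0.
- by rewrite lee_fin mulr_ge0 ?powR_ge0// exprn_ge0.
apply: eq_integral => h _; rewrite addr0 -EFinM l1Z ?(ltW a0)// /kapf; congr _%:E.
rewrite mulrA; congr (_ * _); rewrite gtr0_norm//.
rewrite powRM ?l1_ge0 ?(ltW a0)// mulrA -powR_mulrn ?(ltW a0)// -!powRD ?an0 ?implybT//.
by rewrite (_ : _ + _ + _ = 0) ?powRr0 ?mul1r//; ring.
Qed.

End gagliardo_weight.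

(** * Differences of Littlewood-Paley sums for p >= 2 *)

Section lp_differences.
Context {R : realType} {n : nat}.
Local Notation T := 'rV[R]_n.
Implicit Types (f g u : T -> R) (x y h : T) (a : R).

Variables psi eta : T -> R.
Hypotheses (tpsi : tame psi) (teta : tame eta) (pe : lp_symbols psi eta).
Hypothesis n0 : (0 < n)%N.

(** If a |h| > 1, then w = 1 and the triangle inequality suffices. Otherwise [lpd_repr] shows the
    piece to be smooth at length 1 / a, and [kernel_diff] gains the factor a |h|. *)
Lemma lp_difference_pointwise : exists2 K, 0 <= K & forall a u h x, 0 < a -> bl u ->
  let w := Num.min 1 ((a * l1 h) ^+ 2) in
  (lpd eta a u (x - h) - lpd eta a u x) ^+ 2 <=
  K * (w * lpd eta a u (x - h) ^+ 2 + w * lpd eta a u x ^+ 2 +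
       avo a (fun y => w * lpd eta a u y ^+ 2) x).
Proof.
have [A gz] := zeta_good_kernel tpsi pe.
have A0 := good_kernel_ge0 gz.
pose B := A * 2 ^+ n.+1; have B0 : 0 <= B by rewrite mulr_ge0// exprn_ge0.
have o0 := omI_ge0 (R := R) (n := n).
exists (2 + B ^+ 2 * omI (R := R) (n := n)) => [|a u h x a0 bu /=].
  by rewrite addr_ge0// mulr_ge0// sqr_ge0.
set w := Num.min _ _; set K := 2 + _; have bD := bl_lpd teta a0 bu; set D := lpd eta a u in bD *.
have w0 : 0 <= w by rewrite le_min ler01 sqr_ge0.
have BK : B ^+ 2 * omI (R := R) (n := n) <= K by rewrite lerDr.
have K2 : 2 <= K by rewrite lerDl mulr_ge0// sqr_ge0.
have s1 : 0 <= w * D (x - h) ^+ 2 by rewrite mulr_ge0// sqr_ge0.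
have s2 : 0 <= w * D x ^+ 2 by rewrite mulr_ge0// sqr_ge0.
have s3 : 0 <= avo a (fun y => w * D y ^+ 2) x.
  exact: (avo_ge0 x a0 (fun y => mulr_ge0 w0 (sqr_ge0 _))).
have [al|al] := leP (a * l1 h) 1; last first.
  have w1 : w = 1 by apply/min_idPl; rewrite exprn_ege1// ltW.
  move: s1 s2 s3; rewrite w1 !mul1r => s1 s2 s3; clear -K2 s1 s2 s3.
  apply: (@le_trans _ _ (2 * (D (x - h) ^+ 2 + D x ^+ 2))).
    by have := sqr_ge0 (D (x - h) + D x); nra.
  by apply: ler_pM => //; [exact: addr_ge0|rewrite lerDl].
have al0 : 0 <= a * l1 h by rewrite mulr_ge0 ?l1_ge0// ltW.
have wE : w = (a * l1 h) ^+ 2 by apply/min_idPr; rewrite exprn_ile1.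
have d : `|D (x - h) - D x| <= B * (a * l1 h) * avo a (fun y => `|D y|) x.
  have := kernel_diff gz x h a0 bD.
  rewrite !lpd_repr// => /le_trans; apply.
  apply: ler_wpM2r; first by apply: avo_ge0.
  rewrite /B -[leRHS]mulrA; apply: ler_wpM2l => //; rewrite mulrC; apply: ler_wpM2r => //.
  by apply: lerXn2r; rewrite ?nnegrE//; lra.
apply: (@le_trans _ _ ((B * (a * l1 h) * avo a (fun y => `|D y|) x) ^+ 2)).
  by rewrite -real_normK ?num_real//; apply: lerXn2r; rewrite ?nnegrE//; exact: le_trans d.
have nb := bl_norm bD.
have hs := avo_sqr x a0 (bl_bdm nb) (fun y => normr_ge0 (D y)).
rewrite exprMn [(B * _) ^+ 2]exprMn -wE.
have e : avo a (fun y => w * D y ^+ 2) x = w * avo a (fun y => `|D y| ^+ 2) x.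
  rewrite -cvZr; [|exact: bl_omd|by bdms].
  by apply: eq_cvr => y; rewrite real_normK ?num_real.
apply: (@le_trans _ _ (B ^+ 2 * omI (R := R) (n := n) * avo a (fun y => w * D y ^+ 2) x)).
  rewrite e -[leLHS]mulrA -[leRHS]mulrA; apply: ler_wpM2l; first exact: sqr_ge0.
  by rewrite [leRHS]mulrCA; apply: ler_wpM2l.
apply: ler_pM => //; first by rewrite mulr_ge0// sqr_ge0.
by rewrite lerDr addr_ge0.
Qed.

Lemma Int_translates (c : R) (h : T) f g : bl f -> bl g ->
  Int (fun x => c * (c * (f (x - h) + f x) + g x)) = c * (c * 2 * Int f + Int g).
Proof.
move=> bf bg; have bfh := bl_subr h bf.
rewrite IntZ; last by bls.
rewrite Int_add//; last by bls.
rewrite IntZ; last by bls.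
by rewrite Int_add// Int_subr// -mulrA mulr_natl.
Qed.

(** The square function estimate applied to the differenced pieces; the translates and averages in
    the pointwise bound are removed by translation invariance and [dual_doob_om]. *)
Theorem lp_difference (p : R) : 2 <= p -> exists2 C, 0 <= C &
  forall I a0 u h, 0 < a0 -> bl u ->
  Int (fun x => `|\sum_(i < I) (lpd eta (a0 * 2 ^+ i) u (x - h) - lpd eta (a0 * 2 ^+ i) u x)| `^ p)
  <= C * Int (fun x => (\sum_(i < I) Num.min 1 ((a0 * 2 ^+ i * l1 h) ^+ 2) *
      lpd eta (a0 * 2 ^+ i) u x ^+ 2) `^ (p / 2)).
Proof.
move=> p2; pose q := p / 2; have q1 : 1 <= q by rewrite /q; lra.
have q0 : 0 <= q by lra.
have [A gz] := zeta_good_kernel tpsi pe.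
have [C1 C10 H1] := square_function p2 n0 gz.
have [K K0 HK] := lp_difference_pointwise.
have [C2 C20 H2] := @dual_doob_om R n q q1.
pose c : R := 2 `^ (q - 1); have c0 : 0 <= c by exact: powR_ge0.
exists (C1 * (K `^ q * (c * (c * 2 + C2)))) => [|I a0 u h a00 bu].
  by rewrite !mulr_ge0 ?powR_ge0// addr_ge0 ?mulr_ge0.
pose a i := a0 * 2 ^+ i; have a_0 i : 0 < a i by rewrite mulr_gt0// exprn_gt0.
pose D i := lpd eta (a i) u; have bD i : bl (D i) by exact: bl_lpd.
pose g i x := D i (x - h) - D i x; have bg i : bl (g i) by apply: bl_sub; [apply: (bl_subr h); exact: bD|exact: bD].
pose w i := Num.min 1 ((a i * l1 h) ^+ 2).
have w0 i : 0 <= w i by rewrite le_min ler01 sqr_ge0.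
pose F i x := w i * D i x ^+ 2.
have F0 i x : 0 <= F i x by rewrite mulr_ge0// sqr_ge0.
have bF i : bl (F i) by apply: bl_mulr; [exact: bdm_cst|exact: bl_exp].
pose S x := \sum_(i < I) F i x; pose S3 x := \sum_(i < I) avo (a i) (F i) x.
have bS : bl S by apply: bl_sum => i _.
have S0 x : 0 <= S x by exact: sumr_ge0.
have bS3 : bl S3 by apply: bl_sum => i _; exact: bl_avo.
have S30 x : 0 <= S3 x by apply: sumr_ge0 => i _; exact: avo_ge0.
have sa : scales a.
  split=> // i; rewrite /a exprS mulrCA; apply: ler_peMl; first exact: ltW (a_0 i).
  by rewrite ler1n.
have E : Int (fun x => `|\sum_(i < I) (D i (x - h) - D i x)| `^ p) <=
    C1 * Int (fun x => (\sum_(i < I) g i x ^+ 2) `^ q).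
  apply: le_trans (H1 I a0 g a00 bg); rewrite le_eqVlt; apply/orP; left; apply/eqP.
  apply: eq_Int => x; congr (`|_| `^ _); apply: eq_bigr => i _.
  have bz := bl_dil (a_0 i) (bl_zeta pe); have bDi := bl_bdm (bD i).
  rewrite /g (cvBr x bz (bdm_subr h bDi) bDi) (cv_shiftr x h bz bDi).
  by rewrite !lpd_repr.
apply: le_trans E _; rewrite -mulrA; apply: ler_wpM2l => //.
have bSq : bl (fun x => S x `^ q) by exact: bl_powR0.
have bSqh : bl (fun x => S (x - h) `^ q) by exact: (bl_subr h bSq).
have bS3q : bl (fun x => S3 x `^ q) by exact: bl_powR0.
have pt x : (\sum_(i < I) g i x ^+ 2) `^ q <=
    K `^ q * (c * (c * (S (x - h) `^ q + S x `^ q) + S3 x `^ q)).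
  apply: (@le_trans _ _ ((K * (S (x - h) + S x + S3 x)) `^ q)).
    apply: powR_le_mono => //; first by apply: sumr_ge0 => i _; exact: sqr_ge0.
    rewrite /S /S3 -!big_split mulr_sumr; apply: ler_sum => i _; exact: HK.
  rewrite powRM ?addr_ge0//; apply: ler_wpM2l; first exact: powR_ge0.
  apply: le_trans (powR_add q1 (addr_ge0 (S0 _) (S0 _)) (S30 x)) _.
  apply: ler_wpM2l => //; apply: lerD => //.
  exact: powR_add.
have b1 := bl_add bSqh bSq.
have b2 : bl (fun x => c * (S (x - h) `^ q + S x `^ q)) by apply: bl_mulr => //; exact: bdm_cst.
have b3 := bl_add b2 bS3q.
have b4 : bl (fun x => c * (c * (S (x - h) `^ q + S x `^ q) + S3 x `^ q)).
  by apply: bl_mulr => //; exact: bdm_cst.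
have b5 : bl (fun x => K `^ q * (c * (c * (S (x - h) `^ q + S x `^ q) + S3 x `^ q))).
  by apply: bl_mulr => //; exact: bdm_cst.
have b6 : bl (fun x => (\sum_(i < I) g i x ^+ 2) `^ q).
  apply: bl_powR0 => // [x|]; first by apply: sumr_ge0 => i _; exact: sqr_ge0.
  by apply: bl_sum => i _; exact: bl_exp.
apply: le_trans (Int_le b6 b5 pt) _.
rewrite (IntZ _ b4) -[leRHS]mulrA; apply: ler_wpM2l; first exact: powR_ge0.
have /= -> := Int_translates c h bSq bS3q.
rewrite -[leRHS]mulrA; apply: ler_wpM2l; first exact: c0.
rewrite mulrDl.
by apply: lerD; [|exact: H2].
Qed.

End lp_differences.

(** * The upper bound for real functions, p >= 2 *)

Section liminf_bounds.
Context {R : realType} {n : nat}.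
Local Notation T := 'rV[R]_n.
Local Notation mu := (lebesgue_rV R n).

Lemma le_limn_einf (u v : nat -> \bar R) :
  (forall k, u k <= v k)%E -> (limn_einf u <= limn_einf v)%E.
Proof.
move=> uv; rewrite !limn_einf_lim; apply: lee_lim; [exact: is_cvg_einfs..|].
apply: nearW => k; apply: le_ereal_inf_tmp => _ [m /= km <-].
by apply: le_trans (uv m); apply: ereal_inf_lbound; exists m.
Qed.

Lemma limn_einf_le (u : nat -> \bar R) M : (forall k, u k <= M)%E -> (limn_einf u <= M)%E.
Proof.
move=> uM; rewrite limn_einf_lim; apply: lime_le; first exact: is_cvg_einfs.
apply: nearW => k; apply: le_trans (uM k).
by apply: ereal_inf_lbound; exists k => /=.
Qed.

Lemma integral_le_liminf (G : T -> \bar R) (B : nat -> T -> \bar R) M :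
  measurable_fun setT G -> (forall h, 0 <= G h)%E ->
  (forall k, measurable_fun setT (B k)) -> (forall k h, 0 <= B k h)%E ->
  (forall h, G h <= limn_einf (B^~ h))%E ->
  (forall k, \int[mu]_h B k h <= M)%E -> (\int[mu]_h G h <= M)%E.
Proof.
move=> mG G0 mB B0 GB BM.
apply: (@le_trans _ _ (\int[mu]_h limn_einf (B^~ h))%E).
  apply: ge0_le_integral => //.
  apply: measurableT_comp => //; apply: measurable_fun_limn_esup => k.
  exact: measurableT_comp (mB k).
apply: (@le_trans _ _ (limn_einf (fun k => \int[mu]_h B k h)%E)); first exact: fatou.
exact: limn_einf_le.
Qed.

Lemma bl_le_liminf (f_ : nat -> T -> R) (f : T -> R) : (forall k, bl (f_ k)) -> bl f ->
  (forall k x, 0 <= f_ k x) -> (forall x, f_ k x @[k --> \oo] --> f x) ->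
  ((Int f)%:E <= limn_einf (fun k => (Int (f_ k))%:E))%E.
Proof.
move=> bf_ bf f0 cf; rewrite -ge0_integral_bl//.
under [X in limn_einf X]eq_fun do rewrite -ge0_integral_bl//.
have -> : (\int[mu]_x (f x)%:E = \int[mu]_x limn_einf (fun k => (f_ k x)%:E))%E.
  apply: eq_integral => x _.
  have c : (f_ k x)%:E @[k --> \oo] --> (f x)%:E by apply/cvg_EFin; [exact: nearW|exact: cf].
  by rewrite (cvg_limn_einf_sup c).
apply: fatou => // k; first by apply/measurable_EFinP; exact: bl_mf.
by move=> x _; rewrite lee_fin.
Qed.

Lemma mf_Int_translate (u : T -> R) (p : R) : bl u -> 1 <= p ->
  measurable_fun setT (fun h : T => Int (fun x => `|u x - u (x - h)| `^ p)).
Proof.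
move=> bu p1; have mu' := bl_mf bu.
pose F (z : T * T) := (`|u z.2 - u (z.2 - z.1)| `^ p)%:E.
have mF : measurable_fun setT F.
  apply/measurable_EFinP; apply: mf_powR; apply: mf_norm; apply: mf_sub.
    exact: (mf_snd mu').
  have := @mf_sub2 _ _ (fun x => u (- x)) (mf_neg mu').
  by under eq_fun do rewrite opprB.
have := @measurable_fun_fubini_tonelli_F _ _ _ _ _ mu F mF.
move=> /(_ (fun z => _)) H.
rewrite (_ : (fun h => _) = fine \o fubini_F mu F); last first.
  apply/funext => h; rewrite /fubini_F /F /= ge0_integral_bl//.
  by apply: bl_powR => //; apply: bl_sub => //; exact: (bl_subr h bu).
apply: measurableT_comp => //; apply: H => z.
by rewrite lee_fin powR_ge0.
Qed.

End liminf_bounds.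

Section upper_bound.
Context {R : realType} {n : nat}.
Local Notation T := 'rV[R]_n.
Local Notation mu := (lebesgue_rV R n).
Implicit Types (u : T -> R) (x y h : T) (a s p : R).

(** The p-th power of a Gagliardo seminorm, with the l^1 norm and the variable h = x - y. *)
Definition gag s p u : \bar R :=
  (\int[mu]_h (l1 h `^ (- (n%:R + s * p)) * Int (fun x => `|u x - u (x - h)| `^ p))%:E)%E.

Lemma min_powR_le (y s : R) : 0 <= y -> 0 < s -> s < 1 -> Num.min 1 (y ^+ 2) <= y `^ (2 * s).
Proof.
move=> y0 s0 s1; have s20 : 0 <= 2 * s by lra.
have [y1|y1] := leP 1 y.
  apply: (@le_trans _ _ 1); first by rewrite ge_min lexx.
  have e : 1 `^ (2 * s) = 1 :> R by rewrite powR1.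
  by rewrite -[leLHS]e; apply: powR_le_mono.
apply: (@le_trans _ _ (y ^+ 2)); first by rewrite ge_min lexx orbT.
rewrite -powR_sqr//; have [->|yn0] := eqVneq y 0.
  by rewrite !powR0// gt_eqF//; lra.
have yp : 0 < y by rewrite lt_neqAle eq_sym yn0.
by apply: ger_powR; [rewrite yp ltW|lra].
Qed.

(** Of the q factors Y, all but one are traded for S, which does not involve h. The last one carries
    |h|^(-n-2s), so integration in h meets the exponent 2 whatever p is; this yields the factor in s
    with the right power. *)
Lemma weight_powR_le (q s t Y S : R) : 1 <= q -> 0 < s -> 0 < t -> 0 <= Y ->
  t `^ (- (2 * s)) * Y <= S ->
  t `^ (- (n%:R + s * (2 * q))) * Y `^ q <= t `^ (- (n%:R + 2 * s)) * (S `^ (q - 1) * Y).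
Proof.
move=> q1 s0 t0 Y0 YS; pose Z := t `^ (- (2 * s)) * Y.
have q10 : 0 <= q - 1 by lra.
have tn0 : t != 0 by rewrite gt_eqF.
have Z0 : 0 <= Z by rewrite mulr_ge0// powR_ge0.
have -> : t `^ (- (n%:R + s * (2 * q))) * Y `^ q = t `^ (- n%:R) * Z `^ q.
  rewrite /Z powRM ?powR_ge0// -powRrM [RHS]mulrA -powRD ?tn0 ?implybT//.
  by congr (_ `^ _ * _); ring.
have -> : t `^ (- (n%:R + 2 * s)) * (S `^ (q - 1) * Y) = t `^ (- n%:R) * (S `^ (q - 1) * Z).
  have -> : t `^ (- (n%:R + 2 * s)) = t `^ (- n%:R) * t `^ (- (2 * s)).
    by rewrite -powRD ?tn0 ?implybT// opprD.
  by rewrite /Z -[LHS]mulrA (mulrCA (S `^ _)).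
apply: ler_wpM2l; first exact: powR_ge0.
rewrite -(mulr_powRB1 Z0); last lra.
by rewrite mulrC; apply: ler_wpM2r => //; apply: powR_le_mono.
Qed.

Variables psi eta : T -> R.
Hypotheses (tpsi : tame psi) (teta : tame eta) (pe : lp_symbols psi eta).
Hypothesis n0 : (0 < n)%N.

(** The window j = -J, ..., J is indexed by i = j + J, keeping indices natural. *)
Definition dya (J i : nat) : R := 2 ^- J * 2 ^+ i.

Lemma dya_gt0 J i : 0 < dya J i.
Proof. by rewrite mulr_gt0 ?invr_gt0 ?exprn_gt0. Qed.

Definition sqf s J u x : R :=
  \sum_(i < J.*2.+1) dya J i `^ (2 * s) * lpd eta (dya J i) u x ^+ 2.

Lemma sqf_ge0 s J u x : 0 <= sqf s J u x.
Proof. by apply: sumr_ge0 => i _; rewrite mulr_ge0 ?powR_ge0// sqr_ge0. Qed.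

Lemma bl_sqf s J u : bl u -> bl (sqf s J u).
Proof.
move=> bu; apply: bl_sum => i _; apply: bl_mulr; first exact: bdm_cst.
by apply: bl_exp; apply: bl_lpd => //; exact: dya_gt0.
Qed.

Theorem gag_le p : 2 <= p -> exists2 C, 0 <= C & forall s u X, 0 < s -> s < 1 ->
  tame u -> (forall J, (Int (fun x => sqf s J u x `^ (p / 2)))%:E <= X)%E ->
  (gag s p u <= (C * (s^-1 + (1 - s)^-1))%:E * X)%E.
Proof.
move=> p2; have [C1 C10 H1] := lp_difference tpsi teta pe n0 p2.
have [C2 C20 H2] := @kapf_integral R n.
pose q := p / 2; have q1 : 1 <= q by rewrite /q; lra.
have q10 : 0 <= q - 1 by lra.
have pE : p = 2 * q by rewrite /q; field.
have p1 : 1 <= p by lra.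
exists (C1 * C2) => [|s u X s0 s1 tu HX]; first exact: mulr_ge0.
have bu := tame_bl tu; have cu := tame_rc tu.
pose D J i := lpd eta (dya J i) u; have bD J i : bl (D J i) by apply: bl_lpd => //; exact: dya_gt0.
pose S J := sqf s J u; have bS J : bl (S J) by exact: bl_sqf.
have S0 J x : 0 <= S J x by exact: sqf_ge0.
have bc J i : bl (fun x => S J x `^ (q - 1) * D J i x ^+ 2).
  by apply: bl_mulr; [apply: bdm_powR => //; exact: bl_bdm|exact: bl_exp].
pose c J i := Int (fun x => S J x `^ (q - 1) * D J i x ^+ 2).
have c0 J i : 0 <= c J i by apply: Int_ge0 => x; rewrite mulr_ge0 ?powR_ge0// sqr_ge0.
pose k J i h := l1 h `^ (- (n%:R + 2 * s)) * Num.min 1 ((dya J i * l1 h) ^+ 2).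
have k0 J i h : 0 <= k J i h by rewrite mulr_ge0 ?powR_ge0// le_min ler01 sqr_ge0.
have ml := @mf_l1 R n.
have mk J i : measurable_fun setT (k J i).
  apply: mf_mul; first exact: mf_powR.
  by apply: measurable_minr; [exact: mf_cst|apply: mf_exp; apply: mf_mul; [exact: mf_cst|exact: ml]].
(* A majorant linear in the weights k, so that it can be integrated in h term by term. *)
pose B J h := C1 * \sum_(i < J.*2.+1) c J i * k J i h.
pose f J x := \sum_(i < J.*2.+1) D J i x.
have bf J : bl (f J) by apply: bl_sum => i _; exact: bD.
pose W h := l1 h `^ (- (n%:R + s * p)).
have W0 h : 0 <= W h by exact: powR_ge0.
have B0 J h : 0 <= B J h.
  by apply: mulr_ge0 => //; apply: sumr_ge0 => i _; exact: mulr_ge0.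
have bdf J h : bl (fun x => `|f J x - f J (x - h)| `^ p).
  by apply: bl_powR => //; apply: bl_sub => //; exact: (bl_subr h (bf J)).
have claim1 J h : W h * Int (fun x => `|f J x - f J (x - h)| `^ p) <= B J h.
  have [h0|h0] := eqVneq (l1 h) 0.
    rewrite /W h0 powR0 ?mul0r// oppr_eq0 gt_eqF// ltr_wpDl// mulr_gt0//; lra.
  have {}h0 : 0 < l1 h by rewrite lt_neqAle eq_sym h0 l1_ge0.
  pose Y x := \sum_(i < J.*2.+1) Num.min 1 ((dya J i * l1 h) ^+ 2) * D J i x ^+ 2.
  have Y0 x : 0 <= Y x.
    by apply: sumr_ge0 => i _; rewrite mulr_ge0 ?sqr_ge0// le_min ler01 sqr_ge0.
  have bY : bl (fun x => Y x `^ q).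
    apply: bl_powR0 => //; apply: bl_sum => i _; apply: bl_mulr; first exact: bdm_cst.
    exact: bl_exp.
  have a0 : 0 < 2 ^- J :> R by rewrite invr_gt0 exprn_gt0.
  have := H1 J.*2.+1 (2 ^- J) u h a0 bu.
  have -> : Int (fun x => `|\sum_(i < J.*2.+1) (lpd eta (2 ^- J * 2 ^+ i) u (x - h) -
      lpd eta (2 ^- J * 2 ^+ i) u x)| `^ p) = Int (fun x => `|f J x - f J (x - h)| `^ p).
    by apply: eq_Int => x; rewrite sumrB distrC.
  move=> /(ler_wpM2l (W0 h)) /le_trans; apply; rewrite mulrCA; apply: ler_wpM2l => //.
  rewrite -(IntZ _ bY).
  have bck i : bl (fun x => k J i h * (S J x `^ (q - 1) * D J i x ^+ 2)).
    by apply: bl_mulr => //; exact: bdm_cst.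
  have -> : \sum_(i < J.*2.+1) c J i * k J i h =
      Int (fun x => \sum_(i < J.*2.+1) k J i h * (S J x `^ (q - 1) * D J i x ^+ 2)).
    rewrite Int_sum; last by move=> i _; exact: bck.
    by apply: eq_bigr => i _; rewrite (IntZ _ (bc J i)) mulrC.
  apply: Int_le => [||x].
  - by apply: bl_mulr => //; exact: bdm_cst.
  - by apply: bl_sum => i _; exact: bck.
  have YS : l1 h `^ (- (2 * s)) * Y x <= S J x.
    rewrite mulr_sumr; apply: ler_sum => i _; rewrite mulrA; apply: ler_wpM2r; first exact: sqr_ge0.
    have a0' := dya_gt0 J i.
    have al0 : 0 <= dya J i * l1 h by rewrite mulr_ge0 ?l1_ge0// ltW.
    apply: le_trans (ler_wpM2l (powR_ge0 _ _) (min_powR_le al0 s0 s1)) _.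
    rewrite powRM ?l1_ge0 ?(ltW a0')// mulrCA -powRD ?(gt_eqF h0) ?implybT//.
    by rewrite addNr powRr0 mulr1.
  have := weight_powR_le q1 s0 h0 (Y0 x) YS; rewrite -pE => /le_trans; apply.
  rewrite le_eqVlt; apply/orP; left; apply/eqP; rewrite /Y mulr_sumr mulr_sumr.
  by apply: eq_bigr => i _; rewrite /k; ring.
have SqE J : Int (fun x => S J x `^ q) = \sum_(i < J.*2.+1) dya J i `^ (2 * s) * c J i.
  have -> : Int (fun x => S J x `^ q) =
      Int (fun x => \sum_(i < J.*2.+1) dya J i `^ (2 * s) * (S J x `^ (q - 1) * D J i x ^+ 2)).
    apply: eq_Int => x; rewrite -(mulr_powRB1 (S0 J x)); last lra.
    rewrite {1}/S /sqf mulr_suml; apply: eq_bigr => i _.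
    by rewrite -mulrA; congr (_ * _); rewrite mulrC.
  rewrite Int_sum; first by apply: eq_bigr => i _; rewrite (IntZ _ (bc J i)).
  by move=> i _; apply: bl_mulr => //; exact: bdm_cst.
have kk0 : 0 <= s^-1 + (1 - s)^-1 by rewrite addr_ge0// invr_ge0; lra.
(* Integration replaces k_i by the weight of the i-th frequency times the factor in s, and [SqE]
   reassembles the square function. *)
have claim2 J : (\int[mu]_h (B J h)%:E <= (C1 * C2 * (s^-1 + (1 - s)^-1))%:E * X)%E.
  apply: (@le_trans _ _ ((C1 * C2 * (s^-1 + (1 - s)^-1))%:E * (Int (fun x => S J x `^ q))%:E)%E);
    last first.
    by apply: lee_wpmul2l; [rewrite lee_fin !mulr_ge0|exact: HX].
  have -> : (\int[mu]_h (B J h)%:E = C1%:E * \sum_(i < J.*2.+1) ((c J i)%:E * \int[mu]_h (k J i h)%:E))%E.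
    rewrite /B; under eq_integral do rewrite EFinM -sumEFin.
    have mc i : measurable_fun setT (fun h => (c J i * k J i h)%:E).
      by apply/measurable_EFinP; apply: mf_mul; [exact: mf_cst|exact: mk].
    rewrite ge0_integralZl//; last 2 first.
    - by apply: emeasurable_sum => i _; exact: mc.
    - by move=> h _; rewrite sume_ge0// => i _; rewrite lee_fin mulr_ge0.
    congr (_ * _)%E; rewrite ge0_integral_sum//; last by move=> i h _; rewrite lee_fin mulr_ge0.
    apply: eq_bigr => i _; under eq_integral do rewrite EFinM.
    rewrite ge0_integralZl//.
    - by apply/measurable_EFinP; exact: mk.
    - by move=> h _; rewrite lee_fin.
    - by rewrite lee_fin.
  apply: (@le_trans _ _ (C1%:E * \sum_(i < J.*2.+1) ((c J i)%:E *
      ((dya J i `^ (2 * s))%:E * (C2 * (s^-1 + (1 - s)^-1))%:E)))%E).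
    apply: lee_wpmul2l; first by rewrite lee_fin.
    apply: lee_sum => i _; apply: lee_wpmul2l; first by rewrite lee_fin.
    rewrite (kapf_integral_scale _ _ (dya_gt0 J i)).
    by apply: lee_wpmul2l; [rewrite lee_fin powR_ge0|exact: H2].
  under eq_bigr do rewrite -!EFinM; rewrite sumEFin -!EFinM lee_fin SqE.
  rewrite le_eqVlt; apply/orP; left; apply/eqP; rewrite !mulr_sumr.
  by apply: eq_bigr => i _; ring.
(* Fatou is used twice to let J tend to infinity: in x for fixed h, and then in h. *)
apply: (integral_le_liminf (B := fun J h => (B J h)%:E)) => //.
- apply/measurable_EFinP; apply: mf_mul; first exact: mf_powR.
  exact: mf_Int_translate.
- by move=> h; rewrite lee_fin; apply: (mulr_ge0 (W0 h)); apply: Int_ge0 => x; exact: powR_ge0.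
- move=> J; apply/measurable_EFinP; apply: mf_mul; first exact: mf_cst.
  by apply: mf_sum => i _; apply: mf_mul; [exact: mf_cst|exact: mk].
- move=> h; have bW : bl (fun x => `|u x - u (x - h)| `^ p).
    by apply: bl_powR => //; apply: bl_sub => //; exact: (bl_subr h bu).
  rewrite -(IntZ _ bW).
  apply: le_trans (bl_le_liminf (f_ := fun J x => W h * `|f J x - f J (x - h)| `^ p) _ _ _ _) _.
  + by move=> J; apply: bl_mulr => //; exact: bdm_cst.
  + by apply: bl_mulr => //; exact: bdm_cst.
  + by move=> J x; rewrite mulr_ge0// powR_ge0.
  + move=> x; apply: cvgM; first exact: cvg_cst.
    apply: cvg_powR => //; apply: cvg_norm; apply: cvgB.
      exact: (@lpd_sum_cvg _ _ _ _ tpsi pe u x n0 bu cu).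
    exact: (@lpd_sum_cvg _ _ _ _ tpsi pe u (x - h) n0 bu cu).
  + apply: le_limn_einf => J; rewrite lee_fin (IntZ _ (bdf J h)); exact: claim1.
Qed.

End upper_bound.

(** * Tools for p <= 2: duality, telescoped differences, shifted averages *)

Section duality_tools.
Context {R : realType} {n : nat}.
Local Notation T := 'rV[R]_n.
Implicit Types (f g k b d u : T -> R) (x y h : T) (a c p : R).

Lemma young_conj p e : 1 < p -> 0 < e -> exists2 K, 0 <= K &
  forall a b : R, 0 <= a -> 0 <= b -> a * b <= K * a `^ p + e * b `^ (p / (p - 1)).
Proof.
move=> p1 e0; have [|K K0 H] := @young_split R p e e0; first lra.
exists K => // a b a0 b0; have p10 : p - 1 != 0 by rewrite gt_eqF//; lra.
have := H a (b `^ (p - 1)^-1) a0 (powR_ge0 _ _).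
by rewrite -!powRrM mulVf// powRr1// (mulrC _ p).
Qed.

Lemma Int_cv_even k f g : bl k -> bl f -> bl g -> (forall x, k (- x) = k x) ->
  Int (fun x => cv k f x * g x) = Int (fun x => f x * cv k g x).
Proof.
move=> bk bf bg ke; have [b1 ->] := Int_cvM bk bf (bl_bdm bg).
have [_ e2] := Int_cvM bk bg (bl_bdm bf).
have -> : Int (fun x => f x * cv k g x) = Int (fun x => cv k g x * f x).
  by apply: eq_Int => x; rewrite mulrC.
rewrite e2 -(Int_neg b1); apply: eq_Int => y; rewrite ke; congr (_ * _).
have B : bl (fun x => g x * f (x + y)) by bls.
rewrite -(Int_subr y B); apply: eq_Int => x /=.
by rewrite subrK mulrC.
Qed.

(** d x - d (x - L h) is a sum of L translates of x -> d x - d (x - h); translation invariance moves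
    the shifts to b. *)
Lemma Int_telescope b d h L : bl b -> bl d ->
  Int (fun x => b x * (d x - d (x - L%:R *: h))) =
  Int (fun x => (\sum_(l < L) b (x + l%:R *: h)) * (d x - d (x - h))).
Proof.
move=> bb bd; have bbl (l : nat) : bl (fun x => b (x + l%:R *: h)) by exact: bl_addr.
have bdd : bl (fun x => d x - d (x - h)) by apply: bl_sub => //; exact: bl_subr.
have bS L' : bl (fun x => \sum_(l < L') b (x + l%:R *: h)) by apply: bl_sum.
elim: L => [|L IH].
  by apply: eq_Int => x; rewrite big_ord0 scale0r subr0 subrr mulr0 mul0r.
pose dL x := d (x - L%:R *: h); have bdL : bl dL by exact: bl_subr.
have e1 : Int (fun x => b x * (d x - d (x - L.+1%:R *: h))) =
    Int (fun x => b x * (d x - dL x)) + Int (fun x => b x * (dL x - dL (x - h))).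
  have b1 : bl (fun x => b x * (d x - dL x)).
    by apply: bl_mulr; [exact: bl_bdm|exact: bl_sub].
  have b2 : bl (fun x => b x * (dL x - dL (x - h))).
    by apply: bl_mulr; [exact: bl_bdm|apply: bl_sub => //; exact: bl_subr].
  rewrite -(Int_add b1 b2); apply: eq_Int => x.
  by rewrite -mulrDr addrA subrK /dL -natr1 scalerDl scale1r opprD addrA (addrAC x).
rewrite e1 IH.
have -> : Int (fun x => b x * (dL x - dL (x - h))) =
    Int (fun x => b (x + L%:R *: h) * (d x - d (x - h))).
  have b2 : bl (fun x => b x * (dL x - dL (x - h))).
    by apply: bl_mulr; [exact: bl_bdm|apply: bl_sub => //; exact: bl_subr].
  rewrite -(Int_addr (L%:R *: h) b2); apply: eq_Int => x.
  by rewrite /dL addrK (addrAC x) addrK.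
have b3 : bl (fun x => (\sum_(l < L) b (x + l%:R *: h)) * (d x - d (x - h))).
  by apply: bl_mulr => //; exact: bl_bdm.
have b4 : bl (fun x => b (x + L%:R *: h) * (d x - d (x - h))).
  by apply: bl_mulr => //; exact: bl_bdm.
rewrite -(Int_add b3 b4); apply: eq_Int => x.
by rewrite big_ord_recr mulrDl.
Qed.

Lemma Int_dil_shift (f d : T -> R) (L : nat) c x : 0 < c -> (0 < L)%N -> bl f -> bl d ->
  Int (fun h => dil c f h * d (x - L%:R *: h)) = cv d (dil (c / L%:R) f) x.
Proof.
move=> c0 L0 bf bd; have L0' : 0 < L%:R :> R by rewrite ltr0n.
have Ln0 : L%:R != 0 :> R by rewrite gt_eqF.
have cL : 0 < c / L%:R by rewrite divr_gt0.
have bF : bl (fun y => d (x - y) * dil (c / L%:R) f y).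
  by apply: bl_cv_sect => //; apply: bl_bdm; exact: bl_dil.
have bs := bl_scale Ln0 bF.
rewrite /cv -(Int_scale Ln0 bF) -(IntZ _ bs).
apply: eq_Int => h; rewrite /dil scalerA divfK// gtr0_norm//.
rewrite exprMn exprVn; field.
by rewrite expf_eq0 negb_and Ln0 orbT.
Qed.

Variables psi eta : T -> R.
Hypotheses (tpsi : tame psi) (teta : tame eta) (pe : lp_symbols psi eta).

Lemma lpd_low c a u x : 0 < c -> 0 < a -> c <= a / 4 -> bl u ->
  cv (lpd eta a u) (dil c psi) x = 0.
Proof.
move=> c0 a0 ca bu; have bp := tame_bl tpsi; have be := tame_bl teta.
have bd := bl_dil a0 be; have bc := bl_dil c0 bp.
rewrite cvC; [|exact: bl_lpd|exact: bl_bdm].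
rewrite (cvA x bc bd bu) -[RHS](@Int0 R n); apply: eq_Int => y.
have -> : cv (dil c psi) (dil a eta) (x - y) = 0; last by rewrite mul0r.
rewrite cvC//; last exact: bl_bdm.
have ca0 : 0 < c / a by rewrite divr_gt0.
have -> : dil c psi = dil a (dil (c / a) psi).
  by rewrite dil_dil mulrCA divff ?mulr1// gt_eqF.
rewrite (cv_dil _ a0 be (bl_dil ca0 bp)) /dil -/(dil (c / a) psi).
by rewrite (lp_cv_low pe)// ?mulr0// ler_pdivrMr// mulrC.
Qed.

(* Averaging d x - d (x - L h) over h at scale b reproduces d, since the
   subtracted average only sees frequencies below those of d. *)
Lemma lpd_average (b a : R) (L : nat) u x : 0 < b -> 0 < a -> (0 < L)%N -> b <= L%:R * a ->
  bl u ->
  Int (fun h => dil (b / 4) psi h * (lpd eta a u x - lpd eta a u (x - L%:R *: h))) = lpd eta a u x.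
Proof.
move=> b0 a0 L0 bL bu; have bp := tame_bl tpsi; have bd := bl_lpd teta a0 bu.
have b40 : 0 < b / 4 by rewrite divr_gt0.
have L0' : 0 < L%:R :> R by rewrite ltr0n.
have bq := bl_dil b40 bp.
have bs : bl (fun h => dil (b / 4) psi h * lpd eta a u (x - L%:R *: h)).
  apply: bl_mull => //.
  apply: (@bdm_scale _ _ (fun h => lpd eta a u (x - h))); apply: bdm_rsub; exact: bl_bdm.
transitivity (Int (fun h => dil (b / 4) psi h * lpd eta a u x) -
    Int (fun h => dil (b / 4) psi h * lpd eta a u (x - L%:R *: h))).
  rewrite -Int_sub//; last by apply: bl_mull => //; exact: bdm_cst.
  by apply: eq_Int => h; rewrite mulrBr.
rewrite (IntZr _ bq) (Int_dil b40 bp) (Int_lp_psi pe) mul1r.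
rewrite (Int_dil_shift _ b40 L0 bp bd) lpd_low ?subr0//; first by rewrite divr_gt0.
by rewrite ler_pdivrMr// mulrAC ler_pM2r// mulrC.
Qed.

End duality_tools.

Section shifted_averages.
Context {R : realType} {n : nat}.
Local Notation T := 'rV[R]_n.
Implicit Types (f g u : T -> R) (x y h : T) (a b : R).

Variables psi eta : T -> R.
Hypotheses (tpsi : tame psi) (teta : tame eta) (pe : lp_symbols psi eta).
Hypothesis n0 : (0 < n)%N.

Definition shift_mean (L : nat) h f x : R := L%:R^-1 * \sum_(l < L) f (x + l%:R *: h).

Lemma bl_shift_mean L h f : bl f -> bl (shift_mean L h f).
Proof.
move=> bf; apply: bl_mulr; first exact: bdm_cst.
by apply: bl_sum => l _; exact: bl_addr.
Qed.

Lemma shift_mean_sqr L h f x : (0 < L)%N ->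
  shift_mean L h f x ^+ 2 <= shift_mean L h (fun y => f y ^+ 2) x.
Proof.
move=> L0; have L0' : 0 < L%:R :> R by rewrite ltr0n.
have w0 (l : 'I_L) : true -> 0 <= L%:R^-1 :> R by rewrite invr_ge0.
have t0 (l : 'I_L) : true -> 0 <= `|f (x + l%:R *: h)| by [].
have := @sum_sqr R _ (index_enum 'I_L) xpredT _ _ w0 t0; rewrite -!mulr_sumr sumr_const card_ord.
rewrite -[L%:R^-1 *+ L]mulr_natr mulVf ?gt_eqF// mul1r /shift_mean.
under [X in _ <= _ * X -> _]eq_bigr do rewrite real_normK ?num_real//.
apply: le_trans; rewrite !exprMn ler_wpM2l ?sqr_ge0// -[leLHS]real_normK ?num_real//.
by apply: lerXn2r; rewrite ?nnegrE ?normr_ge0 ?sumr_ge0//; exact: ler_norm_sum.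
Qed.

(** A translate by l h costs (1 + a l |h|)^(n+1) by Harnack, and l a <= b makes this uniform in l
    and in the scale. *)
Lemma avo_shift_mean (L : nat) a b h f x : (0 < L)%N -> 0 < a -> bl f -> (forall y, 0 <= f y) ->
  (forall l : nat, (l < L)%N -> l%:R * a <= b) ->
  avo a (shift_mean L h f) x <= (1 + b * l1 h) ^+ n.+1 * avo a f x.
Proof.
move=> L0 a0 bf f0 Lb; have L0' : 0 < L%:R :> R by rewrite ltr0n.
have bo := @bl_omd R n a a0.
have bfl (l : nat) : bl (fun y => f (y + l%:R *: h)) by exact: bl_addr.
have bS : bl (fun y => \sum_(l < L) f (y + l%:R *: h)) by apply: bl_sum.
have A0 : 0 <= avo a f x by exact: avo_ge0.
rewrite /avo (cvZr _ _ bo (bl_bdm bS)) cv_sumr//; last by move=> l _; exact: bl_bdm.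
rewrite ler_pdivrMl//.
have -> : L%:R * ((1 + b * l1 h) ^+ n.+1 * avo a f x) =
    \sum_(l < L) (1 + b * l1 h) ^+ n.+1 * avo a f x.
  by rewrite sumr_const card_ord mulr_natl.
apply: ler_sum => l _.
have -> : cv (omd a) (fun y => f (y + l%:R *: h)) x = avo a f (x - - (l%:R *: h)).
  rewrite /avo -cv_shiftr//; last exact: bl_bdm.
  by apply: eq_cvr => y; rewrite opprK.
apply: le_trans (avo_harnack _ _ a0 bf f0) _; apply: ler_wpM2r => //.
have h0 := l1_ge0 h.
rewrite l1N l1Z//; apply: lerXn2r; rewrite ?nnegrE.
- by rewrite addr_ge0// mulr_ge0 ?(ltW a0)// mulr_ge0.
- by rewrite addr_ge0// mulr_ge0//; have := Lb 0%N L0; rewrite mul0r.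
- by rewrite lerD2l mulrA; apply: ler_wpM2r => //; rewrite mulrC; exact: Lb.
Qed.

(** The shifts are confined to l a_i <= b, so they only cost a power of 1 + b |h|, the same for all
    pieces. This polynomial loss is paid later by the decay of psi. *)
Theorem shifted_square_function (r : R) : 2 <= r -> exists2 C, 0 <= C &
  forall I a0 b h (L : nat -> nat) (g : nat -> T -> R), 0 < a0 -> (forall i, 0 < L i)%N ->
  (forall i (l : nat), (l < L i)%N -> l%:R * (a0 * 2 ^+ i) <= b) -> (forall i, bl (g i)) ->
  Int (fun x => `|\sum_(i < I) lpd eta (a0 * 2 ^+ i) (shift_mean (L i) h (g i)) x| `^ r) <=
  C * ((1 + b * l1 h) ^+ n.+1) `^ (r / 2) * Int (fun x => (\sum_(i < I) g i x ^+ 2) `^ (r / 2)).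
Proof.
move=> r2; pose q := r / 2; have q1 : 1 <= q by rewrite /q; lra.
have q0 : 0 <= q by lra.
have [A gz] := zeta_good_kernel tpsi pe; have [A' ge] := eta_good_kernel teta pe.
have A'0 := good_kernel_ge0 ge.
have [C1 C10 H1] := square_function r2 n0 gz.
have [C2 C20 H2] := @dual_doob_om R n q q1.
have o0 := omI_ge0 (R := R) (n := n).
pose K := A' ^+ 2 * omI (R := R) (n := n); have K0 : 0 <= K by rewrite mulr_ge0// sqr_ge0.
exists (C1 * (K `^ q * C2)) => [|I a0 b h L g a00 L0 Lb bg].
  by rewrite !mulr_ge0// powR_ge0.
pose a i := a0 * 2 ^+ i; have a_0 i : 0 < a i by rewrite mulr_gt0// exprn_gt0.
have sa : scales a.
  split=> // i; rewrite /a exprS mulrCA; apply: ler_peMl; first exact: ltW (a_0 i).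
  by rewrite ler1n.
pose B i := shift_mean (L i) h (g i); have bB i : bl (B i) by exact: bl_shift_mean.
pose v i := lpd eta (a i) (B i); have bv i : bl (v i) by exact: bl_lpd.
have bg2 i : bl (fun x => g i x ^+ 2) by exact: bl_exp.
have b0 : 0 <= b by have := Lb 0%N 0%N (L0 0%N); rewrite mul0r.
pose th := (1 + b * l1 h) ^+ n.+1.
have th0 : 0 <= th by rewrite exprn_ge0// addr_ge0// mulr_ge0// l1_ge0.
have pt i x : v i x ^+ 2 <= K * th * avo (a i) (fun y => g i y ^+ 2) x.
  have d := kernel_cv_le ge x (a_0 i) (bB i).
  have nb := bl_norm (bB i); have bB2 : bl (fun y => `|B i y| ^+ 2) by exact: bl_exp.
  apply: (@le_trans _ _ ((A' * avo (a i) (fun y => `|B i y|) x) ^+ 2)).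
    by rewrite -real_normK ?num_real//; apply: lerXn2r; rewrite ?nnegrE//; exact: le_trans d.
  have s := avo_sqr x (a_0 i) (bl_bdm nb) (fun y => normr_ge0 (B i y)).
  rewrite exprMn -[leRHS]mulrA /K -[leRHS]mulrA; apply: ler_wpM2l; first exact: sqr_ge0.
  apply: le_trans s _; apply: ler_wpM2l => //.
  apply: (le_trans _ (avo_shift_mean h x (L0 i) (a_0 i) (bg2 i) (fun y => sqr_ge0 _) (Lb i))).
  apply: avo_le => //; [exact: bl_bdm|by apply: bl_bdm; exact: bl_shift_mean|].
  by move=> y; rewrite real_normK ?num_real//; exact: shift_mean_sqr.
have E : Int (fun x => `|\sum_(i < I) v i x| `^ r) <= C1 * Int (fun x => (\sum_(i < I) v i x ^+ 2) `^ q).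
  apply: le_trans (H1 I a0 v a00 bv); rewrite le_eqVlt; apply/orP; left; apply/eqP.
  apply: eq_Int => x; congr (`|_| `^ _); apply: eq_bigr => i _.
  exact/esym/(lpd_repr teta pe x (a_0 i) (bB i)).
apply: le_trans E _.
have -> : C1 * (K `^ q * C2) * th `^ q * Int (fun x => (\sum_(i < I) g i x ^+ 2) `^ q) =
    C1 * ((K * th) `^ q * (C2 * Int (fun x => (\sum_(i < I) g i x ^+ 2) `^ q))).
  by rewrite powRM//; ring.
apply: ler_wpM2l => //.
have H3 := H2 I a (fun i x => g i x ^+ 2) sa bg2 (fun i x => sqr_ge0 _).
apply: (@le_trans _ _ ((K * th) `^ q * Int (fun x => (\sum_(i < I) avo (a i) (fun y => g i y ^+ 2) x) `^ q)));
  last by apply: ler_wpM2l; [exact: powR_ge0|exact: H3].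
have s0 x : 0 <= \sum_(i < I) avo (a i) (fun y => g i y ^+ 2) x.
  by apply: sumr_ge0 => i _; apply: avo_ge0 => // y; exact: sqr_ge0.
have bq : bl (fun x => (\sum_(i < I) avo (a i) (fun y => g i y ^+ 2) x) `^ q).
  by apply: bl_powR0 => //; apply: bl_sum => i _; exact: bl_avo.
rewrite -(IntZ _ bq); apply: Int_le => [||x].
- apply: bl_powR0 => // [x|]; first by apply: sumr_ge0 => i _; exact: sqr_ge0.
  by apply: bl_sum => i _; exact: bl_exp.
- by apply: bl_mulr => //; exact: bdm_cst.
rewrite -powRM ?mulr_ge0//; apply: powR_le_mono => //.
  by apply: sumr_ge0 => i _; exact: sqr_ge0.
by rewrite mulr_sumr; apply: ler_sum => i _; exact: pt.
Qed.

End shifted_averages.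

(** * The estimate at a single scale, p <= 2 *)

Section single_scale.
Context {R : realType} {n : nat}.
Local Notation T := 'rV[R]_n.
Implicit Types (f g u v : T -> R) (x y h : T) (a b p : R).

(** The decay of psi left after paying for (1 + b |h|)^(n+1). The order n + 3 is what
    [tail_weight_le] consumes. *)
Definition tail : T -> R := fun x => ((1 + l1 x) ^+ n.+3)^-1.

Lemma tail_ge0 x : 0 <= tail x.
Proof. by rewrite invr_ge0 exprn_ge0// ltW// l1p_gt0. Qed.

Lemma bl_tail : bl tail.
Proof.
apply: (@bl_dom _ _ _ om) => [||x]; [exact: mf_inv_l1p|exact: bl_om|].
rewrite ger0_norm ?tail_ge0// lef_pV2 ?posrE ?exprn_gt0 ?l1p_gt0//.
by rewrite ler_weXn2l ?l1p_ge1// !ltnS leqW.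
Qed.

Lemma bdm_Int_translate u p : bl u -> 1 <= p ->
  bdm (fun h => Int (fun x => `|u x - u (x - h)| `^ p)).
Proof.
move=> bu p1; have p0 : 0 <= p by lra.
have bp : bl (fun x => `|u x| `^ p) by exact: bl_powR.
apply: (bdmI (M := 2 `^ (p - 1) * (Int (fun x => `|u x| `^ p) + Int (fun x => `|u x| `^ p)))).
  exact: mf_Int_translate.
move=> h; have bph := bl_subr h bp.
have bd : bl (fun x => `|u x - u (x - h)| `^ p).
  by apply: bl_powR => //; apply: bl_sub => //; exact: bl_subr.
rewrite ger0_norm; last by apply: Int_ge0 => x; exact: powR_ge0.
have e : Int (fun x => `|u x| `^ p) = Int (fun x => `|u (x - h)| `^ p) by rewrite -(Int_subr h bp).
rewrite {2}e -(Int_add bp bph) -(IntZ _ (bl_add bp bph)).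
apply: Int_le => [||x]; [exact: bd|by apply: bl_mulr; [exact: bdm_cst|exact: bl_add]|].
apply: le_trans (powR_add p1 (normr_ge0 (u x)) (normr_ge0 (u (x - h)))).
by apply: powR_le_mono; [exact: p0|exact: normr_ge0|exact: ler_normB].
Qed.

(** Young's inequality for t u and v / t. As p <= 2 and t >= 1, the factor t^p on the side of u is
    at most t^2, so a loss in the norm of v can be shifted to u. *)
Lemma Int_young p e K u v (t : R) : 1 < p -> p <= 2 -> 1 <= t -> bl u -> bl v ->
  (forall a b, 0 <= a -> 0 <= b -> a * b <= K * a `^ p + e * b `^ (p / (p - 1))) -> 0 <= K ->
  `|Int (fun x => u x * v x)| <=
  K * (t ^+ 2 * Int (fun x => `|u x| `^ p)) +
  e * (t `^ (- (p / (p - 1))) * Int (fun x => `|v x| `^ (p / (p - 1)))).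
Proof.
move=> p1 p2 t1 bu bv H K0; set r := p / (p - 1) in H *.
have p10 : 0 < p - 1 by lra.
have r1 : 1 <= r by rewrite /r ler_pdivlMr//; lra.
have t0 : 0 < t by lra.
have p1' : 1 <= p by lra.
have bup : bl (fun x => `|u x| `^ p) by exact: bl_powR.
have bvr : bl (fun x => `|v x| `^ r) by exact: bl_powR.
have b1 : bl (fun x => t ^+ 2 * `|u x| `^ p) by apply: bl_mulr => //; exact: bdm_cst.
have b2 : bl (fun x => t `^ (- r) * `|v x| `^ r) by apply: bl_mulr => //; exact: bdm_cst.
have b3 : bl (fun x => K * (t ^+ 2 * `|u x| `^ p)) by apply: bl_mulr => //; exact: bdm_cst.
have b4 : bl (fun x => e * (t `^ (- r) * `|v x| `^ r)) by apply: bl_mulr => //; exact: bdm_cst.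
have buv : bl (fun x => u x * v x) by apply: bl_mulr => //; exact: bl_bdm.
rewrite -(IntZ _ bup) -(IntZ _ bvr) -(IntZ _ b1) -(IntZ _ b2) -(Int_add b3 b4).
apply: le_trans (Int_norm buv) _; apply: Int_le => [||x]; [exact: bl_norm|exact: bl_add|].
have := H (t * `|u x|) (t^-1 * `|v x|); rewrite !mulr_ge0 ?invr_ge0 ?(ltW t0)// => /(_ isT isT).
rewrite mulrACA divff ?gt_eqF// mul1r -normrM => /le_trans; apply.
have ti : 0 <= t^-1 by rewrite invr_ge0 ltW.
rewrite !powRM ?(ltW t0)//; apply: lerD; last first.
  by rewrite -[t^-1]powR_inv1 ?(ltW t0)// -powRrM mulN1r.
apply: ler_wpM2l => //; apply: ler_wpM2r; first exact: powR_ge0.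
by rewrite -powR_sqr ?(ltW t0)//; apply: ler_powR.
Qed.

Variables psi eta : T -> R.
Hypotheses (tpsi : tame psi) (teta : tame eta) (pe : lp_symbols psi eta).
Hypothesis n0 : (0 < n)%N.
Hypothesis eta_even : forall x, eta (- x) = eta x.
Hypothesis psi_decay : exists A, forall x, `|psi x| * (1 + l1 x) ^+ (n.+1 + n.+3) <= A.

Lemma psi_tail : exists2 A, 0 <= A & forall b h, 0 < b ->
  `|dil (b / 4) psi h| * (1 + b * l1 h) ^+ n.+1 <= A * dil b tail h.
Proof.
have [A hA] := psi_decay.
have A0 : 0 <= A by apply: le_trans (hA 0); rewrite mulr_ge0// exprn_ge0// ltW// l1p_gt0.
exists (4 ^+ (n.+1 + n.+3) * A) => [|b h b0]; first by rewrite mulr_ge0// exprn_ge0.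
have h0 := l1_ge0 h; have bh : 0 <= b * l1 h by rewrite mulr_ge0// ltW.
have b4 : 0 <= b / 4 by rewrite divr_ge0// ltW.
have := hA ((b / 4) *: h); rewrite l1Z//; set y := psi _ => H.
have t0 : 0 < 1 + b * l1 h by lra.
rewrite /dil /tail l1Z ?(ltW b0)// normrM ger0_norm ?exprn_ge0// -/y.
rewrite [leRHS]mulrCA -[leLHS]mulrA; apply: ler_pM; rewrite ?exprn_ge0//.
- by rewrite mulr_ge0// exprn_ge0// ltW.
- by apply: lerXn2r; rewrite ?nnegrE ?(ltW b0)//; lra.
rewrite ler_pdivlMr ?exprn_gt0// -mulrA -exprD.
have h1 : (1 + b * l1 h) ^+ (n.+1 + n.+3) <= 4 ^+ (n.+1 + n.+3) * (1 + b / 4 * l1 h) ^+ (n.+1 + n.+3).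
  by rewrite -exprMn; apply: lerXn2r; rewrite ?nnegrE; lra.
apply: le_trans (ler_wpM2l (normr_ge0 y) h1) _.
by rewrite mulrCA; apply: ler_wpM2l => //; rewrite exprn_ge0.
Qed.

(* Self-adjointness of convolution by the even kernel dil a eta moves it onto the
   test function, leaving the difference of u itself. *)
Lemma piece_identity a b (L : nat) u (beta : T -> R) : 0 < b -> 0 < a -> (0 < L)%N ->
  b <= L%:R * a -> bl u -> bl beta ->
  bl (fun h => dil (b / 4) psi h *
        Int (fun x => (u x - u (x - h)) * lpd eta a (shift_mean L h beta) x)) /\
  Int (fun x => L%:R^-1 * beta x * lpd eta a u x) =
  Int (fun h => dil (b / 4) psi h *
        Int (fun x => (u x - u (x - h)) * lpd eta a (shift_mean L h beta) x)).
Proof.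
move=> b0 a0 L0 bL bu bb; pose d := lpd eta a u; have bd : bl d by exact: bl_lpd.
have bp := tame_bl tpsi; have be := tame_bl teta.
have b40 : 0 < b / 4 by rewrite divr_gt0.
pose phi := dil (b / 4) psi; have bphi : bl phi by exact: bl_dil.
have [M dM] := bl_bound bd.
(* Integrated first in h, G gives the left-hand side by [lpd_average]; integrated first in x, it
   gives the right-hand side. *)
pose G (z : T * T) := L%:R^-1 * beta z.1 * (phi z.2 * (d z.1 - d (z.1 - L%:R *: z.2))).
have mG : measurable_fun setT G.
  have md := bl_mf bd; have mb := bl_mf bb; have mph := bl_mf bphi.
  apply: mf_mul; first by apply: mf_mul; [exact: mf_cst|exact: (mf_fst mb)].
  apply: mf_mul; first exact: (mf_snd mph).
  apply: mf_sub; first exact: (mf_fst md).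
  have := mf_lin2 1 (- L%:R) md.
  by under eq_fun do rewrite scale1r scaleNr.
have L1 : 0 <= L%:R^-1 :> R by rewrite invr_ge0.
have ba : bl (fun x => (M + M) * (L%:R^-1 * `|beta x|)).
  by apply: bl_mulr; [exact: bdm_cst|apply: bl_mulr; [exact: bdm_cst|exact: bl_norm]].
have dom x h : `|G (x, h)| <= (M + M) * (L%:R^-1 * `|beta x|) * `|phi h|.
  rewrite /G /= !normrM (ger0_norm L1).
  have dd : `|d x - d (x - L%:R *: h)| <= M + M by apply: le_trans (ler_normB _ _) (lerD _ _).
  have e (m z w : R) : m * z * w = z * w * m by ring.
  rewrite [leLHS]mulrA [leRHS]e.
  by apply: ler_wpM2l => //; rewrite !mulr_ge0.
have [_ bF E] := Int_swap_mul mG ba (bl_norm bphi) dom.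
have in1 x : Int (fun h => G (x, h)) = L%:R^-1 * beta x * d x.
  have bh : bl (fun h => phi h * (d x - d (x - L%:R *: h))).
    apply: (bl_mull bphi); apply: bdm_sub; first exact: bdm_cst.
    by apply: (@bdm_scale _ _ (fun h => d (x - h))); apply: bdm_rsub; exact: bl_bdm.
  have := IntZ (L%:R^-1 * beta x) bh.
  by rewrite (lpd_average tpsi teta pe x b0 a0 L0 bL bu) => <-; apply: eq_Int.
have in2 h : Int (fun x => G (x, h)) =
    phi h * Int (fun x => (u x - u (x - h)) * lpd eta a (shift_mean L h beta) x).
  have buh : bl (fun x => u x - u (x - h)) by exact: bl_sub bu (bl_subr h bu).
  have bS : bl (fun x => \sum_(l < L) beta (x + l%:R *: h)).
    by apply: bl_sum => l _; exact: (bl_addr (l%:R *: h) bb).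
  have bm : bl (shift_mean L h beta) by exact: (bl_shift_mean L h bb).
  have bda := bl_dil a0 be.
  have b1 : bl (fun x => beta x * (d x - d (x - L%:R *: h))).
    exact: (bl_mulr (bl_bdm bb) (bl_sub bd (bl_subr (L%:R *: h) bd))).
  have b2 : bl (fun x => (\sum_(l < L) beta (x + l%:R *: h)) * (d x - d (x - h))).
    exact: (bl_mulr (bl_bdm bS) (bl_sub bd (bl_subr h bd))).
  have ev z : dil a eta (- z) = dil a eta z by rewrite /dil scalerN eta_even.
  transitivity (phi h * (L%:R^-1 * Int (fun x => beta x * (d x - d (x - L%:R *: h))))).
    rewrite -(IntZ _ b1) -(IntZ _ (bl_mulr (bdm_cst _) b1)).
    by apply: eq_Int => x; rewrite /G /=; ring.
  congr (_ * _); rewrite (Int_telescope h L bb bd) -(IntZ _ b2).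
  rewrite -(Int_cv_even bda buh bm ev); apply: eq_Int => x.
  rewrite mulrA mulrC; congr (_ * _).
  have bub := bl_bdm bu.
  by rewrite (cvBr x bda bub (bdm_subr h bub)) (cv_shiftr x h bda bub).
have e2 : (fun h => Int (fun x => G (x, h))) = fun h =>
   phi h * Int (fun x => (u x - u (x - h)) * lpd eta a (shift_mean L h beta) x).
  by apply/funext => h; exact: in2.
have <- := e2; split; first exact: bF.
rewrite -[RHS]E; apply: eq_Int => x; exact: esym (in1 x).
Qed.

End single_scale.

Section dual_weights.
Context {R : realType}.
Implicit Types (p chi : R) (w d : nat -> R).

Definition wsum I w d : R := \sum_(i < I) w i ^+ 2 * d i ^+ 2.

(** The cutoff chi makes these test functions integrable: they have size A^(p-1), whose exponent may
    be less than 1. *)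
Definition dual_weight p chi I w d i : R := w i * d i * wsum I w d `^ (p / 2 - 1) * chi.

Lemma wsum_ge0 I w d : 0 <= wsum I w d.
Proof. by apply: sumr_ge0 => i _; rewrite mulr_ge0 ?sqr_ge0. Qed.

Lemma dual_weight_pairing p chi I w d : 1 < p ->
  \sum_(i < I) w i * dual_weight p chi I w d i * d i = wsum I w d `^ (p / 2) * chi.
Proof.
move=> p1; set P := wsum I w d.
have -> : \sum_(i < I) w i * dual_weight p chi I w d i * d i = P * P `^ (p / 2 - 1) * chi.
  rewrite {1}/P /wsum !mulr_suml; apply: eq_bigr => i _.
  by rewrite /dual_weight -/P; ring.
have p20 : 0 < p / 2 by rewrite divr_gt0//; lra.
by rewrite (mulr_powRB1 (wsum_ge0 _ _ _) p20).
Qed.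

Lemma dual_weight_sqr p chi I w d : 1 < p ->
  \sum_(i < I) dual_weight p chi I w d i ^+ 2 = (wsum I w d `^ ((p - 1) / 2) * chi) ^+ 2.
Proof.
move=> p1; set P := wsum I w d.
have -> : \sum_(i < I) dual_weight p chi I w d i ^+ 2 = P * P `^ (p / 2 - 1) ^+ 2 * chi ^+ 2.
  rewrite {1}/P /wsum !mulr_suml; apply: eq_bigr => i _.
  by rewrite /dual_weight -/P; ring.
rewrite exprMn; congr (_ * _); rewrite -!powR_sqr ?powR_ge0// -!powRrM.
have -> : (p / 2 - 1) * 2 = p - 1 - 1 by field.
have p10 : 0 < p - 1 by lra.
by rewrite (mulr_powRB1 (wsum_ge0 _ _ _) p10) divfK.
Qed.

Lemma dual_weight_le p chi I w d i : 1 < p -> 0 <= chi -> (i < I)%N ->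
  `|dual_weight p chi I w d i| <= wsum I w d `^ ((p - 1) / 2) * chi.
Proof.
move=> p1 c0 iI; rewrite -(@ler_pXn2r _ 2)// ?nnegrE// ?mulr_ge0// ?powR_ge0//.
rewrite -dual_weight_sqr// real_normK ?num_real//.
rewrite (bigD1 (Ordinal iI))//= lerDl; apply: sumr_ge0 => j _; exact: sqr_ge0.
Qed.

(** The left side is A^p chi^(p/(p-1)), and this power of chi is at most chi because 0 <= chi <= 1
    and the exponent is at least 1. *)
Lemma dual_weight_norm p chi I w d : 1 < p -> 0 <= chi -> chi <= 1 ->
  (\sum_(i < I) dual_weight p chi I w d i ^+ 2) `^ (p / (p - 1) / 2) <=
  wsum I w d `^ (p / 2) * chi.
Proof.
move=> p1 c0 c1; have p10 : 0 < p - 1 by lra.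
have r1 : 1 <= p / (p - 1) by rewrite ler_pdivlMr//; lra.
have Q0 : 0 <= wsum I w d `^ ((p - 1) / 2) by exact: powR_ge0.
rewrite dual_weight_sqr// -powR_sqr ?mulr_ge0// -powRrM.
have -> : 2 * (p / (p - 1) / 2) = p / (p - 1) by field; rewrite gt_eqF.
rewrite powRM// -powRrM (_ : (p - 1) / 2 * (p / (p - 1)) = p / 2); last first.
  by field; rewrite gt_eqF.
apply: ler_wpM2l; first exact: powR_ge0.
have [->|cn] := eqVneq chi 0; first by rewrite powR0// gt_eqF//; lra.
rewrite -[leRHS]powRr1//; apply: ger_powR => //.
by rewrite c1 andbT lt_neqAle eq_sym cn.
Qed.

End dual_weights.

Lemma sum_sqr_le {R : realType} (I : Type) (s : seq I) (t : I -> R) :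
  (forall i, 0 <= t i) -> \sum_(i <- s) t i ^+ 2 <= (\sum_(i <- s) t i) ^+ 2.
Proof.
move=> t0; elim: s => [|i s IH]; first by rewrite !big_nil expr0n.
rewrite !big_cons sqrrD -addrA lerD2l; apply: le_trans IH _.
by rewrite lerDr mulrn_wge0// mulr_ge0// sumr_ge0.
Qed.

Section single_scale_estimate.
Context {R : realType} {n : nat}.
Local Notation T := 'rV[R]_n.
Implicit Types (u : T -> R) (x y h : T) (a b p : R).

Variables psi eta : T -> R.
Hypotheses (tpsi : tame psi) (teta : tame eta) (pe : lp_symbols psi eta).
Hypothesis n0 : (0 < n)%N.
Hypothesis eta_even : forall x, eta (- x) = eta x.
Hypothesis psi_decay : exists A, forall x, `|psi x| * (1 + l1 x) ^+ (n.+1 + n.+3) <= A.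

Definition scale_sum I a0 (L : nat -> nat) u x : R :=
  \sum_(i < I) (L i)%:R^-1 ^+ 2 * lpd eta (a0 * 2 ^+ i) u x ^+ 2.

Lemma scale_sum_ge0 I a0 L u x : 0 <= scale_sum I a0 L u x.
Proof. by apply: sumr_ge0 => i _; rewrite mulr_ge0// sqr_ge0. Qed.

Lemma bl_scale_sum I a0 L u : 0 < a0 -> bl u -> bl (scale_sum I a0 L u).
Proof.
move=> a00 bu; apply: bl_sum => i _; apply: bl_mulr; first exact: bdm_cst.
by apply: bl_exp; apply: (bl_lpd teta) => //; rewrite mulr_gt0// exprn_gt0.
Qed.

(** C is fixed before e, so that the term in the test functions can be absorbed afterwards. *)
Lemma pairing_le p : 1 < p -> p <= 2 -> exists2 C, 0 <= C & forall e, 0 < e ->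
  exists2 K, 0 <= K & forall I a0 b h u (L : nat -> nat) (beta : nat -> T -> R),
  0 < a0 -> 0 < b -> (forall i, 0 < L i)%N ->
  (forall i (l : nat), (l < L i)%N -> l%:R * (a0 * 2 ^+ i) <= b) ->
  bl u -> (forall i, bl (beta i)) ->
  `|\sum_(i < I) dil (b / 4) psi h * Int (fun x => (u x - u (x - h)) *
      lpd eta (a0 * 2 ^+ i) (shift_mean (L i) h (beta i)) x)| <=
  K * (dil b tail h * Int (fun x => `|u x - u (x - h)| `^ p)) +
  e * (C * Int (fun x => (\sum_(i < I) beta i x ^+ 2) `^ (p / (p - 1) / 2))) *
    `|dil (b / 4) psi h|.
Proof.
move=> p1 p2; set r := p / (p - 1).
have r2 : 2 <= r by rewrite /r ler_pdivlMr; lra.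
have [C C0 HC] := shifted_square_function tpsi teta pe n0 r2.
have [A A0 HA] := psi_tail psi_decay.
exists C => // e e0; have [K K0 HK] := young_conj p1 e0.
exists (K * A) => [|I a0 b h u L beta a00 b0 L0 Lb bu bb]; first exact: mulr_ge0.
have ai i : 0 < a0 * 2 ^+ i by rewrite mulr_gt0// exprn_gt0.
have bm i : bl (shift_mean (L i) h (beta i)) by exact: (bl_shift_mean _ _ (bb i)).
have bl_i i : bl (lpd eta (a0 * 2 ^+ i) (shift_mean (L i) h (beta i))).
  exact: (bl_lpd teta (ai i) (bm i)).
have buh : bl (fun x => u x - u (x - h)) by exact: bl_sub bu (bl_subr h bu).
have := HC I a0 b h L beta a00 L0 Lb bb.
have bV : bl (fun x => \sum_(i < I) lpd eta (a0 * 2 ^+ i) (shift_mean (L i) h (beta i)) x).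
  by apply: bl_sum => i _; exact: bl_i.
have -> : \sum_(i < I) dil (b / 4) psi h * Int (fun x => (u x - u (x - h)) *
      lpd eta (a0 * 2 ^+ i) (shift_mean (L i) h (beta i)) x) =
    dil (b / 4) psi h * Int (fun x => (u x - u (x - h)) *
      \sum_(i < I) lpd eta (a0 * 2 ^+ i) (shift_mean (L i) h (beta i)) x).
  rewrite -mulr_sumr; congr (_ * _).
  rewrite -Int_sum; last by move=> i _; exact: (bl_mulr (bl_bdm buh) (bl_i i)).
  by apply: eq_Int => x; rewrite mulr_sumr.
move: bV; set V := fun x => \sum_(i < I) _; set Z := Int (fun x => (\sum_(i < I) _) `^ _) => bV HV.
set G := Int _; set G' := Int _ in HV; set D := fun x => u x - u (x - h) in buh *.
pose th := (1 + b * l1 h) ^+ n.+1; have th1 : 1 <= th.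
  by rewrite exprn_ege1// lerDl mulr_ge0 ?l1_ge0// ltW.
have th0 : 0 <= th by lra.
have t1 : 1 <= th `^ 2^-1.
  rewrite -[leLHS](_ : 1 `^ 2^-1 = 1); last by rewrite powR1.
  by apply: powR_le_mono; rewrite ?invr_ge0.
(* With t^2 = (1 + b |h|)^(n+1), the factor t^-r cancels the loss of the square function estimate
   exactly, and t^2 lands beside [dil (b / 4) psi], whose decay pays for it. *)
have H := Int_young p1 p2 t1 buh bV HK K0.
have tE : th `^ 2^-1 ^+ 2 = th by rewrite -powR_sqr ?powR_ge0// -powRrM mulVf// powRr1.
rewrite normrM mulrC; apply: le_trans (ler_wpM2r (normr_ge0 _) H) _.
rewrite mulrDl; apply: lerD.
  rewrite tE -/G mulrAC -mulrA;
  have := HA b h b0; rewrite -/th.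
  set f := `|_|; set g := dil b tail h => fg.
  have G0 : 0 <= Int (fun x => `|D x| `^ p) by apply: Int_ge0 => x; exact: powR_ge0.
  have e1 : K * (f * (th * Int (fun x => `|D x| `^ p))) = K * (f * th * Int (fun x => `|D x| `^ p)) by ring.
  have e2 : K * A * (g * Int (fun x => `|D x| `^ p)) = K * (A * g * Int (fun x => `|D x| `^ p)) by ring.
  rewrite e1 e2; apply: (ler_wpM2l K0); exact: (ler_wpM2r G0 fg).
apply: ler_wpM2r; first exact: normr_ge0.
apply: ler_wpM2l; first exact: ltW.
apply: le_trans (ler_wpM2l (powR_ge0 _ _) HV) _.
rewrite -/th -/Z.
have -> : th `^ 2^-1 `^ (- r) * (C * th `^ (r / 2) * Z) =
    C * (th `^ 2^-1 `^ (- r) * th `^ (r / 2)) * Z by ring.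
rewrite -powRrM -powRD; last by rewrite (gt_eqF (lt_le_trans ltr01 th1)) implybT.
by rewrite (_ : 2^-1 * - r + r / 2 = 0) ?powRr0 ?mulr1//; field.
Qed.

Lemma scale_sumE I a0 L u x : scale_sum I a0 L u x =
  wsum I (fun i => (L i)%:R^-1) (fun i => lpd eta (a0 * 2 ^+ i) u x).
Proof. by []. Qed.

Lemma bl_dual_weight p I a0 L u (chi : T -> R) i : 1 < p -> p <= 2 -> 0 < a0 -> bl u ->
  bl chi -> (forall x, 0 <= chi x) -> (i < I)%N ->
  bl (fun x => dual_weight p (chi x) I (fun j => (L j)%:R^-1)
    (fun j => lpd eta (a0 * 2 ^+ j) u x) i).
Proof.
move=> p1 p2 a00 bu bc c0 iI; have q0 : 0 <= (p - 1) / 2 by rewrite divr_ge0//; lra.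
have bS := bl_scale_sum I L a00 bu.
have bd : bl (lpd eta (a0 * 2 ^+ i) u).
  by apply: (bl_lpd teta) => //; rewrite mulr_gt0// exprn_gt0.
apply: (@bl_dom _ _ _ (fun x => scale_sum I a0 L u x `^ ((p - 1) / 2) * chi x)) => [||x].
- apply: mf_mul; last exact: bl_mf.
  apply: mf_mul; first by apply: mf_mul; [exact: mf_cst|exact: bl_mf].
  exact: (mf_powR _ (bl_mf bS)).
- exact: (bl_mulr (bdm_powR q0 (bl_bdm bS)) bc).
- exact: dual_weight_le.
Qed.

Lemma Int_dil_norm b : 0 < b -> Int (fun h => `|dil (b / 4) psi h|) = Int (fun h => `|psi h|).
Proof.
move=> b0; have b4 : 0 < b / 4 by rewrite divr_gt0.
rewrite -(Int_dil b4 (bl_norm (tame_bl tpsi))); apply: eq_Int => h.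
by rewrite /dil normrM ger0_norm// exprn_ge0// ltW.
Qed.

Lemma single_scale_cutoff p : 1 < p -> p <= 2 -> exists2 C, 0 <= C &
  forall I a0 b u (L : nat -> nat) (chi : T -> R), 0 < a0 -> 0 < b -> (forall i, 0 < L i)%N ->
  (forall i, b <= (L i)%:R * (a0 * 2 ^+ i)) ->
  (forall i (l : nat), (l < L i)%N -> l%:R * (a0 * 2 ^+ i) <= b) ->
  bl u -> bl chi -> (forall x, 0 <= chi x) -> (forall x, chi x <= 1) ->
  Int (fun x => scale_sum I a0 L u x `^ (p / 2) * chi x) <=
  C * Int (fun h => dil b tail h * Int (fun x => `|u x - u (x - h)| `^ p)).
Proof.
move=> p1 p2; have [C C0 HC] := pairing_le p1 p2.
set N1 := Int (fun h => `|psi h|); have N10 : 0 <= N1 by apply: Int_ge0.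
have CN : 0 <= C * N1 by exact: mulr_ge0.
(* Since Z <= Y and the L^1 norm of [dil (b / 4) psi] is N1, this makes the term in the test
   functions at most Y / 2, which is finite thanks to the cutoff. *)
pose e := (2 * (C * N1 + 1))^-1; have e0 : 0 < e by rewrite invr_gt0; lra.
have [K K0 HK] := HC e e0.
exists (2 * K) => [|I a0 b u L chi a00 b0 L0 bL Lb bu bc c0 c1]; first exact: mulr_ge0.
have ai i : 0 < a0 * 2 ^+ i by rewrite mulr_gt0// exprn_gt0.
pose w j : R := (L j)%:R^-1; pose d j := lpd eta (a0 * 2 ^+ j) u.
have bd j : bl (d j) := bl_lpd teta (ai j) bu.
pose beta i := if (i < I)%N then fun x => dual_weight p (chi x) I w (fun j => d j x) i else fun=> 0.
have bbeta i : bl (beta i).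
  rewrite /beta; case: ifPn => iI; last exact: bl0.
  exact: bl_dual_weight.
have betaE (i : 'I_I) x : beta i x = dual_weight p (chi x) I w (fun j => d j x) i.
  by rewrite /beta ltn_ord.
pose G h := Int (fun x => `|u x - u (x - h)| `^ p).
have p1' : 1 <= p by lra.
have bG : bdm G by exact: bdm_Int_translate.
have bt : bl (dil b (@tail R n)) by apply: bl_dil => //; exact: bl_tail.
have btG : bl (fun h => dil b tail h * G h) by exact: bl_mull bt bG.
have b4 : 0 < b / 4 by rewrite divr_gt0.
have bphi : bl (fun h => `|dil (b / 4) psi h|) := bl_norm (bl_dil b4 (tame_bl tpsi)).
pose Y := Int (fun x => scale_sum I a0 L u x `^ (p / 2) * chi x).
pose F (i : nat) h := dil (b / 4) psi h *
  Int (fun x => (u x - u (x - h)) * lpd eta (a0 * 2 ^+ i) (shift_mean (L i) h (beta i)) x).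
have bF i : bl (F i).
  by have [] := piece_identity tpsi teta pe eta_even b0 (ai i) (L0 i) (bL i) bu (bbeta i).
have YE : Y = Int (fun h => \sum_(i < I) F i h).
  rewrite Int_sum; last by move=> i _; exact: bF.
  have bt' (i : 'I_I) : bl (fun x => w i * beta i x * d i x).
    exact: (bl_mulr (bdm_mul (bdm_cst _) (bl_bdm (bbeta i))) (bd i)).
  transitivity (\sum_(i < I) Int (fun x => w i * beta i x * d i x)).
    rewrite -Int_sum; last by move=> i _; exact: bt'.
    apply: eq_Int => x; rewrite scale_sumE -dual_weight_pairing//.
    by apply: eq_bigr => i _; rewrite betaE.
  apply: eq_bigr => i _.
  by have [_] := piece_identity tpsi teta pe eta_even b0 (ai i) (L0 i) (bL i) bu (bbeta i).
pose Z := Int (fun x => (\sum_(i < I) beta i x ^+ 2) `^ (p / (p - 1) / 2)).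
have q1 : 1 <= p / (p - 1) / 2 by rewrite ler_pdivlMr// ler_pdivlMr; lra.
have p20 : 0 <= p / 2 by rewrite divr_ge0//; lra.
have ZY : Z <= Y.
  apply: Int_le => [||x].
  - apply: (bl_powR0 q1) => [x|]; first by apply: sumr_ge0 => i _; exact: sqr_ge0.
    by apply: bl_sum => i _; exact: (bl_exp 1 (bbeta i)).
  - apply: bl_mulr bc; apply: (bdm_powR p20); apply: bl_bdm; exact: bl_scale_sum.
  - under eq_bigr do rewrite betaE.
    exact: dual_weight_norm.
have Y0 : 0 <= Y by apply: Int_ge0 => x; rewrite mulr_ge0// powR_ge0.
have b1 : bl (fun h => K * (dil b tail h * G h)) by exact: (bl_mulr (bdm_cst _) btG).
have b2 : bl (fun h => e * (C * Z) * `|dil (b / 4) psi h|) by exact: (bl_mulr (bdm_cst _) bphi).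
have bFs : bl (fun h => \sum_(i < I) F i h) by apply: bl_sum => i _; exact: bF.
have H : Y <= K * Int (fun h => dil b tail h * G h) + e * (C * Z) * N1.
  rewrite YE -(IntZ _ btG) /N1 -(Int_dil_norm b0) -(IntZ _ bphi) -(Int_add b1 b2).
  apply: (Int_le bFs (bl_add b1 b2)) => h.
  exact: le_trans (ler_norm _) (HK I a0 b h u L beta a00 b0 L0 Lb bu bbeta).
have H2 : e * (C * Z) * N1 <= Y / 2.
  apply: (@le_trans _ _ (e * (C * Y) * N1)).
    by apply: ler_wpM2r => //; apply: ler_wpM2l; [exact: ltW|exact: ler_wpM2l].
  have -> : e * (C * Y) * N1 = (C * N1) * Y * e by ring.
  rewrite /e ler_pdivrMr; last lra.
  have -> : Y / 2 * (2 * (C * N1 + 1)) = (C * N1) * Y + Y by field.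
  by rewrite lerDl.
have H3 : Y <= K * Int (fun h => dil b tail h * G h) + Y / 2 by exact: le_trans H (lerD _ _).
by rewrite -/Y -/(G _) -mulrA; move: H3; clear; lra.
Qed.

Theorem single_scale p : 1 < p -> p <= 2 -> exists2 C, 0 <= C &
  forall I a0 b u (L : nat -> nat), 0 < a0 -> 0 < b -> (forall i, 0 < L i)%N ->
  (forall i, b <= (L i)%:R * (a0 * 2 ^+ i)) ->
  (forall i (l : nat), (l < L i)%N -> l%:R * (a0 * 2 ^+ i) <= b) ->
  bl u -> bl (fun x => scale_sum I a0 L u x `^ (p / 2)) /\
  Int (fun x => scale_sum I a0 L u x `^ (p / 2)) <=
  C * Int (fun h => dil b tail h * Int (fun x => `|u x - u (x - h)| `^ p)).
Proof.
move=> p1 p2; have [C C0 HC] := single_scale_cutoff p1 p2.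
exists C => // I a0 b u L a00 b0 L0 bL Lb bu.
have bS := bl_scale_sum I L a00 bu; have S0 := scale_sum_ge0 I a0 L u.
have ai i : 0 < a0 * 2 ^+ i by rewrite mulr_gt0// exprn_gt0.
have p20 : 0 <= p / 2 by rewrite divr_ge0//; lra.
(* The exponent p / 2 is at most 1, so integrability is taken from the bound A <= sum of the |d_i|,
   whose p-th power is integrable. *)
have bA : bl (fun x => scale_sum I a0 L u x `^ (p / 2)).
  pose D x := \sum_(i < I) `|lpd eta (a0 * 2 ^+ i) u x|.
  have bD : bl D by apply: bl_sum => i _; apply: bl_norm; exact: (bl_lpd teta (ai i) bu).
  have D0 x : 0 <= D x by exact: sumr_ge0.
  have p1' : 1 <= p by lra.
  apply: (bl_dom (mf_powR _ (bl_mf bS)) (bl_powR0 p1' D0 bD)) => x.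
  rewrite ger0_norm ?powR_ge0//.
  have -> : D x `^ p = (D x ^+ 2) `^ (p / 2) by rewrite -powR_sqr// -powRrM mulrC divfK.
  apply: powR_le_mono => //; apply: (@le_trans _ _ (\sum_(i < I) `|lpd eta (a0 * 2 ^+ i) u x| ^+ 2)).
    apply: ler_sum => i _; rewrite real_normK ?num_real//; apply: ler_piMl; first exact: sqr_ge0.
    by rewrite exprn_ile1 ?invr_ge0// invf_le1// ?ltr0n// ler1n.
  exact: (@sum_sqr_le R _ (index_enum 'I_I) (fun i => `|lpd eta (a0 * 2 ^+ i) u x|)
    (fun i => normr_ge0 _)).
split=> //.
(* Integrable cutoffs tending to 1 pointwise; Fatou removes them. *)
pose chi k x := expR (- l1 ((k.+1%:R^-1 : R) *: x)) : R.
have bchi k : bl (chi k).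
  by apply: (@bl_scale _ _ (fun x => expR (- l1 x))); [rewrite invr_eq0|exact: bl_exp_l1].
have c1 k x : chi k x <= 1 by rewrite -expR0 ler_expR oppr_le0 l1_ge0.
have c0 k x : 0 <= chi k x by exact: expR_ge0.
apply: (fatou_bl (f_ := fun k x => scale_sum I a0 L u x `^ (p / 2) * chi k x)) => //.
- by move=> k; exact: (bl_mull bA (bl_bdm (bchi k))).
- by move=> k x; rewrite mulr_ge0// powR_ge0.
- move=> x; rewrite -[X in _ --> X]mulr1; apply: cvgM; first exact: cvg_cst.
  have -> : 1 = expR (- (0 * l1 x)) by rewrite mul0r oppr0 expR0.
  under eq_fun do rewrite /chi l1Z//.
  apply: continuous_cvg; first exact: continuous_expR.
  by apply: cvgN; apply: cvgM; [exact: cvg_harmonic|exact: cvg_cst].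
- by move=> k; exact: HC.
Qed.

End single_scale_estimate.

(** * Dyadic sums and geometric series *)

Section dyadic_sums.
Context {R : realType}.
Implicit Types (y s t : R).

Lemma dyadic_min_sum y m : 0 < y ->
  \sum_(k < m) Num.min (y * 2 ^+ k) (y * 2 ^+ k)^-1 <= 3.
Proof.
(* V is a potential with values between 0 and 3 whose increment from t to 2t dominates min (t, 1/t),
   so the sum telescopes. *)
move=> y0; pose V t : R := if t <= 1 then t else 3 - 2 / t.
have V0 t : 0 < t -> 0 <= V t.
  move=> t0; rewrite /V; have [t1|t1] := leP t 1; first exact: ltW.
  by rewrite subr_ge0 ler_pdivrMr//; lra.
have V3 t : 0 < t -> V t <= 3.
  move=> t0; rewrite /V; have [t1|t1] := leP t 1; first lra.
  by rewrite gerBl divr_ge0// ltW.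
have step t : 0 < t -> Num.min t t^-1 <= V (2 * t) - V t.
  move=> t0; have ti : t * t^-1 = 1 by rewrite divff// gt_eqF.
  have i0 : 0 < t^-1 by rewrite invr_gt0.
  rewrite /V invfM; have [t1|t1] := leP t 1; have [t2|t2] := leP (2 * t) 1.
  - have -> : 2 * t - t = t by ring.
    by rewrite ge_min lexx.
  - rewrite ge_min; apply/orP; left.
    have e : t * (3 - 2 * (2^-1 * t^-1) - t - t) = 3 * t - t * t^-1 - 2 * t ^+ 2 by field; rewrite gt_eqF.
    rewrite -subr_ge0 -(pmulr_rge0 _ t0) e ti; nra.
  - lra.
  - rewrite ge_min; apply/orP; right.
    by rewrite le_eqVlt; apply/orP; left; apply/eqP; field; rewrite gt_eqF.
suff : \sum_(k < m) Num.min (y * 2 ^+ k) (y * 2 ^+ k)^-1 <= V (y * 2 ^+ m) - V y.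
  have ym : 0 < y * 2 ^+ m by rewrite mulr_gt0// exprn_gt0.
  have := V3 _ ym; have := V0 _ y0; lra.
elim: m => [|m IH]; first by rewrite big_ord0 expr0 mulr1 subrr.
have ym : 0 < y * 2 ^+ m by rewrite mulr_gt0// exprn_gt0.
have := step _ ym; rewrite big_ord_recr /= exprS mulrCA; lra.
Qed.

(** For y <= 1 it is enough that n + s >= 1; for y > 1 that n + s + 1 <= n + 3, which is where s <=
    2 enters. *)
Lemma tail_weight_le n s y : (0 < n)%N -> 0 < s -> s <= 2 -> 0 < y ->
  y `^ (n%:R + s) * ((1 + y) ^+ n.+3)^-1 <= Num.min y y^-1.
Proof.
move=> n0 s0 s2 y0; have y1 : 0 < 1 + y by lra.
have n1 : 1 <= n%:R :> R by rewrite ler1n.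
have p1 : 1 <= (1 + y) ^+ n.+3 by rewrite exprn_ege1//; lra.
have yn0 : y != 0 by rewrite gt_eqF.
have q0 : 0 < (1 + y) ^+ n.+3 by rewrite exprn_gt0.
have [h|h] := leP y 1.
  have -> : Num.min y y^-1 = y.
    by apply/min_idPl; rewrite (le_trans h)// invf_ge1.
  rewrite ler_pdivrMr//; apply: (@le_trans _ _ y); last first.
    by rewrite ler_peMr// ltW.
  rewrite -[leRHS]powRr1 ?(ltW y0)//; apply: ger_powR; first by rewrite y0.
  lra.
have -> : Num.min y y^-1 = y^-1.
  by apply/min_idPr; rewrite (le_trans _ (ltW h))// invf_le1// ltW.
rewrite ler_pdivrMr//; apply: (@le_trans _ _ (y ^+ n.+2)).
  rewrite -powR_mulrn ?(ltW y0)//; apply: ler_powR; first exact: ltW.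
  rewrite -addn2 natrD; lra.
apply: (@le_trans _ _ (y^-1 * y ^+ n.+3)).
  by rewrite [y ^+ n.+3]exprS mulrA mulVf// mul1r.
rewrite ler_wpM2l ?invr_ge0 ?(ltW y0)//; apply: lerXn2r; rewrite ?nnegrE; lra.
Qed.

(** From 4^s <= 1 + 3 s, which is Bernoulli with exponent 1/s, and (1 + 3 s)^-1 >= 1 - 3 s. *)
Lemma quarter_powR_ge s : 0 < s -> s <= 1 -> 1 - 3 * s <= 4^-1 `^ s.
Proof.
move=> s0 s1; have s'1 : 1 <= s^-1 by rewrite invf_ge1.
have t0 : 0 <= 1 + 3 * s by lra.
have t1 : 0 < 1 + 3 * s by lra.
have := bernoulli t0 s'1; rewrite (_ : 1 + _ = 4); last by field; rewrite gt_eqF.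
move=> h; have h4 : 4 `^ s <= 1 + 3 * s.
  have -> : 1 + 3 * s = ((1 + 3 * s) `^ s^-1) `^ s by rewrite -powRrM mulVf ?powRr1// gt_eqF.
  by apply: powR_le_mono => //; exact: ltW.
have -> : 4^-1 `^ s = (4 `^ s)^-1 :> R by rewrite -[4^-1]powR_inv1// -powRrM mulN1r powRN.
apply: (@le_trans _ _ (1 + 3 * s)^-1); last by rewrite lef_pV2 ?posrE// powR_gt0.
by rewrite -[leRHS]mul1r ler_pdivlMr//; nra.
Qed.

(** The sum is (1 - r^K) / (1 - r), with numerator at least 1/2 and denominator at most 3 s. K
    depends on s, the resulting bound does not. *)
Lemma geometric_sum_ge s K : 0 < s -> s < 1 -> (4^-1 `^ s) ^+ K <= 2^-1 ->
  6^-1 * s^-1 <= \sum_(m < K) (4^-1 `^ s) ^+ m.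
Proof.
move=> s0 s1; set r := 4^-1 `^ s => rK; have h := quarter_powR_ge s0 (ltW s1).
have h' := quarter_powR_le s0 (ltW s1); rewrite -/r in h h'.
have r1 : 0 < 1 - r by lra.
have -> : \sum_(m < K) r ^+ m = (1 - r ^+ K) / (1 - r).
  apply: (mulfI (lt0r_neq0 r1)); rewrite mulrCA divff ?gt_eqF// mulr1.
  by rewrite -[1 - r]opprB mulNr -subrX1 opprB.
apply: (@le_trans _ _ (2^-1 * (3 * s)^-1)).
  by rewrite le_eqVlt; apply/orP; left; apply/eqP; field; rewrite gt_eqF.
apply: ler_pM; rewrite ?invr_ge0//; [by rewrite mulr_ge0// ltW|lra|].
by rewrite lef_pV2 ?posrE//; [lra|by rewrite mulr_gt0].
Qed.

Lemma geometric_half s : 0 < s -> s < 1 -> \forall K \near \oo, (4^-1 `^ s) ^+ K <= 2^-1 :> R.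
Proof.
move=> s0 s1; have h := quarter_powR_le s0 (ltW s1).
have r1 : `|4^-1 `^ s| < 1 :> R by rewrite ger0_norm ?powR_ge0//; lra.
have c : (4^-1 `^ s) ^+ K @[K --> \oo] --> (0 : R) by exact: cvg_expr.
by apply: cvgr_le c _ _; rewrite invr_gt0.
Qed.

Lemma sum_window (f : nat -> R) c K N : (forall k, 0 <= f k) -> (c + K <= N)%N ->
  \sum_(m < K) f (c + m)%N <= \sum_(k < N) f k.
Proof.
move=> f0 /subnKC <-; rewrite !big_split_ord /= -addrA.
rewrite -[leLHS]add0r; apply: lerD; first by apply: sumr_ge0.
by rewrite lerDl; apply: sumr_ge0.
Qed.

End dyadic_sums.

Section dyadic_scales.
Context {R : realType}.
Implicit Types (s : R) (J M k i : nat).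

(** This is max (1, b / a) for b = 2^(k-M) and a = 2^(i-J), the truncated subtraction providing the
    maximum. *)
Definition steps J M k i : nat := 2 ^ (k + J - (i + M)).

Lemma steps_gt0 J M k i : (0 < steps J M k i)%N.
Proof. by rewrite expn_gt0. Qed.

Lemma dya_high J M k i : (i + M <= k + J)%N ->
  dya M k = 2 ^+ (k + J - (i + M)) * dya J i :> R.
Proof.
move=> h; have e : (k + J = (k + J - (i + M)) + (i + M))%N by rewrite subnK.
have := congr1 (fun m => (2 : R) ^+ m) e; rewrite !exprD => E.
have J0 : (2 : R) ^+ J != 0 by rewrite gt_eqF// exprn_gt0.
have M0 : (2 : R) ^+ M != 0 by rewrite gt_eqF// exprn_gt0.
apply: (mulIf (mulf_neq0 J0 M0)); rewrite /dya.
have -> : 2 ^- M * 2 ^+ k * (2 ^+ J * 2 ^+ M) = 2 ^+ k * 2 ^+ J :> R by field.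
by rewrite E; field.
Qed.

Lemma dya_low J M k i : (k + J <= i + M)%N ->
  dya M k = 2 ^- (i + M - (k + J)) * dya J i :> R.
Proof.
move=> h; rewrite (dya_high h) mulrA mulVf ?mul1r// gt_eqF// exprn_gt0//.
Qed.

Lemma steps_reach J M k i : dya M k <= (steps J M k i)%:R * dya J i :> R.
Proof.
rewrite /steps natrX; have [h|h] := leqP (i + M) (k + J).
  by rewrite (dya_high h).
rewrite (dya_low (ltnW h)); apply: ler_wpM2r; first exact: ltW (dya_gt0 _ _).
have -> : (k + J - (i + M))%N = 0%N by apply/eqP; rewrite subn_eq0 ltnW.
by rewrite expr0 invf_le1 ?exprn_gt0// exprn_ege1// ler1n.
Qed.

Lemma steps_below J M k i (l : nat) : (l < steps J M k i)%N -> l%:R * dya J i <= dya M k :> R.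
Proof.
rewrite /steps; have [h|h] := leqP (i + M) (k + J).
  move=> hl; rewrite (dya_high h); apply: ler_wpM2r; first exact: ltW (dya_gt0 _ _).
  by rewrite -natrX ler_nat ltnW.
have -> : (k + J - (i + M))%N = 0%N by apply/eqP; rewrite subn_eq0 ltnW.
by rewrite expn0 ltnS leqn0 => /eqP ->; rewrite mul0r ltW// dya_gt0.
Qed.

Definition scale_weight s J M k i : R :=
  dya M k `^ (2 * s) * (steps J M k i)%:R^-1 ^+ 2.

Lemma scale_weight_ge0 s J M k i : 0 <= scale_weight s J M k i.
Proof. by rewrite mulr_ge0 ?powR_ge0// sqr_ge0. Qed.

Lemma scale_weight_low s J M k i : (k + J <= i + M)%N ->
  scale_weight s J M k i = (4^-1 `^ s) ^+ (i + M - (k + J)) * dya J i `^ (2 * s).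
Proof.
move=> h; have d0 := @dya_gt0 R J i.
rewrite /scale_weight /steps (dya_low h) powRM ?invr_ge0 ?exprn_ge0 ?(ltW d0)//.
have -> : (k + J - (i + M))%N = 0%N by apply/eqP; rewrite subn_eq0.
rewrite expn0 invr1 expr1n mulr1; congr (_ * _).
by rewrite -powR_inv1 ?exprn_ge0// -powRrM mulN1r two_powR_X.
Qed.

Lemma scale_weight_high s J M k i : (i + M <= k + J)%N ->
  scale_weight s J M k i = (4^-1 `^ (1 - s)) ^+ (k + J - (i + M)) * dya J i `^ (2 * s).
Proof.
move=> h; have d0 := @dya_gt0 R J i; set m := (k + J - (i + M))%N.
have m0 : 0 < (2 : R) ^+ m by rewrite exprn_gt0.
rewrite /scale_weight /steps -/m (dya_high h) -/m powRM ?(ltW m0) ?(ltW d0)//.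
rewrite mulrAC; congr (_ * _); rewrite natrX -two_powR_X -powR_inv1 ?(ltW m0)//.
rewrite -powR_sqr ?powR_ge0// -powRrM -powRD ?(gt_eqF m0) ?implybT//.
by congr (_ `^ _); ring.
Qed.

Lemma scale_weight_le s J M k i : 0 < s -> s < 1 ->
  scale_weight s J M k i <= dya J i `^ (2 * s).
Proof.
move=> s0 s1.
have q (t : R) m : 0 < t -> t < 1 -> (4^-1 `^ t) ^+ m * dya J i `^ (2 * s) <= dya J i `^ (2 * s).
  move=> t0 t1; rewrite ler_piMl ?powR_ge0// exprn_ile1 ?powR_ge0//.
  by have := quarter_powR_le t0 (ltW t1); lra.
have [h|/ltnW h] := leqP (i + M) (k + J).
  by rewrite scale_weight_high//; apply: q; lra.
by rewrite scale_weight_low//; apply: q; lra.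
Qed.

(** At m octaves from a = [dya J i], the weight is a^(2s) times 4^(-s m) if b <= a, and 4^(-(1-s) m)
    if b >= a. Enlarging the window of b by K octaves on each side leaves room for K terms of both
    series at every i. *)
Lemma scale_weight_sum s J K i : 0 < s -> s < 1 -> (i < J.*2.+1)%N ->
  (4^-1 `^ s) ^+ K <= 2^-1 :> R -> (4^-1 `^ (1 - s)) ^+ K <= 2^-1 :> R ->
  12^-1 * (s^-1 + (1 - s)^-1) * dya J i `^ (2 * s) <=
  \sum_(k < (J + K).*2.+1) scale_weight s J (J + K) k i.
Proof.
move=> s0 s1 iJ h1 h2; set N := (J + K).*2.+1; set D := dya J i `^ (2 * s).
have D0 : 0 <= D by exact: powR_ge0.
have w0 k := scale_weight_ge0 s J (J + K) k i.
have A1 : 6^-1 * s^-1 * D <= \sum_(k < N) scale_weight s J (J + K) k i.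
  apply: (le_trans (ler_wpM2r D0 (geometric_sum_ge s0 s1 h1))).
  have hc : (i.+1 + K <= N)%N by rewrite /N -!addnn in iJ *; lia.
  apply: le_trans (sum_window w0 hc); rewrite (reindex_inj rev_ord_inj) mulr_suml.
  rewrite le_eqVlt; apply/orP; left; apply/eqP; apply: eq_bigr => m _ /=.
  have mK := ltn_ord m.
  rewrite scale_weight_low; last lia.
  by congr (_ ^+ _ * _); lia.
have s1' : 0 < 1 - s by lra.
have s2' : 1 - s < 1 by lra.
have A2 : 6^-1 * (1 - s)^-1 * D <= \sum_(k < N) scale_weight s J (J + K) k i.
  apply: (le_trans (ler_wpM2r D0 (geometric_sum_ge s1' s2' h2))).
  have hc : (i + K + K <= N)%N by rewrite /N -!addnn in iJ *; lia.
  apply: le_trans (sum_window w0 hc); rewrite mulr_suml.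
  rewrite le_eqVlt; apply/orP; left; apply/eqP; apply: eq_bigr => m _ /=.
  rewrite scale_weight_high; last lia.
  by congr (_ ^+ _ * _); lia.
(* Both families contain the scale k = i + K, so the two lower bounds are averaged, not added; hence
   12 instead of 6. *)
have -> : 12^-1 * (s^-1 + (1 - s)^-1) * D = (6^-1 * s^-1 * D + 6^-1 * (1 - s)^-1 * D) / 2.
  by field; rewrite !gt_eqF.
lra.
Qed.

End dyadic_scales.


(** * The lower bound for real functions, p <= 2 *)

Section lower_bound.
Context {R : realType} {n : nat}.
Local Notation T := 'rV[R]_n.
Local Notation mu := (lebesgue_rV R n).
Implicit Types (u : T -> R) (x y h : T) (s p : R).

(** Each term is |h|^(-n-s) times a function of b |h|, which [tail_weight_le] bounds by min (b |h|,
    1 / (b |h|)). *)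
Lemma tail_sum_le s M N (h : T) : (0 < n)%N -> 0 < s -> s <= 2 -> 0 < l1 h ->
  \sum_(k < N) dya M k `^ s * dil (dya M k) tail h <= 3 * l1 h `^ (- (n%:R + s)).
Proof.
move=> n0 s0 s2 h0.
have E (k : nat) : dya M k `^ s * dil (dya M k) tail h <=
    Num.min (dya M 0 * l1 h * 2 ^+ k) (dya M 0 * l1 h * 2 ^+ k)^-1 * l1 h `^ (- (n%:R + s)).
  set b := dya M k; have b0 : 0 < b by exact: dya_gt0.
  have bh0 : 0 < b * l1 h by rewrite mulr_gt0.
  have -> : dya M 0 * l1 h * 2 ^+ k = b * l1 h by rewrite /b /dya expr0 mulr1 mulrAC.
  have := tail_weight_le n0 s0 s2 bh0.
  move=> /(ler_wpM2r (powR_ge0 (l1 h) (- (n%:R + s)))); apply: le_trans.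
  rewrite le_eqVlt; apply/orP; left; apply/eqP.
  rewrite /dil /tail (l1Z _ (ltW b0)) powRM ?l1_ge0 ?(ltW b0)//.
  rewrite powRD ?(gt_eqF b0) ?implybT// powR_mulrn ?(ltW b0)//.
  have e : l1 h `^ (n%:R + s) * l1 h `^ (- (n%:R + s)) = 1.
    by rewrite powRN divff// gt_eqF// powR_gt0.
  set t := ((1 + _) ^+ _)^-1; set P := l1 h `^ _ in e *; set Q := l1 h `^ _ in e *.
  have -> : b ^+ n * b `^ s * P * t * Q = b ^+ n * b `^ s * t * (P * Q) by ring.
  by rewrite e; ring.
apply: (le_trans (ler_sum _ (fun (k : 'I_N) _ => E k))).
rewrite -mulr_suml; apply: ler_wpM2r; first exact: powR_ge0.
by apply: dyadic_min_sum; rewrite mulr_gt0// dya_gt0.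
Qed.

(** As q <= 1 and X_k <= S, each X_k^q is at least S^(q-1) X_k. Hence c, which carries the factor in
    s, is not itself raised to the power q. *)
Lemma concave_sum_le (q c S : R) N (X : nat -> R) : 0 < q -> q <= 1 -> 0 <= S ->
  (forall k, 0 <= X k) -> (forall k, X k <= S) -> c * S <= \sum_(k < N) X k ->
  c * S `^ q <= \sum_(k < N) X k `^ q.
Proof.
move=> q0 q1 S0 X0 XS cS; have [->|Sn] := eqVneq S 0.
  rewrite powR0 ?gt_eqF// mulr0; apply: sumr_ge0 => k _; exact: powR_ge0.
have Sp : 0 < S by rewrite lt_neqAle eq_sym Sn.
apply: (@le_trans _ _ (S `^ (q - 1) * \sum_(k < N) X k)).
  apply: le_trans (ler_wpM2l (powR_ge0 S (q - 1)) cS).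
  rewrite mulrCA; rewrite -[X in c * (_ * X)]powRr1// -powRD ?Sn ?implybT//.
  by rewrite subrK.
rewrite mulr_sumr; apply: ler_sum => k _.
have [->|Xn] := eqVneq (X k) 0; first by rewrite mulr0 powR_ge0.
have Xp : 0 < X k by rewrite lt_neqAle eq_sym Xn X0.
rewrite -(mulr_powRB1 (X0 k) q0) mulrC; apply: ler_wpM2l => //.
rewrite -opprB; apply: powRN_le => //; lra.
Qed.

Variables psi eta : T -> R.
Hypotheses (tpsi : tame psi) (teta : tame eta) (pe : lp_symbols psi eta).
Hypothesis n0 : (0 < n)%N.
Hypothesis eta_even : forall x, eta (- x) = eta x.
Hypothesis psi_decay : exists A, forall x, `|psi x| * (1 + l1 x) ^+ (n.+1 + n.+3) <= A.

Theorem sqf_le_gag p : 1 < p -> p <= 2 -> exists2 C, 0 <= C & forall s u J,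
  0 < s -> s < 1 -> bl u ->
  bl (fun x => sqf eta s J u x `^ (p / 2)) /\
  (((s^-1 + (1 - s)^-1) * Int (fun x => sqf eta s J u x `^ (p / 2)))%:E <= C%:E * gag s p u)%E.
Proof.
move=> p1 p2; have [C C0 HC] := single_scale tpsi teta pe n0 eta_even psi_decay p1 p2.
pose q := p / 2; have q0 : 0 < q by rewrite /q; lra.
have q1 : q <= 1 by rewrite /q; lra.
have p1' : 1 <= p by lra.
exists (12 * (C * 3)) => [|s u J s0 s1 bu]; first by rewrite !mulr_ge0.
have s1' : 0 < 1 - s by lra.
have s2' : 1 - s < 1 by lra.
(* K depends on s but only enlarges the range of b; it does not enter the constant. *)
have [K h1 h2] : exists2 K, (4^-1 `^ s) ^+ K <= 2^-1 :> R & (4^-1 `^ (1 - s)) ^+ K <= 2^-1 :> R.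
  have [K1 _ H1] := geometric_half s0 s1; have [K2 _ H2] := geometric_half s1' s2'.
  by exists (maxn K1 K2); [apply: H1|apply: H2]; rewrite /= ?leq_maxl ?leq_maxr.
set kap := s^-1 + _; have kap0 : 0 < kap by rewrite addr_gt0// invr_gt0.
pose M := (J + K)%N; pose N := M.*2.+1; pose I := J.*2.+1.
have a0 : 0 < 2 ^- J :> R by rewrite invr_gt0 exprn_gt0.
pose P k := scale_sum eta I (2 ^- J) (steps J M k) u.
have P0 k x : 0 <= P k x by exact: scale_sum_ge0.
have Hk k : bl (fun x => P k x `^ q) /\ Int (fun x => P k x `^ q) <=
    C * Int (fun h => dil (dya M k) tail h * Int (fun x => `|u x - u (x - h)| `^ p)).
  exact: (HC I (2 ^- J) (dya M k) u (steps J M k) a0 (dya_gt0 M k) (steps_gt0 J M k)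
    (steps_reach J M k) (fun i l => @steps_below R J M k i l) bu).
pose G h := Int (fun x => `|u x - u (x - h)| `^ p).
have bG : bdm G by exact: bdm_Int_translate.
have G0 h : 0 <= G h by apply: Int_ge0 => x; exact: powR_ge0.
pose S := sqf eta s J u; have S0 x : 0 <= S x by exact: sqf_ge0.
have bS : bl S by exact: (bl_sqf teta).
have sp0 : 0 < s * p by rewrite mulr_gt0//; lra.
have sp2 : s * p <= 2 by nra.
have pw x : 12^-1 * kap * S x `^ q <= \sum_(k < N) dya M k `^ (s * p) * P k x `^ q.
  pose X k := dya M k `^ (2 * s) * P k x.
  have XE k : X k = \sum_(i < I) scale_weight s J M k i * lpd eta (dya J i) u x ^+ 2.
    by rewrite /X /P /scale_sum mulr_sumr; apply: eq_bigr => i _; rewrite mulrA.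
  have X0 k : 0 <= X k by rewrite mulr_ge0// powR_ge0.
  have XS k : X k <= S x.
    rewrite XE; apply: ler_sum => i _; apply: ler_wpM2r; first exact: sqr_ge0.
    exact: scale_weight_le.
  have cS : 12^-1 * kap * S x <= \sum_(k < N) X k.
    under eq_bigr do rewrite XE.
    rewrite exchange_big /= /S /sqf mulr_sumr; apply: ler_sum => i _.
    rewrite -mulr_suml mulrA; apply: ler_wpM2r; first exact: sqr_ge0.
    exact: scale_weight_sum.
  apply: le_trans (concave_sum_le q0 q1 (S0 x) X0 XS cS) _.
  rewrite le_eqVlt; apply/orP; left; apply/eqP; apply: eq_bigr => k _.
  rewrite /X powRM ?powR_ge0// -powRrM; congr (_ `^ _ * _).
  by rewrite /q; field.
have bR : bl (fun x => \sum_(k < N) dya M k `^ (s * p) * P k x `^ q).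
  by apply: bl_sum => k _; exact: (bl_mulr (bdm_cst _) (Hk k).1).
have bSq : bl (fun x => S x `^ q).
  have c0 : 0 < 12^-1 * kap by rewrite mulr_gt0.
  apply: (bl_dom (mf_powR _ (bl_mf bS)) (bl_mulr (bdm_cst (12^-1 * kap)^-1) bR)) => x.
  by rewrite ger0_norm ?powR_ge0// ler_pdivlMl.
split; first exact: bSq.
have bt k : bl (dil (dya M k) (@tail R n)) by apply: bl_dil; [exact: dya_gt0|exact: bl_tail].
have btG k : bl (fun h => dil (dya M k) tail h * G h) := bl_mull (bt k) bG.
pose W h := \sum_(k < N) dya M k `^ (s * p) * (dil (dya M k) tail h * G h).
have bW : bl W by apply: bl_sum => k _; exact: (bl_mulr (bdm_cst _) (btG k)).
have B1 : kap * Int (fun x => S x `^ q) <= 12 * (C * Int W).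
  rewrite -ler_pdivrMl// mulrA -(IntZ _ bSq).
  apply: le_trans (Int_le (bl_mulr (bdm_cst _) bSq) bR pw) _.
  rewrite Int_sum; last by move=> k _; exact: (bl_mulr (bdm_cst _) (Hk k).1).
  rewrite Int_sum; last by move=> k _; exact: (bl_mulr (bdm_cst _) (btG k)).
  rewrite mulr_sumr; apply: ler_sum => k _.
  rewrite (IntZ _ (Hk k).1) (IntZ _ (btG k)) mulrCA.
  by apply: ler_wpM2l; [exact: powR_ge0|exact: (Hk k).2].
apply: (@le_trans _ _ (12 * (C * Int W))%:E); first by rewrite lee_fin.
rewrite !EFinM -!muleA; apply: lee_wpmul2l => //; apply: lee_wpmul2l; first by rewrite lee_fin.
rewrite -(ge0_integral_bl bW) /gag -ge0_integralZl//; last 2 first.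
- apply/measurable_EFinP; apply: mf_mul; first by apply: mf_powR; exact: mf_l1.
  exact: mf_Int_translate.
- by move=> h _; rewrite lee_fin; apply: mulr_ge0; [exact: powR_ge0|exact: G0].
apply: ge0_le_integral => //.
- move=> h _; rewrite lee_fin; apply: sumr_ge0 => k _; apply: mulr_ge0; first exact: powR_ge0.
  by apply: mulr_ge0 (G0 h); apply: dil_ge0; [exact: dya_gt0|exact: tail_ge0].
- by apply/measurable_EFinP; exact: bl_mf.
- apply/measurable_EFinP; apply: mf_mul; first exact: mf_cst.
  apply: mf_mul; first by apply: mf_powR; exact: mf_l1.
  exact: mf_Int_translate.
move=> h _; rewrite -EFinM lee_fin -/(G h) mulrA.
(* At h = 0 the weight on the right is 0 by convention, so the left side must vanish, and it does
   because u - u (. - h) = 0. *)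
have [h0|h0] := eqVneq (l1 h) 0.
  have hz : h = 0.
    apply/rowP => i; rewrite mxE; apply/eqP; rewrite -normr_eq0 eq_le normr_ge0 andbT.
    by rewrite -h0 /l1 (bigD1 i)//= lerDl sumr_ge0.
  have Gh : G h = 0.
    rewrite /G hz -[RHS](@Int0 R n); apply: eq_Int => x.
    by rewrite subr0 subrr normr0 powR0// gt_eqF//; lra.
  by rewrite Gh mulr0 /W big1// => k _; rewrite Gh !mulr0.
have {}h0 : 0 < l1 h by rewrite lt_neqAle eq_sym h0 l1_ge0.
apply: (@le_trans _ _ ((\sum_(k < N) dya M k `^ (s * p) * dil (dya M k) tail h) * G h)).
  by rewrite /W mulr_suml; under eq_bigr do rewrite mulrA.
by apply: ler_wpM2r; [exact: G0|exact: tail_sum_le].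
Qed.

End lower_bound.

(** * Bilateral sums, double integrals and the comparison of norms *)

Section extended_powers.
Context {R : realType}.
Implicit Types (x y : \bar R) (a b q : R).

Lemma lee_poweR x y q : 0 <= q -> (0 <= x)%E -> (x <= y)%E -> (x `^ q <= y `^ q)%E.
Proof.
move=> q0 x0 xy; apply: gt0_ler_poweR => //; rewrite in_itv /= ?leey ?andbT//.
exact: le_trans xy.
Qed.

Lemma powR_add_le a b q : 0 < q -> q <= 1 -> 0 <= a -> 0 <= b ->
  (a + b) `^ q <= a `^ q + b `^ q.
Proof.
move=> q0 q1 a0 b0; have qi : 1 <= q^-1 by rewrite invf_ge1.
have qi0 : 0 < q^-1 by rewrite invr_gt0.
have x0 : 0 <= a `^ q by exact: powR_ge0.
have y0 : 0 <= b `^ q by exact: powR_ge0.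
have e t : 0 <= t -> t = (t `^ q) `^ q^-1 by move=> t0; rewrite -powRrM divff ?gt_eqF// powRr1.
have H : a + b <= (a `^ q + b `^ q) `^ q^-1.
  rewrite {1}(e a)// {1}(e b)// -[leRHS](mulr_powRB1 (addr_ge0 x0 y0) qi0) mulrDl.
  have qi1 : 0 <= q^-1 - 1 by lra.
  apply: lerD.
    rewrite -(mulr_powRB1 x0 qi0); apply: ler_wpM2l => //.
    by apply: powR_le_mono => //; rewrite lerDl.
  rewrite -(mulr_powRB1 y0 qi0); apply: ler_wpM2l => //.
  by apply: powR_le_mono => //; rewrite lerDr.
have := powR_le_mono (ltW q0) (addr_ge0 a0 b0) H.
by rewrite -[X in _ <= X -> _]powRrM mulVf ?gt_eqF// powRr1 ?addr_ge0.
Qed.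

Definition dyadic_sum (a : int -> R) J : R := \sum_(i < J.*2.+1) a (i%:Z - J%:Z).

Let IJ J : set int := (fun i : nat => i%:Z - J%:Z) @` `I_J.*2.+1.

Let fin_IJ J : finite_set (IJ J). Proof. by apply: finite_image; exact: finite_II. Qed.

Let dyadic_sum_fsum (a : int -> R) J : (dyadic_sum a J)%:E = (\sum_(j \in IJ J) (a j)%:E)%E.
Proof.
rewrite /dyadic_sum -sumEFin (@fsbig_ord _ _ _ J.*2.+1 (fun i : nat => (a (i%:Z - J%:Z))%:E)).
rewrite (@reindex_fsbig _ _ _ _ _ (fun i : nat => i%:Z - J%:Z) `I_J.*2.+1)//.
split=> [i iJ|i j _ _ /addIr [] //|//]; by exists i.
Qed.

Let mem_IJ J (j : int) : (absz j <= J)%N -> IJ J j.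
Proof.
move=> h; exists (absz (j + J%:Z)); last by lia.
by rewrite /=; lia.
Qed.

(** The symmetric windows increase and exhaust the integers, so the partial sums converge to their
    supremum, possibly infinite. *)
Lemma cvg_dyadic_esum (a : int -> R) q : 0 < q -> (forall j, 0 <= a j) ->
  (forall J, (dyadic_sum a J `^ q)%:E <= (\esum_(j in [set: int]) (a j)%:E) `^ q)%E /\
  (dyadic_sum a J `^ q)%:E @[J --> \oo] --> ((\esum_(j in [set: int]) (a j)%:E) `^ q)%E.
Proof.
move=> q0 a0; set E := \esum_(j in _) _.
have aE j : (0 <= (a j)%:E)%E by rewrite lee_fin.
have S0 J : 0 <= dyadic_sum a J by exact: sumr_ge0.
have SE J : ((dyadic_sum a J)%:E <= E)%E.
  rewrite dyadic_sum_fsum; apply: esum_ge; exists (IJ J) => //.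
have SqE J : ((dyadic_sum a J `^ q)%:E <= E `^ q)%E.
  by rewrite -poweR_EFin; apply: lee_poweR; [exact: ltW|rewrite lee_fin|].
have SX (X : set int) : finite_set X -> exists J, (\sum_(j \in X) (a j)%:E <= (dyadic_sum a J)%:E)%E.
  move=> fX; have /finite_seqP[s Xs] := fX.
  exists (\max_(j <- s) absz j); rewrite dyadic_sum_fsum.
  apply: lee_fsum_nneg_subset => // j; rewrite !inE Xs => js.
  by apply: mem_IJ; apply: leq_bigmax_seq.
have mono : {homo (fun J => (dyadic_sum a J `^ q)%:E) : J J' / (J <= J')%N >-> (J <= J')%E}.
  move=> J J' h; rewrite lee_fin; apply: powR_le_mono => //; first exact: ltW.
  rewrite -lee_fin !dyadic_sum_fsum; apply: lee_fsum_nneg_subset => // j; rewrite !inE.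
  by move=> [i /= iJ <-]; apply: mem_IJ; lia.
split=> //; have := ereal_nondecreasing_cvgn mono.
suff -> : ereal_sup (range (fun J => (dyadic_sum a J `^ q)%:E)) = (E `^ q)%E by [].
set Z := ereal_sup _; apply/eqP; rewrite eq_le; apply/andP; split.
  by apply: ge_ereal_sup => _ [J _ <-].
have Z0 : (0 <= Z)%E.
  apply: (@le_trans _ _ (dyadic_sum a 0 `^ q)%:E); first by rewrite lee_fin powR_ge0.
  by apply: ereal_sup_ubound; exists 0%N.
(* The power is undone with exponent 1/q, so that the supremum commutes with it by monotonicity
   alone. *)
have -> : Z = ((Z `^ q^-1) `^ q)%E by rewrite -poweRrM mulVf ?gt_eqF// poweRe1.
apply: lee_poweR; [exact: ltW|by apply: esum_ge0|].
apply: ge_ereal_sup => _ [X [fX _] <-]; have [J] := SX X fX.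
move/le_trans; apply.
have -> : (dyadic_sum a J)%:E = ((dyadic_sum a J `^ q)%:E `^ q^-1)%E.
  by rewrite poweR_EFin -powRrM divff ?gt_eqF// powRr1.
apply: lee_poweR; [by rewrite invr_ge0 ltW|by rewrite lee_fin powR_ge0|].
by apply: ereal_sup_ubound; exists J.
Qed.

End extended_powers.

Section double_integrals.
Context {R : realType} {n : nat}.
Local Notation T := 'rV[R]_n.
Local Notation mu := (lebesgue_rV R n).
Implicit Types (u v : T -> R) (x y h : T) (s p : R).

Lemma le_integral2 (F G : T * T -> R) : measurable_fun setT F -> measurable_fun setT G ->
  (forall z, 0 <= F z) -> (forall z, F z <= G z) ->
  (\int[mu]_y \int[mu]_x (F (x, y))%:E <= \int[mu]_y \int[mu]_x (G (x, y))%:E)%E.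
Proof.
move=> mF mG F0 FG; have G0 z : 0 <= G z by exact: le_trans (FG z).
have m1 (H : T * T -> R) : measurable_fun setT H -> (forall z, 0 <= H z) ->
    measurable_fun setT (fun y => \int[mu]_x (H (x, y))%:E)%E.
  move=> mH H0; apply: (@measurable_fun_fubini_tonelli_G _ _ _ _ _ mu (EFin \o H)).
    exact/measurable_EFinP.
  by move=> z; rewrite lee_fin.
apply: ge0_le_integral => //.
- by move=> y _; apply: integral_ge0 => x _; rewrite lee_fin.
- exact: m1.
- exact: m1.
move=> y _; apply: ge0_le_integral => //.
- by move=> x _; rewrite lee_fin.
- by apply/measurable_EFinP; exact: mf_ysect.
- by apply/measurable_EFinP; exact: mf_ysect.
- by move=> x _; rewrite lee_fin.
Qed.

(** Tonelli, the substitution y = x - h, and Tonelli again. *)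
Lemma gag_double s p u : 1 <= p -> bl u ->
  (\int[mu]_y \int[mu]_x (l1 (x - y) `^ (- (n%:R + s * p)) * `|u x - u y| `^ p)%:E = gag s p u)%E.
Proof.
move=> p1 bu; have mu' := bl_mf bu; set al := - (n%:R + s * p).
have ml := @mf_l1 R n.
pose F (z : T * T) : \bar R := (l1 (z.1 - z.2) `^ al * `|u z.1 - u z.2| `^ p)%:E.
have mF : measurable_fun setT F.
  apply/measurable_EFinP; apply: mf_mul.
    by apply: mf_powR; exact: (mf_sub2 ml).
  apply: mf_powR; apply: mf_norm; apply: mf_sub; [exact: (mf_fst mu')|exact: (mf_snd mu')].
have F0 z : (0 <= F z)%E by rewrite lee_fin mulr_ge0// powR_ge0.
pose H (z : T * T) : \bar R := (l1 z.2 `^ al * `|u z.1 - u (z.1 - z.2)| `^ p)%:E.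
have mH : measurable_fun setT H.
  apply/measurable_EFinP; apply: mf_mul.
    by apply: mf_powR; exact: (mf_snd ml).
  apply: mf_powR; apply: mf_norm; apply: mf_sub; [exact: (mf_fst mu')|exact: (mf_sub2 mu')].
have H0 z : (0 <= H z)%E by rewrite lee_fin mulr_ge0// powR_ge0.
rewrite -(@fubini_tonelli _ _ _ _ _ mu mu F mF F0).
transitivity (\int[mu]_x \int[mu]_h H (x, h))%E.
  apply: eq_integral => x _.
  have m1 : (-1 : R) != 0 by rewrite oppr_eq0 oner_neq0.
  have mFx : measurable_fun setT (fun y => F (x, y)).
    have := @measurable_pair1 _ _ T T x => mp; exact: (measurableT_comp mF mp).
  rewrite -(ge0_integral_affine x m1 mFx (fun y => F0 (x, y))) normrN1 expr1n mul1e.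
  apply: eq_integral => h _; rewrite /F /H /=.
  by rewrite scaleN1r (addrC (- h)) subKr.
rewrite (@fubini_tonelli _ _ _ _ _ mu mu H mH H0); apply: eq_integral => h _.
have bd : bl (fun x => `|u x - u (x - h)| `^ p).
  by apply: bl_powR => //; exact: (bl_sub bu (bl_subr h bu)).
rewrite EFinM -(ge0_integral_bl bd) -ge0_integralZl//.
- by apply/measurable_EFinP; exact: bl_mf.
- by rewrite lee_fin powR_ge0.
Qed.

Lemma enorm_ge0 x : 0 <= enorm x. Proof. exact: sqrtr_ge0. Qed.

Lemma enorm_le_l1 x : enorm x <= l1 x.
Proof.
rewrite /enorm -[leRHS]ger0_norm ?l1_ge0// -sqrtr_sqr; apply: ler_wsqrtr.
apply: le_trans (sum_sqr_le _ (fun i => normr_ge0 (x 0 i))).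
by rewrite /dotp; apply: ler_sum => i _; rewrite real_normK ?num_real.
Qed.

Lemma l1_le_enorm x : l1 x <= n%:R * enorm x.
Proof.
have h i : `|x 0 i| <= enorm x.
  rewrite -sqrtr_sqr /enorm; apply: ler_wsqrtr; rewrite expr2 /dotp (bigD1 i)//= lerDl.
  by apply: sumr_ge0 => j _; rewrite -expr2 sqr_ge0.
apply: (@le_trans _ _ (\sum_(i < n) enorm x)); first by apply: ler_sum => i _; exact: h.
by rewrite sumr_const card_ord mulr_natl.
Qed.

Lemma mf_enorm : measurable_fun setT (@enorm R n).
Proof.
have -> : @enorm R n = fun x => dotp x x `^ 2^-1.
  apply/funext => x; rewrite powR12_sqrt//; apply: sumr_ge0 => i _.
  by rewrite -expr2 sqr_ge0.
apply: mf_powR; apply: mf_sum => i _; apply: mf_mul; exact: mf_coord.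
Qed.

(** The Euclidean norm is at most the l^1 norm. At the origin both sides are 0 by the conventions
    for inverses and powers of 0. *)
Lemma enorm_weight_ge x (al : R) : 0 < al -> l1 x `^ (- al) <= (enorm x `^ al)^-1.
Proof.
move=> a0; rewrite -powRN; have [e0|e0] := eqVneq (enorm x) 0.
  have l0 : l1 x = 0.
    by apply/eqP; rewrite eq_le l1_ge0 andbT (le_trans (l1_le_enorm x))// e0 mulr0.
  by rewrite l0 e0.
have {}e0 : 0 < enorm x by rewrite lt_neqAle eq_sym e0 enorm_ge0.
by apply: powRN_le => //; [exact: ltW|exact: enorm_le_l1].
Qed.

Lemma enorm_weight_le x (al : R) : (0 < n)%N -> 0 < al ->
  (enorm x `^ al)^-1 <= n%:R `^ al * l1 x `^ (- al).
Proof.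
move=> n0 a0; rewrite -powRN; have nn : 0 < n%:R :> R by rewrite ltr0n.
have an : - al != 0 by rewrite oppr_eq0 gt_eqF.
have [l0|l0] := eqVneq (l1 x) 0.
  have e0 : enorm x = 0.
    by apply/eqP; rewrite eq_le enorm_ge0 andbT (le_trans (enorm_le_l1 x))// l0.
  by rewrite l0 e0 powR0// mulr0.
have {}l0 : 0 < l1 x by rewrite lt_neqAle eq_sym l0 l1_ge0.
have e1 : l1 x / n%:R <= enorm x by rewrite ler_pdivrMr// mulrC l1_le_enorm.
apply: le_trans (powRN_le (ltW a0) _ e1) _; first by rewrite divr_gt0.
rewrite powRM ?invr_ge0 ?l1_ge0// mulrC -[n%:R^-1]powR_inv1// -powRrM mulrN mulN1r opprK.
by [].
Qed.

End double_integrals.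

(** * Reduction of complex-valued functions to real and imaginary parts *)

Section complex_functions.
Context {R : realType} {n : nat}.
Local Notation T := 'rV[R]_n.
Local Notation mu := (lebesgue_rV R n).
Local Notation normc := ComplexField.Normc.normc.
Implicit Types (f eta : T -> R[i]) (x y : T) (s p : R).

Lemma normc_sqr (z : R[i]) : normc z ^+ 2 = complex.Re z ^+ 2 + complex.Im z ^+ 2.
Proof. by case: z => a b /=; rewrite sqr_sqrtr// addr_ge0// sqr_ge0. Qed.

Lemma normc_le_add (z : R[i]) : normc z <= `|complex.Re z| + `|complex.Im z|.
Proof.
rewrite -(@ler_pXn2r _ 2)// ?nnegrE ?normc_ge0 ?addr_ge0// normc_sqr sqrrD.
rewrite !real_normK ?num_real// addrAC lerDl mulrn_wge0// mulr_ge0//.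
Qed.

Definition rpart f x : R := complex.Re (f x).
Definition ipart f x : R := complex.Im (f x).

(** As eta is real, the projection acts on the two parts separately; the two orders of convolution
    are reconciled by [cvC]. *)
Lemma LP_projectionE eta j f x : (forall z, complex.Im (eta z) = 0) ->
  bl (rpart eta) -> bl (rpart f) -> bl (ipart f) ->
  LP_projection eta j f x =
  (lpd (rpart eta) ((2 : R) ^ j) (rpart f) x +i* lpd (rpart eta) ((2 : R) ^ j) (ipart f) x)%C.
Proof.
move=> e0 be bu bv; have j0 : 0 < (2 : R) ^ j by rewrite exprz_gt0.
have bd := bl_dil j0 be.
have C u : bl u -> lpd (rpart eta) ((2 : R) ^ j) u x = cv u (dil ((2 : R) ^ j) (rpart eta)) x.
  by move=> b; exact: (cvC x bd (bl_bdm b)).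
rewrite (C _ bu) (C _ bv).
have E : (2 : R) ^ (j * n%:Z) = ((2 : R) ^ j) ^+ n by rewrite exprnP exprz_exp.
rewrite /LP_projection /convolution /cintegral; congr (_ +i* _)%C.
  apply: eq_Int => y; rewrite /dil /rpart E//.
  by move: (e0 ((2 : R) ^ j *: y)); case: (f _) (eta _) => a b [c d] /= ->; ring.
apply: eq_Int => y; rewrite /dil /rpart /ipart E//.
by move: (e0 ((2 : R) ^ j *: y)); case: (f _) (eta _) => a b [c d] /= ->; ring.
Qed.

Definition lp_term eta s f x (j : int) : R :=
  2 `^ (j%:~R * s * 2) * normc (LP_projection eta j f x) `^ 2.

Lemma lp_term_ge0 eta s f x j : 0 <= lp_term eta s f x j.
Proof. by rewrite mulr_ge0 ?powR_ge0. Qed.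

Lemma lp_term_sum eta s f x J : (forall z, complex.Im (eta z) = 0) ->
  bl (rpart eta) -> bl (rpart f) -> bl (ipart f) ->
  \sum_(i < J.*2.+1) lp_term eta s f x (i%:Z - J%:Z) =
  sqf (rpart eta) s J (rpart f) x + sqf (rpart eta) s J (ipart f) x.
Proof.
move=> e0 be bu bv; rewrite /sqf -big_split; apply: eq_bigr => i _ /=.
rewrite /lp_term powR_sqr ?normc_ge0// normc_sqr LP_projectionE//= -mulrDr.
have E : (2 : R) ^ (i%:Z - J%:Z) = dya J i.
  by rewrite expfzDr ?pnatr_eq0// -exprnN -exprnP mulrC.
rewrite E; congr (_ * _); rewrite -E -powR_intmul// -powRrM.
by congr (_ `^ _); ring.
Qed.

Definition tl_integral eta s p f : \bar R :=
  (\int[mu]_x (\esum_(j in [set: int]) (lp_term eta s f x j)%:E) `^ (p / 2))%E.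

Lemma triebel_lizorkinE eta s p f :
  triebel_lizorkin eta s p 2 f = (tl_integral eta s p f `^ p^-1)%E.
Proof. by []. Qed.

Definition gag_integral s p f : \bar R :=
  (\int[mu]_y \int[mu]_x
     (normc (f x - f y) `^ p / enorm (x - y) `^ (n%:R + s * p))%:E)%E.

Lemma gagliardoE s p f : gagliardo s p f = (gag_integral s p f `^ p^-1)%E.
Proof. by []. Qed.

Lemma mf_gag_integrand s p f : bl (rpart f) -> bl (ipart f) ->
  measurable_fun setT (fun z : T * T =>
    normc (f z.1 - f z.2) `^ p / enorm (z.1 - z.2) `^ (n%:R + s * p)).
Proof.
move=> /bl_mf mu' /bl_mf mv; apply: mf_mul.
  have -> : (fun z : T * T => normc (f z.1 - f z.2) `^ p) = fun z =>
      (((rpart f z.1 - rpart f z.2) ^+ 2 + (ipart f z.1 - ipart f z.2) ^+ 2) `^ 2^-1) `^ p.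
    apply/funext => z; rewrite powR12_sqrt ?addr_ge0 ?sqr_ge0//.
    by rewrite /rpart /ipart; case: (f z.1) (f z.2) => a b [c d].
  apply: mf_powR; apply: mf_powR; apply: mf_add; apply: mf_exp; apply: mf_sub.
  - exact: (mf_fst mu').
  - exact: (mf_snd mu').
  - exact: (mf_fst mv).
  - exact: (mf_snd mv).
have -> : (fun z : T * T => (enorm (z.1 - z.2) `^ (n%:R + s * p))^-1) =
    fun z => enorm (z.1 - z.2) `^ (- (n%:R + s * p)).
  by apply/funext => z; rewrite powRN.
apply: mf_powR; exact: (mf_sub2 mf_enorm).
Qed.

Lemma gag_le_integral s p f (u : T -> R) : 0 < s -> 1 <= p -> bl (rpart f) -> bl (ipart f) -> bl u ->
  (forall x y, `|u x - u y| <= normc (f x - f y)) ->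
  (gag s p u <= gag_integral s p f)%E.
Proof.
move=> s0 p1 br bi bu uf; rewrite -(gag_double s p1 bu).
have p0 : 0 <= p by lra.
have al0 : 0 < n%:R + s * p by rewrite ltr_wpDl// mulr_gt0//; lra.
apply: (le_integral2 (F := fun z => l1 (z.1 - z.2) `^ (- (n%:R + s * p)) * `|u z.1 - u z.2| `^ p)
  (G := fun z => normc (f z.1 - f z.2) `^ p / enorm (z.1 - z.2) `^ (n%:R + s * p))).
- have mu' := bl_mf bu; apply: mf_mul.
    by apply: mf_powR; exact: (mf_sub2 (@mf_l1 R n)).
  apply: mf_powR; apply: mf_norm; apply: mf_sub; [exact: (mf_fst mu')|exact: (mf_snd mu')].
- exact: mf_gag_integrand.
- by move=> z; rewrite mulr_ge0// powR_ge0.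
move=> z; rewrite mulrC; apply: ler_pM; rewrite ?powR_ge0//.
  by apply: powR_le_mono.
exact: enorm_weight_ge.
Qed.

Lemma integral_le_gag s p f : (0 < n)%N -> 0 < s -> s < 1 -> 1 <= p ->
  bl (rpart f) -> bl (ipart f) ->
  (gag_integral s p f <=
   (2 `^ (p - 1) * n%:R `^ (n%:R + p))%:E * (gag s p (rpart f) + gag s p (ipart f)))%E.
Proof.
(* In K, the factor 2^(p-1) splits the two parts and n^(n+p) bounds the norm comparison n^(n+sp)
   uniformly in s. *)
move=> n0 s0 s1 p1 br bi; set al := n%:R + s * p; set K := _ * _.
have p0 : 0 <= p by lra.
have al0 : 0 < al by rewrite ltr_wpDl// mulr_gt0//; lra.
have K0 : 0 <= K by rewrite mulr_ge0// powR_ge0.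
pose F (u : T -> R) (z : T * T) := l1 (z.1 - z.2) `^ (- al) * `|u z.1 - u z.2| `^ p.
have mF u : bl u -> measurable_fun setT (F u).
  move=> /bl_mf mu'; apply: mf_mul; first by apply: mf_powR; exact: (mf_sub2 (@mf_l1 R n)).
  apply: mf_powR; apply: mf_norm; apply: mf_sub; [exact: (mf_fst mu')|exact: (mf_snd mu')].
have F0 u z : 0 <= F u z by rewrite mulr_ge0// powR_ge0.
have mr := mF _ br; have mi := mF _ bi.
have m2 u : bl u -> measurable_fun setT (fun y => \int[mu]_x (F u (x, y))%:E)%E.
  move=> bu; apply: (@measurable_fun_fubini_tonelli_G _ _ _ _ _ mu (EFin \o F u)).
    by apply/measurable_EFinP; exact: mF.
  by move=> z; rewrite lee_fin.
have Fe0 u x y : (0 <= (F u (x, y))%:E)%E by rewrite lee_fin.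
have Fm u y : bl u -> measurable_fun setT (fun x => (F u (x, y))%:E).
  by move=> bu; apply/measurable_EFinP; exact: (mf_ysect _ (mF _ bu)).
have i0 u y : (0 <= \int[mu]_x (F u (x, y))%:E)%E.
  by apply: integral_ge0 => x _; rewrite lee_fin.
have -> : (K%:E * (gag s p (rpart f) + gag s p (ipart f)) =
    \int[mu]_y \int[mu]_x (K * (F (rpart f) (x, y) + F (ipart f) (x, y)))%:E)%E.
  have gE u : bl u -> gag s p u = (\int[mu]_y \int[mu]_x (F u (x, y))%:E)%E.
    by move=> bu; rewrite -(gag_double s p1 bu).
  rewrite (gE _ br) (gE _ bi) -ge0_integralD//; last 2 first.
  - exact: (m2 _ br).
  - exact: (m2 _ bi).
  rewrite -ge0_integralZl//; last 2 first.
  - by apply: emeasurable_funD; [exact: (m2 _ br)|exact: (m2 _ bi)].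
  - by move=> y _; rewrite adde_ge0.
  apply: eq_integral => y _; rewrite -ge0_integralD//; last 2 first.
  - exact: (Fm _ y br).
  - exact: (Fm _ y bi).
  rewrite -ge0_integralZl//.
  - by apply: emeasurable_funD; [exact: (Fm _ y br)|exact: (Fm _ y bi)].
  - by move=> x _; rewrite adde_ge0.
apply: (le_integral2 (F := fun z => normc (f z.1 - f z.2) `^ p / enorm (z.1 - z.2) `^ al)
  (G := fun z => K * (F (rpart f) z + F (ipart f) z))).
- exact: mf_gag_integrand.
- by apply: mf_mul; [exact: mf_cst|exact: mf_add].
- by move=> z; rewrite mulr_ge0 ?invr_ge0// powR_ge0.
move=> z; have h1 : normc (f z.1 - f z.2) `^ p <=
    2 `^ (p - 1) * (`|rpart f z.1 - rpart f z.2| `^ p + `|ipart f z.1 - ipart f z.2| `^ p).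
  apply: le_trans (powR_add p1 (normr_ge0 _) (normr_ge0 _)).
  apply: powR_le_mono => //; first exact: normc_ge0.
  apply: le_trans (normc_le_add _) _.
  by rewrite /rpart /ipart; case: (f z.1) (f z.2) => a b [c d].
have h2 : (enorm (z.1 - z.2) `^ al)^-1 <= n%:R `^ (n%:R + p) * l1 (z.1 - z.2) `^ (- al).
  apply: le_trans (enorm_weight_le _ n0 al0) _; apply: ler_wpM2r; first exact: powR_ge0.
  apply: ler_powR; first by rewrite ler1n.
  by rewrite lerD2l ler_piMl// ltW.
have h0 : 0 <= (enorm (z.1 - z.2) `^ al)^-1 by rewrite invr_ge0 powR_ge0.
apply: le_trans (ler_pM (powR_ge0 _ _) h0 h1 h2) _.
by rewrite le_eqVlt; apply/orP; left; apply/eqP; rewrite /K /F; ring.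
Qed.

End complex_functions.

Section complex_bounds.
Context {R : realType} {n : nat}.
Local Notation T := 'rV[R]_n.
Local Notation mu := (lebesgue_rV R n).
Implicit Types (f : T -> R[i]) (s p : R).

Variable eta : T -> R[i].
Hypothesis lp : littlewood_paley eta.
Hypothesis n0 : (0 < n)%N.

Let eI z : complex.Im (eta z) = 0. Proof. by have [_ H _ _] := lp; exact: H. Qed.

Let te : tame (rpart eta).
Proof. by have [se _ _ _] := lp; exact: schwartz_tame_Re. Qed.

Let be : bl (rpart eta). Proof. exact: tame_bl. Qed.

Let square s f J x := sqf (rpart eta) s J (rpart f) x + sqf (rpart eta) s J (ipart f) x.

Let cvg_square s p f x : 0 < p -> schwartz f ->
  (forall J, (square s f J x `^ (p / 2))%:E <=
    (\esum_(j in [set: int]) (lp_term eta s f x j)%:E) `^ (p / 2))%E /\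
  (square s f J x `^ (p / 2))%:E @[J --> \oo] -->
    ((\esum_(j in [set: int]) (lp_term eta s f x j)%:E) `^ (p / 2))%E.
Proof.
move=> p0 sf; have q0 : 0 < p / 2 by rewrite divr_gt0.
have br := tame_bl (schwartz_tame_Re sf); have bi := tame_bl (schwartz_tame_Im sf).
have := cvg_dyadic_esum q0 (lp_term_ge0 eta s f x).
have -> // : dyadic_sum (lp_term eta s f x) = square s f ^~ x.
by apply/funext => J; exact: lp_term_sum.
Qed.

Let mf_square s p f J : schwartz f ->
  measurable_fun setT (fun x => (square s f J x `^ (p / 2))%:E).
Proof.
move=> sf; apply/measurable_EFinP; apply: mf_powR; apply: bl_mf.
have br := tame_bl (schwartz_tame_Re sf); have bi := tame_bl (schwartz_tame_Im sf).
exact: (bl_add (bl_sqf te s J br) (bl_sqf te s J bi)).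
Qed.

Let mf_tl s p f : 0 < p -> schwartz f -> measurable_fun setT
  (fun x => (\esum_(j in [set: int]) (lp_term eta s f x j)%:E) `^ (p / 2))%E.
Proof.
move=> p0 sf; apply: (emeasurable_fun_cvg (fun J x => (square s f J x `^ (p / 2))%:E)).
  by move=> J; exact: mf_square.
by move=> x _; have [] := cvg_square s x p0 sf.
Qed.

Lemma tl_integral_ge0 s p f : (0 <= tl_integral eta s p f)%E.
Proof. by apply: integral_ge0 => x _; exact: poweR_ge0. Qed.

Lemma gag_integral_ge0 s p f : (0 <= gag_integral s p f)%E.
Proof.
apply: integral_ge0 => y _; apply: integral_ge0 => x _.
by rewrite lee_fin mulr_ge0 ?invr_ge0 ?powR_ge0.
Qed.

Lemma gag_integral_le p : 2 <= p -> exists2 C, 0 <= C & forall s f, 0 < s -> s < 1 ->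
  schwartz f ->
  (gag_integral s p f <= (C * (s^-1 + (1 - s)^-1))%:E * tl_integral eta s p f)%E.
Proof.
move=> p2; have p1 : 1 <= p by lra.
have p0 : 0 < p by lra.
have q1 : 1 <= p / 2 by lra.
have [psi [tp _ pe _]] := littlewood_paley_symbols lp.
have [C C0 HC] := gag_le tp te pe n0 p2.
set K := 2 `^ (p - 1) * n%:R `^ (n%:R + p) : R.
have K0 : 0 <= K by rewrite mulr_ge0// powR_ge0.
exists (K * (C + C)) => [|s f s0 s1 sf]; first by rewrite mulr_ge0// addr_ge0.
have tr := schwartz_tame_Re sf; have ti := schwartz_tame_Im sf.
have br := tame_bl tr; have bi := tame_bl ti.
set X := tl_integral _ _ _ _; set kap := s^-1 + _.
have HX u : bl u -> (forall J x, sqf (rpart eta) s J u x <= square s f J x) ->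
    forall J, ((Int (fun x => sqf (rpart eta) s J u x `^ (p / 2)))%:E <= X)%E.
  move=> bu us J; have S0 x : 0 <= sqf (rpart eta) s J u x by exact: sqf_ge0.
  have bS : bl (sqf (rpart eta) s J u) by exact: (bl_sqf te).
  rewrite -(ge0_integral_bl (bl_powR0 q1 S0 bS)).
  apply: ge0_le_integral => //.
  - by move=> x _; rewrite lee_fin powR_ge0.
  - by apply/measurable_EFinP; apply: mf_powR; exact: bl_mf.
  - exact: mf_tl.
  move=> x _; have [H _] := cvg_square s x p0 sf; apply: le_trans (H J).
  by rewrite lee_fin; apply: powR_le_mono => //; lra.
have Hr := HC s (rpart f) X s0 s1 tr
  (HX _ br (fun J x => ler_wpDr (sqf_ge0 _ _ _ _ _) (lexx _))).
have Hi := HC s (ipart f) X s0 s1 ti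
  (HX _ bi (fun J x => ler_wpDl (sqf_ge0 _ _ _ _ _) (lexx _))).
apply: le_trans (integral_le_gag n0 s0 s1 p1 br bi) _; rewrite -/K.
have K0' : (0 <= K%:E)%E by rewrite lee_fin.
apply: le_trans (lee_wpmul2l K0' (leeD Hr Hi)) _.
have ck0 : 0 <= C * kap by rewrite mulr_ge0// addr_ge0// invr_ge0; lra.
by rewrite -ge0_muleDl ?lee_fin// -EFinD muleA -EFinM -(mulrDl C) mulrA.
Qed.

Lemma tl_integral_le p : 1 < p -> p <= 2 -> exists2 C, 0 <= C & forall s f, 0 < s -> s < 1 ->
  schwartz f ->
  ((s^-1 + (1 - s)^-1)%:E * tl_integral eta s p f <= C%:E * gag_integral s p f)%E.
Proof.
move=> p1 p2; have p1' : 1 <= p by lra.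
have p0 : 0 < p by lra.
have q0 : 0 < p / 2 by lra.
have q1 : p / 2 <= 1 by lra.
have [psi [tp _ pe dec]] := littlewood_paley_symbols lp.
have ev x : complex.Re (eta (- x)) = complex.Re (eta x) by have [_ _ -> _] := lp.
have [C C0 HC] := sqf_le_gag tp te pe n0 ev (dec _) p1 p2.
exists (C + C) => [|s f s0 s1 sf]; first exact: addr_ge0.
have br := tame_bl (schwartz_tame_Re sf); have bi := tame_bl (schwartz_tame_Im sf).
set G := gag_integral _ _ _; set kap := s^-1 + _.
have G0 : (0 <= G)%E by exact: gag_integral_ge0.
have kap0 : 0 < kap by rewrite addr_gt0// invr_gt0; lra.
have ki0 : 0 <= kap^-1 by rewrite invr_ge0 ltW.
have HI u J : bl u -> (forall x y, `|u x - u y| <= ComplexField.Normc.normc (f x - f y)) ->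
    bl (fun x => sqf (rpart eta) s J u x `^ (p / 2)) /\
    ((Int (fun x => sqf (rpart eta) s J u x `^ (p / 2)))%:E <= (kap^-1 * C)%:E * G)%E.
  move=> bu uf; have [bS H] := HC s u J s0 s1 bu; split; first exact: bS.
  have H2 := le_trans H (lee_wpmul2l (_ : (0 <= C%:E)%E) (gag_le_integral s0 p1' br bi bu uf)).
  have := lee_wpmul2l (_ : (0 <= kap^-1%:E)%E) (H2 _).
  rewrite !lee_fin => /(_ ki0 C0).
  by rewrite muleA -!EFinM mulrA mulVf ?gt_eqF// mul1r.
have [ur ui] : (forall x y, `|rpart f x - rpart f y| <= ComplexField.Normc.normc (f x - f y)) /\
    (forall x y, `|ipart f x - ipart f y| <= ComplexField.Normc.normc (f x - f y)).
  split=> x y.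
    by apply: le_trans (Re_le_normc (f x - f y)); rewrite /rpart; case: (f x) (f y) => a b [].
  by apply: le_trans (Im_le_normc (f x - f y)); rewrite /ipart; case: (f x) (f y) => a b [].
have S0 u J x : 0 <= sqf (rpart eta) s J u x by exact: sqf_ge0.
have T : (tl_integral eta s p f <= (kap^-1 * (C + C))%:E * G)%E.
  apply: (integral_le_liminf (B := fun J x => (square s f J x `^ (p / 2))%:E)).
  - exact: mf_tl.
  - by move=> x; exact: poweR_ge0.
  - by move=> J; exact: mf_square.
  - by move=> J x; rewrite lee_fin powR_ge0.
  - by move=> x; have [_ c] := cvg_square s x p0 sf; rewrite (cvg_limn_einf_sup c).
  move=> J; have [b1 h1] := HI _ J br ur; have [b2 h2] := HI _ J bi ui.
  (* Since p / 2 <= 1, the power is subadditive and the two parts separate. *)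
  apply: (@le_trans _ _ (\int[mu]_x (sqf (rpart eta) s J (rpart f) x `^ (p / 2) +
      sqf (rpart eta) s J (ipart f) x `^ (p / 2))%:E)%E).
    apply: ge0_le_integral => //.
    - by move=> x _; rewrite lee_fin powR_ge0.
    - exact: mf_square.
    - by apply/measurable_EFinP; exact: (bl_mf (bl_add b1 b2)).
    - by move=> x _; rewrite lee_fin; exact: powR_add_le.
  rewrite (ge0_integral_bl (bl_add b1 b2)) (Int_add b1 b2) EFinD.
  apply: le_trans (leeD h1 h2) _.
  by rewrite -ge0_muleDl ?lee_fin ?mulr_ge0// -EFinD -mulrDr.
apply: le_trans (lee_wpmul2l _ T) _; first by rewrite lee_fin ltW.
by rewrite muleA -EFinM mulrA divff ?gt_eqF// mul1r.
Qed.

End complex_bounds.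

(** * Taking p-th roots *)

Lemma powR_inv {R : realType} (x r : R) : 0 <= x -> x^-1 `^ r = (x `^ r)^-1.
Proof. by move=> x0; rewrite -powR_inv1// -powRrM mulN1r powRN. Qed.

Theorem theorem1p5 (R : realType) (N : nat) (eta : 'rV[R]_N -> R[i]) (p : R) :
  (1 <= N)%N -> littlewood_paley eta -> 1 < p ->
  exists C : R, 0 < C /\
    forall (s : R) (f : 'rV[R]_N -> R[i]), 0 < s -> s < 1 -> schwartz f ->
      (p <= 2 ->
        ((C^-1 * ((s `^ p^-1)^-1 + ((1 - s) `^ p^-1)^-1))%:E
           * triebel_lizorkin eta s p 2 f <= gagliardo s p f)%E) /\
      (2 <= p ->
        (gagliardo s p f <=
           (C * ((s `^ p^-1)^-1 + ((1 - s) `^ p^-1)^-1))%:E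
             * triebel_lizorkin eta s p 2 f)%E).
Proof.
move=> N0 lp p1; pose r := p^-1; have p0 : 0 < p by lra.
have r0 : 0 < r by rewrite invr_gt0.
have r1 : r <= 1 by rewrite invf_le1// ltW.
(* Outside the range of p of each estimate the claim is vacuous, and 0 serves as the constant. *)
have [C1 C10 H1] : exists2 C1, 0 <= C1 & forall s f, 0 < s -> s < 1 -> schwartz f -> p <= 2 ->
    ((s^-1 + (1 - s)^-1)%:E * tl_integral eta s p f <= C1%:E * gag_integral s p f)%E.
  have [p2|p2] := leP p 2; last by exists 0 => // s f _ _ _; rewrite leNgt p2.
  have [C C0 H] := tl_integral_le lp N0 p1 p2.
  by exists C => // s f s0 s1 sf _; exact: H.
have [C2 C20 H2] : exists2 C2, 0 <= C2 & forall s f, 0 < s -> s < 1 -> schwartz f -> 2 <= p ->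
    (gag_integral s p f <= (C2 * (s^-1 + (1 - s)^-1))%:E * tl_integral eta s p f)%E.
  have [p2|p2] := leP 2 p; last by exists 0 => // s f _ _ _; rewrite leNgt p2.
  have [C C0 H] := gag_integral_le lp N0 p2.
  by exists C => // s f s0 s1 sf _; exact: H.
(* With kap = 1/s + 1/(1-s) and D the factor of the statement, kap^r <= D <= 2 kap^r. The upper
   comparison puts the 2 in front of C1^r, the lower one serves C2^r, and the summand 1 keeps C
   positive. *)
pose C := 2 * C1 `^ r + C2 `^ r + 1.
have Cr1 : 0 <= C1 `^ r by exact: powR_ge0.
have Cr2 : 0 <= C2 `^ r by exact: powR_ge0.
have C0 : 0 < C by rewrite /C; lra.
exists C; split=> // s f s0 s1 sf; rewrite triebel_lizorkinE gagliardoE -/r.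
set X := tl_integral _ _ _ _ in H1 H2 *; set G := gag_integral _ _ _ in H1 H2 *.
have X0 : (0 <= X)%E by exact: tl_integral_ge0.
have G0 : (0 <= G)%E by exact: gag_integral_ge0.
have Xr0 : (0 <= X `^ r)%E by exact: poweR_ge0.
have Gr0 : (0 <= G `^ r)%E by exact: poweR_ge0.
have s'0 : 0 < 1 - s by lra.
set D := (s `^ r)^-1 + _.
pose kap := s^-1 + (1 - s)^-1.
have si : 0 <= s^-1 by rewrite invr_ge0 ltW.
have s'i : 0 <= (1 - s)^-1 by rewrite invr_ge0 ltW.
have kap0 : 0 <= kap by exact: addr_ge0.
have DE : D = s^-1 `^ r + (1 - s)^-1 `^ r by rewrite !powR_inv// ltW.
have D0 : 0 <= D by rewrite DE addr_ge0// powR_ge0.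
have kD : kap `^ r <= D by rewrite DE; exact: powR_add_le.
have Dk : D <= 2 * kap `^ r.
  rewrite DE mulr_natl mulr2n; apply: lerD; apply: powR_le_mono => //; first exact: ltW.
  - by rewrite lerDl.
  - exact: ltW.
  - by rewrite lerDr.
split=> p2.
  have h : ((kap `^ r)%:E * X `^ r <= (C1 `^ r)%:E * G `^ r)%E.
    rewrite -!poweR_EFin -!poweRM ?lee_fin//; apply: lee_poweR; first exact: ltW.
      by rewrite mule_ge0// lee_fin.
    exact: H1.
  rewrite EFinM -muleA; apply: (@le_trans _ _ (C^-1%:E * (C%:E * G `^ r))%E); last first.
    by rewrite muleA -EFinM mulVf ?gt_eqF// mul1e.
  apply: lee_wpmul2l; first by rewrite lee_fin invr_ge0 ltW.
  apply: (@le_trans _ _ (2%:E * ((kap `^ r)%:E * X `^ r))%E).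
    by rewrite muleA -EFinM; apply: lee_wpmul2r => //; rewrite lee_fin.
  apply: (le_trans (lee_wpmul2l _ h)) => //.
  rewrite muleA -EFinM; apply: lee_wpmul2r => //; rewrite lee_fin /C; lra.
have h : (G `^ r <= ((C2 * kap) `^ r)%:E * X `^ r)%E.
  rewrite -poweR_EFin -poweRM ?lee_fin ?mulr_ge0//; apply: lee_poweR => //; first exact: ltW.
  exact: H2.
apply: le_trans h _; apply: lee_wpmul2r => //; rewrite lee_fin powRM//.
by apply: ler_pM; rewrite ?powR_ge0// /C; lra.
Qed.
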